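(* Let $r\ge 1$ and $\delta\ge 1$ be integers, and let $X\subset\mathbb P^{\binom{r+1+\delta}{r+1}-1}$ be an irreducible non-degenerate complex projective variety of dimension $r+1$ which is $2$-covered by a family of irreducible curves of degree $\delta$ (that is, $X=\overline X(r+1,2,\delta)$). Then $X$ is projectively equivalent to the Veronese manifold $\nu_\delta(\mathbb P^{r+1})$. In particular, every curve in the $2$-covering family is a rational normal curve of degree $\delta$ in the given embedding, and through two distinct points of $X$ there passes a unique rational normal curve of degree $\delta$ contained in $X$.
   Context: All varieties are over $\mathbb C$. A projective variety $X\subset\mathbb P^N$ is $n$-covered by a family $\Sigma$ of irreducible curves of degree $\delta$ if $\Sigma$ is an irreducible family of irreducible curves of degree $\delta$ contained in $X$ and through $n$ general points of $X$ there passes a curve belonging to $\Sigma$. A rational normal curve of degree $\delta$ is a smooth rational curve of degree $\delta$ whose linear span has dimension $\delta$. $\nu_\delta(\mathbb P^{r+1})$ is the image of $\mathbb P^{r+1}$ under the embedding given by the complete linear system $|\mathcal O_{\mathbb P^{r+1}}(\delta)|$. Non-degenerate means not contained in a hyperplane. For $n=2$ the paper's constant $\overline\pi(r,2,\delta)$ equals $\binom{r+1+\delta}{r+1}$. *)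

(* Defs.v *)
From HB Require Import structures.
From mathcomp Require Import all_boot all_order all_algebra.
From mathcomp Require Import mpoly.
From mathcomp Require Import boolp classical_sets functions cardinality.

Set Implicit Arguments.
Unset Strict Implicit.
Unset Printing Implicit Defensive.

Import GRing.Theory.
Local Open Scope ring_scope.
Local Open Scope classical_set_scope.
Local Open Scope card_scope.

(* A point of P^N is a line through the origin of K^(N+1); a row vector v is a
   vector of homogeneous coordinates of x iff val x = <[v]>%VS, and such a v is
   automatically nonzero since val x has dimension 1. *)
Definition proj (K : closedFieldType) (N : nat) : Type :=
  {L : {vspace 'rV[K]_N.+1} | \dim L == 1%N}.

Section Zariski.
Variable K : closedFieldType.

Definition vanishes_at N (f : {mpoly K[N.+1]}) (x : proj K N) : Prop :=
  forall v : 'rV[K]_N.+1, val x = <[v]>%VS -> f.@[v 0] = 0.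

Definition zariski_closed N (Z : set (proj K N)) : Prop :=
  exists S : set {mpoly K[N.+1]},
    (forall f, S f -> exists d, f \is d.-homog) /\
    Z = [set x | forall f, S f -> vanishes_at f x].

Definition locally_closed N (T : set (proj K N)) : Prop :=
  exists A B : set (proj K N),
    [/\ zariski_closed A, zariski_closed B & T = A `\` B].

Definition open_in N (X U : set (proj K N)) : Prop :=
  exists2 Z : set (proj K N), zariski_closed Z & U = X `\` Z.

(* Irreducibility for the topology induced on A. *)
Definition irreducible N (A : set (proj K N)) : Prop :=
  A !=set0 /\
  forall B C : set (proj K N), zariski_closed B -> zariski_closed C ->
    A `<=` B `|` C -> A `<=` B \/ A `<=` C.

Definition projective_variety N (X : set (proj K N)) : Prop :=
  zariski_closed X /\ irreducible X.

Definition variety_chain N (X : set (proj K N)) (d : nat) : Prop :=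
  exists Z : nat -> set (proj K N),
    (forall i, (i <= d)%N -> projective_variety (Z i) /\ Z i `<=` X) /\
    (forall i, (i < d)%N -> Z i `<` Z i.+1).

(* Krull dimension *)
Definition has_dim N (X : set (proj K N)) (d : nat) : Prop :=
  variety_chain X d /\ ~ variety_chain X d.+1.

(* Points a of the dual projective space are given by the coefficients of the
   linear forms defining the hyperplane. *)
Definition hyperplane N (a : proj K N) : set (proj K N) :=
  [set x | forall u v : 'rV[K]_N.+1,
     val a = <[u]>%VS -> val x = <[v]>%VS -> u *m v^T = 0].

Definition non_degenerate N (X : set (proj K N)) : Prop :=
  ~ exists a : proj K N, X `<=` hyperplane a.

(* The degree of a curve is the number of points of its intersection with a
   general hyperplane (one outside a proper closed subset B of the dual
   projective space). *)
Definition curve_degree N (C : set (proj K N)) (d : nat) : Prop :=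
  exists B : set (proj K N),
    [/\ zariski_closed B, B <> setT &
        forall a, ~ B a -> C `&` hyperplane a #= `I_d].

Definition irreducible_curve N (C : set (proj K N)) (d : nat) : Prop :=
  [/\ projective_variety C, has_dim C 1 & curve_degree C d].

Definition bihomogeneous M N (f : {mpoly K[M.+1 + N.+1]}) : Prop :=
  exists a b : nat, forall m : 'X_{1..(M.+1 + N.+1)}, m \in msupp f ->
    (\sum_(i < M.+1) m (lshift N.+1 i) = a)%N /\
    (\sum_(j < N.+1) m (rshift M.+1 j) = b)%N.

(* Closed subsets of P^M x P^N: loci of bihomogeneous equations. *)
Definition biprojective_closed M N (Z : set (proj K M * proj K N)) : Prop :=
  exists S : set {mpoly K[M.+1 + N.+1]},
    (forall f, S f -> bihomogeneous f) /\
    Z = [set p | forall f, S f ->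
           forall (u : 'rV[K]_M.+1) (v : 'rV[K]_N.+1),
             val p.1 = <[u]>%VS -> val p.2 = <[v]>%VS ->
             f.@[(row_mx u v) 0] = 0].

(* Sigma is the set of fibres over T of a closed incidence correspondence
   Z in T x P^N, where T is an irreducible quasi-projective variety. *)
Definition irreducible_family N (Sigma : set (set (proj K N))) : Prop :=
  exists (M : nat) (T : set (proj K M)) (Z : set (proj K M * proj K N)),
    [/\ locally_closed T, irreducible T, biprojective_closed Z &
        Sigma = [set [set x | Z (t, x)] | t in T]].

(* "Through two general points of X": for all (x, y) in a nonempty open subset
   of X x X. *)
Definition two_covered N (X : set (proj K N)) (d : nat)
    (Sigma : set (set (proj K N))) : Prop :=
  [/\ irreducible_family Sigma,
      forall C, Sigma C -> irreducible_curve C d /\ C `<=` X &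
      exists W : set (proj K N * proj K N),
        [/\ biprojective_closed W,
            ~ (X `*` X `<=` W) &
            forall x y, X x -> X y -> ~ W (x, y) ->
              exists C, [/\ Sigma C, C x & C y]]].

(* Affine cone over the embedded projective tangent space of X at p. *)
Definition tangent_cone_space N (X : set (proj K N)) (p : proj K N) :
    set 'rV[K]_N.+1 :=
  [set w | forall (e : nat) (f : {mpoly K[N.+1]}),
     f \is e.-homog -> (forall x, X x -> vanishes_at f x) ->
     forall v : 'rV[K]_N.+1, val p = <[v]>%VS ->
       \sum_(i < N.+1) (f^`M(i)).@[v 0] * w 0 i = 0].

Definition smooth_of_dim N (X : set (proj K N)) (d : nat) : Prop :=
  forall p, X p -> exists2 U : {vspace 'rV[K]_N.+1},
    \dim U = d.+1 & forall w, w \in U <-> tangent_cone_space X p w.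

(* y = [F_0(x) : ... : F_N(x)]; this entails that the F_i do not all vanish
   at x. *)
Definition rational_map_at M N (F : 'I_N.+1 -> {mpoly K[M.+1]})
    (x : proj K M) (y : proj K N) : Prop :=
  forall v : 'rV[K]_M.+1, val x = <[v]>%VS ->
    val y = <[(\row_i (F i).@[v 0])%R]>%VS.

(* Birationality of the irreducible varieties X and Y, as the existence of
   isomorphic nonempty open subsets; these are taken small enough that each of
   the two isomorphisms is given by a single tuple of forms. *)
Definition birational M N (X : set (proj K M)) (Y : set (proj K N)) : Prop :=
  exists (e e' : nat) (F : 'I_N.+1 -> {mpoly K[M.+1]})
         (G : 'I_M.+1 -> {mpoly K[N.+1]})
         (U : set (proj K M)) (V : set (proj K N)),
    [/\ (forall i, F i \is e.-homog) /\ (forall j, G j \is e'.-homog),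
        open_in X U /\ U !=set0,
        open_in Y V /\ V !=set0,
        forall x, U x ->
          exists y, [/\ V y, rational_map_at F x y & rational_map_at G y x] &
        forall y, V y ->
          exists x, [/\ U x, rational_map_at F x y & rational_map_at G y x]].

Definition rational_curve N (C : set (proj K N)) : Prop :=
  birational [set: proj K 1] C.

(* W is the affine cone over the linear span of A. *)
Definition linear_span N (A : set (proj K N)) (W : {vspace 'rV[K]_N.+1}) :
    Prop :=
  (forall x, A x -> (val x <= W)%VS) /\
  (forall W' : {vspace 'rV[K]_N.+1},
     (forall x, A x -> (val x <= W')%VS) -> (W <= W')%VS).

Definition rational_normal_curve N (d : nat) (C : set (proj K N)) : Prop :=
  [/\ irreducible_curve C d,
      smooth_of_dim C 1,
      rational_curve C &
      exists2 W, linear_span C W & \dim W = d.+1].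

Definition projectively_equivalent N (X Y : set (proj K N)) : Prop :=
  exists2 A : 'M[K]_N.+1, A \in unitmx &
    forall x, X x <->
      exists2 y, Y y & forall v : 'rV[K]_N.+1,
        val y = <[v]>%VS -> val x = <[v *m A]>%VS.

Definition monomials (n d : nat) : seq 'X_{1..n} :=
  [seq s2m (val t) | t : d.-tuple 'I_n <- enum (basis n d)].

Lemma mem_monomials n d (m : 'X_{1..n}) : (m \in monomials n d) = (mdeg m == d).
Proof. by rewrite basis_cover. Qed.

Lemma uniq_monomials n d : uniq (monomials n d).
Proof. exact: uniq_basis. Qed.

Lemma size_monomials n d : size (monomials n.+1 d) = 'C(n + d, n).-1.+1.
Proof.
rewrite size_basis prednK ?bin_gt0 ?leq_addr // addnC.
by rewrite -bin_sub ?leq_addl // addnK.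
Qed.

Definition veronese (n d : nat) : set (proj K ('C(n + d, n)).-1) :=
  [set y | exists x : proj K n,
     rational_map_at (fun i => 'X_[nth 0%MM (monomials n.+1 d) i]) x y].

End Zariski.

(* Main.v *)
(** Let P be the cone over X and V a space of linear forms whose ratios have
    transcendence degree m on P.  A form u in V has contact i with x if u/w lies
    in the i-th power of the maximal ideal of x in the ring k[V/w], for a fixed w
    in V, and O_x is the space of forms of contact delta with x.  On a
    curve C of degree delta the ring k[V/w] has rank at most delta over k[u/w], so
    a form having contact delta with a point of C and vanishing at another point
    of C vanishes on C.  Hence the ratios of O_x are constant along the curves
    through x; these cover X, so O_x has transcendence degree m - 1, and counting
    conditions gives dim V <= dim O_x + C(m + delta - 1, m).  By induction
    dim V <= C(m + delta, m), and equality for V forces equality for O_x.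

    In case of equality V consists of the products h F(b_0, ..., b_m), F a form of
    degree delta, where h and the homogeneously independent b_j live in a field
    of germs of functions on P.  For m = 1 this holds because V/w generates a
    field k(s).  For larger m it holds for O_x, and for O_x, O_y, O_z with x, y, z
    general one may take the same h and find one common space of b's spanned by
    those of O_x and O_y; since O_z contains h c^delta for all c in a hyperplane
    of that space, a Vandermonde argument on varying z puts all h c^delta in V.
    Applied to all linear forms, m = r + 1, this says that X is a linear image of
    the Veronese manifold.

    Lines are mapped to rational normal curves.  Conversely, a curve of degree
    delta in the Veronese manifold through the images of e1 and e2 stays in the
    image of the line e1 e2: otherwise a product of delta linear forms, one of
    them vanishing at e1 and e2, would give a hyperplane section with at least
    delta + 1 points. *)

From HB Require Import structures.
Require Import Defs.
From mathcomp Require Import all_boot all_order all_algebra.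
From mathcomp Require Import perm separable cyclotomic generic_quotient.
From mathcomp Require Import mpoly ring.
From mathcomp Require Import boolp classical_sets functions cardinality filter reals complex.

Set Implicit Arguments.
Unset Strict Implicit.
Unset Printing Implicit Defensive.

Import GRing.Theory.
Local Open Scope ring_scope.
Local Open Scope classical_set_scope.

(** * Germs of functions along an ultrafilter *)

(** Function fields and dimension theory are replaced by homogeneous relations between linear forms:
    dimension is defined by chains, and all that is taken from it is that independent forms produce
    a chain. In the ultrafilter field every function has a class, so division is free; but a germ
    has no value at a given point, and only homogeneous relations lead back to points. X is not
    known to be smooth, so contact is measured by powers of an ideal of k[V/w]; generic smoothness
    survives as the fact that at a general point m sections generate this ideal modulo its square.
    Contact with a curve is not treated as a local intersection number: Nakayama produces functions
    of contact exactly 0, 1, 2, ..., and a rank bound limits how many there are. The rank bound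
    itself comes from the degree, because a general fibre of u/w has as many points as the rank and
    lies in a hyperplane section. In the gluing, a section of O_z is picked arbitrarily for each z,
    so the z that suit a given x need not form an open set; membership in the ultrafilter then takes
    the place of genericity. *)

Section Germs.
Local Open Scope quotient_scope.
Variables (k : fieldType) (T : Type) (U : set_system T).
Hypothesis UU : UltraFilter U.

(** [{classic _}] supplies the choice structure that the quotient construction requires. *)
Definition fct : Type := {classic (T -> k)}.
HB.instance Definition _ := Choice.on fct.

Definition germ_eq (f g : fct) : bool :=
  `[< U [set x | (f : T -> k) x = (g : T -> k) x] >].

Lemma germ_eq_equiv : equiv_class_of germ_eq.
Proof.
split=> [f|f g|g f h].
- by apply/asboolP/filterS; [|exact: filterT].
- by apply/idP/idP => /asboolP H; apply/asboolP; apply: filterS H => x /= ->.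
- move=> /asboolP H1 /asboolP H2; apply/asboolP.
  by apply: filterS (filterI H1 H2) => x [/= -> ->].
Qed.

Canonical germ_equiv := EquivRelPack germ_eq_equiv.
Definition germ := {eq_quot germ_eq}.
HB.instance Definition _ : EqQuotient fct germ_eq germ := EqQuotient.on germ.
HB.instance Definition _ := Choice.on germ.

Definition mkgerm (f : T -> k) : germ := \pi_germ (f : fct).
Definition ungerm (a : germ) : T -> k := (repr a : fct).

Lemma ungermK a : mkgerm (ungerm a) = a.
Proof. exact: reprK. Qed.

Lemma mkgermE f g : mkgerm f = mkgerm g <-> U [set x | f x = g x].
Proof.
rewrite /mkgerm; split=> [/eqmodP/asboolP//|H].
by apply/eqmodP/asboolP.
Qed.

Lemma ungermP f : U [set x | ungerm (mkgerm f) x = f x].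
Proof. by apply/mkgermE; rewrite ungermK. Qed.

Definition gadd (a b : germ) := mkgerm (fun x => ungerm a x + ungerm b x).
Definition gmul (a b : germ) := mkgerm (fun x => ungerm a x * ungerm b x).
Definition gopp (a : germ) := mkgerm (fun x => - ungerm a x).
Definition ginv (a : germ) := mkgerm (fun x => (ungerm a x)^-1).

Lemma mkgermD f g : mkgerm (fun x => f x + g x) = gadd (mkgerm f) (mkgerm g).
Proof.
apply/mkgermE; apply: filterS (filterI (ungermP f) (ungermP g)) => x.
by move=> [/= -> ->].
Qed.

Lemma mkgermM f g : mkgerm (fun x => f x * g x) = gmul (mkgerm f) (mkgerm g).
Proof.
apply/mkgermE; apply: filterS (filterI (ungermP f) (ungermP g)) => x.
by move=> [/= -> ->].
Qed.

Lemma mkgermN f : mkgerm (fun x => - f x) = gopp (mkgerm f).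
Proof. by apply/mkgermE; apply: filterS (ungermP f) => x /= ->. Qed.

Lemma mkgermV f : mkgerm (fun x => (f x)^-1) = ginv (mkgerm f).
Proof. by apply/mkgermE; apply: filterS (ungermP f) => x /= ->. Qed.

Let c0 := mkgerm (fun=> 0).
Let c1 := mkgerm (fun=> 1).

Lemma gaddA : associative gadd.
Proof.
move=> a b c; rewrite -(ungermK a) -(ungermK b) -(ungermK c) -!mkgermD.
by congr mkgerm; apply/funext => x; rewrite addrA.
Qed.
Lemma gaddC : commutative gadd.
Proof.
move=> a b; rewrite -(ungermK a) -(ungermK b) -!mkgermD.
by congr mkgerm; apply/funext => x; rewrite addrC.
Qed.
Lemma gadd0 : left_id c0 gadd.
Proof.
move=> a; rewrite -(ungermK a) -!mkgermD.
by congr mkgerm; apply/funext => x; rewrite add0r.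
Qed.
Lemma gaddN : left_inverse c0 gopp gadd.
Proof.
move=> a; rewrite -(ungermK a) -mkgermN -!mkgermD.
by congr mkgerm; apply/funext => x; rewrite addNr.
Qed.
HB.instance Definition _ := GRing.isZmodule.Build germ gaddA gaddC gadd0 gaddN.

Lemma gmulA : associative gmul.
Proof.
move=> a b c; rewrite -(ungermK a) -(ungermK b) -(ungermK c) -!mkgermM.
by congr mkgerm; apply/funext => x; rewrite mulrA.
Qed.
Lemma gmulC : commutative gmul.
Proof.
move=> a b; rewrite -(ungermK a) -(ungermK b) -!mkgermM.
by congr mkgerm; apply/funext => x; rewrite mulrC.
Qed.
Lemma gmul1 : left_id c1 gmul.
Proof.
move=> a; rewrite -(ungermK a) -!mkgermM.
by congr mkgerm; apply/funext => x; rewrite mul1r.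
Qed.
Lemma gmulDl : left_distributive gmul gadd.
Proof.
move=> a b c; rewrite -(ungermK a) -(ungermK b) -(ungermK c).
rewrite -mkgermD -!mkgermM -[RHS]mkgermD.
by congr mkgerm; apply/funext => x; rewrite mulrDl.
Qed.
Lemma germ10 : c1 != c0.
Proof.
apply/eqP => /mkgermE H.
have : U set0 by apply: filterS H => x /= /eqP; rewrite oner_eq0.
exact: filter_not_empty.
Qed.
HB.instance Definition _ :=
  GRing.Zmodule_isComNzRing.Build germ gmulA gmulC gmul1 gmulDl germ10.

(** The step of the construction that uses maximality of the filter: either the zero set of f is
    large and the germ is 0, or its complement is large and the pointwise inverse works. *)
Lemma gmulVf (a : germ) : a != 0 -> ginv a * a = 1.
Proof.
rewrite -(ungermK a); set f := ungerm a => /eqP nz.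
rewrite -mkgermV; change (gmul (mkgerm (fun x => (f x)^-1)) (mkgerm f) = c1).
rewrite -mkgermM.
have [H|H] := in_ultra_setVsetC [set x | f x = 0] UU; first by case: nz; apply/mkgermE.
by apply/mkgermE; apply: filterS H => x /= /eqP fx; rewrite mulVf.
Qed.
Lemma ginv0 : ginv 0 = 0.
Proof.
change (ginv c0 = c0); rewrite /c0 -mkgermV.
by congr mkgerm; apply/funext => x; rewrite invr0.
Qed.
HB.instance Definition _ := GRing.ComNzRing_isField.Build germ gmulVf ginv0.

Lemma mkgerm_is_zmod_morphism : zmod_morphism (mkgerm : (T -> k) -> germ).
Proof.
move=> f g; rewrite -[RHS]/(gadd (mkgerm f) (gopp (mkgerm g))) -mkgermN.
by rewrite -mkgermD; congr mkgerm; apply/funext.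
Qed.
HB.instance Definition _ :=
  GRing.isZmodMorphism.Build (T -> k) germ mkgerm mkgerm_is_zmod_morphism.
Lemma mkgerm_is_monoid_morphism : monoid_morphism (mkgerm : (T -> k) -> germ).
Proof.
split=> // f g; rewrite -[RHS]/(gmul (mkgerm f) (mkgerm g)) -mkgermM.
by congr mkgerm; apply/funext.
Qed.
HB.instance Definition _ :=
  GRing.isMonoidMorphism.Build (T -> k) germ mkgerm mkgerm_is_monoid_morphism.

Lemma mkgermVr (f : T -> k) : (mkgerm f)^-1 = mkgerm (fun x => (f x)^-1).
Proof. by rewrite mkgermV. Qed.

Lemma mkgerm_eq0 (f : T -> k) : mkgerm f = 0 <-> U [set x | f x = 0].
Proof. exact: mkgermE. Qed.
End Germs.

(** * Homogeneous functions on a cone *)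

Section Infinite.
Variable k : fieldType.
Hypothesis char0 : [pchar k] =i pred0.

Lemma natr_inj0 : injective (fun i : nat => i%:R : k).
Proof.
move=> i j /eqP; wlog le_ij : i j / (i <= j)%N.
  by move=> H E; have [/H|/ltnW/H] := leqP i j; [apply|rewrite eq_sym => /(_ E)].
rewrite eq_sym -subr_eq0 -natrB // ((pcharf0P k).1 char0) subn_eq0 => le_ji.
by apply/eqP; rewrite eqn_leq le_ij.
Qed.

Lemma poly_nonroot (p : {poly k}) : p != 0 -> exists c, p.[c] != 0.
Proof.
move=> p0; pose s : seq k := [seq i%:R | i <- iota 0 (size p)].
have us : uniq s by rewrite map_inj_uniq ?iota_uniq //; exact: natr_inj0.
have [all_s|] := boolP (all (root p) s).
  by have := max_poly_roots p0 all_s us; rewrite size_map size_iota ltnn.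
by move=> /allPn [c _ rc]; exists c.
Qed.

Lemma mnmwiden_split n (m : 'X_{1..n.+1}) :
  m = (mnmwiden [multinom (m (widen_ord (leqnSn n) i)) | i < n]
       + U_(ord_max) *+ (m ord_max))%MM.
Proof.
apply/mnmP => i; rewrite mnmDE mulmnE mnm1E.
have [->|i_ne] := eqVneq i ord_max.
  by rewrite mnmwiden_ordmax mul1n.
have lt_in : (i < n)%N.
  by have := ltn_ord i; rewrite ltnS leq_eqVlt => /orP[/eqP e|//]; case/eqP: i_ne; exact/val_inj.
rewrite mul0n addn0 (_ : i = widen_ord (leqnSn n) (Ordinal lt_in)); last exact/val_inj.
by rewrite mnmwiden_widen mnmE.
Qed.

Lemma muniK n (p : {mpoly k[n.+1]}) :
  p = (map_poly (@mwiden n k) (muni p)).['X_ord_max].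
Proof.
rewrite muniE rmorph_sum horner_sum {1}[p]mpolyE; apply: eq_bigr => m _ /=.
rewrite map_polyZ map_polyXn hornerZ hornerXn /= mwidenZ mwidenX -scalerAl.
by congr (_ *: _); rewrite [in LHS](mnmwiden_split m) mpolyXD mpolyXn.
Qed.

Lemma meval_mwiden n (p : {mpoly k[n]}) (v : 'I_n.+1 -> k) :
  (mwiden p).@[v] = p.@[fun i => v (widen_ord (leqnSn n) i)].
Proof.
rewrite /mwiden {2}[p]mpolyE /mmap !rmorph_sum /=; apply: eq_bigr => m _.
rewrite rmorphM /= mevalC mevalZ mevalX /mmap1 rmorph_prod /=; congr (_ * _).
by apply: eq_bigr => i _; rewrite rmorphXn /= mevalXU.
Qed.

Lemma meval_muni n (p : {mpoly k[n.+1]}) (v : 'I_n.+1 -> k) :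
  p.@[v] =
  (map_poly (meval (fun i => v (widen_ord (leqnSn n) i))) (muni p)).[v ord_max].
Proof.
rewrite {1}[p]muniK horner_poly (raddf_sum (meval v)) /=.
rewrite (@horner_coef_wide _ (size (muni p))) ?size_poly //.
apply: eq_bigr => i _; rewrite coef_poly ltn_ord rmorphM rmorphXn /= mevalXU.
by rewrite meval_mwiden.
Qed.

(** Induction on the number of variables: the first n values avoid the zeros of the leading
    coefficient in the last variable, then the last value avoids the roots of a nonzero univariate
    polynomial. *)
Lemma mpoly_nonroot n (p : {mpoly k[n]}) :
  p != 0 -> exists v : 'I_n -> k, p.@[v] != 0.
Proof.
elim: n p => [|n IHn] p p0.
  exists (fun=> 0); apply: contraNneq p0 => pv0; rewrite [p]mpolyE big1_seq // => m _.
  suff -> : p@_m = 0 by rewrite scale0r.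
  have m0 m' : m' = 0%MM :> 'X_{1..0} by apply/mnmP => -[].
  move: pv0; rewrite (m0 m) [p in p.@[_]]mpolyE raddf_sum /=.
  have [mp|] := boolP (0%MM \in msupp p); last first.
    by rewrite -mcoeff_eq0 => /eqP.
  rewrite (bigD1_seq 0%MM) ?msupp_uniq //= big1_seq ?addr0; last first.
    by move=> m' /andP[/eqP ne _]; case: ne.
  by rewrite mevalZ mevalX big_ord0 mulr1.
have q0 : muni p != 0.
  by apply: contraNneq p0 => q0; rewrite [p]muniK q0 rmorph0 horner0.
have /IHn [v' v'P] : lead_coef (muni p) != 0 by rewrite lead_coef_eq0.
pose q := map_poly (meval v') (muni p).
have /poly_nonroot [c cP] : q != 0.
  apply: contraNneq v'P => /(congr1 (fun r : {poly k} => r`_(size (muni p)).-1)).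
  by rewrite coef_map coef0 /= => /eqP.
exists (fun i => if insub (val i) is Some j then v' j else c).
rewrite meval_muni insubF ?ltnn //= (_ : map_poly _ _ = q) //.
apply: eq_map_poly => r; apply: meval_eq => i /=.
by case: insubP => [j _ /val_inj -> //|]; rewrite ltn_ord.
Qed.
End Infinite.

(** * Homogeneous polynomial functions and linear forms *)

Section PolyFun.
Variable k : fieldType.
Implicit Types (n d e : nat).

(** Linear forms are identified with row vectors through this pairing, so that a linear system is a
    [{vspace}] of row vectors and sections and points have the same type. *)
Definition lin n (u v : 'rV[k]_n) : k := \sum_i u 0 i * v 0 i.

(** The degree is an argument, so the zero function has every degree and sums of forms need no case
    distinction. *)
Definition polyfun n d (f : 'rV[k]_n -> k) : Prop :=
  exists2 F : {mpoly k[n]}, F \is d.-homog & forall v, f v = F.@[v 0].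

Lemma polyfun_ext n d (f g : 'rV[k]_n -> k) :
  f =1 g -> polyfun d f -> polyfun d g.
Proof. by move=> fg [F Fd FE]; exists F => // v; rewrite -fg. Qed.

Lemma polyfun_const n (c : k) : polyfun 0 (fun _ : 'rV[k]_n => c).
Proof.
exists (c%:MP) => [|v]; last by rewrite mevalC.
by rewrite -[c%:MP]mulr1 mul_mpolyC rpredZ ?dhomog1.
Qed.

Lemma polyfun_var n i : polyfun 1 (fun v : 'rV[k]_n => v 0 i).
Proof. by exists 'X_i => [|v]; rewrite ?mevalXU // dhomogX /= mdeg1. Qed.

Lemma polyfunD n d (f g : 'rV[k]_n -> k) :
  polyfun d f -> polyfun d g -> polyfun d (fun v => f v + g v).
Proof.
move=> [F Fd FE] [G Gd GE]; exists (F + G); first exact: rpredD.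
by move=> v; rewrite mevalD FE GE.
Qed.

Lemma polyfunM n d e (f g : 'rV[k]_n -> k) :
  polyfun d f -> polyfun e g -> polyfun (d + e) (fun v => f v * g v).
Proof.
move=> [F Fd FE] [G Gd GE]; exists (F * G); first exact: dhomogM.
by move=> v; rewrite mevalM FE GE.
Qed.

Lemma polyfunZ n d (c : k) (f : 'rV[k]_n -> k) :
  polyfun d f -> polyfun d (fun v => c * f v).
Proof. exact: polyfunM (polyfun_const _ _). Qed.

Lemma polyfunN n d (f : 'rV[k]_n -> k) :
  polyfun d f -> polyfun d (fun v => - f v).
Proof. by move/(polyfunZ (-1)); apply: polyfun_ext => v; rewrite mulN1r. Qed.

Lemma polyfunB n d (f g : 'rV[k]_n -> k) :
  polyfun d f -> polyfun d g -> polyfun d (fun v => f v - g v).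
Proof. by move=> pf /polyfunN pg; apply: polyfunD. Qed.

Lemma polyfun0 n d : polyfun d (fun _ : 'rV[k]_n => 0).
Proof. by exists 0 => [|v]; rewrite ?rpred0 ?meval0. Qed.

Lemma polyfun_sum n d (I : Type) (s : seq I) (P : pred I) (f : I -> 'rV[k]_n -> k) :
  (forall i, P i -> polyfun d (f i)) ->
  polyfun d (fun v => \sum_(i <- s | P i) f i v).
Proof.
move=> H; elim: s => [|i s IHs].
  by apply: polyfun_ext (polyfun0 n d) => v; rewrite big_nil.
have [Pi|/negbTE nPi] := boolP (P i); last first.
  by apply: polyfun_ext IHs => v; rewrite big_cons nPi.
by apply: polyfun_ext (polyfunD (H i Pi) IHs) => v; rewrite big_cons Pi.
Qed.

Lemma polyfun_prod n (I : Type) (s : seq I) (P : pred I) (d : I -> nat)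
    (f : I -> 'rV[k]_n -> k) :
  (forall i, P i -> polyfun (d i) (f i)) ->
  polyfun (\sum_(i <- s | P i) d i) (fun v => \prod_(i <- s | P i) f i v).
Proof.
move=> H; elim: s => [|i s IHs].
  by rewrite big_nil; apply: polyfun_ext (polyfun_const n 1) => v; rewrite big_nil.
have [Pi|/negbTE nPi] := boolP (P i); rewrite big_cons ?Pi ?nPi; last first.
  by apply: polyfun_ext IHs => v; rewrite big_cons nPi.
by apply: polyfun_ext (polyfunM (H i Pi) IHs) => v; rewrite big_cons Pi.
Qed.

Lemma polyfunX n d e (f : 'rV[k]_n -> k) :
  polyfun d f -> polyfun (d * e) (fun v => f v ^+ e).
Proof.
move=> pf; elim: e => [|e IHe].
  by rewrite muln0; apply: polyfun_ext (polyfun_const n 1) => v; rewrite expr0.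
by rewrite mulnS; apply: polyfun_ext (polyfunM pf IHe) => v; rewrite exprS.
Qed.

Lemma polyfun_comp m n d e (F : {mpoly k[m]}) (f : 'I_m -> 'rV[k]_n -> k) :
  F \is d.-homog -> (forall i, polyfun e (f i)) ->
  polyfun (d * e) (fun v => F.@[fun i => f i v]).
Proof.
move=> Fd pf.
suff : polyfun (d * e) (fun v => \sum_(M <- msupp F | M \in msupp F)
           F@_M * \prod_i f i v ^+ M i).
  by apply: polyfun_ext => v; rewrite mevalE -big_seq.
apply: polyfun_sum => M /(dhomogP _ _ _ Fd) <-.
apply: polyfunZ; rewrite /= mdegE big_distrl /=.
by apply: polyfun_prod => i _; rewrite mulnC; exact: polyfunX.
Qed.

Lemma polyfun_lin n (u : 'rV[k]_n) : polyfun 1 (lin u).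
Proof. by apply: polyfun_sum => i _; apply: polyfunZ; exact: polyfun_var. Qed.

Lemma homog_scale m d (F : {mpoly k[m]}) (c : k) (x : 'I_m -> k) :
  F \is d.-homog -> F.@[fun i => c * x i] = c ^+ d * F.@[x].
Proof.
move=> Fd; rewrite !mevalE big_distrr /= big_seq [RHS]big_seq.
apply: eq_bigr => M /(dhomogP _ _ _ Fd) <-.
rewrite mulrCA; congr (_ * _); rewrite /= mdegE -prodrXr -big_split /=.
by apply: eq_bigr => i _; rewrite exprMn.
Qed.

Lemma polyfun_scale n d (f : 'rV[k]_n -> k) c v :
  polyfun d f -> f (c *: v) = c ^+ d * f v.
Proof.
move=> [F Fd FE]; rewrite !FE -(homog_scale c _ Fd).
by apply: meval_eq => i; rewrite mxE.
Qed.

Lemma mpoly_line m (F : {mpoly k[m]}) (a b : 'I_m -> k) :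
  exists p : {poly k}, forall c, p.[c] = F.@[fun i => a i + c * b i].
Proof.
exists (mmap (@polyC k) (fun i => (a i)%:P + b i *: 'X) F) => c.
rewrite mevalE /mmap horner_sum; apply: eq_bigr => M _.
rewrite hornerM hornerC /mmap1 horner_prod; congr (_ * _).
by apply: eq_bigr => i _; rewrite horner_exp !hornerE mulrC.
Qed.

Lemma polyfun_line n d (f : 'rV[k]_n -> k) a b :
  polyfun d f -> exists p : {poly k}, forall c, p.[c] = f (a + c *: b).
Proof.
move=> [F _ FE]; have [p pE] := mpoly_line F (a 0) (b 0); exists p => c.
by rewrite pE FE; apply: meval_eq => i; rewrite !mxE.
Qed.

Lemma linDl n (u u' v : 'rV[k]_n) : lin (u + u') v = lin u v + lin u' v.
Proof. by rewrite -big_split; apply: eq_bigr => i _; rewrite mxE mulrDl. Qed.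
Lemma linZl n c (u v : 'rV[k]_n) : lin (c *: u) v = c * lin u v.
Proof. by rewrite /lin big_distrr /=; apply: eq_bigr => i _; rewrite mxE mulrA. Qed.
Lemma linNl n (u v : 'rV[k]_n) : lin (- u) v = - lin u v.
Proof. by rewrite -scaleN1r linZl mulN1r. Qed.
Lemma linBl n (u u' v : 'rV[k]_n) : lin (u - u') v = lin u v - lin u' v.
Proof. by rewrite linDl linNl. Qed.
Lemma lin0l n (v : 'rV[k]_n) : lin 0 v = 0.
Proof. by rewrite -(scale0r 0) linZl mul0r. Qed.
Lemma linC n (u v : 'rV[k]_n) : lin u v = lin v u.
Proof. by apply: eq_bigr => i _; rewrite mulrC. Qed.
Lemma lin_suml n (I : Type) (s : seq I) (P : pred I) (F : I -> 'rV[k]_n) v :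
  lin (\sum_(i <- s | P i) F i) v = \sum_(i <- s | P i) lin (F i) v.
Proof.
by elim/big_rec2: _ => [|i y1 y2 _ <-]; rewrite ?lin0l ?linDl.
Qed.
Lemma linZr n c (u v : 'rV[k]_n) : lin u (c *: v) = c * lin u v.
Proof. by rewrite linC linZl linC. Qed.
Lemma linDr n (u v v' : 'rV[k]_n) : lin u (v + v') = lin u v + lin u v'.
Proof. by rewrite linC linDl !(linC u). Qed.
Lemma lin_delta n (v : 'rV[k]_n) i : lin (delta_mx 0 i) v = v 0 i.
Proof.
rewrite /lin (bigD1 i) //= big1 ?addr0 ?mxE ?eqxx ?mul1r // => j ji.
by rewrite mxE (negbTE ji) mul0r.
Qed.

(** For a cone this expresses irreducibility of the projective set: primality of a homogeneous ideal
    may be tested on homogeneous elements. *)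
Definition irr n (Q : set 'rV[k]_n) : Prop :=
  Q !=set0 /\ forall d e f g, polyfun d f -> polyfun e g ->
    (forall v, Q v -> f v * g v = 0) ->
    (forall v, Q v -> f v = 0) \/ (forall v, Q v -> g v = 0).

Definition nz n (Q : set 'rV[k]_n) (f : 'rV[k]_n -> k) := exists2 v, Q v & f v != 0.

Lemma nzPn n (Q : set 'rV[k]_n) f : ~ nz Q f <-> forall v, Q v -> f v = 0.
Proof.
split=> [nf v Qv|H [v Qv]]; last by rewrite H ?eqxx.
by apply/eqP; apply: contrapT => /negP fv; apply: nf; exists v.
Qed.

Lemma irr_nzM n (Q : set 'rV[k]_n) d e f g : irr Q -> polyfun d f -> polyfun e g ->
  nz Q f -> nz Q g -> nz Q (fun v => f v * g v).
Proof.
move=> [_ H] pf pg [x Qx fx] [y Qy gy]; apply: contrapT => /nzPn /(H _ _ _ _ pf pg).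
by case=> /(_ _ _) H'; [rewrite H' ?eqxx in fx|rewrite H' ?eqxx in gy].
Qed.

End PolyFun.

(** An interface that hides the ultrafilter. [ge_nz] makes the values off a proper closed subset
    decisive; [ge_eq0] brings a vanishing germ back to every point, but for forms only. *)
Record genf (k : fieldType) n (Q : set 'rV[k]_n) := GenF {
  gK :> fieldType;
  ge : ('rV[k]_n -> k) -> gK;
  geD : forall f g, ge (fun v => f v + g v) = ge f + ge g;
  geM : forall f g, ge (fun v => f v * g v) = ge f * ge g;
  geV : forall f, ge (fun v => (f v)^-1) = (ge f)^-1;
  ge1 : ge (fun=> 1) = 1;
  ge_nz : forall d q f, polyfun d q -> nz Q q ->
    (forall v, Q v -> q v != 0 -> f v = 0) -> ge f = 0;
  ge_eq0 : forall d f, polyfun d f -> ge f = 0 -> forall v, Q v -> f v = 0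
}.

(** * Existence and calculus of the field of germs *)

Section GenfExists.
Variables (k : fieldType) (n : nat) (Q : set 'rV[k]_n).

(** Irreducibility makes the nonempty open sets [q != 0] stable under intersection, so they generate
    a proper filter; any ultrafilter containing it serves. *)
Lemma ultra_irr : irr Q -> exists2 U : set_system 'rV[k]_n, UltraFilter U &
  forall d q, polyfun d q -> nz Q q -> U [set v | Q v /\ q v != 0].
Proof.
move=> iQ; pose B : set_system 'rV[k]_n := [set S | exists d q,
  [/\ polyfun d q, nz Q q & [set v | Q v /\ q v != 0] `<=` S]].
have BF : ProperFilter B.
  apply: Build_ProperFilter_ex => [S [d [q [_ [v Qv qv] H]]]|].
    by exists v; apply: H.
  split.
  - exists 0%N, (fun=> 1); split; [exact: polyfun_const| |by []].
    by case: iQ => -[v Qv] _; exists v; rewrite ?oner_eq0.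
  - move=> S S' [d [q [pq nq H]]] [d' [q' [pq' nq' H']]].
    exists (d + d')%N, (fun v => q v * q' v); split.
    + exact: polyfunM.
    + exact: (irr_nzM iQ pq pq' nq nq').
    + by move=> v [Qv]; rewrite mulf_eq0 negb_or => /andP[? ?]; split; [apply: H|apply: H'].
  - move=> S S' SS' [d [q [pq nq H]]]; exists d, q; split => //.
    exact: subset_trans SS'.
have [U [UU BU]] := ultraFilterLemma BF.
by exists U => // d q pq nq; apply: BU; exists d, q; split.
Qed.

Lemma genf_exists : irr Q -> exists G : genf Q, True.
Proof.
move=> iQ; have [U UU HU] := ultra_irr iQ.
pose K : fieldType := @germ k _ U UU.
have H1 : forall d q f, polyfun d q -> nz Q q ->
    (forall v, Q v -> q v != 0 -> f v = 0) -> mkgerm UU f = 0 :> K.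
  move=> d q f pq nq H; apply/mkgerm_eq0; apply: filterS (HU d q pq nq).
  by move=> v [Qv qv]; apply: H.
have H2 : forall d f, polyfun d f -> mkgerm UU f = 0 :> K -> forall v, Q v -> f v = 0.
  move=> d f pf f0; apply/nzPn => nf.
  have PF : ProperFilter U by apply: (@ultra_proper _ U UU).
  have FU : Filter U by exact: filter_filter.
  have H := @filterI _ U FU _ _ (HU d f pf nf) ((mkgerm_eq0 UU f).1 f0).
  suff U0 : U set0 by case: (@filter_not_empty _ U PF U0).
  by apply: filterS H => v [[_ /eqP]].
unshelve eexists (@GenF k n Q K (mkgerm UU) _ _ _ _ H1 H2); last by [].
- by move=> f g; exact: rmorphD (mkgerm UU) f g.
- by move=> f g; exact: rmorphM (mkgerm UU) f g.
- by move=> f; rewrite mkgermVr.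
- exact: rmorph1 (mkgerm UU).
Qed.
End GenfExists.

Section GenfTheory.
Variables (k : fieldType) (n : nat) (Q : set 'rV[k]_n) (G : genf Q).
Implicit Types f g : 'rV[k]_n -> k.

Lemma ge0 : ge G (fun=> 0) = 0.
Proof.
apply: (@addrI _ (ge G (fun=> 0))); rewrite -[LHS]geD [RHS]addr0.
by congr (ge G _); apply/funext => v; rewrite addr0.
Qed.

Lemma geN f : ge G (fun v => - f v) = - ge G f.
Proof.
apply/eqP; rewrite -subr_eq0 opprK -geD -ge0; apply/eqP; congr ge.
by apply/funext => v; rewrite addNr.
Qed.

Lemma geB f g : ge G (fun v => f v - g v) = ge G f - ge G g.
Proof. by rewrite (geD G f (fun v => - g v)) geN. Qed.

Definition iota (c : k) : G := ge G (fun=> c).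

Lemma iota_is_zmod_morphism : zmod_morphism iota.
Proof. by move=> c c'; rewrite -geB. Qed.
HB.instance Definition _ := GRing.isZmodMorphism.Build k G iota iota_is_zmod_morphism.
Lemma iota_is_monoid_morphism : monoid_morphism iota.
Proof. by split=> [|c c']; [exact: ge1|rewrite -geM]. Qed.
HB.instance Definition _ := GRing.isMonoidMorphism.Build k G iota iota_is_monoid_morphism.

Lemma ge_sum (I : Type) (s : seq I) (P : pred I) (f : I -> 'rV[k]_n -> k) :
  ge G (fun v => \sum_(i <- s | P i) f i v) = \sum_(i <- s | P i) ge G (f i).
Proof.
elim: s => [|i s IHs]; first by rewrite big_nil -ge0; congr ge; apply/funext => v; rewrite big_nil.
rewrite big_cons; case: ifP => Pi; rewrite -IHs -?geD; congr ge; apply/funext => v;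
  by rewrite big_cons Pi.
Qed.

Lemma ge_prod (I : Type) (s : seq I) (P : pred I) (f : I -> 'rV[k]_n -> k) :
  ge G (fun v => \prod_(i <- s | P i) f i v) = \prod_(i <- s | P i) ge G (f i).
Proof.
elim: s => [|i s IHs]; first by rewrite big_nil -(ge1 G); congr ge; apply/funext => v; rewrite big_nil.
rewrite big_cons; case: ifP => Pi; rewrite -IHs -?geM; congr ge; apply/funext => v;
  by rewrite big_cons Pi.
Qed.

Lemma geX f e : ge G (fun v => f v ^+ e) = ge G f ^+ e.
Proof.
elim: e => [|e IHe]; first by rewrite expr0 -(ge1 G); congr ge; apply/funext => v; rewrite expr0.
by rewrite exprS -IHe -geM; congr ge; apply/funext => v; rewrite exprS.
Qed.

Lemma geZ c f : ge G (fun v => c * f v) = iota c * ge G f.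
Proof. exact: geM. Qed.

Lemma ge_comp m (F : {mpoly k[m]}) (f : 'I_m -> 'rV[k]_n -> k) :
  ge G (fun v => F.@[fun i => f i v]) = mmap iota (fun i => ge G (f i)) F.
Proof.
rewrite /mmap (_ : (fun v => F.@[fun i => f i v]) =
  fun v => \sum_(M <- msupp F) F@_M * \prod_i f i v ^+ M i); last first.
  by apply/funext => v; rewrite mevalE.
rewrite ge_sum; apply: eq_bigr => M _; rewrite geZ; congr (_ * _).
by rewrite ge_prod; apply: eq_bigr => i _; rewrite geX.
Qed.

Lemma ge_horner (p : {poly k}) f :
  ge G (fun v => p.[f v]) = (map_poly iota p).[ge G f].
Proof.
rewrite (_ : (fun v => p.[f v]) = fun v => \sum_(i < size p) p`_i * f v ^+ i); last first.
  by apply/funext => v; rewrite horner_coef.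
rewrite ge_sum horner_coef size_map_poly; apply: eq_bigr => i _.
by rewrite geZ geX coef_map.
Qed.
End GenfTheory.

(** * Extension of homomorphisms *)

Section Extension.
Variables (k : closedFieldType) (K : fieldType) (i : {rmorphism k -> K}).
Hypothesis char0 : [pchar k] =i pred0.
Implicit Types (B : set K) (x y a b : K) (p q h : {poly K}).

Definition subalg B : Prop :=
  [/\ forall c, B (i c), forall a b, B a -> B b -> B (a + b) &
      forall a b, B a -> B b -> B (a * b)].

Definition pover B p : Prop := forall j, B p`_j.

Definition adj B y : set K := [set x | exists2 p, pover B p & x = p.[y]].

(** A k-algebra homomorphism from B to k, encoded as a total function on K that is constrained on B
    only; extending it needs no change of type. *)
Definition hom B (phi : K -> k) : Prop :=
  [/\ forall c, phi (i c) = c,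
      forall a b, B a -> B b -> phi (a + b) = phi a + phi b &
      forall a b, B a -> B b -> phi (a * b) = phi a * phi b].

Definition algebraic B y : Prop :=
  exists p, [/\ pover B p, p != 0 & p.[y] = 0].

Section Closure.
Variable B : set K.
Hypothesis sB : subalg B.
Let BC c : B (i c). Proof. by case: sB. Qed.
Let BD a b : B a -> B b -> B (a + b). Proof. by case: sB => _ H _; apply: H. Qed.
Let BM a b : B a -> B b -> B (a * b). Proof. by case: sB => _ _; apply. Qed.

Lemma subalg0 : B 0. Proof. by rewrite -(rmorph0 i). Qed.
Lemma subalg1 : B 1. Proof. by rewrite -(rmorph1 i). Qed.
Lemma subalgN a : B a -> B (- a).
Proof. by move=> Ba; rewrite -mulN1r -(rmorph1 i) -rmorphN; apply: BM. Qed.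
Lemma subalgX a n : B a -> B (a ^+ n).
Proof. by move=> Ba; elim: n => [|n IHn]; rewrite ?expr0 ?exprS; [exact: subalg1|exact: BM]. Qed.
Lemma subalg_sum (I : Type) (s : seq I) (P : pred I) (F : I -> K) :
  (forall j, P j -> B (F j)) -> B (\sum_(j <- s | P j) F j).
Proof. by move=> H; elim/big_ind: _ => //; exact: subalg0. Qed.
Lemma subalg_prod (I : Type) (s : seq I) (P : pred I) (F : I -> K) :
  (forall j, P j -> B (F j)) -> B (\prod_(j <- s | P j) F j).
Proof. by move=> H; elim/big_ind: _ => //; exact: subalg1. Qed.

Lemma poverC a : B a -> pover B a%:P.
Proof. by move=> Ba j; rewrite coefC; case: ifP => _ //; exact: subalg0. Qed.
Lemma pover0 : pover B 0. Proof. by move=> j; rewrite coef0; exact: subalg0. Qed.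
Lemma poverX : pover B 'X.
Proof. by move=> j; rewrite coefX; case: (_ == _); [exact: subalg1|exact: subalg0]. Qed.
Lemma poverXn n : pover B 'X^n.
Proof. by move=> j; rewrite coefXn; case: (_ == _); [exact: subalg1|exact: subalg0]. Qed.
Lemma poverD p q : pover B p -> pover B q -> pover B (p + q).
Proof. by move=> Hp Hq j; rewrite coefD; apply: BD. Qed.
Lemma poverN p : pover B p -> pover B (- p).
Proof. by move=> Hp j; rewrite coefN; apply: subalgN. Qed.
Lemma poverB p q : pover B p -> pover B q -> pover B (p - q).
Proof. by move=> Hp Hq; apply: poverD => //; apply: poverN. Qed.
Lemma poverM p q : pover B p -> pover B q -> pover B (p * q).
Proof. by move=> Hp Hq j; rewrite coefM; apply: subalg_sum => l _; apply: BM. Qed.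
Lemma poverZ a p : B a -> pover B p -> pover B (a *: p).
Proof. by move=> Ba Hp j; rewrite coefZ; apply: BM. Qed.
Lemma pover_deriv p : pover B p -> pover B p^`().
Proof.
by move=> Hp j; rewrite coef_deriv -mulr_natr -(rmorph_nat i); apply: BM.
Qed.
Lemma pover_horner p a : pover B p -> B a -> B p.[a].
Proof.
move=> Hp Ba; rewrite horner_coef; apply: subalg_sum => j _; apply: BM => //.
exact: subalgX.
Qed.

Lemma subalg_adj y : subalg (adj B y).
Proof.
split=> [c|_ _ [p Hp ->] [q Hq ->]|_ _ [p Hp ->] [q Hq ->]].
- by exists (i c)%:P; rewrite ?hornerC //; exact: poverC.
- by exists (p + q); rewrite ?hornerD //; exact: poverD.
- by exists (p * q); rewrite ?hornerM //; exact: poverM.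
Qed.

Lemma adj_base y a : B a -> adj B y a.
Proof. by move=> Ba; exists a%:P; rewrite ?hornerC //; exact: poverC. Qed.
Lemma adj_gen y : adj B y y.
Proof. by exists 'X; rewrite ?hornerX //; exact: poverX. Qed.

(** Pseudo-division: B is only a subring of K, so the leading coefficient of p is paid for by a
    power of it. *)
Lemma pdiv p q : pover B p -> pover B q -> p != 0 -> exists s g r,
  [/\ pover B g, pover B r, lead_coef p ^+ s *: q = g * p + r & (size r < size p)%N].
Proof.
move=> Hp Hq p0; have [n] := ubnP (size q); elim: n q Hq => // n IHn q Hq.
rewrite ltnS => szq; have [lt_qp|le_pq] := ltnP (size q) (size p).
  exists 0%N, 0, q; split=> //; first exact: pover0.
  by rewrite expr0 scale1r mul0r add0r.
have q0 : q != 0 by rewrite -size_poly_gt0 (leq_trans _ le_pq) // size_poly_gt0.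
pose c := lead_coef p; pose m := lead_coef q *: 'X^(size q - size p).
have Hm : pover B m by apply: poverZ; [exact: Hq|exact: poverXn].
pose q' := c *: q - m * p.
have Hq' : pover B q' by apply: poverB; [apply: poverZ => //; exact: Hp|exact: poverM].
have szq' : (size q' < size q)%N.
  have szmp : size (m * p) = size q.
    rewrite -scalerAl size_scale ?lead_coef_eq0 // mulrC size_mulXn //.
    by rewrite subnK.
  have szcq : size (c *: q) = size q by rewrite size_scale ?lead_coef_eq0.
  rewrite -(prednK (_ : (0 < size q)%N)) ?size_poly_gt0 // ltnS.
  apply/leq_sizeP => j; rewrite leq_eqVlt => /orP[/eqP <-|lt_j].
    have -> : q'`_(size q).-1 = c * lead_coef q - lead_coef (m * p).
      by rewrite coefB coefZ lead_coefE lead_coefE szmp.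
    rewrite lead_coefM /m lead_coefZ lead_coefXn mulr1.
    by rewrite mulrC subrr.
  rewrite coefB !nth_default ?subrr // ?szmp ?szcq;
    by move: lt_j; rewrite prednK ?size_poly_gt0.
have [s [g [r [Hg Hr E szr]]]] := IHn q' Hq' (leq_trans szq' szq).
exists s.+1, (g + c ^+ s *: m), r; split=> //.
  by apply: poverD => //; apply: poverZ => //; apply: subalgX; exact: Hp.
rewrite mulrDl -[_ *: m * p]scalerAl addrAC -E /q' scalerBr scalerA -exprSr.
by rewrite subrK.
Qed.

Section Hom.
Variable phi : K -> k.
Hypothesis Hphi : hom B phi.

Let phiC c : phi (i c) = c. Proof. by case: Hphi. Qed.
Let phiD a b : B a -> B b -> phi (a + b) = phi a + phi b.
Proof. by case: Hphi => _ H _; apply: H. Qed.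
Let phiM a b : B a -> B b -> phi (a * b) = phi a * phi b.
Proof. by case: Hphi => _ _; apply. Qed.

Lemma hom0 : phi 0 = 0. Proof. by rewrite -(rmorph0 i). Qed.
Lemma hom1 : phi 1 = 1. Proof. by rewrite -(rmorph1 i). Qed.
Lemma homN a : B a -> phi (- a) = - phi a.
Proof.
by move=> Ba; rewrite -mulN1r -(rmorph1 i) -rmorphN phiM ?phiC ?mulN1r.
Qed.
Lemma homB a b : B a -> B b -> phi (a - b) = phi a - phi b.
Proof. by move=> Ba Bb; rewrite phiD ?homN //; exact: subalgN. Qed.
Lemma homX a n : B a -> phi (a ^+ n) = phi a ^+ n.
Proof.
move=> Ba; elim: n => [|n IHn]; first by rewrite !expr0 hom1.
by rewrite !exprS phiM ?IHn //; exact: subalgX.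
Qed.
Lemma hom_sum (I : Type) (s : seq I) (P : pred I) (F : I -> K) :
  (forall j, P j -> B (F j)) ->
  phi (\sum_(j <- s | P j) F j) = \sum_(j <- s | P j) phi (F j).
Proof.
move=> H; elim: s => [|j s IHs]; first by rewrite !big_nil hom0.
rewrite !big_cons; case: ifP => // Pj; rewrite phiD ?IHs //; first exact: H.
exact: subalg_sum.
Qed.
Lemma hom_prod (I : Type) (s : seq I) (P : pred I) (F : I -> K) :
  (forall j, P j -> B (F j)) ->
  phi (\prod_(j <- s | P j) F j) = \prod_(j <- s | P j) phi (F j).
Proof.
move=> H; elim: s => [|j s IHs]; first by rewrite !big_nil hom1.
rewrite !big_cons; case: ifP => // Pj; rewrite phiM ?IHs //; first exact: H.
exact: subalg_prod.
Qed.

Lemma coef_hom p j : (map_poly phi p)`_j = phi p`_j.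
Proof. by rewrite coef_map_id0 // hom0. Qed.

Lemma map_homD p q : pover B p -> pover B q ->
  map_poly phi (p + q) = map_poly phi p + map_poly phi q.
Proof.
by move=> Hp Hq; apply/polyP => j; rewrite coefD !coef_hom coefD phiD.
Qed.
Lemma map_homM p q : pover B p -> pover B q ->
  map_poly phi (p * q) = map_poly phi p * map_poly phi q.
Proof.
move=> Hp Hq; apply/polyP => j; rewrite coefM !coef_hom coefM hom_sum.
  by apply: eq_bigr => l _; rewrite phiM ?coef_hom.
by move=> l _; case: sB => _ _; apply.
Qed.
Lemma map_homC a : map_poly phi a%:P = (phi a)%:P.
Proof. by apply/polyP => j; rewrite coef_hom !coefC; case: ifP => // _; rewrite hom0. Qed.
Lemma map_homX : map_poly phi 'X = 'X.
Proof. by apply/polyP => j; rewrite coef_hom !coefX; case: (_ == _); rewrite ?hom0 ?hom1. Qed.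
Lemma map_homZ a p : B a -> pover B p -> map_poly phi (a *: p) = phi a *: map_poly phi p.
Proof. by move=> Ba Hp; apply/polyP => j; rewrite coefZ !coef_hom coefZ phiM. Qed.
Lemma map_hom_deriv p : pover B p -> map_poly phi p^`() = (map_poly phi p)^`().
Proof.
move=> Hp; apply/polyP => j; rewrite coef_deriv !coef_hom coef_deriv.
rewrite -(mulr_natr (phi _)) -(mulr_natr p`_j.+1).
by rewrite -{1}(rmorph_nat i) phiM // phiC.
Qed.

(** Two representations of an element of [adj B y] differ by a relation of y, which eta satisfies by
    hypothesis; so sending y to eta is well defined. *)
Lemma ext_hom y eta :
  (forall h, pover B h -> h.[y] = 0 -> (map_poly phi h).[eta] = 0) ->
  exists2 psi, hom (adj B y) psi &
    forall h, pover B h -> psi h.[y] = (map_poly phi h).[eta].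
Proof.
move=> H.
have /choice [psi psiP] : forall x, exists c : k,
    forall h, pover B h -> x = h.[y] -> c = (map_poly phi h).[eta].
  move=> x; have [[h Hh xE]|nh] := pselect (exists2 h, pover B h & x = h.[y]).
    exists (map_poly phi h).[eta] => h' Hh' xE'; apply/eqP.
    rewrite -subr_eq0 -hornerN -hornerD.
    have -> : map_poly phi h - map_poly phi h' = map_poly phi (h - h').
      apply/polyP => j; rewrite coefB !coef_hom coefB homB //.
    by rewrite H ?eqxx //; [exact: poverB|rewrite hornerD hornerN -xE -xE' subrr].
  by exists 0 => h Hh xE; case: nh; exists h.
exists psi; last by move=> h Hh; apply: psiP.
split=> [c|_ _ [p Hp ->] [q Hq ->]|_ _ [p Hp ->] [q Hq ->]].
- by rewrite (psiP _ (i c)%:P) ?hornerC ?map_homC ?hornerC //; exact: poverC.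
- rewrite (psiP p.[y] p) // (psiP q.[y] q) // -hornerD.
  by rewrite (psiP _ (p + q)) ?map_homD ?hornerD //; exact: poverD.
- rewrite (psiP p.[y] p) // (psiP q.[y] q) // -hornerM.
  by rewrite (psiP _ (p * q)) ?map_homM ?hornerM //; exact: poverM.
Qed.
End Hom.

Section Algebraic.
Variables (y : K) (p : {poly K}).
Hypotheses (Hp : pover B p) (p0 : p != 0) (py : p.[y] = 0).
Hypothesis pmin : forall q, pover B q -> q.[y] = 0 -> (size q < size p)%N -> q = 0.

(** A polynomial of least size killing y is a minimal polynomial over the fraction field of B, hence
    coprime to every h with [h.[y] != 0]. To stay over B, take a nonzero r of least size in the
    ideal of p and h and pseudo-divide both by it. *)
Lemma bezout_min h : pover B h -> h.[y] != 0 -> exists b u v,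
  [/\ B b, b != 0, pover B u, pover B v & u * p + v * h = b%:P].
Proof.
move=> Hh hy.
pose J (r : {poly K}) := exists u v, [/\ pover B u, pover B v & r = u * p + v * h].
have [n [r [Jr r0 szr]] nmin] : exists2 n : nat,
    exists r, [/\ J r, r != 0 & size r = n] &
    forall m, (exists r, [/\ J r, r != 0 & size r = m]) -> (n <= m)%N.
  pose P n := `[< exists r, [/\ J r, r != 0 & size r = n] >].
  have exP : exists n, P n.
    exists (size p); apply/asboolP; exists p; split=> //.
    exists 1, 0; split; [exact: poverC subalg1|exact: pover0|].
    by rewrite mul1r mul0r addr0.
  exists (ex_minn exP); case: ex_minnP => n /asboolP // _ H m Hm.
  by apply: H; apply/asboolP.
have HJ q : J q -> pover B q.
  by move=> [u [v [Hu Hv ->]]]; apply: poverD; apply: poverM.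
have dvd q : J q -> exists s g, pover B g /\ lead_coef r ^+ s *: q = g * r.
  move=> Jq; have [s [g [t [Hg Ht E szt]]]] := pdiv (HJ _ Jr) (HJ _ Jq) r0.
  exists s, g; split=> //; have [t0|t0] := eqVneq t 0; first by rewrite E t0 addr0.
  have : (n <= size t)%N.
    apply: nmin; exists t; split=> //.
    have -> : t = lead_coef r ^+ s *: q - g * r by rewrite E addrC addKr.
    move: Jq Jr (HJ _ Jr) => [u [v [Hu Hv ->]]] [u' [v' [Hu' Hv' rE]]] Hr.
    have Bc : B (lead_coef r ^+ s) by apply: subalgX; exact: Hr.
    exists (lead_coef r ^+ s *: u - g * u'), (lead_coef r ^+ s *: v - g * v').
    split; try by apply: poverB; [exact: poverZ|exact: poverM].
    rewrite [in g * r]rE; move: (_ ^+ _) => c.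
    rewrite scalerDr mulrDr !mulrBl !scalerAl !mulrA.
    by rewrite opprD addrACA.
  by rewrite -szr leqNgt szt.
have Jp : J p.
  exists 1, 0; split; [exact: poverC subalg1|exact: pover0|].
  by rewrite mul1r mul0r addr0.
have Jh : J h.
  exists 0, 1; split; [exact: pover0|exact: poverC subalg1|].
  by rewrite mul1r mul0r add0r.
have [s [g [Hg Eg]]] := dvd p Jp.
have [s' [g' [Hg' Eg']]] := dvd h Jh.
have c0 m : lead_coef r ^+ m != 0 by rewrite expf_neq0 ?lead_coef_eq0.
have ry : r.[y] != 0.
  apply: contraNneq hy => ry; move/(congr1 (fun q => q.[y])): Eg'.
  by rewrite hornerZ hornerM ry mulr0 => /eqP; rewrite mulf_eq0 (negbTE (c0 _)).
(* r does not vanish at y, so its cofactor in p does; by minimality the cofactor is at least as long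
   as p, and r has to be constant. *)
have gy : g.[y] = 0.
  move/(congr1 (fun q => q.[y])): Eg; rewrite hornerZ hornerM py mulr0 => /esym/eqP.
  by rewrite mulf_eq0 (negbTE ry) orbF => /eqP.
have g0 : g != 0.
  by apply: contraNneq p0 => g0; move/eqP: Eg; rewrite g0 mul0r scaler_eq0 (negbTE (c0 _)).
have szg : (size p <= size g)%N.
  by rewrite leqNgt; apply: contra g0 => /(pmin Hg gy) ->.
have /eqP : size p = (size g + size r).-1.
  by rewrite -size_mul // -Eg size_scale.
have r_gt0 : (0 < size r)%N by rewrite size_poly_gt0.
have szr1 : (size r <= 1)%N -> exists2 b, b != 0 & r = b%:P.
  move=> /size1_polyC rE; exists r`_0 => //.
  by apply: contraNneq r0 => r00; rewrite rE r00.
move=> /eqP szE; have /szr1 [b b0 rE] : (size r <= 1)%N.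
  move: szg r_gt0 szE; case: (size r) => [|[|m]] //= le_pg _ E.
  by move: le_pg; rewrite E addnS /= addnS leqNgt ltnS leq_addr.
move: Jr => [u [v [Hu Hv E]]]; exists b, u, v; split=> //; last by rewrite -E.
by have := HJ r (ex_intro _ u (ex_intro _ v (And3 Hu Hv E))) 0%N; rewrite rE coefC.
Qed.

(** The Bezout identity evaluated at y, where p drops out. The value b serves as a norm of x. *)
Lemma norm_min x : adj B y x -> x != 0 ->
  exists b x', [/\ B b, b != 0, adj B y x' & x' * x = b].
Proof.
move=> [h Hh ->] /(bezout_min Hh) [b [u [v [Bb b0 Hu Hv E]]]].
exists b, v.[y]; split=> //; first by exists v.
by rewrite -hornerM -[RHS](hornerC b y) -E hornerD [in RHS]hornerM py mulr0 add0r.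
Qed.

Lemma span_min x : adj B y x -> exists c (q : 'I_(size p).-1 -> K),
  [/\ B c, c != 0, forall j, B (q j) & c * x = \sum_j q j * y ^+ j].
Proof.
move=> [h Hh ->]; have [s [g [r [Hg Hr E szr]]]] := pdiv Hp Hh p0.
exists (lead_coef p ^+ s), (fun j => r`_j); split=> //.
- by apply: subalgX; exact: Hp.
- by rewrite expf_neq0 ?lead_coef_eq0.
rewrite -hornerZ E hornerD hornerM py mulr0 add0r.
by rewrite (@horner_coef_wide _ (size p).-1) // -ltnS prednK // size_poly_gt0.
Qed.

Lemma size_min : (1 < size p)%N.
Proof.
rewrite ltnNge; apply/negP => /size1_polyC pE; move: py p0.
by rewrite pE hornerC => ->; rewrite eqxx.
Qed.

(** In characteristic 0 the minimal polynomial is separable, so where [phi b != 0] its image has as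
    many roots as its degree, and each root gives one extension. *)
Lemma ext_min a : adj B y a -> a != 0 -> exists2 b, B b /\ b != 0 &
  forall phi, hom B phi -> phi b != 0 ->
  exists psi : 'I_(size p).-1 -> K -> k,
    [/\ forall j, hom (adj B y) (psi j), forall j x, B x -> psi j x = phi x,
        forall j, psi j a != 0 & injective (fun j => psi j y)].
Proof.
move=> [h Hh ->] hy.
have dp0 : p^`() != 0.
  have : (size p).-1%:R * lead_coef p != 0.
    rewrite mulf_neq0 ?lead_coef_eq0 // -(rmorph_nat i) fmorph_eq0.
    by rewrite ((pcharf0P k).1 char0) -lt0n -ltnS prednK ?size_min // (ltnW size_min).
  apply: contraNneq => dp0; move/(congr1 (fun q : {poly K} => q`_(size p).-2)): dp0.
  rewrite coef_deriv coef0 prednK; last by rewrite -ltnS prednK ?size_min // (ltnW size_min).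
  by rewrite mulr_natl lead_coefE => ->.
have dpy : p^`().[y] != 0.
  apply: contraNneq dp0 => dpy; rewrite (pmin _ dpy) ?lt_size_deriv //.
  exact: pover_deriv.
have [b1 [u1 [v1 [Bb1 b10 Hu1 Hv1 E1]]]] := bezout_min (pover_deriv Hp) dpy.
have [b2 [u2 [v2 [Bb2 b20 Hu2 Hv2 E2]]]] := bezout_min Hh hy.
(* Three open conditions at once: the leading coefficient preserves the degree of the image of p, b1
   keeps its roots simple, and b2 keeps a from vanishing at them. *)
exists (lead_coef p * (b1 * b2)).
  split; last by rewrite !mulf_neq0 ?lead_coef_eq0.
  by apply: BM; [exact: Hp|exact: BM].
move=> phi Hphi; have phiM := let: And3 _ _ H := Hphi in H.
rewrite (phiM (lead_coef p) _ (Hp _) (BM Bb1 Bb2)) (phiM _ _ Bb1 Bb2) !mulf_eq0 !negb_or.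
move=> /and3P[lp0 pb1 pb2].
pose q := map_poly phi p.
have szq : size q = size p.
  apply/eqP; rewrite eqn_leq size_poly /= -(prednK (ltnW size_min)).
  rewrite ltnNge; apply: contra lp0 => /leq_sizeP /(_ _ (leqnn _)).
  by rewrite coef_hom -?lead_coefE // => ->.
have q0 : q != 0 by rewrite -size_poly_gt0 szq size_poly_gt0.
have [r qE] := closed_field_poly_normal q.
have szr : size r = (size p).-1.
  by rewrite -szq qE size_scale ?lead_coef_eq0 // size_prod_XsubC.
have ur : uniq r.
  rewrite -separable_prod_XsubC.
  have : coprimep q q^`().
    apply/Bezout_eq1_coprimepP.
    exists ((phi b1)^-1 *: map_poly phi u1, (phi b1)^-1 *: map_poly phi v1) => /=.
    rewrite -!scalerAl -scalerDr -map_hom_deriv // -!map_homM //;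
      try exact: pover_deriv.
    rewrite -map_homD //; try by apply: poverM => //; exact: pover_deriv.
    by rewrite E1 map_homC // -mul_polyC -polyCM mulVf.
  rewrite qE derivZ coprimepZl ?lead_coef_eq0 // coprimepZr ?lead_coef_eq0 //.
  by rewrite separable_poly.unlock.
have rootr (j : 'I_(size p).-1) : q.[r`_j] = 0.
  apply/rootP; rewrite qE rootZ ?lead_coef_eq0 // root_prod_XsubC mem_nth //.
  by rewrite szr.
have H (j : 'I_(size p).-1) g : pover B g -> g.[y] = 0 -> (map_poly phi g).[r`_j] = 0.
  move=> Hg gy; have [s [g' [t [Hg' Ht E szt]]]] := pdiv Hp Hg p0.
  have t0 : t = 0.
    apply: pmin => //; move/(congr1 (fun q => q.[y])): E.
    by rewrite hornerZ hornerD hornerM py gy !mulr0 add0r.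
  have Bl : B (lead_coef p ^+ s) by apply: subalgX; exact: Hp.
  move/(congr1 (fun f => (map_poly phi f).[r`_j])): E.
  rewrite t0 addr0 map_homZ // map_homM // hornerZ hornerM rootr mulr0 => /eqP.
  rewrite mulf_eq0 homX ?expf_eq0 ?(negbTE lp0) ?andbF //= => [/eqP //|].
  exact: Hp.
have /choice [psi psiP] : forall j : 'I_(size p).-1, exists psi, hom (adj B y) psi /\
    forall h, pover B h -> psi h.[y] = (map_poly phi h).[r`_j].
  by move=> j; have [psi ? ?] := ext_hom Hphi (H j); exists psi.
exists (fun j => psi j); split.
- by move=> j; case: (psiP j).
- move=> j x Bx; case: (psiP j) => _ /(_ x%:P (poverC Bx)).
  by rewrite map_homC // !hornerC.
- move=> j; case: (psiP j) => _ -> //; apply: contra pb2 => /eqP hr.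
  have := congr1 (fun f => (map_poly phi f).[r`_j]) E2.
  rewrite /= map_homC // hornerC => <-.
  rewrite map_homD ?map_homM //; try exact: poverM.
  by rewrite hornerD !hornerM rootr hr !mulr0 addr0.
- move=> j l; case: (psiP j) => _ /(_ 'X poverX); case: (psiP l) => _ /(_ 'X poverX).
  rewrite map_homX // !hornerX => -> -> /eqP.
  by rewrite nth_uniq ?szr // => /eqP/val_inj.
Qed.
End Algebraic.

Lemma algebraic_min y : algebraic B y -> exists p,
  [/\ pover B p, p != 0, p.[y] = 0 &
      forall q, pover B q -> q.[y] = 0 -> (size q < size p)%N -> q = 0].
Proof.
move=> [p1 [Hp1 p10 p1y]].
pose P n := `[< exists p, [/\ pover B p, p != 0, p.[y] = 0 & size p = n] >].
have exP : exists n, P n by exists (size p1); apply/asboolP; exists p1.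
case: (ex_minnP exP) => n /asboolP [p [Hp p0 py szp]] nmin.
exists p; split=> // q Hq qy; rewrite szp ltnNge => /negP lt_q.
apply/eqP; apply: contrapT => /negP q0; apply: lt_q.
by apply: nmin; apply/asboolP; exists q.
Qed.

(** A transcendental y may be sent anywhere; it suffices to avoid the roots of the image of h. *)
Lemma ext_transc y a : ~ algebraic B y -> adj B y a -> a != 0 ->
  exists2 b, B b /\ b != 0 & forall phi, hom B phi -> phi b != 0 ->
  exists psi, [/\ hom (adj B y) psi, forall x, B x -> psi x = phi x & psi a != 0].
Proof.
move=> ny [h Hh ->] hy.
have h0 : h != 0 by apply: contraNneq hy => ->; rewrite horner0.
exists (lead_coef h); first by split; [exact: Hh|rewrite lead_coef_eq0].
move=> phi Hphi lh; have q0 : map_poly phi h != 0.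
  apply: contraNneq lh => /(congr1 (fun q : {poly k} => q`_(size h).-1)).
  by rewrite coef_hom // coef0 => <-.
have [eta etaP] := poly_nonroot char0 q0.
have [|psi Hpsi psiE] := @ext_hom phi Hphi y eta.
  move=> g Hg gy; suff -> : g = 0 by rewrite map_poly0 horner0.
  by apply: contrapT => /eqP g0; apply: ny; exists g.
exists psi; split=> //; last by rewrite psiE.
by move=> x Bx; have := psiE x%:P (poverC Bx); rewrite map_homC // !hornerC.
Qed.

Lemma ext_one y a : adj B y a -> a != 0 ->
  exists2 b, B b /\ b != 0 & forall phi, hom B phi -> phi b != 0 ->
  exists psi, [/\ hom (adj B y) psi, forall x, B x -> psi x = phi x & psi a != 0].
Proof.
move=> ya a0; have [ay|] := pselect (algebraic B y); last first.
  by move/ext_transc; apply.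
have [p [Hp p0 py pmin]] := algebraic_min ay.
have [b bP H] := ext_min Hp p0 py pmin ya a0.
exists b => // phi Hphi pb; have [psi [H1 H2 H3 _]] := H phi Hphi pb.
have j : 'I_(size p).-1.
  by exists 0%N; rewrite -ltnS prednK ?(size_min p0 py) // (ltnW (size_min p0 py)).
by exists (psi j); split; [exact: H1|move=> x; exact: H2|exact: H3].
Qed.
End Closure.

Definition adjs B (zs : seq K) : set K := foldl adj B zs.

Lemma subalg_adjs B zs : subalg B -> subalg (adjs B zs).
Proof. by elim: zs B => //= z zs IHzs B sB; apply: IHzs; exact: subalg_adj. Qed.

Lemma adjs_base B zs a : subalg B -> B a -> adjs B zs a.
Proof.
elim: zs B => //= z zs IHzs B sB Ba; apply: IHzs; first exact: subalg_adj.
exact: adj_base.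
Qed.

Lemma adjs_gen B zs z : subalg B -> z \in zs -> adjs B zs z.
Proof.
elim: zs B => //= z' zs IHzs B sB; rewrite inE => /orP[/eqP ->|/IHzs]; last first.
  by apply; exact: subalg_adj.
by apply: adjs_base; [exact: subalg_adj|exact: adj_gen].
Qed.

Lemma algebraic_sub B B' y : (forall a, B a -> B' a) -> algebraic B y -> algebraic B' y.
Proof. by move=> H [p [Hp p0 py]]; exists p; split=> // j; apply: H. Qed.

(** The extension theorem that replaces the Nullstellensatz: homomorphisms to k, which later become
    points, extend to a finitely generated algebra away from the zeros of one element. *)
Lemma ext_seq B ys a : subalg B -> adjs B ys a -> a != 0 ->
  exists2 b, B b /\ b != 0 & forall phi, hom B phi -> phi b != 0 ->
  exists psi, [/\ hom (adjs B ys) psi, forall x, B x -> psi x = phi x & psi a != 0].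
Proof.
elim: ys B => [|y ys IHys] B sB /= Ba a0.
  by exists a => // phi Hphi pa; exists phi.
have sB1 := subalg_adj sB y.
have [b1 [Bb1 b10] H1] := IHys _ sB1 Ba a0.
have [b [Bb b0] H] := ext_one sB Bb1 b10.
exists b => // phi Hphi pb; have [psi [Hpsi psiE pb1]] := H phi Hphi pb.
have [psi' [Hpsi' psiE' pa]] := H1 psi Hpsi pb1.
exists psi'; split=> // x Bx; rewrite psiE' ?psiE //; exact: adj_base.
Qed.

Lemma norm_seq B zs a : subalg B -> {in zs, forall z, algebraic B z} ->
  adjs B zs a -> a != 0 -> exists b a',
  [/\ B b, b != 0, adjs B zs a' & a' * a = b].
Proof.
elim: zs B a => [|z zs IHzs] B a sB /= alg Ba a0.
  by exists a, 1; split=> //; [exact: subalg1|rewrite mul1r].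
have sB1 := subalg_adj sB z.
have alg1 : {in zs, forall z', algebraic (adj B z) z'}.
  move=> z' z'zs; apply: (@algebraic_sub B); first by move=> x; apply: adj_base.
  by apply: alg; rewrite inE z'zs orbT.
have [b1 [a1 [Bb1 b10 Ba1 E1]]] := IHzs _ _ sB1 alg1 Ba a0.
have [p [Hp p0 pz pmin]] := algebraic_min (alg z (mem_head _ _)).
have [b [b' [Bb b0 Bb' E]]] := norm_min sB Hp p0 pz pmin Bb1 b10.
exists b, (b' * a1); split=> //; last by rewrite -mulrA E1.
have [_ _ M] := subalg_adjs zs sB1; apply: M => //.
exact: adjs_base.
Qed.

(** One finite type I indexes both the extensions of phi and a family spanning over B up to
    denominators. This coincidence of fibre size and rank is what turns counting points into
    bounding ranks. *)
Lemma fib_seq B zs a : subalg B -> {in zs, forall z, algebraic B z} ->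
  adjs B zs a -> a != 0 ->
  exists (I : finType) b, [/\ B b /\ b != 0,
    forall phi, hom B phi -> phi b != 0 -> exists psi : I -> K -> k,
      [/\ forall j, hom (adjs B zs) (psi j), forall j x, B x -> psi j x = phi x,
          forall j, psi j a != 0 &
          forall j l, {in zs, psi j =1 psi l} -> j = l] &
    exists E : I -> K, forall x, adjs B zs x -> exists c (q : I -> K),
      [/\ B c, c != 0, forall j, B (q j) & c * x = \sum_j q j * E j]].
Proof.
elim: zs B a => [|z zs IHzs] B a sB /= alg Ba a0.
  exists (unit : finType), a; split=> //.
    move=> phi Hphi pa; exists (fun=> phi); split=> //.
    by move=> [] [].
  exists (fun=> 1) => x Bx; exists 1, (fun=> x); split; rewrite ?oner_eq0 //.
    exact: subalg1.
  by rewrite (big_pred1 tt) ?mul1r ?mulr1 //; case.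
have sB1 := subalg_adj sB z.
have alg1 : {in zs, forall z', algebraic (adj B z) z'}.
  move=> z' z'zs; apply: (@algebraic_sub B); first by move=> x; apply: adj_base.
  by apply: alg; rewrite inE z'zs orbT.
have [I1 [b1 [[Bb1 b10] H1 [E1 HE1]]]] := IHzs _ _ sB1 alg1 Ba a0.
have [p [Hp p0 pz pmin]] := algebraic_min (alg z (mem_head _ _)).
have [b [Bb b0] H] := ext_min sB Hp p0 pz pmin Bb1 b10.
exists ('I_(size p).-1 * I1)%type, b; split=> //.
  move=> phi Hphi pb; have [psi [Hpsi psiE pb1 psi_inj]] := H phi Hphi pb.
  have /choice [chi chiP] : forall j, exists chi : I1 -> K -> k,
    [/\ forall l, hom (adjs (adj B z) zs) (chi l),
        forall l x, adj B z x -> chi l x = psi j x,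
        forall l, chi l a != 0 &
        forall l m, {in zs, chi l =1 chi m} -> l = m].
    by move=> j; apply: H1 => //.
  exists (fun jl => chi jl.1 jl.2); split.
  - by move=> [j l]; case: (chiP j).
  - move=> [j l] x Bx; have [_ H' _ _] := chiP j.
    by rewrite H' ?psiE //; exact: adj_base.
  - by move=> [j l]; case: (chiP j).
  - move=> [j l] [j' l'] /= eq_chi.
    have ejj' : j = j'.
      apply: psi_inj => /=; have := eq_chi z (mem_head _ _).
      have [_ Hj _ _] := chiP j; have [_ Hj' _ _] := chiP j'.
      by rewrite Hj ?Hj' //; exact: adj_gen.
    rewrite -ejj' in eq_chi *; congr (_, _); case: (chiP j) => _ _ _; apply.
    by move=> x xzs; apply: eq_chi; rewrite inE xzs orbT.
exists (fun jl : 'I_(size p).-1 * I1 => z ^+ jl.1 * E1 jl.2) => x /HE1 [c1 [q1 [Bc1 c10 Bq1 Ex]]].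
have [bc [c' [Bbc bc0 Bc' Ec]]] := norm_min sB Hp p0 pz pmin Bc1 c10.
have [_ _ M1] := sB1; have [_ DB MB] := sB.
have /choice [cq cqP] : forall l, exists cq : K * ('I_(size p).-1 -> K),
    [/\ B cq.1, cq.1 != 0, forall j, B (cq.2 j) &
        cq.1 * (c' * q1 l) = \sum_j cq.2 j * z ^+ j].
  move=> l; have [c [q ?]] := span_min sB Hp p0 pz (M1 _ _ Bc' (Bq1 l)).
  by exists (c, q).
(* C is a common denominator for the coefficients of all the [E1 l]; [C' l] leaves out the factor
   belonging to l. *)
pose C := \prod_l (cq l).1; pose C' l := \prod_(m | m != l) (cq m).1.
have BC' l : B (C' l) by apply: subalg_prod => // m _; case: (cqP m).
have CE l : C = C' l * (cq l).1 by rewrite /C (bigD1 l) //= mulrC.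
exists (C * bc), (fun jl : 'I_(size p).-1 * I1 => C' jl.2 * (cq jl.2).2 jl.1); split.
- by apply: MB => //; apply: subalg_prod => // m _; case: (cqP m).
- rewrite mulf_neq0 //; apply/prodf_neq0 => m _; by case: (cqP m).
- by move=> [j l] /=; apply: MB => //; case: (cqP l).
rewrite -Ec -!mulrA Ex !mulr_sumr.
transitivity (\sum_l \sum_(j < (size p).-1) C' l * (cq l).2 j * (z ^+ j * E1 l)).
  apply: eq_bigr => l _; rewrite !mulrA (CE l) -(mulrA (C' l)) -!mulrA.
  case: (cqP l) => _ _ _ Eq.
  rewrite [c' * _]mulrA [(cq l).1 * _]mulrA Eq mulr_suml mulr_sumr.
  by apply: eq_bigr => j _; rewrite !mulrA.
rewrite exchange_big /= pair_big /=; apply: eq_bigr => -[j l] _ //.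
Qed.

(** The elements zs carry the count; the further generators ys, later the ambient coordinates,
    merely have to be extended in some way. The separation matters because a linear system V may
    fail to determine the points of P. *)
Lemma fib_ext B zs ys a : subalg B -> {in zs, forall z, algebraic B z} ->
  adjs (adjs B zs) ys a -> a != 0 ->
  exists (I : finType) b, [/\ B b /\ b != 0,
    forall phi, hom B phi -> phi b != 0 -> exists psi : I -> K -> k,
      [/\ forall j, hom (adjs (adjs B zs) ys) (psi j),
          forall j x, B x -> psi j x = phi x,
          forall j, psi j a != 0 &
          forall j l, {in zs, psi j =1 psi l} -> j = l] &
    exists E : I -> K, forall x, adjs B zs x -> exists c (q : I -> K),
      [/\ B c, c != 0, forall j, B (q j) & c * x = \sum_j q j * E j]].
Proof.
move=> sB alg Ba a0; have sB1 := subalg_adjs zs sB.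
have [b1 [Bb1 b10] H1] := ext_seq sB1 Ba a0.
have [I [b [bP H HE]]] := fib_seq sB alg Bb1 b10.
exists I, b; split=> // phi Hphi pb; have [psi [Hpsi psiE pb1 inj]] := H phi Hphi pb.
have /choice [chi chiP] : forall j, exists chi,
    [/\ hom (adjs (adjs B zs) ys) chi, forall x, adjs B zs x -> chi x = psi j x & chi a != 0].
  by move=> j; apply: H1.
exists chi; split.
- by move=> j; case: (chiP j).
- by move=> j x Bx; have [_ H' _] := chiP j; rewrite H' ?psiE //; exact: adjs_base.
- by move=> j; case: (chiP j).
- move=> j l E; apply: inj => z zzs; have := E z zzs.
  have [_ Hj _] := chiP j; have [_ Hl _] := chiP l.
  by rewrite Hj ?Hl //; exact: adjs_gen.
Qed.

Definition kpoly (g : K) : set K := [set x | exists p : {poly k}, x = (map_poly i p).[g]].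

Lemma subalg_kpoly g : subalg (kpoly g).
Proof.
split=> [c|_ _ [p ->] [q ->]|_ _ [p ->] [q ->]].
- by exists c%:P; rewrite map_polyC hornerC.
- by exists (p + q); rewrite rmorphD hornerD.
- by exists (p * q); rewrite rmorphM hornerM.
Qed.

Definition transcendental (g : K) : Prop :=
  forall p : {poly k}, p != 0 -> (map_poly i p).[g] != 0.

(** Transcendence of g makes the value at c independent of the polynomial that represents an
    element. *)
Lemma kpoly_hom g c : transcendental g ->
  exists2 phi, hom (kpoly g) phi & forall p : {poly k}, phi (map_poly i p).[g] = p.[c].
Proof.
move=> tg; have /choice [phi phiP] : forall x, exists y : k,
    forall p : {poly k}, x = (map_poly i p).[g] -> y = p.[c].
  move=> x; have [[p xE]|nx] := pselect (kpoly g x); last first.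
    by exists 0 => p xE; case: nx; exists p.
  exists p.[c] => q xE'; congr (_.[c]); apply: contrapT => /eqP.
  rewrite -subr_eq0 => /tg; rewrite rmorphB hornerD hornerN -xE -xE' subrr.
  by rewrite eqxx.
have phiE (p : {poly k}) : phi (map_poly i p).[g] = p.[c] by apply: phiP.
exists phi => //; split=> [a|_ _ [p ->] [q ->]|_ _ [p ->] [q ->]].
- by have := phiE a%:P; rewrite map_polyC !hornerC.
- by rewrite -hornerD -rmorphD !phiE hornerD.
- by rewrite -hornerM -rmorphM !phiE hornerM.
Qed.

Lemma dep_of_span g (I : finType) (E : I -> K) n (x : 'I_n -> K) :
  (#|I| < n)%N -> transcendental g ->
  (forall j, exists c (q : I -> K), [/\ kpoly g c, c != 0,
     forall l, kpoly g (q l) & c * x j = \sum_l q l * E l]) ->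
  exists2 p : 'I_n -> {poly k}, exists j, p j != 0 &
    \sum_j (map_poly i (p j)).[g] * x j = 0.
Proof.
move=> lt_In tg span; pose ev (p : {poly k}) := (map_poly i p).[g].
have /choice [cq cqP] : forall j, exists cq : {poly k} * (I -> {poly k}),
    cq.1 != 0 /\ ev cq.1 * x j = \sum_l ev (cq.2 l) * E l.
  move=> j; have [c [q [[p cE] c0 /choice [r rP] Ec]]] := span j.
  exists (p, r); split => /=; first by apply: contraNneq c0 => p0; rewrite cE p0 rmorph0 horner0.
  by rewrite /ev -cE Ec; apply: eq_bigr => l _; rewrite -rP.
(* The coefficients fill the first [#|I|] columns of a square matrix and the rest is 0. As
   [#|I| < n] there is a zero column, so the determinant vanishes and there is a left kernel vector
   over [{poly k}]. *)
pose M : 'M[{poly k}]_n := \matrix_(j, l)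
  if insub (val l) is Some l' then (cq j).2 (enum_val (l' : 'I_#|I|)) else 0.
have /eqP/det0P [v v0 vM] : \det M = 0.
  apply/eqP; rewrite -det_tr; apply/det0P.
  exists (delta_mx 0 (Ordinal lt_In)).
    by apply/eqP => /matrixP/(_ 0 (Ordinal lt_In)); rewrite !mxE !eqxx => /eqP; rewrite oner_eq0.
  apply/matrixP => a j; rewrite !mxE big1 // => l _; rewrite !mxE.
  case: (l =P Ordinal lt_In) => [->|_]; last by rewrite andbF mul0r.
  by rewrite insubF ?mulr0 // ltnn.
exists (fun j => v 0 j * (cq j).1).
  have /rV0Pn [j vj] := v0; exists j; rewrite mulf_neq0 //; by case: (cqP j).
transitivity (\sum_j ev (v 0 j) * \sum_l ev ((cq j).2 l) * E l).
  apply: eq_bigr => j _; case: (cqP j) => _ <-.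
  by rewrite /ev rmorphM hornerM mulrA.
under eq_bigr do rewrite mulr_sumr.
rewrite exchange_big big1 //= => l _.
under eq_bigr do rewrite mulrA.
rewrite -mulr_suml; apply/eqP; rewrite mulf_eq0; apply/orP; left; apply/eqP.
have lt_l : (enum_rank l < n)%N by apply: ltn_trans lt_In.
have ev0 : ev 0 = 0 by rewrite /ev rmorph0 horner0.
have /matrixP/(_ 0 (Ordinal lt_l)) := vM; rewrite !mxE => /(congr1 ev) E'.
apply: etrans (etrans E' ev0); rewrite /ev rmorph_sum horner_sum; apply: eq_bigr => j _.
rewrite rmorphM hornerM mxE /= (valK (enum_rank l)) enum_rankK //.
Qed.
End Extension.

Section Noetherian.

(** * Noetherian rings and projective cones *)

(** The ascending chain condition without ideals as objects: some term of each sequence lies in the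
    ideal of its predecessors. *)
Definition noeth (R : comNzRingType) : Prop :=
  forall f : nat -> R, exists n (c : nat -> R), f n = \sum_(j < n) c j * f j.

Lemma noeth_field (k : fieldType) : noeth k.
Proof.
move=> f; have [f0|f0] := eqVneq (f 0%N) 0.
  by exists 0%N, (fun=> 0); rewrite big_ord0.
by exists 1%N, (fun=> f 1%N / f 0%N); rewrite big_ord1 divfK.
Qed.

Lemma noeth_surj (R S : comNzRingType) (phi : {rmorphism R -> S}) :
  (forall y, exists x, phi x = y) -> noeth R -> noeth S.
Proof.
move=> /choice [s sK] nR f; have [n [c E]] := nR (s \o f).
exists n, (phi \o c); rewrite -[LHS]sK [s _]E rmorph_sum; apply: eq_bigr => j _.
by rewrite rmorphM /= sK.
Qed.

(** Hilbert's basis theorem. If the ideal of F were not finitely generated, choose g n of least size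
    outside the ideal of the earlier ones; a relation between leading coefficients then produces a
    smaller element outside it. *)
Lemma noeth_poly (R : comNzRingType) : noeth R -> noeth {poly R}.
Proof.
move=> nR F; apply: contrapT => nF.
pose inid (gs : nat -> {poly R}) n p := exists c : nat -> {poly R}, p = \sum_(j < n) c j * gs j.
have inidD gs n p q : inid gs n p -> inid gs n q -> inid gs n (p + q).
  move=> [c ->] [d ->]; exists (fun j => c j + d j).
  by rewrite -big_split; apply: eq_bigr => j _; rewrite mulrDl.
have inidM gs n a p : inid gs n p -> inid gs n (a * p).
  move=> [c ->]; exists (fun j => a * c j).
  by rewrite mulr_sumr; apply: eq_bigr => j _; rewrite mulrA.
have inid0 gs n : inid gs n 0.
  by exists (fun=> 0); rewrite big1 // => j _; rewrite mul0r.
have inid_sum gs n m (E : nat -> {poly R}) : (forall j, (j < m)%N -> inid gs n (E j)) ->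
    inid gs n (\sum_(j < m) E j).
  move=> H; elim: m H => [|m IHm] H; first by rewrite big_ord0.
  rewrite big_ord_recr; apply: inidD; last exact: H.
  by apply: IHm => j lt_jm; apply: H; apply: ltnW.
have inid_gen gs n j : (j < n)%N -> inid gs n (gs j).
  move=> lt_jn; exists (fun l => if l == j then 1 else 0).
  rewrite (bigD1 (Ordinal lt_jn)) //= eqxx mul1r big1 ?addr0 // => l lj.
  by rewrite -val_eqE /= in lj; rewrite (negbTE lj) mul0r.
have inidW gs n m p : (n <= m)%N -> inid gs n p -> inid gs m p.
  move=> le_nm [c ->]; apply: (inid_sum _ _ _ (fun j => c j * gs j)) => j lt_jn.
  by apply: inidM; apply: inid_gen; exact: leq_trans le_nm.
pose I p := exists n, inid F n p.
have ID p q : I p -> I q -> I (p + q).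
  move=> [n Hn] [m Hm]; exists (maxn n m).
  by apply: inidD; [apply: inidW Hn|apply: inidW Hm]; rewrite ?leq_maxl ?leq_maxr.
have IM a p : I p -> I (a * p) by move=> [n Hn]; exists n; apply: inidM.
have I_sum m (E : nat -> {poly R}) : (forall j, (j < m)%N -> I (E j)) ->
    I (\sum_(j < m) E j).
  move=> H; elim: m H => [|m IHm] H; first by exists 0%N; rewrite big_ord0; apply: inid0.
  rewrite big_ord_recr; apply: ID; last exact: H.
  by apply: IHm => j lt_jm; apply: H; apply: ltnW.
have nfg gs n : (forall j, (j < n)%N -> I (gs j)) -> exists2 p, I p & ~ inid gs n p.
  move=> H; have [N HN] : exists N, forall j, (j < n)%N -> inid F N (gs j).
    elim: n H => [|n IHn] H; first by exists 0%N.
    have [N HN] := IHn (fun j lt => H j (ltnW lt)).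
    have [m Hm] := H n (ltnSn n); exists (maxn N m) => j.
    rewrite ltnS leq_eqVlt => /orP[/eqP ->|/HN]; [move: Hm|]; apply: inidW;
      by rewrite ?leq_maxl ?leq_maxr.
  exists (F N); first by exists N.+1; apply: inid_gen.
  move=> [c E]; apply: nF; exists N.
  have : inid F N (F N) by rewrite E; apply: (inid_sum _ _ _ (fun j => c j * gs j)) => j ?; apply: inidM; apply: HN.
  by move=> [c' E']; exists c'.
have minp gs n : (forall j, (j < n)%N -> I (gs j)) ->
    exists p, [/\ I p, ~ inid gs n p & forall q, I q -> (size q < size p)%N -> inid gs n q].
  move=> /nfg [p0 Ip0 np0].
  pose P m := `[< exists p, [/\ I p, ~ inid gs n p & size p = m] >].
  have exP : exists m, P m by exists (size p0); apply/asboolP; exists p0.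
  case: (ex_minnP exP) => m /asboolP [p [Ip np szp]] mmin; exists p; split=> // q Iq szq.
  apply: contrapT => nq; have /mmin : P (size q) by apply/asboolP; exists q.
  by rewrite leqNgt -szp szq.
have /choice [nxt nxtP] : forall gn : (nat -> {poly R}) * nat, exists p,
    (forall j, (j < gn.2)%N -> I (gn.1 j)) ->
    [/\ I p, ~ inid gn.1 gn.2 p & forall q, I q -> (size q < size p)%N -> inid gn.1 gn.2 q].
  move=> [gs n]; have [H|H] := pselect (forall j, (j < n)%N -> I (gs j)).
    by have [p Hp] := minp gs n H; exists p.
  by exists 0 => /H.
(* [st n] tabulates g 0, ..., g (n - 1), so that each choice can depend on all earlier ones. *)
pose st := fix st n : nat -> {poly R} := if n is n'.+1 then
   let s := st n' in fun j => if (j < n')%N then s j else nxt (s, n') else fun=> 0.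
pose g n := nxt (st n, n).
have stE n j : (j < n)%N -> st n j = g j.
  elim: n j => // n IHn j; rewrite ltnS => le_jn /=; case: ltnP => [/IHn //|le_nj].
  by have -> : j = n by apply/eqP; rewrite eqn_leq le_jn le_nj.
have gI n : I (g n).
  elim/ltn_ind: n => n IHn; case: (nxtP (st n, n)) => //= j lt_jn.
  by rewrite stE //; apply: IHn.
have inidE n p : inid (st n) n p <-> inid g n p.
  split=> -[c ->]; exists c; apply: eq_bigr => j _; by rewrite stE.
have gP n : ~ inid g n (g n) /\ forall q, I q -> (size q < size (g n))%N -> inid g n q.
  have [|_ /= H1 H2] := nxtP (st n, n).
    by move=> j /= lt_jn; rewrite stE.
  by split=> [/inidE //|q Iq /(H2 q Iq)/inidE].
have szg j n : (j <= n)%N -> (size (g j) <= size (g n))%N.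
  move=> le_jn; rewrite leqNgt; apply/negP => /(proj2 (gP j) _ (gI n)).
  by move/(inidW _ _ _ _ le_jn); case: (gP n).
have [n [c E]] := nR (fun n => lead_coef (g n)).
have [nin Hmin] := gP n.
pose h := g n - \sum_(j < n) (c j)%:P * 'X^(size (g n) - size (g j)) * g j.
have Hsum : inid g n (\sum_(j < n) (c j)%:P * 'X^(size (g n) - size (g j)) * g j).
  by exists (fun j => (c j)%:P * 'X^(size (g n) - size (g j))).
have gn0 : g n != 0 by apply/eqP => gn0; apply: nin; rewrite gn0.
have szh : (size h < size (g n))%N.
  have sz_gt0 : (0 < size (g n))%N by rewrite size_poly_gt0.
  rewrite -(prednK sz_gt0) ltnS; apply/leq_sizeP => j.
  rewrite leq_eqVlt => /orP[/eqP <-|lt_j].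
    rewrite coefB -lead_coefE E coef_sum -sumrB big1 // => l _.
    rewrite -mulrA coefCM coefXnM.
    have le_l := szg l n (ltnW (ltn_ord l)).
    have [gl0|gl0] := eqVneq (g l) 0.
      by rewrite gl0 lead_coef0 coef0 if_same !mulr0 subrr.
    rewrite ifF; last first.
      apply/negbTE; rewrite -leqNgt -(leq_add2r (size (g l))) subnK //.
      by rewrite -[X in (X <= _)%N](prednK sz_gt0) -addn1 leq_add2l size_poly_gt0.
    rewrite (_ : (_ - _)%N = (size (g l)).-1) -?lead_coefE ?subrr //.
    by rewrite -!subn1 -subnDA addnC subnDA subKn.
  rewrite coefB nth_default; last by rewrite -(prednK sz_gt0).
  rewrite coef_sum big1 ?subrr // => l _; rewrite -mulrA coefCM coefXnM.
  case: ifP => _; first by rewrite mulr0.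
  rewrite nth_default ?mulr0 //.
  have le_l := szg l n (ltnW (ltn_ord l)).
  rewrite -(leq_add2r (size (g n) - size (g l))) subnKC //.
  rewrite subnK; first by rewrite -(prednK sz_gt0).
  apply: leq_trans (leq_subr _ _) _; by rewrite -(prednK sz_gt0).
apply: nin; have -> : g n = h + \sum_(j < n) (c j)%:P * 'X^(size (g n) - size (g j)) * g j.
  by rewrite subrK.
apply: inidD => //; apply: Hmin => //; apply: ID => //.
rewrite -mulN1r; apply: (IM); apply: (I_sum n (fun j => (c j)%:P * 'X^(size (g n) - size (g j)) * g j)) => j _.
exact: IM.
Qed.

Lemma noeth_mpoly (k : fieldType) n : noeth {mpoly k[n]}.
Proof.
elim: n => [|n IHn].
  apply: (noeth_surj (phi := @mpolyC 0 k)) _ (@noeth_field k) => y.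
  exists y@_0; apply/mpolyP => m; have -> : m = 0%MM by apply/mnmP => -[].
  by rewrite mcoeffC eqxx mulr1.
pose phi := horner_eval ('X_ord_max : {mpoly k[n.+1]}) \o map_poly (@mwiden n k).
apply: (noeth_surj (phi := phi)) _ (@noeth_poly _ IHn) => y.
by exists (muni y); rewrite [RHS]muniK.
Qed.
End Noetherian.

(** * Affine cones over subsets of projective space *)

Section Cones.
Variable k : closedFieldType.

Lemma dim_vline_neq0 n (v : 'rV[k]_n) : v != 0 -> \dim <[v]>%VS == 1%N.
Proof. by rewrite dim_vline => ->. Qed.

Definition mkpt N (v : 'rV[k]_N.+1) (v0 : v != 0) : proj k N :=
  exist _ <[v]>%VS (dim_vline_neq0 v0).

Lemma proj_rep N (x : proj k N) : exists2 v, v != 0 & val x = <[v]>%VS.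
Proof.
case: x => L /= dL; have [v] : exists v, v \in L /\ v != 0.
  exists (vpick L); split; first exact: memv_pick.
  by rewrite vpick0 -dimv_eq0 (eqP dL).
move=> [vL v0]; exists v => //; apply/eqP; rewrite eq_sym eqEdim -memvE vL /=.
by rewrite (eqP dL) dim_vline v0.
Qed.

Lemma rep_neq0 N (x : proj k N) v : val x = <[v]>%VS -> v != 0.
Proof.
by case: x => L /= /eqP dL LE; move: dL; rewrite LE dim_vline; case: eqP.
Qed.

Lemma vline_eq n (v w : 'rV[k]_n) : v != 0 -> <[v]>%VS = <[w]>%VS ->
  exists2 c, c != 0 & v = c *: w.
Proof.
move=> v0 E; have /vlineP [c vE] : v \in <[w]>%VS by rewrite -E memv_line.
by exists c => //; apply: contraNneq v0 => c0; rewrite vE c0 scale0r.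
Qed.

Lemma rep_scale N (x : proj k N) v w : val x = <[v]>%VS -> val x = <[w]>%VS ->
  exists2 c, c != 0 & w = c *: v.
Proof.
by move=> xE xE'; apply: vline_eq; [exact: rep_neq0 xE'|rewrite -xE -xE'].
Qed.

Lemma vlineZ n (c : k) (v : 'rV[k]_n) : c != 0 -> <[c *: v]>%VS = <[v]>%VS.
Proof.
move=> c0; apply/eqP; rewrite eqEsubv -!memvE memvZ ?memv_line //=.
by rewrite -[X in X \in _](scalerK c0) memvZ ?memv_line.
Qed.

Definition cone N (X : set (proj k N)) : set 'rV[k]_N.+1 :=
  [set v | exists2 x, X x & val x = <[v]>%VS].

Lemma cone_neq0 N (X : set (proj k N)) v : cone X v -> v != 0.
Proof. by move=> [x _ /rep_neq0]. Qed.

Lemma cone_mkpt N (X : set (proj k N)) v (v0 : v != 0) : cone X v <-> X (mkpt v0).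
Proof.
split=> [[x Xx xE]|Xv]; last by exists (mkpt v0).
by suff <- : x = mkpt v0 by []; apply/val_inj.
Qed.

Lemma coneP N (X : set (proj k N)) x v : val x = <[v]>%VS -> cone X v <-> X x.
Proof.
move=> xE; split=> [[y Xy yE]|Xx]; last by exists x.
by suff <- : y = x by []; apply/val_inj; rewrite yE xE.
Qed.

Lemma coneZ N (X : set (proj k N)) c v : c != 0 -> cone X v -> cone X (c *: v).
Proof. by move=> c0 [x Xx xE]; exists x => //; rewrite xE vlineZ. Qed.

Lemma cone_subset N (X Y : set (proj k N)) : X `<=` Y <-> cone X `<=` cone Y.
Proof.
split=> [XY v [x Xx xE]|XY x Xx]; first by exists x => //; apply: XY.
by have [v _ xE] := proj_rep x; apply/(coneP _ xE)/XY/(coneP _ xE).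
Qed.

Lemma vanishes_atP N (f : {mpoly k[N.+1]}) d x v : f \is d.-homog ->
  val x = <[v]>%VS -> vanishes_at f x <-> f.@[v 0] = 0.
Proof.
move=> fd xE; split=> [|fv w xE']; first exact.
have [c c0 ->] := rep_scale xE xE'.
by rewrite (polyfun_scale c v (ex_intro2 _ _ f fd (fun=> erefl))) fv mulr0.
Qed.

Definition zeros N (S : set ('rV[k]_N.+1 -> k)) : set (proj k N) :=
  [set x | forall f, S f -> forall v, val x = <[v]>%VS -> f v = 0].

Lemma zeros_closed N (S : set ('rV[k]_N.+1 -> k)) :
  (forall f, S f -> exists d, polyfun d f) -> zariski_closed (zeros S).
Proof.
move=> HS; exists [set F | (exists d, F \is d.-homog) /\ S (fun v => F.@[v 0])].
split=> [f [] //|]; apply/seteqP; split=> x /= Hx.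
  by move=> F [_ SF] v xE; exact: (Hx _ SF v xE).
move=> f Sf v xE; have [d [F Fd FE]] := HS f Sf.
have fE : f = fun v => F.@[v 0] by apply/funext.
by rewrite fE; apply: Hx xE; split; [exists d|rewrite -fE].
Qed.

(** Closedness of a cone expressed through forms only; the origin is exempted because [cone] never
    contains it. *)
Definition ccl n (P : set 'rV[k]_n) : Prop := forall v, v != 0 ->
  (forall d f, polyfun d f -> (forall u, P u -> f u = 0) -> f v = 0) -> P v.

Lemma closed_ccl N (X : set (proj k N)) : zariski_closed X -> ccl (cone X).
Proof.
move=> [S [Sh ->]] v v0 Hv; apply/(cone_mkpt _ v0) => f Sf.
have [d fd] := Sh f Sf; apply/(vanishes_atP fd (erefl : val (mkpt v0) = _)).
apply: (Hv d (fun u => f.@[u 0])); first by exists f.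
by move=> u [x Xx xE]; apply/(vanishes_atP fd xE)/Xx.
Qed.

Lemma closed_sep N (X : set (proj k N)) v : zariski_closed X -> v != 0 -> ~ cone X v ->
  exists d f, [/\ polyfun d f, forall u, cone X u -> f u = 0 & f v != 0].
Proof.
move=> cX v0 nXv; apply: contrapT => H; apply: nXv; apply: (closed_ccl cX) => // d f pf fX.
by apply/eqP; apply: contrapT => /negP fv; apply: H; exists d, f.
Qed.

Lemma zeros_cone N (S : set ('rV[k]_N.+1 -> k)) v : v != 0 ->
  (forall f, S f -> exists d, polyfun d f) ->
  cone (zeros S) v <-> forall f, S f -> f v = 0.
Proof.
move=> v0 HS; split=> [[x Hx xE] f Sf|Hv]; first exact: Hx xE.
apply/(cone_mkpt _ v0) => f Sf w /= E.
have [c c0 wE] := @rep_scale _ (mkpt v0) v w erefl E.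
by have [d pf] := HS f Sf; rewrite wE (polyfun_scale _ _ pf) Hv ?mulr0.
Qed.

Lemma zariski_closedI N (X Y : set (proj k N)) :
  zariski_closed X -> zariski_closed Y -> zariski_closed (X `&` Y).
Proof.
move=> [S [Sh ->]] [S' [Sh' ->]]; exists (S `|` S'); split=> [f [/Sh|/Sh'] //|].
apply/seteqP; split=> x /=; first by move=> [H H'] f [/H|/H'].
by move=> H; split=> f Sf; apply: H; [left|right].
Qed.

Lemma irr_cone N (X : set (proj k N)) : irreducible X -> irr (cone X).
Proof.
move=> [[x Xx] H]; split; first by have [v _ xE] := proj_rep x; exists v, x.
move=> d e f g pf pg fg.
have clf d' h : polyfun d' h -> zariski_closed (zeros [set h] : set (proj k N)).
  by move=> ph; apply: zeros_closed => _ ->; exists d'.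
case: (H _ _ (clf _ _ pf) (clf _ _ pg)).
- move=> y Xy; have [v v0 yE] := proj_rep y.
  have /eqP := fg v (ex_intro2 _ _ y Xy yE); rewrite mulf_eq0.
  have yz d' h : polyfun d' h -> h v = 0 -> zeros [set h] y.
    move=> ph hv _ -> w yE'.
    have [c c0 ->] := rep_scale yE yE'.
    by rewrite (polyfun_scale _ _ ph) hv mulr0.
  by case/orP => /eqP /yz; [move/(_ d pf); left|move/(_ e pg); right].
- by move=> HX; left=> v [y Xy yE]; apply: HX Xy f erefl v yE.
- by move=> HX; right=> v [y Xy yE]; apply: HX Xy g erefl v yE.
Qed.

(** A strictly descending sequence Z gives forms f n that vanish on Z (n + 1) but not on Z n. Some f
    n is a combination of earlier ones, and those vanish on Z n. *)
Lemma closed_min N (F : set (set (proj k N))) :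
  (forall Z, F Z -> zariski_closed Z) -> F !=set0 ->
  exists2 Z, F Z & forall Z', F Z' -> Z' `<=` Z -> Z `<=` Z'.
Proof.
move=> Fc [Z0 FZ0]; apply: contrapT => nmin.
have /choice [nx nxP] : forall Z, exists Z', F Z -> [/\ F Z', Z' `<=` Z & ~ Z `<=` Z'].
  move=> Z; apply: contrapT => H; apply: nmin; exists Z.
    by apply: contrapT => nZ; apply: H; exists Z.
  by move=> Z' FZ' ZZ'; apply: contrapT => nZ; apply: H; exists Z'.
pose Z n := iter n nx Z0.
have FZ n : F (Z n) by elim: n => //= n /nxP [].
have Zle n m : (n <= m)%N -> Z m `<=` Z n.
  elim: m => [|m IHm]; first by rewrite leqn0 => /eqP ->.
  rewrite leq_eqVlt => /orP[/eqP -> //|]; rewrite ltnS => /IHm H.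
  by have [_ H' _] := nxP _ (FZ m); apply: subset_trans H.
have /choice [f fP] : forall n, exists f : {mpoly k[N.+1]},
    (forall v, cone (Z n.+1) v -> f.@[v 0] = 0) /\ exists2 v, cone (Z n) v & f.@[v 0] != 0.
  move=> n; have [_ _ H] := nxP _ (FZ n).
  have [v Zv nZv] : exists2 v, cone (Z n) v & ~ cone (Z n.+1) v.
    apply: contrapT => H'; apply: H; apply/cone_subset => v Zv.
    by apply: contrapT => nv; apply: H'; exists v.
  have [d [g [[G _ GE] gZ gv]]] := closed_sep (Fc _ (FZ n.+1)) (cone_neq0 Zv) nZv.
  exists G; split=> [u /gZ|]; first by rewrite GE.
  by exists v => //; rewrite -GE.
have [n [c fE]] := noeth_mpoly f.
have [_ [v Zv]] := fP n; rewrite fE rmorph_sum big1 ?eqxx // => j _.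
rewrite rmorphM /=; have [fj _] := fP j; rewrite fj ?mulr0 //.
exact: (cone_subset (Z n) (Z j.+1)).1 (Zle j.+1 n (ltn_ord j)) v Zv.
Qed.
End Cones.

Section Homogenize.
Variable k : fieldType.

(** * Regular functions and their fibres *)

Definition cons0 (T : Type) m (c : T) (x : 'I_m -> T) : 'I_m.+1 -> T :=
  fun i => if unlift ord0 i is Some j then x j else c.

Lemma cons00 (T : Type) m (c : T) (x : 'I_m -> T) : cons0 c x ord0 = c.
Proof. by rewrite /cons0 unlift_none. Qed.
Lemma cons0S (T : Type) m (c : T) (x : 'I_m -> T) j : cons0 c x (lift ord0 j) = x j.
Proof. by rewrite /cons0 liftK. Qed.

Lemma homogenize m (F : {mpoly k[m]}) : exists d (H : {mpoly k[m.+1]}),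
  H \is d.-homog /\
  forall c x, c != 0 -> H.@[cons0 c x] = c ^+ d * F.@[fun j => x j / c].
Proof.
(* For nonzero F this is one more than the degree; any upper bound for the degrees of the monomials
   will do. *)
pose d := msize F.
pose N (M : 'X_{1..m}) : 'X_{1..m.+1} := [multinom cons0 (d - mdeg M)%N M i | i < m.+1].
exists d, (\sum_(M <- msupp F | M \in msupp F) F@_M *: 'X_[N M]); split.
  apply: rpred_sum => M MF; apply: rpredZ; rewrite dhomogX /= mdegE big_ord_recl.
  rewrite mnmE cons00 (eq_bigr M); last by move=> j _; rewrite mnmE cons0S.
  by rewrite -mdegE subnK // ltnW // msize_mdeg_lt.
move=> c x c0; rewrite rmorph_sum mevalE big_distrr /= -big_seq.
rewrite big_seq [RHS]big_seq; apply: eq_bigr => M MF.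
rewrite mevalZ mevalX mulrCA; congr (_ * _).
rewrite big_ord_recl mnmE !cons00.
have le_Md : (mdeg M <= d)%N by rewrite ltnW // msize_mdeg_lt.
rewrite -{2}(subnK le_Md) exprD -mulrA; congr (_ * _).
rewrite [in RHS]mdegE -prodrXr -big_split /=; apply: eq_bigr => j _.
by rewrite mnmE !cons0S -exprMn mulrC divfK.
Qed.
End Homogenize.

(** * Functions whose denominators are powers of a form *)

Section Regular.
Variables (k : fieldType) (n : nat) (P : set 'rV[k]_n).
Implicit Types (f g W : 'rV[k]_n -> k) (u w : 'rV[k]_n).

(* degree-0 rational functions with denominator a power of W *)
Definition reg e W f : Prop := exists d g, polyfun (e * d) g /\
  forall v, P v -> W v != 0 -> f v = g v / W v ^+ d.

Section Reg.
Variables (e : nat) (W : 'rV[k]_n -> k).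
Hypothesis pW : polyfun e W.

Lemma reg_ext f g : reg e W f -> (forall v, P v -> W v != 0 -> f v = g v) -> reg e W g.
Proof. by move=> [d [h [ph fE]]] fg; exists d, h; split=> // v Pv Wv; rewrite -fg ?fE. Qed.
Lemma reg_const c : reg e W (fun=> c).
Proof.
exists 0%N, (fun=> c); split=> [|v _ _]; last by rewrite expr0 divr1.
by rewrite muln0; exact: polyfun_const.
Qed.
Lemma regM f g : reg e W f -> reg e W g -> reg e W (fun v => f v * g v).
Proof.
move=> [d [F [pF fE]]] [d' [F' [pF' gE]]]; exists (d + d')%N, (fun v => F v * F' v).
split=> [|v Pv Wv]; first by rewrite mulnDr; exact: polyfunM.
by rewrite fE // gE // exprD invfM mulrACA.
Qed.
Lemma regD f g : reg e W f -> reg e W g -> reg e W (fun v => f v + g v).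
Proof.
move=> [d [F [pF fE]]] [d' [F' [pF' gE]]].
exists (d + d')%N, (fun v => F v * W v ^+ d' + F' v * W v ^+ d); split=> [|v Pv Wv].
  rewrite mulnDr; apply: polyfunD; first by apply: polyfunM => //; exact: polyfunX.
  by rewrite addnC; apply: polyfunM => //; exact: polyfunX.
rewrite fE // gE // mulrDl exprD invfM; congr (_ + _).
  by rewrite mulrA [X in _ = X](mulrAC _ _ (W v ^- d')) mulfK // expf_neq0.
by rewrite -mulrA [W v ^+ d * _]mulrA divff ?expf_neq0 // mul1r.
Qed.
Lemma reg_sum (I : Type) (s : seq I) (Q : pred I) (F : I -> 'rV[k]_n -> k) :
  (forall i, Q i -> reg e W (F i)) -> reg e W (fun v => \sum_(i <- s | Q i) F i v).
Proof.
move=> H; elim: s => [|i s IHs].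
  by apply: reg_ext (reg_const 0) _ => v _ _; rewrite big_nil.
have [Qi|nQi] := boolP (Q i).
  by apply: reg_ext (regD (H i Qi) IHs) _ => v _ _; rewrite big_cons Qi.
by apply: reg_ext IHs _ => v _ _; rewrite big_cons (negbTE nQi).
Qed.
Lemma reg_prod (I : Type) (s : seq I) (Q : pred I) (F : I -> 'rV[k]_n -> k) :
  (forall i, Q i -> reg e W (F i)) -> reg e W (fun v => \prod_(i <- s | Q i) F i v).
Proof.
move=> H; elim: s => [|i s IHs].
  by apply: reg_ext (reg_const 1) _ => v _ _; rewrite big_nil.
have [Qi|nQi] := boolP (Q i).
  by apply: reg_ext (regM (H i Qi) IHs) _ => v _ _; rewrite big_cons Qi.
by apply: reg_ext IHs _ => v _ _; rewrite big_cons (negbTE nQi).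
Qed.
Lemma regX f m : reg e W f -> reg e W (fun v => f v ^+ m).
Proof.
move=> rf; elim: m => [|m IHm].
  by apply: reg_ext (reg_const 1) _ => v _ _; rewrite expr0.
by apply: reg_ext (regM rf IHm) _ => v _ _; rewrite exprS.
Qed.
Lemma reg_irr f g : irr P -> nz P W -> reg e W f -> reg e W g ->
  (forall v, P v -> W v != 0 -> f v * g v = 0) ->
  (forall v, P v -> W v != 0 -> f v = 0) \/ (forall v, P v -> W v != 0 -> g v = 0).
Proof.
move=> iP nW [d [F [pF fE]]] [d' [F' [pF' gE]]] fg.
have : ~ nz P (fun v => W v * (F v * F' v)).
  apply/nzPn => v Pv; have [->|Wv] := eqVneq (W v) 0; first by rewrite mul0r.
  have := fg v Pv Wv; rewrite fE // gE // mulrACA -invfM => /eqP.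
  rewrite mulf_eq0 invr_eq0 !mulf_eq0 !expf_eq0 (negbTE Wv) !andbF !orbF.
  by case/orP => /eqP ->; rewrite ?mulr0 ?mul0r ?mulr0.
have [nF|/nzPn F0] := pselect (nz P F); last first.
  by left=> v Pv Wv; rewrite fE // F0 // mul0r.
have [nF'|/nzPn F0] := pselect (nz P F'); last first.
  by right=> v Pv Wv; rewrite gE // F0 // mul0r.
case; apply: (irr_nzM iP pW (polyfunM pF pF') nW).
exact: (irr_nzM iP pF pF').
Qed.

(** Multiplication by the denominator turns f into a form, the kind of function whose germ controls
    its values. *)
Lemma reg_ge0 (G : genf P) f : nz P W -> reg e W f -> ge G f = 0 ->
  forall v, P v -> W v != 0 -> f v = 0.
Proof.
move=> nW [d [F [pF fE]]] f0 v Pv Wv.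
have FE : ge G F = ge G (fun v => f v * W v ^+ d).
  apply/eqP; rewrite -subr_eq0 -geB; apply/eqP; apply: ge_nz pW nW _ => u Pu Wu.
  by rewrite fE // divfK ?subrr // expf_neq0.
rewrite geM f0 mul0r in FE.
by rewrite fE // (ge_eq0 pF FE) // mul0r.
Qed.
End Reg.

Lemma ge_eq_on (G : genf P) e W f g : polyfun e W -> nz P W ->
  (forall v, P v -> W v != 0 -> f v = g v) -> ge G f = ge G g.
Proof.
move=> pW nW fg; apply/eqP; rewrite -subr_eq0 -geB; apply/eqP.
by apply: ge_nz pW nW _ => v Pv Wv; rewrite fg // subrr.
Qed.

Lemma reg_lin w u : reg 1 (lin w) (fun v => lin u v / lin w v).
Proof. by exists 1%N, (lin u); split=> [|v _ _]; rewrite ?expr1 //; exact: polyfun_lin. Qed.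

Lemma reg_mpoly e W m (F : {mpoly k[m]}) (f : 'I_m -> 'rV[k]_n -> k) :
  polyfun e W -> (forall j, reg e W (f j)) -> reg e W (fun v => F.@[fun j => f j v]).
Proof.
move=> pW rf.
apply: (@reg_ext _ _ (fun v => \sum_(M <- msupp F) F@_M * \prod_i f i v ^+ M i)).
  apply: reg_sum => // M _; apply: regM; first exact: reg_const.
  by apply: reg_prod => // j _; exact: regX.
by move=> v _ _; rewrite mevalE.
Qed.

(** The ring k[V/w] as a set of functions. The inductive form allows induction over ring operations,
    and [Aw_ext] discards the values at zeros of w. *)
Inductive Aw (V : {vspace 'rV[k]_n}) w : ('rV[k]_n -> k) -> Prop :=
| Aw_const c : Aw V w (fun=> c)
| Aw_lin u : u \in V -> Aw V w (fun v => lin u v / lin w v)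
| AwD f g : Aw V w f -> Aw V w g -> Aw V w (fun v => f v + g v)
| AwM f g : Aw V w f -> Aw V w g -> Aw V w (fun v => f v * g v)
| Aw_ext f g : Aw V w f -> (forall v, P v -> lin w v != 0 -> f v = g v) -> Aw V w g.

Lemma Aw_reg V w f : Aw V w f -> reg 1 (lin w) f.
Proof.
elim=> {f} [c|u _|f g _ IHf _ IHg|f g _ IHf _ IHg|f g _ IHf fg].
- exact: reg_const.
- exact: reg_lin.
- by apply: regD => //; exact: polyfun_lin.
- exact: regM.
- exact: reg_ext fg.
Qed.

Lemma AwN V w f : Aw V w f -> Aw V w (fun v => - f v).
Proof.
move=> Af; apply: Aw_ext (AwM (Aw_const V w (-1)) Af) _ => v _ _.
by rewrite mulN1r.
Qed.
Lemma AwB V w f g : Aw V w f -> Aw V w g -> Aw V w (fun v => f v - g v).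
Proof. by move=> Af /AwN; apply: AwD. Qed.
Lemma Aw_sum V w (I : Type) (s : seq I) (Q : pred I) (F : I -> 'rV[k]_n -> k) :
  (forall i, Q i -> Aw V w (F i)) -> Aw V w (fun v => \sum_(i <- s | Q i) F i v).
Proof.
move=> H; elim: s => [|i s IHs].
  by apply: Aw_ext (Aw_const V w 0) _ => v _ _; rewrite big_nil.
have [Qi|nQi] := boolP (Q i).
  by apply: Aw_ext (AwD (H i Qi) IHs) _ => v _ _; rewrite big_cons Qi.
by apply: Aw_ext IHs _ => v _ _; rewrite big_cons (negbTE nQi).
Qed.
Lemma Aw_prod V w (I : Type) (s : seq I) (Q : pred I) (F : I -> 'rV[k]_n -> k) :
  (forall i, Q i -> Aw V w (F i)) -> Aw V w (fun v => \prod_(i <- s | Q i) F i v).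
Proof.
move=> H; elim: s => [|i s IHs].
  by apply: Aw_ext (Aw_const V w 1) _ => v _ _; rewrite big_nil.
have [Qi|nQi] := boolP (Q i).
  by apply: Aw_ext (AwM (H i Qi) IHs) _ => v _ _; rewrite big_cons Qi.
by apply: Aw_ext IHs _ => v _ _; rewrite big_cons (negbTE nQi).
Qed.
Lemma AwX V w f m : Aw V w f -> Aw V w (fun v => f v ^+ m).
Proof.
move=> Af; elim: m => [|m IHm].
  by apply: Aw_ext (Aw_const V w 1) _ => v _ _; rewrite expr0.
by apply: Aw_ext (AwM Af IHm) _ => v _ _; rewrite exprS.
Qed.
Lemma Aw_horner V w (p : {poly k}) f : Aw V w f -> Aw V w (fun v => p.[f v]).
Proof.
move=> Af; apply: (@Aw_ext V w (fun v => \sum_(i < size p) p`_i * f v ^+ i)).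
  by apply: Aw_sum => i _; apply: AwM; [exact: Aw_const|exact: AwX].
by move=> v _ _; rewrite horner_coef.
Qed.
Lemma Aw_mpoly V w m (F : {mpoly k[m]}) (f : 'I_m -> 'rV[k]_n -> k) :
  (forall j, Aw V w (f j)) -> Aw V w (fun v => F.@[fun j => f j v]).
Proof.
move=> Af.
apply: (@Aw_ext V w (fun v => \sum_(M <- msupp F) F@_M * \prod_i f i v ^+ M i)).
  apply: Aw_sum => // M _; apply: AwM; first exact: Aw_const.
  by apply: Aw_prod => // j _; exact: AwX.
by move=> v _ _; rewrite mevalE.
Qed.
End Regular.

(** * From homomorphisms to points of the cone *)

Section Points.
Variables (k : closedFieldType) (n : nat) (P : set 'rV[k]_n) (G : genf P).
Hypotheses (char0 : [pchar k] =i pred0) (iP : irr P).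
Implicit Types (f g : 'rV[k]_n -> k) (u w : 'rV[k]_n).
Let K : fieldType := G.
Let i0 : {rmorphism k -> K} := iota G.

Definition rat u w : K := ge G (fun v => lin u v / lin w v).
Definition coords w : seq K := [seq rat (delta_mx 0 i) w | i <- enum 'I_n].

Lemma mem_coords w i : rat (delta_mx 0 i) w \in coords w.
Proof. by apply: map_f; rewrite mem_enum. Qed.

Lemma hom_mmap (B : set K) phi m (F : {mpoly k[m]}) (x : 'I_m -> K) :
  subalg i0 B -> hom i0 B phi -> (forall j, B (x j)) ->
  B (mmap i0 x F) /\ phi (mmap i0 x F) = F.@[fun j => phi (x j)].
Proof.
move=> sB Hphi Bx; have [BC _ BM] := sB; have [phiC _ phiM] := Hphi.
have Bp M : B (mmap1 x M) by apply: (subalg_prod sB) => j _; apply: (subalgX sB).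
split; first by apply: (subalg_sum sB) => M _; apply: BM.
rewrite (hom_sum sB Hphi); last by move=> M _; apply: BM.
rewrite mevalE; apply: eq_bigr => M _; rewrite phiM // phiC; congr (_ * _).
rewrite /mmap1 (hom_prod sB Hphi); last by move=> j _; apply: (subalgX sB).
by apply: eq_bigr => j _; rewrite (homX sB Hphi).
Qed.

Lemma rat_sum u w : rat u w = \sum_i i0 (u 0 i) * rat (delta_mx 0 i) w.
Proof.
transitivity (\sum_i ge G (fun v => u 0 i * (lin (delta_mx 0 i) v / lin w v))); last first.
  by apply: eq_bigr => i _; rewrite geZ.
rewrite -ge_sum; congr (ge G _); apply/funext => v.
by rewrite {1}/lin mulr_suml; apply: eq_bigr => i _; rewrite lin_delta mulrA.
Qed.

Lemma ratww w : nz P (lin w) -> rat w w = 1.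
Proof.
move=> nw; rewrite -(ge1 G); apply: ge_eq_on (polyfun_lin w) nw _ => v _ wv.
by rewrite divff.
Qed.

(** The images of the coordinate ratios are the coordinates of tau. A form vanishing on P gives the
    germ 0 at these ratios, hence vanishes at tau, and [ccl P] puts tau into P. *)
Lemma hom_point (B : set K) psi w : ccl P -> nz P (lin w) -> subalg i0 B -> hom i0 B psi ->
  (forall i, B (rat (delta_mx 0 i) w)) ->
  let tau := \row_i psi (rat (delta_mx 0 i) w) in
  [/\ P tau, lin w tau = 1 & forall u, B (rat u w) /\ psi (rat u w) = lin u tau].
Proof.
move=> cP nw sB Hpsi Bz tau; have [BC _ BM] := sB; have [psiC _ psiM] := Hpsi.
have linE u : B (rat u w) /\ psi (rat u w) = lin u tau.
  rewrite rat_sum; split; first by apply: (subalg_sum sB) => i _; apply: BM.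
  rewrite (hom_sum sB Hpsi); last by move=> i _; apply: BM.
  by apply: eq_bigr => i _; rewrite psiM // psiC mxE.
have wtau : lin w tau = 1 by have [_ <-] := linE w; rewrite ratww // (hom1 Hpsi).
split=> //; apply: cP.
  apply: contra_eq_neq wtau => ->; rewrite linC lin0l.
  by rewrite eq_sym oner_eq0.
move=> d f [F Fd FE] fP; rewrite FE.
have <- : psi (mmap i0 (fun i => rat (delta_mx 0 i) w) F) = F.@[tau 0].
  have [_ ->] := hom_mmap F sB Hpsi Bz.
  by apply: meval_eq => i; rewrite mxE.
suff -> : mmap i0 (fun i => rat (delta_mx 0 i) w) F = 0 by rewrite (hom0 Hpsi).
rewrite -ge_comp -[RHS](ge0 G).
apply: ge_eq_on (polyfun_lin w) nw _ => v Pv wv.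
transitivity ((lin w v)^-1 ^+ d * F.@[v 0]); last by rewrite -FE fP ?mulr0.
rewrite -(homog_scale _ _ Fd); apply: meval_eq => i.
by rewrite lin_delta mulrC.
Qed.

(** A dominant map hits a nonempty open set: evaluation at s is a homomorphism on the polynomial
    ring of the ratios, and off the zeros of Q it extends to all coordinate ratios, which means to a
    point. *)
Lemma lift_points m (us : 'I_m -> 'rV[k]_n) w : ccl P -> nz P (lin w) ->
  (forall F : {mpoly k[m]}, F != 0 -> mmap i0 (fun j => rat (us j) w) F != 0) ->
  exists2 Q : {mpoly k[m]}, Q != 0 & forall s : 'I_m -> k, Q.@[s] != 0 ->
    exists v, [/\ P v, lin w v = 1 & forall j, lin (us j) v = s j].
Proof.
move=> cP nw ind; pose x j := rat (us j) w.
pose B : set K := [set a | exists F, a = mmap i0 x F].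
have sB : subalg i0 B.
  split=> [c|_ _ [F ->] [F' ->]|_ _ [F ->] [F' ->]].
  - by exists c%:MP; rewrite mmapC.
  - by exists (F + F'); rewrite rmorphD.
  - by exists (F * F'); rewrite rmorphM.
have B1 : adjs B (coords w) 1.
  exact: (adjs_base (coords w) sB (subalg1 sB)).
have [b [[Q bE] b0] H] := ext_seq char0 sB B1 (oner_neq0 _).
exists Q; first by apply: contraNneq b0 => Q0; rewrite bE Q0 rmorph0.
move=> s Qs.
have /choice [phi phiP] : forall a : K, exists y : k, forall F, a = mmap i0 x F -> y = F.@[s].
  move=> a; have [[F aE]|nB] := pselect (B a); last by exists 0 => F aE; case: nB; exists F.
  exists F.@[s] => F' aE'; congr (_.@[s]); apply: contrapT => /eqP; rewrite -subr_eq0.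
  by move/ind; rewrite -/x rmorphB /= -aE -aE' subrr eqxx.
have phiE F : phi (mmap i0 x F) = F.@[s] by apply: phiP.
have Hphi : hom i0 B phi.
  split=> [c|_ _ [F ->] [F' ->]|_ _ [F ->] [F' ->]].
  - by have := phiE c%:MP; rewrite mmapC mevalC.
  - by rewrite -rmorphD !phiE mevalD.
  - by rewrite -rmorphM !phiE mevalM.
have [psi [Hpsi psiE _]] : exists psi, [/\ hom i0 (adjs B (coords w)) psi,
    forall a, B a -> psi a = phi a & psi 1 != 0].
  by apply: H => //; rewrite bE phiE.
have sB1 := subalg_adjs (coords w) sB.
have Bc i : adjs B (coords w) (rat (delta_mx 0 i) w).
  exact: (adjs_gen sB (mem_coords w i)).
have [Pt wt uE] := hom_point cP nw sB1 Hpsi Bc.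
eexists; split; [exact: Pt|exact: wt|move=> j].
have [_ <-] := uE (us j); have Bx : B (rat (us j) w) by exists 'X_j; rewrite mmapX mmap1U.
rewrite psiE //; have := phiE 'X_j; by rewrite mmapX mmap1U mevalXU.
Qed.

(** Transcendence degree at most m: m + 2 forms have m + 1 ratios. A homogeneous relation avoids the
    choice of a denominator and makes sense on P itself. *)
Definition tdle m (V : {vspace 'rV[k]_n}) : Prop :=
  forall us : 'I_m.+2 -> 'rV[k]_n, (forall j, us j \in V) ->
  exists d (F : {mpoly k[m.+2]}), [/\ F \is d.-homog, F != 0 &
     forall v, P v -> F.@[fun j => lin (us j) v] = 0].

(** A polynomial killing u/w splits because k is algebraically closed, and in a field some factor
    u/w - z has to vanish. *)
Lemma nonconst_transc u w : nz P (lin w) ->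
  (forall c, exists2 v, P v & lin u v != c * lin w v) -> transcendental i0 (rat u w).
Proof.
move=> nw nc p p0; apply/eqP => E.
have [r pE] := closed_field_poly_normal p.
move: E; rewrite pE map_polyZ hornerZ => /eqP.
rewrite mulf_eq0 fmorph_eq0 lead_coef_eq0 (negbTE p0) /=.
rewrite rmorph_prod horner_prod prodf_seq_eq0 => /hasP [z _ /=].
rewrite map_polyXsubC hornerXsubC /rat => /eqP E.
have [v Pv /eqP uv] := nc z; apply: uv.
have := @ge_eq0 _ _ _ G 1%N (fun v => lin u v - z * lin w v) _ _ v Pv.
move=> H; apply/eqP; rewrite -subr_eq0; apply/eqP; apply: H.
  apply: polyfunB; first exact: polyfun_lin.
  by apply: polyfunZ; exact: polyfun_lin.
have := congr1 (fun a => a * ge G (lin w)) E; rewrite mul0r mulrBl -geM => <-.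
rewrite geB; congr (_ - _); last by rewrite geZ.
apply: ge_eq_on (polyfun_lin w) nw _ => v' _ wv'; by rewrite divfK.
Qed.

Definition tri (T : Type) (a b c : T) : 'I_3 -> T := fun i => nth a [:: a; b; c] i.

Lemma triE (T T' : Type) (h : T -> T') a b c i : h (tri a b c i) = tri (h a) (h b) (h c) i.
Proof. by rewrite /tri; case: i => -[|[|[|]]]. Qed.

(** The relation between w, u and x, divided by a power of w, is an equation for x/w with
    coefficients in k[u/w]. *)
Lemma tdle1_alg V u w x : tdle 1 V -> nz P (lin w) -> u \in V -> w \in V -> x \in V ->
  transcendental i0 (rat u w) -> algebraic (kpoly i0 (rat u w)) (rat x w).
Proof.
move=> td nw uV wV xV tr.
have [j|d [F [Fd F0 FP]]] := td (tri w u x).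
  by rewrite (triE (fun y => y \in V)) wV uV xV /tri; case: j => -[|[|[|]]].
pose g := rat u w; pose B := kpoly i0 g.
have sB : subalg i0 B by exact: subalg_kpoly.
pose p : {poly K} := mmap (@polyC K \o i0) (tri 1 g%:P 'X) F.
have pE y : p.[y] = mmap i0 (tri 1 g y) F.
  rewrite /p /mmap horner_sum; apply: eq_bigr => M _.
  rewrite hornerM hornerC /mmap1 horner_prod; congr (_ * _); apply: eq_bigr => j _.
  by rewrite horner_exp (triE (fun q => q.[y])) hornerC hornerC hornerX.
exists p; split.
- have HB (s : seq 'X_{1..3}) (f : 'X_{1..3} -> {poly K}) :
      (forall M, pover B (f M)) -> pover B (\sum_(M <- s) f M).
    by move=> H; elim/big_ind: _ => //; [exact: pover0 sB|exact: poverD sB].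
  apply: HB => M; apply: (poverM sB).
    by apply: (poverC sB); case: sB.
  apply: big_ind => [||j _]; [exact: (poverC sB (subalg1 sB))|exact: poverM sB|].
  have pj : pover B (tri 1 g%:P 'X j).
    rewrite /tri; case: j => -[|[|[|//]]] //= _.
    - exact: (poverC sB (subalg1 sB)).
    - by apply: (poverC sB); exists 'X; rewrite map_polyX hornerX.
    - exact: poverX sB.
  elim: (M j) => [|l IHl]; first by rewrite expr0; exact: (poverC sB (subalg1 sB)).
  by rewrite exprS; apply: (poverM sB).
(* The equation is not trivial: at the constant [be] it takes the value r(u/w), where r is a
   specialization of F chosen to be nonzero and u/w is transcendental. *)
- have FX0 : F * 'X_ord0 != 0.
    rewrite mulf_neq0 //; apply/eqP => /(congr1 (meval (fun=> 1))).
    by rewrite mevalXU meval0 => /eqP; rewrite oner_eq0.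
  have [a] := mpoly_nonroot char0 FX0; rewrite mevalM mevalXU mulf_eq0 negb_or.
  move=> /andP [Fa a0]; pose al := a (inord 1) / a ord0; pose be := a (inord 2) / a ord0.
  pose r : {poly k} := mmap (@polyC k) (tri 1 'X be%:P) F.
  have rE y : r.[y] = F.@[tri 1 y be].
    rewrite /r mevalE /mmap horner_sum; apply: eq_bigr => M _.
    rewrite hornerM hornerC /mmap1 horner_prod; congr (_ * _); apply: eq_bigr => j _.
    by rewrite horner_exp (triE (fun q => q.[y])) hornerC hornerC hornerX.
  have ral : r.[al] != 0.
    rewrite rE; apply: contraNneq Fa => E.
    have -> : F.@[a] = a ord0 ^+ d * F.@[tri 1 al be]; last by rewrite E mulr0.
    rewrite -(homog_scale _ _ Fd); apply: meval_eq => j.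
    rewrite (triE (fun y => a ord0 * y)) mulr1 !(mulrC (a ord0)) !divfK //.
    rewrite /tri; case: j => -[|[|[|//]]] //= lt_j; congr (a _); apply/val_inj => //=;
      by rewrite inordK.
  have r0 : r != 0 by apply: contraNneq ral => ->; rewrite horner0.
  apply: contraNneq (tr r r0) => p0; rewrite -/g.
  have := pE (i0 be); rewrite p0 horner0 => ->.
  apply/eqP; rewrite /r [RHS]/mmap /mmap rmorph_sum horner_sum; apply: eq_bigr => M _.
  rewrite rmorphM hornerM /= map_polyC hornerC; congr (_ * _).
  rewrite /mmap1 rmorph_prod horner_prod; apply: eq_bigr => j _.
  rewrite rmorphXn horner_exp /= (triE (fun q => (map_poly i0 q).[g])).
  by rewrite rmorph1 hornerC map_polyX hornerX map_polyC hornerC.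
- rewrite pE -/g; transitivity (ge G (fun v => F.@[tri 1 (lin u v / lin w v) (lin x v / lin w v)])).
    rewrite ge_comp; rewrite /mmap; apply: eq_bigr => M _; congr (_ * _).
    rewrite /mmap1; apply: eq_bigr => j _; congr (_ ^+ _).
    rewrite /tri; case: j => -[|[|[|//]]] //= _.
    by rewrite -(ge1 G).
  rewrite -[RHS](ge0 G); apply: ge_eq_on (polyfun_lin w) nw _ => v Pv wv.
  transitivity ((lin w v)^-1 ^+ d * F.@[fun j => lin (tri w u x j) v]); last by rewrite FP ?mulr0.
  rewrite -(homog_scale _ _ Fd); apply: meval_eq => j.
  rewrite (triE (fun y => (lin w v)^-1 * lin y v)) mulVf //.
  by rewrite !(mulrC (lin w v)^-1).
Qed.

Definition vrats (V : {vspace 'rV[k]_n}) w : seq K := [seq rat x w | x <- vbasis V].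

Lemma Aw_adjs V w B f : nz P (lin w) -> subalg i0 B -> Aw P V w f ->
  adjs B (vrats V w) (ge G f).
Proof.
move=> nw sB; have sB1 := subalg_adjs (vrats V w) sB; have [BC BD BM] := sB1.
elim=> {f} [c|u uV|f g _ IHf _ IHg|f g _ IHf _ IHg|f g _ IHf fg].
- exact: BC.
- rewrite -/(rat u w) rat_sum.
  have -> : \sum_i i0 (u 0 i) * rat (delta_mx 0 i) w =
     \sum_j i0 (coord (vbasis V) j u) * rat (vbasis V)`_j w.
    rewrite -rat_sum [in LHS](coord_vbasis uV) /rat.
    transitivity (ge G (fun v => \sum_j coord (vbasis V) j u *
       (lin (vbasis V)`_j v / lin w v))).
      congr (ge G _); apply/funext => v; rewrite lin_suml mulr_suml.
      by apply: eq_bigr => j _; rewrite linZl mulrA.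
    by rewrite ge_sum; apply: eq_bigr => j _; rewrite geZ.
  apply: (subalg_sum sB1) => j _; apply: BM; first exact: BC.
  apply: (adjs_gen sB); apply: (map_f (fun x => rat x w)); by rewrite mem_nth // size_tuple.
- by rewrite geD; apply: BD.
- by rewrite geM; apply: BM.
- by rewrite -(ge_eq_on G (polyfun_lin w) nw fg).
Qed.

Lemma adjs_min (B C : set K) zs : subalg i0 C -> (forall a, B a -> C a) ->
  {in zs, forall z, C z} -> forall a, adjs B zs a -> C a.
Proof.
move=> sC; elim: zs B => //= z zs IHzs B BC zC; apply: IHzs; last first.
  by move=> z' z'zs; apply: zC; rewrite inE z'zs orbT.
by move=> _ [p Hp ->]; apply: (pover_horner sC) => [j|]; [apply: BC|apply: zC; rewrite mem_head].
Qed.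

Lemma adjs_Aw (V : {vspace 'rV[k]_n}) u w a : nz P (lin w) -> u \in V ->
  adjs (kpoly i0 (rat u w)) (vrats V w) a -> exists2 f, Aw P V w f & a = ge G f.
Proof.
move=> nw uV; pose C : set K := [set a | exists2 f, Aw P V w f & a = ge G f].
apply: (@adjs_min _ C).
- split=> [c|_ _ [f Af ->] [g Ag ->]|_ _ [f Af ->] [g Ag ->]].
  + by exists (fun=> c) => //; exact: Aw_const.
  + by exists (fun v => f v + g v); rewrite ?geD //; exact: AwD.
  + by exists (fun v => f v * g v); rewrite ?geM //; exact: AwM.
- move=> _ [p ->]; exists (fun v => p.[lin u v / lin w v]); last by rewrite ge_horner.
  by apply: Aw_horner; exact: Aw_lin.
- move=> _ /mapP [x xV ->]; exists (fun v => lin x v / lin w v) => //.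
  by apply: Aw_lin; exact: vbasis_mem.
Qed.

(** The ratios of V are algebraic over k[u/w], so f has a nonzero norm there which is a multiple of
    f within k[V/w]. Where f vanishes, a polynomial in u/w alone vanishes too. *)
Lemma Aw_norm V u w f : tdle 1 V -> nz P (lin w) -> u \in V -> w \in V ->
  (forall c, exists2 v, P v & lin u v != c * lin w v) -> Aw P V w f ->
  (exists v, [/\ P v, lin w v != 0 & f v != 0]) ->
  exists (b : {poly k}) f', [/\ b != 0, Aw P V w f' &
    forall v, P v -> lin w v != 0 -> f' v * f v = b.[lin u v / lin w v]].
Proof.
move=> td nw uV wV nc Af [v0 [Pv0 wv0 fv0]].
have tr := nonconst_transc nw nc.
have sB := subalg_kpoly i0 (rat u w).
have alg : {in vrats V w, forall z, algebraic (kpoly i0 (rat u w)) z}.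
  by move=> _ /mapP [x xV ->]; apply: tdle1_alg td nw uV wV (vbasis_mem xV) tr.
have f0 : ge G f != 0.
  apply: contraNneq fv0 => f0; apply/eqP.
  exact: (reg_ge0 (polyfun_lin w) nw (Aw_reg Af) f0).
have [_ [a' [[b ->] b0 Ba' E]]] := norm_seq sB alg (Aw_adjs nw sB Af) f0.
have [f' Af' a'E] := adjs_Aw nw uV Ba'.
exists b, f'; split=> //; first by apply: contraNneq b0 => ->; rewrite rmorph0 horner0.
move=> v Pv wv; apply/eqP; rewrite -subr_eq0; apply/eqP.
pose h v := f' v * f v - b.[lin u v / lin w v].
have Ah : Aw P V w h by apply: AwB; [exact: AwM|apply: Aw_horner; exact: Aw_lin].
apply: (reg_ge0 (G := G) (polyfun_lin w) nw (Aw_reg Ah) _ Pv wv).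
by rewrite geB geM -a'E E ge_horner subrr.
Qed.

(** D is the size of the index type of [fib_ext], hence at once a bound for the rank of k[V/w] over
    k[u/w] and the number of points, separated by V, that are found in a general fibre. The form q
    is an auxiliary one to be kept nonzero at these points. *)
Lemma fib_points V u w q : ccl P -> tdle 1 V -> nz P (lin w) -> nz P (lin q) ->
  u \in V -> w \in V -> (forall c, exists2 v, P v & lin u v != c * lin w v) ->
  exists D : nat,
   (exists2 b : {poly k}, b != 0 & forall c, b.[c] != 0 ->
      exists p : 'I_D -> 'rV[k]_n, [/\ forall i, P (p i), forall i, lin w (p i) = 1,
        forall i, lin u (p i) = c, forall i, lin q (p i) != 0 &
        forall i j, i != j -> exists2 l, l \in V & lin l (p i) != lin l (p j)]) /\
   forall N (a : 'I_N -> 'rV[k]_n -> k), (D < N)%N -> (forall j, Aw P V w (a j)) ->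
      exists2 p : 'I_N -> {poly k}, exists j, p j != 0 &
        forall v, P v -> lin w v != 0 -> \sum_j (p j).[lin u v / lin w v] * a j v = 0.
Proof.
move=> cP td nw nq uV wV nc.
have tr := nonconst_transc nw nc; pose g := rat u w.
have sB := subalg_kpoly i0 g.
have alg : {in vrats V w, forall z, algebraic (kpoly i0 g) z}.
  by move=> _ /mapP [x xV ->]; apply: tdle1_alg td nw uV wV (vbasis_mem xV) tr.
have sB1 := subalg_adjs (vrats V w) sB.
have sB2 := subalg_adjs (coords w) sB1.
have Bc i : adjs (adjs (kpoly i0 g) (vrats V w)) (coords w) (rat (delta_mx 0 i) w).
  exact: (adjs_gen sB1 (mem_coords w i)).
have Bq : adjs (adjs (kpoly i0 g) (vrats V w)) (coords w) (rat q w).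
  by rewrite rat_sum; apply: (subalg_sum sB2) => i _; case: sB2 => C _ M; apply: M.
have q0 : rat q w != 0.
  apply/eqP => q0; case: (irr_nzM iP (polyfun_lin q) (polyfun_lin w) nq nw) => v Pv.
  rewrite mulf_eq0 negb_or => /andP [qv wv].
  have := reg_ge0 (polyfun_lin w) nw (reg_lin P w q) q0 Pv wv => /eqP.
  by rewrite mulf_eq0 invr_eq0 (negbTE qv) (negbTE wv).
have [I [_ [[[b ->] b0] H [E HE]]]] := fib_ext char0 sB alg Bq q0.
exists #|I|; split.
  exists b => [|c bc]; first by apply: contraNneq b0 => ->; rewrite rmorph0 horner0.
  have [phi Hphi phiE] := kpoly_hom c tr.
  have [psi [Hpsi psiE qpsi inj]] := H phi Hphi (eq_ind_r (fun x => x != 0) bc (phiE b)).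
  exists (fun j => \row_i psi (enum_val j) (rat (delta_mx 0 i) w)).
  have pt j := hom_point cP nw sB2 (Hpsi j) Bc.
  split=> [j|j|j|j|j l].
  - by case: (pt (enum_val j)).
  - by case: (pt (enum_val j)).
  - have [_ _ /(_ u) [_ <-]] := pt (enum_val j).
    rewrite psiE; first by have := phiE 'X; rewrite map_polyX !hornerX.
    by exists 'X; rewrite map_polyX hornerX.
  - by have [_ _ /(_ q) [_ <-]] := pt (enum_val j).
  move=> jl; apply: contrapT => nl; case/eqP: jl; apply/enum_val_inj/inj.
  move=> _ /mapP [x xV ->]; have [_ _ /(_ x) [_ ->]] := pt (enum_val j).
  have [_ _ /(_ x) [_ ->]] := pt (enum_val l).
  apply/eqP; apply: contrapT => /negP ne; apply: nl; exists x => //.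
  exact: vbasis_mem.
move=> N a lt_N Aa.
have [j|p pn0 Ep] := dep_of_span lt_N tr (x := fun j => ge G (a j)) (E := E).
  by apply: HE; apply: Aw_adjs.
exists p => // v Pv wv.
pose h v := \sum_j (p j).[lin u v / lin w v] * a j v.
have Ah : Aw P V w h.
  by apply: Aw_sum => j _; apply: AwM => //; apply: Aw_horner; exact: Aw_lin.
apply: (reg_ge0 (G := G) (polyfun_lin w) nw (Aw_reg Ah) _ Pv wv).
rewrite ge_sum -[RHS]Ep; apply: eq_bigr => j _; by rewrite geM ge_horner.
Qed.
End Points.

(** * Chains of subvarieties *)

Section Chains.
Variable k : closedFieldType.
Hypothesis char0 : [pchar k] =i pred0.

Definition indep n m (P : set 'rV[k]_n) (us : 'I_m -> 'rV[k]_n) : Prop :=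
  forall e (F : {mpoly k[m]}), F \is e.-homog -> F != 0 ->
  nz P (fun v => F.@[fun j => lin (us j) v]).

Lemma mvar_neq0 m (i : 'I_m) : ('X_i : {mpoly k[m]}) != 0.
Proof.
apply/eqP => /(congr1 (meval (fun=> 1))).
by rewrite mevalXU meval0 => /eqP; rewrite oner_eq0.
Qed.

Lemma polyfun_lins n m e (F : {mpoly k[m]}) (us : 'I_m -> 'rV[k]_n) :
  F \is e.-homog -> polyfun e (fun v => F.@[fun j => lin (us j) v]).
Proof.
move=> Fe; rewrite -[e]muln1.
by apply: (polyfun_comp (f := fun j => lin (us j)) Fe) => j; exact: polyfun_lin.
Qed.

Lemma indep_nz n m (P : set 'rV[k]_n) (us : 'I_m -> 'rV[k]_n) j :
  indep P us -> nz P (lin (us j)).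
Proof.
move=> /(_ 1%N 'X_j) []; rewrite ?mvar_neq0 //; first by rewrite dhomogX /= mdeg1.
by move=> v Pv; rewrite mevalXU => uv; exists v.
Qed.

Lemma indep_rat n m (P : set 'rV[k]_n) (us : 'I_m.+1 -> 'rV[k]_n) (G : genf P) :
  irr P -> indep P us -> forall F : {mpoly k[m]}, F != 0 ->
  mmap (iota G) (fun j => rat G (us (lift ord0 j)) (us ord0)) F != 0.
Proof.
move=> iP ind F F0; have nw := indep_nz ord0 ind.
have [d [H [Hd HE]]] := homogenize F.
have H0 : H != 0.
  have [s Fs] := mpoly_nonroot char0 F0.
  apply: contraNneq Fs => H0; have := HE 1 s (oner_neq0 _).
  rewrite H0 meval0 expr1n mul1r => /esym; rewrite (_ : (fun j => s j / 1) = s) => [->//|].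
  by apply/funext => j; rewrite divr1.
have [v Pv] := irr_nzM iP (polyfun_lin (us ord0)) (polyfun_lins us Hd) nw (ind _ _ Hd H0).
rewrite mulf_eq0 negb_or => /andP [wv Hv].
apply: contraNneq Hv => E.
have := reg_ge0 (G := G) (polyfun_lin (us ord0)) nw
  (reg_mpoly F (polyfun_lin (us ord0)) (fun j => reg_lin P (us ord0) (us (lift ord0 j)))).
rewrite ge_comp => /(_ E v Pv wv) E'.
have := HE _ (fun j => lin (us (lift ord0 j)) v) wv; rewrite E' mulr0 => <-.
apply/eqP; apply: meval_eq => j; rewrite /cons0.
by case: unliftP => [l ->|->].
Qed.

(** Cut X by the hyperplane on which the ratio of the last form to the first equals a suitable
    constant c. The remaining forms stay independent on the section, and a minimal closed subset on
    which they are independent is irreducible. *)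
Lemma chain_step N d (X : set (proj k N)) (us : 'I_d.+2 -> 'rV[k]_N.+1) :
  projective_variety X -> indep (cone X) us ->
  exists X', [/\ projective_variety X', X' `<=` X, ~ X `<=` X' &
     indep (cone X') (fun j : 'I_d.+1 => us (widen_ord (leqnSn _) j))].
Proof.
move=> [cX iX] ind; have iP := irr_cone iX; have [G _] := genf_exists iP.
have nw := indep_nz ord0 ind; set w := us ord0 in nw.
have [Q Q0 HQ] := lift_points char0 (closed_ccl cX) nw (indep_rat G iP ind).
have [s0 Qs0] := mpoly_nonroot char0 Q0.
pose c := s0 ord_max; pose uL := us ord_max.
pose h v := lin uL v - c * lin w v.
have ph : polyfun 1 h.
  by apply: polyfunB; [|apply: polyfunZ]; exact: polyfun_lin.
pose S : set ('rV[k]_N.+1 -> k) := [set h].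
have pS f : S f -> exists e, polyfun e f by move=> ->; exists 1%N.
pose Y := X `&` zeros S; pose us' (j : 'I_d.+1) := us (widen_ord (leqnSn _) j).
have cY : zariski_closed Y by apply: zariski_closedI => //; exact: zeros_closed.
have YE v : cone Y v <-> cone X v /\ h v = 0.
  split=> [[x [Xx Zx] xE]|[Xv hv]].
    by split; [exists x|apply: Zx].
  have v0 := cone_neq0 Xv; apply/(cone_mkpt _ v0); split; first exact/cone_mkpt.
  by apply/cone_mkpt; apply/zeros_cone => // f ->.
have us'0 : us' ord0 = w by rewrite /us' /w; congr us; apply/val_inj.
have us'S (l : 'I_d) : us' (lift ord0 l) = us (lift ord0 (widen_ord (leqnSn d) l)).
  by rewrite /us'; congr us; apply/val_inj.
have usL : us (lift ord0 ord_max) = uL by rewrite /uL; congr us; apply/val_inj.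
have indY : indep (cone Y) us'.
  move=> e F Fe F0.
  have [a] : exists a, (F * 'X_ord0).@[a] != 0.
    by apply: mpoly_nonroot => //; rewrite mulf_neq0 // mvar_neq0.
  rewrite mevalM mevalXU mulf_eq0 negb_or => /andP [Fa a0].
  pose x (j : 'I_d) := a (lift ord0 j) / a ord0.
  have Fx : F.@[cons0 1 x] != 0.
    apply: contraNneq Fa => E.
    have -> : F.@[a] = a ord0 ^+ e * F.@[cons0 1 x]; last by rewrite E mulr0.
    rewrite -(homog_scale _ _ Fe); apply: meval_eq => j; rewrite /cons0.
    by case: unliftP => [l ->|->]; rewrite ?mulr1 // mulrC divfK.
  pose x0 (j : 'I_d) := s0 (widen_ord (leqnSn d) j).
  pose s1 (j : 'I_d.+1) := if insub (val j) is Some l then x l else c.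
  (* A line joins s0, where Q is nonzero, to a point where F is nonzero. Its points all have last
     coordinate c, and a general one of them is good for both polynomials. *)
  have [p1 p1E] := mpoly_line Q s0 (fun j => s1 j - s0 j).
  have [p2 p2E] := mpoly_line F (cons0 1 x0) (cons0 0 (fun j => x j - x0 j)).
  have p10 : p1.[0] != 0.
    rewrite p1E; apply: contraNneq Qs0 => <-; apply/eqP; apply: meval_eq => j.
    by rewrite mul0r addr0.
  have p21 : p2.[1] != 0.
    rewrite p2E; apply: contraNneq Fx => <-; apply/eqP; apply: meval_eq => j.
    rewrite /cons0; case: unliftP => [l _|_]; rewrite mul1r ?addr0 //.
    by rewrite addrC subrK.
  have [la] : exists la, (p1 * p2).[la] != 0.
    apply: poly_nonroot => //; rewrite mulf_neq0 //.
      by apply: contraNneq p10 => ->; rewrite horner0.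
    by apply: contraNneq p21 => ->; rewrite horner0.
  rewrite hornerM mulf_eq0 negb_or => /andP [p1l p2l].
  rewrite p1E in p1l; have [v [Pv wv uv]] := HQ _ p1l.
  exists v.
    apply/YE; split=> //; rewrite /h wv -usL uv /s1 /= insubF ?ltnn //.
    by rewrite -/c subrr mulr0 addr0 mulr1 subrr.
  rewrite (_ : F.@[_] = p2.[la]) // p2E; apply: meval_eq => j.
  rewrite /cons0; case: unliftP => [l ->|->]; last by rewrite us'0 wv mulr0 addr0.
  rewrite us'S uv /s1 /x0 /=; case: insubP => [l' _ /val_inj -> //|].
  by rewrite ltn_ord.
(* Two proper closed subsets of a minimal member each satisfy a form in the us'; if they covered it,
   the product of these forms would be a relation. *)
pose FF : set (set (proj k N)) := [set Z | [/\ zariski_closed Z, Z `<=` Y & indep (cone Z) us']].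
have [Z [cZ ZY indZ] Zmin] : exists2 Z, FF Z & forall Z', FF Z' -> Z' `<=` Z -> Z `<=` Z'.
  by apply: closed_min => [Z []//|]; exists Y; split.
exists Z; split=> //.
- split=> //; split.
    have [v [x Zx _] _] := indep_nz ord0 indZ; by exists x.
  move=> B C cB cC ZBC.
  have notind D : zariski_closed D -> ~ Z `<=` D -> exists e F,
      [/\ F \is e.-homog, F != 0 & forall v, cone Z v -> cone D v -> F.@[fun j => lin (us' j) v] = 0].
    move=> cD nZD; apply: contrapT => H; apply: nZD.
    have : Z `<=` Z `&` D; last by move=> ZD x /ZD [].
    apply: (Zmin (Z `&` D)); last by move=> x [].
    split=> [||e F Fe F0]; [exact: zariski_closedI|by move=> x [/ZY]|].
    apply: contrapT => /nzPn H'; apply: H; exists e, F; split=> // v Zv Dv.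
    apply: H'; have v0 := cone_neq0 Zv; apply/(cone_mkpt _ v0).
    by split; apply/cone_mkpt.
  have [ZB|nZB] := pselect (Z `<=` B); first by left.
  have [ZC|nZC] := pselect (Z `<=` C); first by right.
  have [e [F [Fe F0 FB]]] := notind B cB nZB.
  have [e' [F' [Fe' F0' FC]]] := notind C cC nZC.
  have [v Zv] := indZ _ _ (dhomogM Fe Fe') (mulf_neq0 F0 F0').
  rewrite mevalM; have v0 := cone_neq0 Zv.
  have [Bx|Cx] := ZBC _ ((cone_mkpt _ v0).1 Zv).
    by rewrite FB ?mul0r ?eqxx //; apply/(cone_mkpt _ v0).
  by rewrite FC ?mulr0 ?eqxx //; apply/(cone_mkpt _ v0).
- by move=> x /ZY [].
- move=> XZ; pose F : {mpoly k[d.+2]} := 'X_ord_max - c *: 'X_ord0.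
  have Fe : F \is 1.-homog.
    by rewrite rpredB ?rpredZ // dhomogX /= mdeg1.
  have F0 : F != 0.
    apply/eqP => /(congr1 (meval (fun j => (j == ord_max)%:R))).
    by rewrite mevalB mevalZ !mevalXU meval0 eqxx mulr0 subr0 => /eqP; rewrite oner_eq0.
  have [v Xv] := ind _ _ Fe F0; rewrite mevalB mevalZ !mevalXU.
  have Yv : cone Y v by move: Xv; apply: (cone_subset _ _).1; apply: subset_trans ZY.
  by have [_ hv] := (YE v).1 Yv; rewrite -/(h v) hv eqxx.
Qed.

Lemma chain_indep N d (X : set (proj k N)) (us : 'I_d.+1 -> 'rV[k]_N.+1) :
  projective_variety X -> indep (cone X) us -> variety_chain X d.
Proof.
elim: d X us => [|d IHd] X us vX ind.
  by exists (fun=> X); split=> i //; move=> _; split.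
have [X' [vX' sX' nX' ind']] := chain_step vX ind.
have [Z [Z1 Z2]] := IHd X' _ vX' ind'.
exists (fun i => if (i <= d)%N then Z i else X); split=> i.
  case: (leqP i d) => [le_id|lt_di] _; last by split.
  by have [vZ sZ] := Z1 i le_id; split=> //; apply: subset_trans sX'.
rewrite ltnS => le_id; rewrite le_id; case: (ltnP i d) => [lt_id|le_di]; first exact: Z2.
have -> : i = d by apply/eqP; rewrite eqn_leq le_id.
have [_ sZ] := Z1 d (leqnn d).
by split; [apply: subset_trans sX'|move=> XZ; apply: nX'; apply: subset_trans sZ].
Qed.

(** An upper bound on dimension is turned into relations: d + 2 independent forms would produce a
    chain that is too long. *)
Lemma no_chain_tdle N d (X : set (proj k N)) V :
  projective_variety X -> ~ variety_chain X d.+1 -> tdle (cone X) d V.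
Proof.
move=> vX nch us _; apply: contrapT => H; apply: nch; apply: (chain_indep vX (us := us)).
move=> e F Fe F0; apply: contrapT => /nzPn Fv; apply: H; exists e, F; split=> //.
Qed.
End Chains.

(** * Contact order and multiplicity *)

Section Filtration.
Variables (k : fieldType) (n : nat) (Q : set 'rV[k]_n) (V : {vspace 'rV[k]_n}).
Variables (w x : 'rV[k]_n).
Implicit Types (f g a : 'rV[k]_n -> k) (u v : 'rV[k]_n).

(** These functions generate the maximal ideal of x in k[V/w]. *)
Definition tc (j : 'I_(\dim V)) v : k :=
  lin (vbasis V)`_j v / lin w v - lin (vbasis V)`_j x / lin w x.

(* [Mk i] is the i-th power of the maximal ideal of x in k[V/w] *)
Fixpoint Mk i f : Prop :=
  if i is i'.+1 then
    exists2 g : 'I_(\dim V) -> 'rV[k]_n -> k, forall j, Mk i' (g j) &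
      forall v, Q v -> lin w v != 0 -> f v = \sum_j tc j v * g j v
  else Aw Q V w f.

Lemma Mk_ext i f g : Mk i f -> (forall v, Q v -> lin w v != 0 -> f v = g v) -> Mk i g.
Proof.
case: i => [|i] /=; first exact: Aw_ext.
by move=> [h Mh fE] fg; exists h => // v Qv wv; rewrite -fg ?fE.
Qed.

Lemma Aw_tc j : Aw Q V w (tc j).
Proof.
apply: AwB; last exact: Aw_const.
by apply: Aw_lin; apply: vbasis_mem; rewrite mem_nth // size_tuple.
Qed.

Lemma Mk_Aw i f : Mk i f -> Aw Q V w f.
Proof.
elim: i f => //= i IHi f [g Mg fE].
apply: (@Aw_ext _ _ _ _ _ (fun v => \sum_j tc j v * g j v)).
  by apply: Aw_sum => j _; apply: AwM; [exact: Aw_tc|exact: IHi].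
by move=> v Qv wv; rewrite fE.
Qed.

Lemma MkD i f g : Mk i f -> Mk i g -> Mk i (fun v => f v + g v).
Proof.
elim: i f g => [|i IHi] f g /=; first exact: AwD.
move=> [h Mh fE] [h' Mh' gE]; exists (fun j v => h j v + h' j v).
  by move=> j; apply: IHi.
move=> v Qv wv; rewrite fE // gE // -big_split; apply: eq_bigr => j _.
by rewrite mulrDr.
Qed.

Lemma MkA i f g : Aw Q V w g -> Mk i f -> Mk i (fun v => g v * f v).
Proof.
move=> Ag; elim: i f => [|i IHi] f /=; first exact: AwM.
move=> [h Mh fE]; exists (fun j v => g v * h j v); first by move=> j; apply: IHi.
move=> v Qv wv; rewrite fE // mulr_sumr; apply: eq_bigr => j _.
by rewrite mulrCA.
Qed.

Lemma MkM i j f g : Mk i f -> Mk j g -> Mk (i + j) (fun v => f v * g v).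
Proof.
move=> + Mg; elim: i f => [|i IHi] f /=; first by move=> Af; exact: MkA.
move=> [h Mh fE]; exists (fun l v => h l v * g v); first by move=> l; apply: IHi.
move=> v Qv wv; rewrite fE // mulr_suml; apply: eq_bigr => l _.
by rewrite mulrA.
Qed.

Lemma MkZ i c f : Mk i f -> Mk i (fun v => c * f v).
Proof. by apply: MkA; exact: Aw_const. Qed.

Lemma MkB i f g : Mk i f -> Mk i g -> Mk i (fun v => f v - g v).
Proof.
move=> Mf Mg; apply: Mk_ext (MkD Mf (MkZ (-1) Mg)) _ => v _ _.
by rewrite mulN1r.
Qed.

Lemma Mk0 i : Mk i (fun=> 0).
Proof.
elim: i => [|i IHi] /=; first exact: Aw_const.
by exists (fun _ _ => 0) => // v _ _; rewrite big1 // => j _; rewrite mulr0.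
Qed.

Lemma Mk_sum i (I : Type) (s : seq I) (R : pred I) (F : I -> 'rV[k]_n -> k) :
  (forall j, R j -> Mk i (F j)) -> Mk i (fun v => \sum_(j <- s | R j) F j v).
Proof.
move=> H; elim: s => [|j s IHs].
  by apply: Mk_ext (Mk0 i) _ => v _ _; rewrite big_nil.
have [Rj|nRj] := boolP (R j).
  by apply: Mk_ext (MkD (H j Rj) IHs) _ => v _ _; rewrite big_cons Rj.
by apply: Mk_ext IHs _ => v _ _; rewrite big_cons (negbTE nRj).
Qed.

Lemma MkS i f : Mk i.+1 f -> Mk i f.
Proof.
move=> [g Mg fE]; apply: (@Mk_ext _ (fun v => \sum_j tc j v * g j v)).
  by apply: Mk_sum => j _; apply: MkA; [exact: Aw_tc|exact: Mg].
by move=> v Qv wv; rewrite fE.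
Qed.

Lemma MkW i j f : (i <= j)%N -> Mk j f -> Mk i f.
Proof.
move=> /subnK <-; elim: (j - i)%N => [|l IHl] //; rewrite addSn.
by move/MkS/IHl.
Qed.

Lemma MkX i f : Mk 1 f -> Mk i (fun v => f v ^+ i).
Proof.
move=> Mf; elim: i => [|i IHi] /=.
  by apply: Aw_ext (Aw_const _ _ _ 1) _ => v _ _; rewrite expr0.
by apply: Mk_ext (MkM Mf IHi) _ => v _ _; rewrite exprS.
Qed.

(** The generators are the products of i of the functions [tc j], one for each word of length i.
    That they are finite in number is what the determinant in [nakayama] needs. *)
Lemma Mk_gens i : exists (I : finType) (e : I -> 'rV[k]_n -> k),
  (forall a : I, Mk i (e a)) /\ forall l f, Mk (i + l) f -> exists2 c : I -> 'rV[k]_n -> k,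
    forall a : I, Mk l (c a) & forall v, Q v -> lin w v != 0 -> f v = \sum_a c a v * e a v.
Proof.
elim: i => [|i [I [e [Me H]]]].
  exists (unit : finType), (fun _ _ => 1); split=> [_|l f Mf]; first exact: Aw_const.
  exists (fun=> f) => // v _ _.
  by rewrite (big_pred1 tt) ?mulr1 //; case.
exists ('I_(\dim V) * I)%type, (fun ja v => tc ja.1 v * e ja.2 v); split.
  move=> [j a] /=; exists (fun l v => if l == j then e a v else 0).
    by move=> l; case: (l == j) => //; exact: Mk0.
  move=> v _ _; rewrite (bigD1 j) //= eqxx big1 ?addr0 // => l /negbTE ->.
  by rewrite mulr0.
move=> l f [g Mg fE].
have /choice [c cP] : forall j, exists c : I -> 'rV[k]_n -> k,
    (forall a : I, Mk l (c a)) /\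
    forall v, Q v -> lin w v != 0 -> g j v = \sum_a c a v * e a v.
  by move=> j; have [c ? ?] := H l (g j) (Mg j); exists c.
exists (fun ja => c ja.1 ja.2); first by move=> [j a]; case: (cP j).
move=> v Qv wv; rewrite fE //; under eq_bigr => j _.
  have [_ ->//] := cP j; rewrite mulr_sumr; over.
rewrite pair_big /=; apply: eq_bigr => -[j a] _ /=; by rewrite mulrCA.
Qed.

Section AtPoint.
Hypotheses (Qx : Q x) (wx : lin w x != 0).

Lemma tc_x j : tc j x = 0. Proof. by rewrite /tc subrr. Qed.

Lemma Mk_x i f : Mk i.+1 f -> f x = 0.
Proof. by move=> [g _ ->//]; rewrite big1 // => j _; rewrite tc_x mul0r. Qed.

Lemma Mk1_lin u : u \in V -> lin u x = 0 -> Mk 1 (fun v => lin u v / lin w v).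
Proof.
move=> uV ux; exists (fun j _ => coord (vbasis V) j u); first by move=> j; exact: Aw_const.
move=> v Qv wv.
transitivity (lin u v / lin w v - lin u x / lin w x); first by rewrite ux mul0r subr0.
rewrite {1 2}(coord_vbasis uV) !lin_suml !mulr_suml -sumrB; apply: eq_bigr => j _.
by rewrite !linZl -!mulrA -mulrBr mulrC.
Qed.

Lemma Aw_x f : Aw Q V w f -> Mk 1 (fun v => f v - f x).
Proof.
elim=> {f} [c|u uV|f g _ IHf _ IHg|f g Af IHf _ IHg|f g _ IHf fg].
- by apply: Mk_ext (Mk0 1) _ => v _ _; rewrite subrr.
- exists (fun j _ => coord (vbasis V) j u); first by move=> j; exact: Aw_const.
  move=> v Qv wv; rewrite {1 2}(coord_vbasis uV) !lin_suml !mulr_suml -sumrB.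
  by apply: eq_bigr => j _; rewrite !linZl -!mulrA -mulrBr mulrC.
- by apply: Mk_ext (MkD IHf IHg) _ => v _ _; rewrite opprD addrACA.
- apply: Mk_ext (MkD (MkA Af IHg) (MkZ (g x) IHf)) _ => v _ _.
  by rewrite !mulrBr [g x * f v]mulrC [g x * f x]mulrC addrA subrK.
- by apply: Mk_ext IHf _ => v Qv wv; rewrite !fg.
Qed.

(** k[V/w] is not localized at x, so units must be cancelled by hand: mu = 1 - b/b(x) lies in the
    maximal ideal and a = (b/b(x)) a + mu a, which raises the contact of a step by step up to i. *)
Lemma Mk_local i a b : Aw Q V w a -> Aw Q V w b -> b x != 0 ->
  Mk i (fun v => b v * a v) -> Mk i a.
Proof.
move=> Aa Ab bx Mba.
suff H j : (j <= i)%N -> Mk j a by apply: H.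
elim: j => // j IHj lt_ji.
pose mu v := 1 - (b x)^-1 * b v.
have Mmu : Mk 1 mu.
  apply: Mk_ext (MkZ (- (b x)^-1) (Aw_x Ab)) _ => v _ _.
  by rewrite mulrBr mulNr [- _ * b x]mulNr mulVf // opprK addrC.
have := MkD (MkW lt_ji (MkZ (b x)^-1 Mba)) (MkM Mmu (IHj (ltnW lt_ji))).
move=> M; apply: Mk_ext M _ => v _ _.
by rewrite /mu mulrBl mul1r mulrA addrC subrK.
Qed.

(** If all elements of the i-th power had contact i + 1, a determinant with value 1 at x would kill
    the generators; irreducibility then makes the generators 0, and with them the i-th power of
    f0. *)
Lemma nakayama i f0 : irr Q -> Mk 1 f0 -> (exists v, [/\ Q v, lin w v != 0 & f0 v != 0]) ->
  exists2 a, Mk i a & ~ Mk i.+1 a.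
Proof.
move=> iQ Mf0 [v0 [Qv0 wv0 fv0]]; apply: contrapT => H.
have {}H a : Mk i a -> Mk i.+1 a.
  by move=> Ma; apply: contrapT => nM; apply: H; exists a.
have [I [e [Me gen]]] := Mk_gens i.
have /choice [c cP] : forall a : I, exists c : I -> 'rV[k]_n -> k, (forall b : I, Mk 1 (c b)) /\
    forall v, Q v -> lin w v != 0 -> e a v = \sum_b c b v * e b v.
  move=> a; have [|c ? ?] := gen 1%N (e a); last by exists c.
  by rewrite addn1; exact: H.
pose C v : 'M[k]_#|I| := \matrix_(a, b) c (enum_val a) (enum_val b) v.
pose D v := \det (1%:M - C v).
have eE v (b : I) : Q v -> lin w v != 0 -> D v * e b v = 0.
  move=> Qv wv; pose ev : 'cV[k]_#|I| := \col_a e (enum_val a) v.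
  have : (1%:M - C v) *m ev = 0.
    rewrite mulmxBl mul1mx; apply/eqP; rewrite subr_eq0; apply/eqP/colP => a.
    rewrite !mxE; have [_ ->//] := cP (enum_val a).
    rewrite (reindex (@enum_val I predT)) /=; last exact: onW_bij (enum_val_bij _).
    by apply: eq_bigr => l _; rewrite !mxE.
  move/(congr1 (mulmx (\adj (1%:M - C v)))); rewrite mulmxA mul_adj_mx mulmx0.
  rewrite mul_scalar_mx => /colP /(_ (enum_rank b)).
  by rewrite !mxE enum_rankK.
have AD : Aw Q V w D.
  apply: Aw_sum => s _; apply: AwM; first exact: Aw_const.
  apply: Aw_prod => a _.
  have A' : Aw Q V w (fun v => (a == s a)%:R - c (enum_val a) (enum_val (s a)) v).
    by apply: AwB; [exact: Aw_const|apply: (@Mk_Aw 1); case: (cP (enum_val a))].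
  by apply: Aw_ext A' _ => v _ _; rewrite !mxE.
have Dx : D x = 1.
  rewrite /D (_ : C x = 0) ?subr0 ?det1 //; apply/matrixP => a b; rewrite !mxE.
  by apply: (@Mk_x 0); case: (cP (enum_val a)).
have nw : nz Q (lin w) by exists x.
have e0 b v : Q v -> lin w v != 0 -> e b v = 0.
  case: (reg_irr (polyfun_lin w) iQ nw (Aw_reg AD) (Aw_reg (Mk_Aw (Me b)))) => [v' Qv' wv'|D0|].
  - exact: eE.
  - by have := D0 x Qx wx; rewrite Dx => /eqP; rewrite oner_eq0.
  - exact.
have [|d _ fE] := gen 0%N (fun v => f0 v ^+ i); first by rewrite addn0; apply: MkX.
have := expf_neq0 i fv0; rewrite fE // big1 ?eqxx // => a _.
by rewrite e0 ?mulr0.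
Qed.
End AtPoint.
End Filtration.

Lemma Aw_sub (k : fieldType) n (P Q : set 'rV[k]_n) V w f :
  Q `<=` P -> Aw P V w f -> Aw Q V w f.
Proof.
move=> QP; elim=> {f} [c|u uV|f g _ IHf _ IHg|f g _ IHf _ IHg|f g _ IHf fg].
- exact: Aw_const.
- exact: Aw_lin.
- exact: AwD.
- exact: AwM.
- by apply: Aw_ext IHf _ => v /QP; apply: fg.
Qed.

Lemma Aw_subV (k : fieldType) n (P : set 'rV[k]_n) (V V' : {vspace 'rV[k]_n}) w f :
  (V <= V')%VS -> Aw P V w f -> Aw P V' w f.
Proof.
move=> VV; elim=> {f} [c|u uV|f g _ IHf _ IHg|f g _ IHf _ IHg|f g _ IHf fg].
- exact: Aw_const.
- by apply: Aw_lin; exact: (subvP VV).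
- exact: AwD.
- exact: AwM.
- by apply: Aw_ext IHf _.
Qed.

Lemma Mk_sub (k : fieldType) n (P Q : set 'rV[k]_n) V w x i f :
  Q `<=` P -> Mk P V w x i f -> Mk Q V w x i f.
Proof.
move=> QP; elim: i f => [|i IHi] f /=; first exact: Aw_sub.
by move=> [g Mg fE]; exists g => [j|v /QP Pv wv]; [exact: IHi|exact: fE].
Qed.

(* k[V/w] has rank at most delta over k[u/w] *)
Definition DEGat (k : fieldType) n (Q : set 'rV[k]_n) (V : {vspace 'rV[k]_n}) delta u w :=
  forall a : 'I_delta.+1 -> 'rV[k]_n -> k, (forall i, Aw Q V w (a i)) ->
  exists2 p : 'I_delta.+1 -> {poly k}, exists i, p i != 0 &
    forall v, Q v -> lin w v != 0 -> \sum_i (p i).[lin u v / lin w v] * a i v = 0.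

Definition DEG (k : fieldType) n (Q : set 'rV[k]_n) (V : {vspace 'rV[k]_n}) (delta : nat) :=
  forall u w, u \in V -> w \in V -> nz Q (lin w) -> DEGat Q V delta u w.

(** * A bound for contact and zeros along a curve *)

Section Multiplicity.
Variables (k : fieldType) (n : nat) (Q : set 'rV[k]_n) (V : {vspace 'rV[k]_n}).
Variables (delta : nat) (w x u : 'rV[k]_n).
Hypotheses (iQ : irr Q) (dQ : DEGat Q V delta u w).
Hypotheses (Qx : Q x) (wx : lin w x != 0) (uV : u \in V).
Hypothesis nu : nz Q (lin u).

Lemma poly_common_X l (p : 'I_l -> {poly k}) : (exists i, p i != 0) ->
  exists s (q : 'I_l -> {poly k}), (forall i, p i = q i * 'X^s) /\ exists i, (q i).[0] != 0.
Proof.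
move=> [i0 pi0].
have exP : exists m, [exists i, (p i)`_m != 0].
  by exists (size (p i0)).-1; apply/existsP; exists i0; rewrite -lead_coefE lead_coef_eq0.
case: (ex_minnP exP) => s /existsP [i1 pi1] smin.
exists s, (fun i => drop_poly s (p i)); split=> [i|].
  rewrite -{1}[p i](poly_take_drop s) (_ : take_poly s (p i) = 0) ?add0r //.
  apply/polyP => j; rewrite coef_take_poly coef0; case: ifP => // lt_js.
  apply/eqP; apply: contraTT lt_js => pij; rewrite -leqNgt; apply: smin.
  by apply/existsP; exists i.
by exists i1; rewrite horner_coef0 coef_drop_poly add0n.
Qed.

(** Bezout without intersection numbers. If kappa + l exceeded delta, there would be delta + 1
    functions independent modulo u/w: kappa of them with distinct contact orders at x, and l
    separating the other zeros. The rank bound yields a relation between them over k[u/w], which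
    survives modulo u/w. *)
Lemma mult_bound kappa l (p : 'I_l -> 'rV[k]_n) :
  Mk Q V w x kappa (fun v => lin u v / lin w v) ->
  (forall i, [/\ Q (p i), lin w (p i) != 0 & lin u (p i) = 0]) ->
  (forall i j, i != j -> exists2 s, s \in V & lin s (p j) = 0 /\ lin s (p i) != 0) ->
  ((0 < kappa)%N -> forall i, exists2 s, s \in V & lin s x = 0 /\ lin s (p i) != 0) ->
  (kappa + l <= delta)%N.
Proof.
move=> Mu Hp sep sepx; rewrite leqNgt; apply/negP => lt_d.
have nw : nz Q (lin w) by exists x.
have [v1 Qv1] := irr_nzM iQ (polyfun_lin u) (polyfun_lin w) nu nw.
rewrite mulf_eq0 negb_or => /andP [uv1 wv1].
have gv1 : lin u v1 / lin w v1 != 0 by rewrite mulf_neq0 ?invr_eq0.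
have /choice [A AP] : forall i, exists a, (i < kappa)%N ->
    Mk Q V w x i a /\ ~ Mk Q V w x i.+1 a.
  move=> i; have [lt_i|le_i] := ltnP i kappa; last by exists (fun=> 0).
  have kgt0 : (0 < kappa)%N by apply: leq_ltn_trans lt_i.
  have [|a Ma nMa] := @nakayama _ _ Q V w x Qx wx i (fun v => lin u v / lin w v) iQ (MkW kgt0 Mu).
    by exists v1.
  by exists a.
have /choice [s sP] : forall i, exists s, (0 < kappa)%N ->
    [/\ s \in V, lin s x = 0 & lin s (p i) != 0].
  move=> i; have [k0|k0] := posnP kappa; first by exists 0.
  by have [s sV [sx spi]] := sepx k0 i; exists s.
have /choice [r rP] : forall ij : 'I_l * 'I_l, exists s, ij.1 != ij.2 ->
    [/\ s \in V, lin s (p ij.2) = 0 & lin s (p ij.1) != 0].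
  move=> [i j] /=; have [->|ij] := eqVneq i j; first by exists 0.
  by have [t tV [tj ti]] := sep i j ij; exists t.
(* B i has contact kappa with x, is nonzero at p i and vanishes at all other p j. *)
pose B (i : 'I_l) v := (\prod_(j | j != i) (lin (r (i, j)) v / lin w v)) *
  (lin (s i) v / lin w v) ^+ kappa.
have MB i : Mk Q V w x kappa (B i).
  apply: MkA.
    apply: Aw_prod => j ji; apply: Aw_lin; rewrite eq_sym in ji.
    by case: (rP (i, j) ji).
  have [->|k0] := posnP kappa.
    by apply: Aw_ext (Aw_const _ _ _ 1) _ => v _ _; rewrite expr0.
  by have [sV sx _] := sP i k0; apply: MkX; apply: Mk1_lin.
have Bii i : B i (p i) != 0.
  have [_ wpi _] := Hp i; rewrite mulf_neq0 //.
    apply/prodf_neq0 => j ji; rewrite eq_sym in ji; case: (rP (i, j) ji) => _ _ rij.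
    by rewrite mulf_neq0 ?invr_eq0.
  have [->|k0] := posnP kappa; first by rewrite expr0 oner_eq0.
  by have [_ _ spi] := sP i k0; rewrite expf_neq0 // mulf_neq0 ?invr_eq0.
have Bij i j : i != j -> B i (p j) = 0.
  move=> ij; rewrite /B (bigD1 j) 1?eq_sym //=.
  by have [_ -> _] := rP (i, j) ij; rewrite !mul0r.
(* First the kappa functions A, in increasing order of contact, then functions B;
   [delta < kappa + l] guarantees that there are enough. *)
pose a (i : 'I_delta.+1) : 'rV[k]_n -> k :=
  if insub (i - kappa)%N is Some j then (if (i < kappa)%N then A i else B j) else A i.
have aA (i : 'I_delta.+1) : (i < kappa)%N -> a i = A i.
  by move=> lt_i; rewrite /a; case: insub => // j; rewrite lt_i.
have aB (i : 'I_delta.+1) (lt_il : (i - kappa < l)%N) : (kappa <= i)%N -> a i = B (Ordinal lt_il).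
  move=> le_i; rewrite /a insubT /= ltnNge le_i /=; congr B; exact/val_inj.
have lt_il (i : 'I_delta.+1) : (kappa <= i)%N -> (i - kappa < l)%N.
  by move=> le_i; rewrite ltn_subLR // (leq_trans _ lt_d).
have Ma (i : 'I_delta.+1) : Mk Q V w x (minn i kappa) (a i).
  have [lt_i|le_i] := ltnP i kappa.
    by rewrite aA //; case: (AP i lt_i).
  by rewrite (aB i (lt_il i le_i)).
have [q [i0 qi0] qE] := dQ (fun i => Mk_Aw (Ma i)).
(* Irreducibility allows division of the relation by the highest common power of u/w, after which
   some coefficient is nonzero at u/w = 0. *)
have [e [q' [q'E [i1 q'i1]]]] := poly_common_X (ex_intro _ i0 qi0).
pose g v := lin u v / lin w v.
have Ag : Aw Q V w g by apply: Aw_lin.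
pose S' v := \sum_i (q' i).[g v] * a i v.
have AS' : Aw Q V w S'.
  by apply: Aw_sum => i _; apply: AwM; [exact: Aw_horner|exact: Mk_Aw (Ma i)].
have S'0 v : Q v -> lin w v != 0 -> S' v = 0.
  case: (reg_irr (polyfun_lin w) iQ nw (Aw_reg (AwX e Ag)) (Aw_reg AS')) => [v' Qv' wv'|g0|].
  - rewrite -[RHS](qE v' Qv' wv') /S' mulr_sumr; apply: eq_bigr => i _.
    by rewrite q'E hornerM hornerXn mulrA [_ ^+ e * _]mulrC.
  - by move: (g0 v1 Qv1 wv1) => /eqP; rewrite expf_eq0 (negbTE gv1) andbF.
  - exact.
pose c i := (q' i).[0].
have /choice [r' r'P] : forall i, exists r' : {poly k}, q' i = r' * 'X + (c i)%:P.
  move=> i; have /factor_theorem [r' r'E] : root (q' i - (c i)%:P) 0.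
    by rewrite /root hornerD hornerN hornerC subrr.
  by exists r'; rewrite -['X]subr0 -polyC0 -r'E subrK.
pose S v := \sum_i c i * a i v.
have SE v : Q v -> lin w v != 0 -> S v = g v * - \sum_i (r' i).[g v] * a i v.
  move=> Qv wv; apply/eqP; rewrite mulrN -subr_eq0 opprK mulr_sumr -big_split /=.
  rewrite -[X in _ == X](S'0 v Qv wv); apply/eqP; apply: eq_bigr => i _.
  by rewrite [in RHS]r'P hornerD hornerM hornerX hornerC mulrDl addrC mulrA [g v * _]mulrC.
have MS : Mk Q V w x kappa S.
  have AR : Aw Q V w (fun v => - \sum_i (r' i).[g v] * a i v).
    apply: AwN; apply: Aw_sum => i _.
    by apply: AwM; [exact: Aw_horner|exact: Mk_Aw (Ma i)].
  by apply: Mk_ext (MkA AR Mu) _ => v Qv wv; rewrite SE // mulrC.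
(* S is a multiple of u/w, so it has contact kappa with x and vanishes at every p j. The first
   nonzero c i contradicts this: for i < kappa it would raise the contact of A i, otherwise evaluate
   at the corresponding p j. *)
have exP : exists i : nat, [exists j : 'I_delta.+1, (val j == i) && (c j != 0)].
  by exists i1; apply/existsP; exists i1; rewrite eqxx.
case: (ex_minnP exP) => _ /existsP [i2 /andP [/eqP <- ci2]] imin.
have cmin (j : 'I_delta.+1) : (j < i2)%N -> c j = 0.
  move=> lt_j; apply/eqP; apply: contraTT lt_j => cj; rewrite -leqNgt.
  by apply: imin; apply/existsP; exists j; rewrite eqxx.
have [lt_i2|le_i2] := ltnP i2 kappa.
  have [_ nA] := AP i2 lt_i2; apply: nA; rewrite -aA //.
  pose T v := \sum_(j | j != i2) c j * a j v.
  have MT : Mk Q V w x i2.+1 T.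
    apply: Mk_sum => j ji; have [lt_j|le_j] := ltnP j i2.
      by apply: Mk_ext (Mk0 _ _ _ _ _) _ => v _ _; rewrite cmin // mul0r.
    apply: MkZ; apply: MkW (Ma j); rewrite leq_min lt_i2 andbT.
    by rewrite ltn_neqAle le_j andbT eq_sym.
  apply: Mk_ext (MkZ (c i2)^-1 (MkB (MkW lt_i2 MS) MT)) _ => v _ _.
  by rewrite /S (bigD1 i2) //= addrK mulKf.
pose j2 := Ordinal (lt_il i2 le_i2); have [Qp wp up] := Hp j2.
have Sp : S (p j2) = 0 by rewrite SE // /g up !mul0r.
move: Sp; rewrite /S (bigD1 i2) //= (aB i2 (lt_il i2 le_i2)) // big1 ?addr0.
  by move/eqP; rewrite mulf_eq0 (negbTE ci2) (negbTE (Bii _)).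
move=> j ji; have [lt_j|le_j] := ltnP j i2; first by rewrite cmin // mul0r.
have le_j' := leq_trans le_i2 le_j; rewrite (aB j (lt_il j le_j')) // Bij ?mulr0 //.
apply: contra ji => /eqP /(congr1 val) /= E; apply/eqP/val_inj.
by rewrite /= -(subnK le_j') E subnK.
Qed.
End Multiplicity.

(** * Generic points and curves of degree delta *)

Section Generic.
Variables (k : fieldType) (n : nat).
Implicit Types (P : set 'rV[k]_n) (R : 'rV[k]_n -> Prop).

Definition gen P R : Prop := exists d q,
  [/\ polyfun d q, nz P q & forall x, P x -> q x != 0 -> R x].

Lemma gen_nz P d q : polyfun d q -> nz P q -> gen P (fun x => q x != 0).
Proof. by move=> pq nq; exists d, q. Qed.

Lemma gen_imp P R R' : (forall x, P x -> R x -> R' x) -> gen P R -> gen P R'.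
Proof. by move=> RR [d [q [pq nq H]]]; exists d, q; split=> // x Px /(H x Px); apply: RR. Qed.

Lemma gen_and P R R' : irr P -> gen P R -> gen P R' -> gen P (fun x => R x /\ R' x).
Proof.
move=> iP [d [q [pq nq H]]] [d' [q' [pq' nq' H']]].
exists (d + d')%N, (fun x => q x * q' x); split; [exact: polyfunM|exact: (irr_nzM iP pq pq')|].
by move=> x Px; rewrite mulf_eq0 negb_or => /andP [/(H x Px) Rx /(H' x Px)].
Qed.

Lemma gen_true P R : irr P -> (forall x, P x -> R x) -> gen P R.
Proof.
move=> [[x Px] _] H; exists 0%N, (fun=> 1).
by split=> [||y Py _]; [exact: polyfun_const|exists x; rewrite ?oner_eq0|exact: H].
Qed.

Lemma gen_all P m (R : 'I_m -> 'rV[k]_n -> Prop) : irr P -> (forall i, gen P (R i)) ->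
  gen P (fun x => forall i, R i x).
Proof.
move=> iP H; elim: m R H => [|m IHm] R H; first by apply: gen_true => // x _ [].
apply: gen_imp (gen_and iP (H ord0) (IHm (fun i => R (lift ord0 i)) (fun i => H _))).
by move=> x _ [R0 Rl] i; case: (unliftP ord0 i) => [j ->|->].
Qed.

Lemma gen_ex P R : gen P R -> exists2 x, P x & R x.
Proof. by move=> [d [q [_ [x Px qx] H]]]; exists x => //; apply: H. Qed.
End Generic.

Lemma irr_setT (k : fieldType) n : [pchar k] =i pred0 -> irr [set: 'rV[k]_n].
Proof.
move=> char0; split=> [|d e f g [F _ fE] [H _ gE] fg]; first by exists 0.
have FH v : F.@[v] * H.@[v] = 0.
  have E : v =1 (\row_i v i) 0 by move=> i; rewrite mxE.
  by rewrite (meval_eq F E) (meval_eq H E) -fE -gE fg.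
have [F0|F0] := eqVneq F 0; first by left=> v _; rewrite fE F0 meval0.
right=> v _; rewrite gE; suff -> : H = 0 by rewrite meval0.
apply/eqP; apply/negPn/negP => H0.
have [u] := mpoly_nonroot char0 (mulf_neq0 F0 H0).
by rewrite mevalM FH eqxx.
Qed.

Section Lines.
Variables (k : fieldType) (n : nat).
Implicit Types (p q u w : 'rV[k]_n).

Lemma sep_lin p q : p != 0 -> (forall c, q != c *: p) -> exists s, lin s p = 0 /\ lin s q != 0.
Proof.
move=> p0 H; have /existsP [i pi0] : [exists i, p 0 i != 0].
  apply: contraNT p0; rewrite negb_exists => /forallP p0.
  by apply/eqP/rowP => i; rewrite mxE; apply/eqP; have := p0 i; rewrite negbK.
have /existsP [j pj] : [exists j, q 0 j * p 0 i - q 0 i * p 0 j != 0].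
  apply: contraNT (H (q 0 i / p 0 i)); rewrite negb_exists => /forallP E.
  apply/eqP/rowP => j; rewrite mxE; apply/(mulIf pi0); rewrite mulrAC divfK //.
  by apply/eqP; rewrite -subr_eq0; have := E j; rewrite negbK.
exists (p 0 i *: delta_mx 0 j - p 0 j *: delta_mx 0 i).
rewrite !linBl !linZl !lin_delta; split; first by rewrite mulrC subrr.
by rewrite mulrC [p 0 j * _]mulrC.
Qed.

Lemma lin_nz u : u != 0 -> nz setT (lin u).
Proof.
move=> u0; apply: contrapT => /nzPn H; move/eqP: u0; apply; apply/rowP => i.
by rewrite mxE -[RHS](H (delta_mx 0 i)) // linC lin_delta.
Qed.
End Lines.

Lemma const_of_poly (k : closedFieldType) n (Q : set 'rV[k]_n) u w (p : {poly k}) :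
  irr Q -> nz Q (lin w) -> p != 0 ->
  (forall v, Q v -> lin w v != 0 -> p.[lin u v / lin w v] = 0) ->
  exists c, forall v, Q v -> lin u v = c * lin w v.
Proof.
move=> iQ nw p0 H; apply: contrapT => nc; have [G _] := genf_exists iQ.
have tr : transcendental (iota G) (rat G u w).
  apply: nonconst_transc => // c; apply: contrapT => nQ; apply: nc; exists c => v Qv.
  by apply/eqP; apply: contrapT => /negP E; apply: nQ; exists v.
have := tr p p0; rewrite -ge_horner.
rewrite (ge_eq_on G (polyfun_lin w) nw (g := fun=> 0)) ?ge0 ?eqxx //.
Qed.

(** * The rank bound for curves of degree delta *)

Section Curve.
Variable k : closedFieldType.
Hypothesis char0 : [pchar k] =i pred0.
Variables (N : nat) (C : set (proj k N)) (delta : nat).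
Hypothesis cC : irreducible_curve C delta.
Let Q := cone C.

Let iQ : irr Q. Proof. by case: cC => -[_ /irr_cone]. Qed.
Let cQ : ccl Q. Proof. by case: cC => -[/closed_ccl]. Qed.
Let tQ : tdle Q 1 fullv. Proof. by case: cC => pC [_ nch] _; apply: no_chain_tdle. Qed.

Lemma curve_two_points : exists p q, [/\ Q p, Q q & forall c, q != c *: p].
Proof.
case: cC => _ [[Z [Z1 Z2]] _] _.
have [[_ [[x Zx] _]] sZ0] := Z1 0%N isT; have [_ sZ1] := Z1 1%N isT.
have [_ nZ] := Z2 0%N isT.
have [y Z1y nZ0y] : exists2 y, Z 1%N y & ~ Z 0%N y.
  apply: contrapT => H; apply: nZ => y Zy; apply: contrapT => nZ0; apply: H; by exists y.
have [p p0 xE] := proj_rep x; have [q q0 yE] := proj_rep y.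
exists p, q; split; [by apply/(coneP _ xE)/sZ0|by apply/(coneP _ yE)/sZ1|].
move=> c; apply: contra_not_neq nZ0y => qE.
have c0 : c != 0 by apply: contraNneq q0 => c0; rewrite qE c0 scale0r.
by suff -> : y = x by []; apply/val_inj; rewrite xE yE qE vlineZ.
Qed.

Lemma hyperplane_count (B : set (proj k N)) D z (p : 'I_D -> 'rV[k]_N.+1) :
  (forall a, ~ B a -> (C `&` hyperplane a #= `I_delta)%card) -> z != 0 -> ~ cone B z ->
  (forall i, Q (p i) /\ lin z (p i) = 0) ->
  (forall i j c, i != j -> p i != c *: p j) -> (D <= delta)%N.
Proof.
move=> HB z0 nB Hp sep.
have p0 i : p i != 0 by case: (Hp i) => /cone_neq0.
pose a := mkpt z0; have := HB a; rewrite card_eq_le => /(_ _) /andP [|le_d _].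
  by move=> /(cone_mkpt _ z0).
have [->//|D0] := posnP D; pose i0 := Ordinal D0.
pose f (j : nat) := mkpt (p0 (insubd i0 j)).
have Hf : {in `I_D &, injective f}.
  move=> j l; rewrite !inE /= => jD lD /(congr1 val) /= /(vline_eq (p0 _)) [c c0 E].
  apply/eqP; apply/negPn/negP => jl.
  have jl' : insubd i0 j != insubd i0 l by rewrite -val_eqE /= !val_insubd jD lD.
  by have := sep _ _ c jl'; rewrite E eqxx.
have sub : [set f j | j in `I_D] `<=` C `&` hyperplane a.
  move=> _ [j jD <-]; have [Qp zp] := Hp (insubd i0 j); split; first by apply/cone_mkpt.
  move=> u v /= /(vline_eq z0) [c c0 zE] /(vline_eq (p0 _)) [d d0 pE].
  apply/matrixP => r s; rewrite !ord1 [RHS]mxE mxE.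
  transitivity (lin u v); first by apply: eq_bigr => l _; rewrite [_^T _ _]mxE.
  move/eqP: zp; rewrite zE pE linZl linZr !mulf_eq0 (negbTE c0) (negbTE d0) /=.
  by move/eqP.
rewrite -card_le_II; apply: card_le_trans le_d.
have := inj_card_eq Hf; rewrite card_eq_le => /andP [_ H].
exact: card_le_trans H (subset_card_le sub).
Qed.

Section DEG.
Variables (B : set (proj k N)) (d : nat) (h : 'rV[k]_N.+1 -> k).
Hypothesis HB : forall a, ~ B a -> (C `&` hyperplane a #= `I_delta)%card.
Hypotheses (ph : polyfun d h) (hB : forall v, cone B v -> h v = 0).

(** One member of the pencil of u and w lies off the exceptional locus, hence so does a general
    member [u - c *: w]. The D points of the fibre over c lie on it, so the degree bounds D. *)
Lemma curve_DEGat_gen u w c' : nz Q (lin w) ->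
  (forall c, exists2 v, Q v & lin u v != c * lin w v) -> h (u + c' *: w) != 0 ->
  DEGat Q fullv delta u w.
Proof.
move=> nw nc hc'; have [G _] := genf_exists iQ.
have [D [[b b0 Hb] Hdep]] := fib_points G char0 iQ cQ tQ nw nw (memvf u) (memvf w) nc.
suff le_D : (D <= delta)%N by move=> a Aa; apply: Hdep.
have [r rE] := polyfun_line u w ph.
have rr0 : r \Po (- 'X) != 0.
  apply: contraNneq hc' => r0; have := horner_comp r (- 'X) (- c').
  by rewrite r0 horner0 hornerN hornerX opprK -rE => <-.
have [c] := poly_nonroot char0 (mulf_neq0 b0 rr0); rewrite hornerM mulf_eq0 negb_or.
rewrite horner_comp hornerN hornerX rE scaleNr => /andP [/Hb [p [Qp wp up _ sep]] hz].
have z0 : u - c *: w != 0.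
  have [v _] := nc c; apply: contraNneq => /eqP; rewrite subr_eq0 => /eqP ->.
  by rewrite linZl.
apply: (hyperplane_count HB z0 (p := p)).
- by move=> /hB /eqP; rewrite (negbTE hz).
- by move=> i; split; [exact: Qp|rewrite linBl linZl up wp mulr1 subrr].
- move=> i j e ij; apply/eqP => E; have := wp i; rewrite E linZr wp mulr1 => e1.
  by have [l _] := sep i j ij; rewrite E e1 scale1r eqxx.
Qed.
End DEG.

(** For constant u/w the coefficient ['X - c] already annihilates every function. *)
Lemma DEGat_const n (P : set 'rV[k]_n) V u w c : (forall v, P v -> lin u v = c * lin w v) ->
  DEGat P V delta u w.
Proof.
move=> uw a _; exists (fun i => if i == ord0 then 'X - c%:P else 0).
  by exists ord0; rewrite eqxx polyXsubC_eq0.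
move=> v Pv wv; rewrite (bigD1 ord0) //= big1 ?addr0 => [|i /negbTE ->].
  by rewrite hornerXsubC uw // mulfK // subrr mul0r.
by rewrite horner0 mul0r.
Qed.

(** A pencil may consist entirely of exceptional hyperplanes. Therefore a member z through the D
    points of a fibre is paired with a form w off the exceptional locus and nonzero at these points:
    the bound holds for z and w, and it limits the number of zeros of z. *)
Lemma curve_DEG : DEG Q fullv delta.
Proof.
case: (cC) => _ _ [B [clB BT HB]].
have [h [d [ph [hB [v0 hv0]]]]] : exists h d, polyfun d h /\
    (forall v, cone B v -> h v = 0) /\ exists v, h v != 0.
  have [a nBa] : exists a, ~ B a.
    by apply: contrapT => H; apply: BT; apply/seteqP; split=> a // _; apply: contrapT => ?; apply: H; exists a.
  have [v v0 aE] := proj_rep a.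
  have nBv : ~ cone B v by move/(coneP _ aE).
  by have [d [h [ph hB hv]]] := closed_sep clB v0 nBv; exists h, d; split=> //; split=> //; exists v.
move=> u1 w1 _ _ nw1.
have [[c cE]|nc] := pselect (exists c, forall v, Q v -> lin u1 v = c * lin w1 v).
  exact: DEGat_const cE.
have {}nc c : exists2 v, Q v & lin u1 v != c * lin w1 v.
  apply: contrapT => H; apply: nc; exists c => v Qv.
  by apply/eqP; apply: contrapT => /negP E; apply: H; exists v.
have [G _] := genf_exists iQ.
have [D [[b b0 Hb] Hdep]] := fib_points G char0 iQ cQ tQ nw1 nw1 (memvf u1) (memvf w1) nc.
suff le_D : (D <= delta)%N by move=> a Aa; apply: Hdep.
have [->//|D0] := posnP D; pose i0 := Ordinal D0.
have [c /Hb [p [Qp wp up _ sep]]] := poly_nonroot char0 b0.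
pose z := u1 - c *: w1.
have zp i : lin z (p i) = 0 by rewrite /z linBl linZl up wp mulr1 subrr.
have nz_z : nz Q (lin z).
  by have [v Qv E] := nc c; exists v => //; rewrite /z linBl linZl subr_eq0.
have [w _ [hw wpi]] : exists2 w, [set: 'rV[k]_N.+1] w &
    h w != 0 /\ forall i, lin w (p i) != 0.
  apply: gen_ex; apply: gen_and; [exact: irr_setT|by apply: (gen_nz ph); exists v0|].
  apply: gen_all; first exact: irr_setT.
  move=> i; apply: gen_imp (gen_nz (polyfun_lin (p i)) (lin_nz (cone_neq0 (Qp i)))).
  by move=> x _; rewrite linC.
have nw : nz Q (lin w) by exists (p i0).
have ncz e : exists2 v, Q v & lin z v != e * lin w v.
  have [->|e0] := eqVneq e 0; first by case: nz_z => v Qv zv; exists v; rewrite ?mul0r.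
  by exists (p i0) => //; rewrite zp eq_sym mulf_neq0.
have [r rE] := polyfun_line w z ph.
have [c' c'0 rc'] : exists2 c', c' != 0 & r.[c'] != 0.
  have r0 : r * 'X != 0.
    rewrite mulf_neq0 ?polyX_eq0 //; apply: contraNneq hw => r0.
    by rewrite -[w]addr0 -(scale0r z) -rE r0 horner0.
  have [c'] := poly_nonroot char0 r0.
  by rewrite hornerM hornerX mulf_eq0 negb_or => /andP [? ?]; exists c'.
have dz : DEGat Q fullv delta z w.
  apply: (curve_DEGat_gen HB ph hB nw ncz (c' := c'^-1)).
  have -> : z + c'^-1 *: w = c'^-1 *: (w + c' *: z).
    by rewrite scalerDr scalerA mulVf // scale1r addrC.
  by rewrite (polyfun_scale _ _ ph) -rE mulf_neq0 // expf_neq0 // invr_eq0.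
(* With contact 0 the base point plays no part beyond w being nonzero there, and the bound says that
   z has at most delta zeros on the curve. *)
apply: (mult_bound (kappa := 0) iQ dz (Qp i0) (wpi i0) (memvf z) nz_z (p := p)) => //.
- by apply: Aw_lin; exact: memvf.
- move=> i j ij; have [|s [sj si]] := @sep_lin _ _ (p j) (p i) (cone_neq0 (Qp j)).
    move=> e; apply/eqP => E; have := wp i; rewrite E linZr wp mulr1 => e1.
    by have [l _] := sep i j ij; rewrite E e1 scale1r eqxx.
  by exists s => //; exact: memvf.
Qed.
End Curve.

(** * Covering curves in terms of cones *)

Section Covering.
Variable k : closedFieldType.
Hypothesis char0 : [pchar k] =i pred0.

(** All that the induction remembers of a covering curve. *)
Definition goodcurve n (P Q : set 'rV[k]_n) delta x y : Prop :=
  [/\ irr Q, Q `<=` P, Q x, Q y & DEG Q fullv delta].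

Lemma bihom_eval M N (f : {mpoly k[M.+1 + N.+1]}) : bihomogeneous f ->
  (forall u, exists b, polyfun b (fun v : 'rV[k]_N.+1 => f.@[(row_mx u v) 0])) /\
  (forall v, exists a, polyfun a (fun u : 'rV[k]_M.+1 => f.@[(row_mx u v) 0])).
Proof.
move=> [a [b fab]].
have fE u v : f.@[(row_mx u v) 0] = \sum_(m <- msupp f | m \in msupp f) f@_m *
   ((\prod_i u 0 i ^+ m (lshift N.+1 i)) * \prod_j v 0 j ^+ m (rshift M.+1 j)).
  rewrite mevalE [LHS]big_seq; apply: eq_bigr => m _; rewrite big_split_ord /=.
  by congr (_ * (_ * _)); apply: eq_bigr => i _; rewrite ?row_mxEl ?row_mxEr.
split=> [u|v]; [exists b|exists a].
  apply: (polyfun_ext (f := fun v => \sum_(m <- msupp f | m \in msupp f) f@_m *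
   ((\prod_i u 0 i ^+ m (lshift N.+1 i)) * \prod_j v 0 j ^+ m (rshift M.+1 j)))) => //.
  apply: polyfun_sum => m mf; apply: polyfunZ; apply: polyfunZ; have [_ <-] := fab m mf.
  apply: polyfun_prod => j _; have H := @polyfunX k _ 1 (m (rshift M.+1 j)) _ (@polyfun_var k N.+1 j).
  by rewrite mul1n in H.
apply: (polyfun_ext (f := fun u => \sum_(m <- msupp f | m \in msupp f) f@_m *
   ((\prod_j v 0 j ^+ m (rshift M.+1 j)) * \prod_i u 0 i ^+ m (lshift N.+1 i)))).
  by move=> u; rewrite fE; apply: eq_bigr => m _; rewrite [X in _ * X]mulrC.
apply: polyfun_sum => m mf; apply: polyfunZ; apply: polyfunZ; have [<- _] := fab m mf.
apply: polyfun_prod => j _; have H := @polyfunX k _ 1 (m (lshift N.+1 j)) _ (@polyfun_var k M.+1 j).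
by rewrite mul1n in H.
Qed.

(** An open subset of X x X is replaced by nested genericity. Choose a bihomogeneous f nonzero at
    (u0, v0): with v0 fixed it restricts x, and then with x fixed it restricts y. *)
Lemma two_covered_gen N (X : set (proj k N)) delta Sigma : two_covered X delta Sigma ->
  gen (cone X) (fun x => gen (cone X) (fun y => exists Q, goodcurve (cone X) Q delta x y)).
Proof.
move=> [_ HS [W [[S [bS ->]] nW cov]]].
have [[x0 y0] [[Xx0 Xy0]]] : exists p, (X `*` X) p /\ ~ forall f, S f -> forall u v,
    val p.1 = <[u]>%VS -> val p.2 = <[v]>%VS -> f.@[(row_mx u v) 0] = 0.
  by apply: contrapT => H; apply: nW => p Xp f Sf u v pu pv; apply: contrapT => E; apply: H; exists p; split=> // /(_ f Sf u v pu pv).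
move=> /existsNP [f /not_implyP [Sf /existsNP [u0 /existsNP [v0 /not_implyP [uE /not_implyP [vE /eqP fuv]]]]]].
have [Hb Ha] := bihom_eval (bS f Sf).
have [a pa] := Ha v0; exists a, (fun u => f.@[(row_mx u v0) 0]); split=> //.
  by exists u0 => //; apply/(coneP _ uE).
move=> x [x1 Xx1 xE] fx; have [b pb] := Hb x.
exists b, (fun v => f.@[(row_mx x v) 0]); split=> //.
  by exists v0 => //; apply/(coneP _ vE).
move=> y [y1 Xy1 yE] fxy.
have [|C [SC Cx Cy]] := cov x1 y1 Xx1 Xy1.
  by move=> /(_ f Sf x y xE yE) /eqP; rewrite (negbTE fxy).
have [cC sC] := HS C SC; exists (cone C); split.
- by case: cC => -[_ /irr_cone].
- by apply/cone_subset.
- by apply/(coneP _ xE).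
- by apply/(coneP _ yE).
- exact: curve_DEG.
Qed.
End Covering.

(** A subspace of largest dimension among those contained in S is all of S; a predicate thus becomes
    an object with a dimension. *)
Lemma vspace_of_closed (k : fieldType) (E : vectType k) (S : E -> Prop) :
  S 0 -> (forall a u v, S u -> S v -> S (a *: u + v)) ->
  exists U : {vspace E}, forall u, u \in U <-> S u.
Proof.
move=> S0 SD; pose D d := `[< exists2 U : {vspace E}, \dim U = d & forall u, u \in U -> S u >].
have D0 : exists d, D d.
  by exists 0%N; apply/asboolP; exists 0%VS; [rewrite dimv0|move=> u; rewrite memv0 => /eqP ->].
have Dmax d : D d -> (d <= \dim (@fullv k E))%N.
  by move=> /asboolP [U <- _]; rewrite dimvS ?subvf.
case: (ex_maxnP D0 Dmax) => d /asboolP [U Ud US] dmax.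
exists U => u; split=> [/US //|Su].
have /dmax : D (\dim (U + <[u]>)%VS).
  apply/asboolP; exists (U + <[u]>)%VS => // x /memv_addP [y yU [_ /vlineP [c ->] ->]].
  by rewrite addrC; apply: SD => //; exact: US.
rewrite -Ud => le_d; have /eqP -> : U == (U + <[u]>)%VS.
  by rewrite eqEdim addvSl.
by apply: (subvP (addvSr U <[u]>)); exact: memv_line.
Qed.

(** * Osculating systems *)

Section Osculating.
Variables (k : fieldType) (n : nat) (P : set 'rV[k]_n) (V : {vspace 'rV[k]_n}).

Lemma osc_exists w x i : exists U : {vspace 'rV[k]_n}, forall u,
  u \in U <-> u \in V /\ Mk P V w x i (fun v => lin u v / lin w v).
Proof.
apply: vspace_of_closed => [|a u v [uV Mu] [vV Mv]].
  by split; [exact: mem0v|apply: Mk_ext (Mk0 _ _ _ _ _) _ => v _ _; rewrite lin0l mul0r].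
split; first by rewrite memvD // memvZ.
by apply: Mk_ext (MkD (MkZ a Mu) Mv) _ => z _ _; rewrite linDl linZl mulrDl mulrA.
Qed.

(* sections of V vanishing to order i at x on P; meaningful when w x <> 0 *)
Definition osc w x i : {vspace 'rV[k]_n} := projT1 (cid (osc_exists w x i)).

Lemma mem_osc w x i u :
  u \in osc w x i <-> u \in V /\ Mk P V w x i (fun v => lin u v / lin w v).
Proof. exact: (projT2 (cid (osc_exists w x i))). Qed.

Lemma osc_sub w x i : (osc w x i <= V)%VS.
Proof. by apply/subvP => u /mem_osc []. Qed.

Lemma osc_x w x i u : P x -> lin w x != 0 -> u \in osc w x i.+1 -> lin u x = 0.
Proof.
move=> Px wx /mem_osc [_ /(Mk_x Px wx) /eqP]; rewrite mulf_eq0 invr_eq0 (negbTE wx) orbF.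
by move/eqP.
Qed.
End Osculating.

(** * First-order expansions at a general point *)

Section Taylor.
Variables (k : fieldType) (n : nat) (P : set 'rV[k]_n) (V : {vspace 'rV[k]_n}).
Variables (w x : 'rV[k]_n).

(** The polynomials that have such an expansion include constants and variables and are stable under
    sums and products; for a product, the extra error is a product of two elements of the maximal
    ideal. *)
Lemma taylor m (F : {mpoly k[m]}) (f : 'I_m -> 'rV[k]_n -> k) :
  P x -> lin w x != 0 -> (forall i, Aw P V w (f i)) ->
  Mk P V w x 2 (fun v => F.@[f^~ v] - F.@[f^~ x] -
     \sum_i (F^`M(i)).@[f^~ x] * (f i v - f i x)).
Proof.
move=> Px wx Af.
pose L (F : {mpoly k[m]}) v := \sum_i (F^`M(i)).@[f^~ x] * (f i v - f i x).
pose T (F : {mpoly k[m]}) := Mk P V w x 2 (fun v => F.@[f^~ v] - F.@[f^~ x] - L F v).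
have ML (F' : {mpoly k[m]}) : Mk P V w x 1 (L F').
  by apply: Mk_sum => i _; apply: MkZ; exact: Aw_x.
have TC c : T c%:MP.
  apply: Mk_ext (Mk0 _ _ _ _ _) _ => v _ _; rewrite !mevalC subrr /L big1 ?subrr // => i _.
  by rewrite mderivC meval0 mul0r.
have TD F1 F2 : T F1 -> T F2 -> T (F1 + F2).
  move=> T1 T2; apply: Mk_ext (MkD T1 T2) _ => v _ _.
  rewrite /L !mevalD; under [X in _ = _ - X]eq_bigr => i _ do rewrite mderivD mevalD mulrDl.
  by rewrite big_split /=; ring.
have TM F1 F2 : T F1 -> T F2 -> T (F1 * F2).
  move=> T1 T2.
  have AF : Aw P V w (fun v => F2.@[f^~ v]) by apply: Aw_mpoly.
  have AL : Aw P V w (fun v => F1.@[f^~ x] + L F1 v).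
    by apply: AwD; [exact: Aw_const|exact: Mk_Aw (ML F1)].
  apply: Mk_ext (MkD (MkM (ML F1) (ML F2)) (MkD (MkA AF T1) (MkA AL T2))) _ => v _ _.
  have -> : L (F1 * F2) v = F2.@[f^~ x] * L F1 v + F1.@[f^~ x] * L F2 v.
    rewrite /L !mulr_sumr -big_split; apply: eq_bigr => i _ /=.
    rewrite mderivM mevalD !mevalM mulrDl mulrA; congr (_ + _); last by rewrite mulrA.
    by rewrite [F2.@[_] * _]mulrC.
  rewrite !mevalM; move: (L F1 v) (L F2 v) (F1.@[f^~ v]) (F2.@[f^~ v]) (F1.@[f^~ x]) (F2.@[f^~ x]).
  by move=> a b c d e g; ring.
have TX i : T 'X_i.
  apply: Mk_ext (Mk0 _ _ _ _ _) _ => v _ _; rewrite !mevalXU /L (bigD1 i) //= big1 => [|j ji].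
    by rewrite mderivX mnm1E eqxx scale1r mevalX big1 ?mul1r ?addr0 ?subrr // => j _; rewrite mnmBE subnn expr0.
  by rewrite mderivX mnm1E eq_sym (negbTE ji) scale0r meval0 mul0r.
rewrite -/(T F); elim/mpolyind: F => [|c M p _ _ Tp]; first by rewrite -mpolyC0; exact: TC.
apply: (TD) => //; rewrite -mul_mpolyC; apply: (TM); first exact: TC.
rewrite mpolyXE_id; elim/big_ind: _ => [||i _]; [by rewrite -mpolyC1; exact: TC|exact: TM|].
by elim: (M i) => [|e IHe]; [rewrite expr0 -mpolyC1; exact: TC|rewrite exprS; exact: TM].
Qed.
End Taylor.

Section Cotangent.
Variables (k : closedFieldType) (n : nat) (P : set 'rV[k]_n).
Hypotheses (char0 : [pchar k] =i pred0) (iP : irr P).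

Lemma form_of_polyfun m d (f : 'rV[k]_m -> k) : polyfun d f ->
  exists2 F : {mpoly k[m]}, F \is d.-homog & forall s, F.@[s] = f (\row_i s i).
Proof.
move=> [F Fd FE]; exists F => // s; rewrite FE; apply: meval_eq => i; by rewrite mxE.
Qed.

Lemma mpoly_eq m (F G : {mpoly k[m]}) : (forall s, F.@[s] = G.@[s]) -> F = G.
Proof.
move=> FG; apply/eqP; rewrite -subr_eq0; apply/negPn/negP => /(mpoly_nonroot char0) [s].
by rewrite mevalB FG subrr eqxx.
Qed.

Lemma indep1 (w : 'rV[k]_n) : nz P (lin w) -> indep P (fun _ : 'I_1 => w).
Proof.
move=> [v Pv wv] e F Fe F0; exists v => //.
have [s Fs] := mpoly_nonroot char0 F0.
have E : F.@[s] = (s ord0 / lin w v) ^+ e * F.@[fun=> lin w v].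
  rewrite -(homog_scale _ _ Fe); apply: meval_eq => j.
  by rewrite ord1 divfK.
by apply: contraNneq Fs => F0'; rewrite E F0' mulr0.
Qed.

(** In characteristic 0 a polynomial whose derivative in the first variable is 0 does not involve
    that variable, so F is really a form in the independent us. *)
Lemma indep_restrict l (us : 'I_l -> 'rV[k]_n) e (F : {mpoly k[l.+1]}) (f : 'rV[k]_n -> k) :
  indep P us -> F \is e.-homog -> F != 0 -> F^`M(ord0) = 0 ->
  nz P (fun v => F.@[cons0 (f v) (fun j => lin (us j) v)]).
Proof.
move=> ind Fe F0 dF.
have sup M : M \in msupp F -> M ord0 = 0%N.
  case E: (M ord0) => [//|j]; rewrite mcoeff_msupp.
  have := mcoeff_deriv ord0 (M - U_(ord0))%MM F; rewrite dF mcoeff0.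
  have -> : ((M - U_(ord0) + U_(ord0)) = M)%MM.
    apply/mnmP => i; rewrite mnmDE mnmBE mnm1E; case: eqP => [<-|_]; first by rewrite E subn1 addn1.
    by rewrite subn0 addn0.
  move/esym/eqP; rewrite -mulr_natr mulf_eq0 => /orP [->//|].
  by move/eqP/(@natr_inj0 _ char0 _ 0%N).
have F0E t s : F.@[cons0 t (fun j => s (lift ord0 j))] = F.@[s].
  rewrite !mevalE; apply: eq_big_seq => M /sup M0; congr (_ * _); apply: eq_bigr => i _.
  by case: (unliftP ord0 i) => [j ->|->]; rewrite ?cons0S // M0 !expr0.
have pf : polyfun e (fun s : 'rV[k]_l => F.@[cons0 0 (s 0)]).
  rewrite -[e]muln1; apply: (polyfun_comp (f := fun i (s : 'rV[k]_l) => cons0 0 (s 0) i) Fe) => i.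
  rewrite /cons0; case: (unlift ord0 i) => [j|]; [exact: polyfun_var|exact: polyfun0].
have [H He HE] := form_of_polyfun pf.
have H0 : H != 0.
  have [s Fs] := mpoly_nonroot char0 F0; apply: contraNneq Fs => H0.
  rewrite -(F0E 0); have := HE (fun j => s (lift ord0 j)); rewrite H0 meval0 => E; apply/eqP.
  rewrite E; apply: meval_eq => i; rewrite /cons0; case: (unlift ord0 i) => [j|] //; by rewrite mxE.
have [v Pv Hv] := ind e H He H0; exists v => //.
have := F0E (f v) (cons0 0 (fun j => lin (us j) v)).
rewrite (meval_eq (v1 := cons0 (f v) _) (v2 := cons0 (f v) (fun j => lin (us j) v))) => [->|i]; last first.
  by rewrite /cons0; case: (unlift ord0 i) => // j; rewrite liftK.
move: Hv; rewrite HE.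
congr (_ != 0); apply: meval_eq => i; rewrite /cons0; case: (unlift ord0 i) => [j|] //; by rewrite mxE.
Qed.

Variables (m : nat) (V : {vspace 'rV[k]_n}) (w : 'rV[k]_n).
Hypotheses (tV : tdle P m V) (wV : w \in V) (nw : nz P (lin w)).

(** A maximal independent family is chosen among those containing w. Since the local function of w
    is 0, the l + 1 forms provide l <= m local parameters. *)
Lemma transcendence_basis : exists l (us : 'I_l.+1 -> 'rV[k]_n),
  [/\ (l <= m)%N, forall j, us j \in V, exists j0, us j0 = w, indep P us &
      forall u, u \in V -> exists e (F : {mpoly k[l.+2]}), [/\ F \is e.-homog, F != 0 &
        forall v, P v -> F.@[cons0 (lin u v) (fun j => lin (us j) v)] = 0]].
Proof.
pose D l := `[< (l <= m)%N /\ exists us : 'I_l.+1 -> 'rV[k]_n,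
  [/\ forall j, us j \in V, exists j0, us j0 = w & indep P us] >].
have D0 : exists l, D l.
  exists 0%N; apply/asboolP; split=> //; exists (fun=> w).
  by split=> //; [exists ord0|exact: indep1].
have Dm l : D l -> (l <= m)%N by move=> /asboolP [].
case: (ex_maxnP D0 Dm) => l /asboolP [le_lm [us [usV [j0 us0] ind]]] lmax.
exists l, us; split=> //; first by exists j0.
move=> u uV; apply: contrapT => H.
have ind' : indep P (cons0 u us).
  move=> e F Fe F0; apply: contrapT => /nzPn E; apply: H; exists e, F; split=> // v Pv.
  rewrite -[RHS](E v Pv); apply: meval_eq => i; rewrite /cons0.
  by case: (unlift ord0 i).
have VE j : cons0 u us j \in V by rewrite /cons0; case: (unlift ord0 j).
have [lt_lm|le_ml] := ltnP l m.
  suff /lmax : D l.+1 by rewrite ltnn.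
  apply/asboolP; split=> //; exists (cons0 u us); split=> //.
  by exists (lift ord0 j0); rewrite cons0S.
have El : l = m by apply/eqP; rewrite eqn_leq le_lm.
subst l; have [e [F [Fe F0 FE]]] := tV VE.
by have [v Pv] := ind' e F Fe F0; rewrite FE // eqxx.
Qed.

Definition loc (w x u v : 'rV[k]_n) : k := lin u v / lin w v - lin u x / lin w x.

Lemma dhomog_deriv l e (F : {mpoly k[l]}) i : F \is e.-homog -> F^`M(i) \is e.-1.-homog.
Proof.
move=> Fe; apply/dhomogP => M; rewrite mcoeff_msupp mcoeff_deriv => H.
have : F@_(M + U_(i)) != 0 by apply: contraNneq H => ->; rewrite mul0rn.
rewrite -mcoeff_msupp => /(dhomogP _ _ _ Fe) /= <-.
by rewrite mdegD mdeg1 addn1.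
Qed.

(* away from the zeros of the derivative of a relation of minimal degree, u is
   a combination of the transcendence basis to second order *)
Lemma cotangent_elt l (us : 'I_l.+1 -> 'rV[k]_n) u : indep P us -> (forall j, us j \in V) ->
  u \in V ->
  (exists e (F : {mpoly k[l.+2]}), [/\ F \is e.-homog, F != 0 &
        forall v, P v -> F.@[cons0 (lin u v) (fun j => lin (us j) v)] = 0]) ->
  gen P (fun x => lin w x != 0 -> exists c : 'I_l.+1 -> k,
    Mk P V w x 2 (fun v => loc w x u v - \sum_j c j * loc w x (us j) v)).
Proof.
move=> ind usV uV rel.
pose D e := `[< exists F : {mpoly k[l.+2]}, [/\ F \is e.-homog, F != 0 &
        forall v, P v -> F.@[cons0 (lin u v) (fun j => lin (us j) v)] = 0] >].
have D0 : exists e, D e by case: rel => e H; exists e; apply/asboolP.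
case: (ex_minnP D0) => e /asboolP [F [Fe F0 FE]] emin.
pose val v : 'I_l.+2 -> k := cons0 (lin u v) (fun j => lin (us j) v).
have FE' v : P v -> F.@[val v] = 0 by exact: FE.
pose G := F^`M(ord0); have Ge : G \is e.-1.-homog by exact: dhomog_deriv.
have pG : polyfun e.-1 (fun v => G.@[val v]).
  apply: polyfun_ext (polyfun_lins (cons0 u us) Ge) => v; apply: meval_eq => i.
  by rewrite /val /cons0; case: (unlift ord0 i).
have nG : nz P (fun v => G.@[val v]).
  apply: contrapT => /nzPn G0.
  have e0 : (0 < e)%N.
    rewrite lt0n; apply/eqP => E; move: Fe; rewrite E => Fe0.
    have [s Fs] := mpoly_nonroot char0 F0; have [[v Pv] _] := iP.
    have /eqP := homog_scale 0 s Fe0; rewrite expr0 mul1r eq_sym.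
    rewrite (meval_eq (v1 := fun i => 0 * s i) (v2 := fun i => 0 * val v i)) => [|i]; last by rewrite !mul0r.
    by rewrite (homog_scale _ _ Fe0) expr0 mul1r FE' // (negbTE Fs).
  have [E|G0'] := eqVneq G 0.
    have [v Pv] := indep_restrict (lin u) ind Fe F0 E.
    by rewrite FE ?eqxx.
  suff /emin : D e.-1 by rewrite leqNgt prednK // leqnn.
  by apply/asboolP; exists G.
apply: gen_imp (gen_nz pG nG) => x Px Gx wx.
pose f i v : k := cons0 (lin u v / lin w v) (fun j => lin (us j) v / lin w v) i.
have Af i : Aw P V w (f i).
  by rewrite /f /cons0; case: (unlift ord0 i) => [j|]; apply: Aw_lin.
have fE v : f^~ v =1 (fun i => (lin w v)^-1 * val v i).
  by move=> i; rewrite /f /val /cons0; case: (unlift ord0 i) => [j|]; rewrite mulrC.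
have f0 H d v : H \is d.-homog -> H.@[f^~ v] = (lin w v)^-1 ^+ d * H.@[val v].
  by move=> Hd; rewrite (meval_eq _ (fE v)) (homog_scale _ _ Hd).
have a0 : G.@[f^~ x] != 0 by rewrite (f0 _ _ _ Ge) mulf_neq0 ?expf_neq0 ?invr_eq0.
exists (fun j => - (G.@[f^~ x])^-1 * (F^`M(lift ord0 j)).@[f^~ x]).
apply: Mk_ext (MkZ (- (G.@[f^~ x])^-1) (taylor F Px wx Af)) _ => v Pv wv.
rewrite !(f0 F _ _ Fe) !FE' // !mulr0 subr0 sub0r mulrNN big_ord_recl mulrDr.
rewrite -/G mulKf // {1 2}/f !cons00 /loc; congr (_ + _).
rewrite mulr_sumr -sumrN; apply: eq_bigr => j _.
by rewrite /f !cons0S !mulNr opprK mulrA.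
Qed.

(** Generic smoothness in the form needed for counting: to second order each member of V is a
    combination of the transcendence basis. The term of w vanishes, and the other l terms are padded
    with zeros to m. *)
Lemma cotangent : gen P (fun x => lin w x != 0 -> exists b : 'I_m -> 'rV[k]_n,
   forall u, u \in V -> exists c : 'I_m -> k,
     Mk P V w x 2 (fun v => loc w x u v - \sum_j c j * loc w x (b j) v)).
Proof.
have [l [us [le_lm usV [j0 usj0] ind rel]]] := transcendence_basis.
have vV (i : 'I_(\dim V)) : (vbasis V)`_i \in V by rewrite vbasis_mem // mem_nth // size_tuple.
have := gen_all iP (fun i => cotangent_elt ind usV (vV i) (rel _ (vV i))).
apply: gen_imp => x Px H wx.
have /choice [c cP] : forall i : 'I_(\dim V), exists c : 'I_l.+1 -> k,
  Mk P V w x 2 (fun v => loc w x (vbasis V)`_i v - \sum_j c j * loc w x (us j) v).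
  by move=> i; apply: H.
pose b (j : 'I_m) := if insub (val j) is Some j' then us (lift j0 j') else (0 : 'rV[k]_n).
exists b => u uV.
pose d j := \sum_i coord (vbasis V) i u * c i j.
exists (fun j => if insub (val j) is Some j' then d (lift j0 j') else 0).
apply: (@Mk_ext _ _ _ _ _ _ _ (fun v => \sum_i coord (vbasis V) i u *
  (loc w x (vbasis V)`_i v - \sum_j c i j * loc w x (us j) v))).
  by apply: Mk_sum => i _; apply: MkZ.
move=> v Pv wv; under eq_bigr => i _ do rewrite mulrBr mulr_sumr.
rewrite sumrB; congr (_ - _).
  rewrite /loc [in RHS](coord_vbasis uV) !lin_suml !mulr_suml -sumrB; apply: eq_bigr => i _.
  by rewrite !linZl mulrBr !mulrA.
rewrite exchange_big /= (bigD1 j0) //= [X in X + _]big1 ?add0r; last first.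
  by move=> i _; rewrite usj0 /loc !divff // subrr !mulr0.
transitivity (\sum_(j < l) d (lift j0 j) * loc w x (us (lift j0 j)) v).
  rewrite (reindex_omap (lift j0) (unlift j0)) /=; last first.
    by move=> i; case: unliftP => [j -> //|->]; rewrite eqxx.
  apply: eq_big => [j|j _]; first by rewrite liftK eqxx eq_sym neq_lift.
  by rewrite /d mulr_suml; apply: eq_bigr => i _; rewrite mulrA.
pose g (j : nat) := (if insub j is Some j' then d (lift j0 j') else 0) *
  loc w x (if insub j is Some j' then us (lift j0 j') else 0) v.
transitivity (\sum_(j < l) g j).
  by apply: eq_bigr => j _; rewrite /g (insubT (fun j => j < l)%N (ltn_ord j)) /=; congr (d (lift _ _) * loc _ _ (us (lift _ _)) _); exact/val_inj.
rewrite (big_ord_widen _ g le_lm) big_mkcond /=; apply: eq_bigr => j _; rewrite /g /b.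
by case: ifP => // nlt; rewrite insubN ?nlt ?mul0r.
Qed.
End Cotangent.

(** * Counting contact conditions *)

Section Count.
Variables (k : closedFieldType) (n : nat) (P : set 'rV[k]_n) (V : {vspace 'rV[k]_n}).
Variables (w x : 'rV[k]_n) (m : nat) (b : 'I_m -> 'rV[k]_n).
Hypotheses (Px : P x) (wx : lin w x != 0).
Hypothesis span_b : forall u, u \in V -> exists c : 'I_m -> k,
     Mk P V w x 2 (fun v => loc w x u v - \sum_j c j * loc w x (b j) v).

Let ev (H : {mpoly k[m.+1]}) v := H.@[cons0 1 (fun j => loc w x (b j) v)].

Let ev_sum (I : finType) (F : I -> {mpoly k[m.+1]}) v : ev (\sum_i F i) v = \sum_i ev (F i) v.
Proof. by rewrite /ev rmorph_sum. Qed.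

(** Induction on the contact: expand f along the generators [tc], replace each of these to second
    order by the m functions [loc w x (b j)], and each coefficient by its own leading form. *)
Lemma leading_form i f : Mk P V w x i f -> exists2 H, H \is i.-homog &
  Mk P V w x i.+1 (fun v => f v - ev H v).
Proof.
elim: i f => [|i IHi] f.
  move=> /Mk_Aw Af; exists (f x)%:MP; first by rewrite -[_%:MP]mulr1 mul_mpolyC dhomogZ ?dhomog1.
  apply: (@Mk_ext _ _ _ _ _ _ 1 (fun v => f v - f x)); first exact: Aw_x.
  by move=> v _ _; rewrite /ev mevalC.
move=> [g Mg fE]; have {}Mg j : Mk P V w x i (g j) by exact: Mg.
have /choice [H HP] : forall j, exists H, H \is i.-homog /\ Mk P V w x i.+1 (fun v => g j v - ev H v).
  by move=> j; have [H ? ?] := IHi _ (Mg j); exists H.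
have bV' (j : 'I_(\dim V)) : (vbasis V)`_j \in V by rewrite vbasis_mem // mem_nth // size_tuple.
have /choice [c cP] : forall j : 'I_(\dim V), exists c : 'I_m -> k,
     Mk P V w x 2 (fun v => tc w x j v - \sum_l c l * loc w x (b l) v).
  by move=> j; apply: span_b.
exists (\sum_j \sum_l c j l *: ('X_(lift ord0 l) * H j)).
  apply: rpred_sum => j _; apply: rpred_sum => l _; apply: rpredZ.
  by rewrite -(add1n i); apply: dhomogM; [rewrite dhomogX /= mdeg1|case: (HP j)].
have MH j : Mk P V w x i (ev (H j)).
  have [_ M] := HP j; apply: Mk_ext (MkB (Mg j) (MkS M)) _ => v _ _.
  by rewrite opprB addrC subrK.
have M1 j : Mk P V w x i.+2 (fun v => tc w x j v * (g j v - ev (H j) v)).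
  have [_ M] := HP j; rewrite -(add1n i.+1); apply: MkM M.
  by exists (fun l v => (l == j)%:R) => [l|v _ _]; [exact: Aw_const|rewrite (bigD1 j) //= eqxx mulr1 big1 ?addr0 // => l /negbTE ->; rewrite mulr0].
have M2 j := MkM (cP j) (MH j).
have M3 := Mk_sum (index_enum 'I_(\dim V)) (R := xpredT) (fun j _ => MkD (M1 j) (M2 j)).
apply: Mk_ext M3 _ => v Pv wv.
rewrite fE // ev_sum -sumrB; apply: eq_bigr => j _.
rewrite ev_sum /= mulrBr [X in _ + X]mulrBl addrA subrK mulr_suml; congr (_ - _); apply: eq_bigr => l _ /=.
by rewrite /ev mevalZ mevalM mevalXU cons0S mulrA.
Qed.

(** The extra variable, evaluated at 1, lets a single form of degree i collect the terms of all
    degrees up to i. *)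
Lemma leading_forms i f : Aw P V w f -> exists2 H, H \is i.-homog &
  Mk P V w x i.+1 (fun v => f v - ev H v).
Proof.
move=> Af; elim: i => [|i [H Hi M]]; first exact: leading_form.
have [H' Hi' M'] := leading_form M; exists ('X_ord0 * H + H').
  by apply: dhomogD => //; rewrite -(add1n i); apply: dhomogM => //; rewrite dhomogX /= mdeg1.
apply: Mk_ext M' _ => v _ _.
by rewrite /ev mevalD mevalM mevalXU cons00 mul1r opprD addrA.
Qed.

(** A complement of the osculating space embeds into the forms of degree i in m + 1 variables: a
    combination whose form is 0 has contact i + 1, so it lies in both spaces. *)
Lemma osc_dim i : (\dim V <= \dim (osc P V w x i.+1) + 'C(m + i, m))%N.
Proof.
set U := osc P V w x i.+1; have sUV : (U <= V)%VS by exact: osc_sub.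
rewrite -(dimv_cap_compl V U) (capv_idPr sUV) leq_add2l leqNgt; apply/negP => lt_C.
pose W := (V :\: U)%VS; pose s := \dim W.
have eW (j : 'I_s) : (vbasis W)`_j \in W by rewrite vbasis_mem // mem_nth // size_tuple.
have sWV : (W <= V)%VS by exact: diffvSl.
have /choice [H HP] : forall j : 'I_s, exists H, H \is i.-homog /\
    Mk P V w x i.+1 (fun v => lin (vbasis W)`_j v / lin w v - ev H v).
  move=> j; have [|H ? ?] := @leading_forms i (fun v => lin (vbasis W)`_j v / lin w v).
    by apply: Aw_lin; exact: (subvP sWV).
  by exists H.
pose ms := monomials m.+1 i; pose A : 'M[k]_(s, size ms) := \matrix_(j, l) (H j)@_(nth 0%MM ms l).
have : kermx A != 0.
  rewrite kermx_eq0 /row_free; apply: contraTneq lt_C => Er; rewrite -leqNgt -/s -Er.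
  by apply: leq_trans (rank_leq_col A) _; rewrite size_monomials prednK // bin_gt0 leq_addr.
move=> /rowV0Pn [c /sub_kermxP cA c0].
pose u := \sum_j c 0 j *: (vbasis W)`_j.
have uW : u \in W by apply: memv_suml => j _; apply: memvZ.
have HE : \sum_j c 0 j *: H j = 0.
  apply/mpolyP => M; rewrite mcoeff0; have [Mi|Mi] := boolP (mdeg M == i).
    rewrite -mem_monomials in Mi; have lt_M : (index M ms < size ms)%N by rewrite index_mem.
    move/matrixP: cA => /(_ 0 (Ordinal lt_M)); rewrite mxE [RHS]mxE => <-.
    rewrite raddf_sum; apply: eq_bigr => j _; by rewrite /= mcoeffZ mxE /= nth_index.
  apply: (@dhomog_nemf_coeff _ _ _ i) Mi.
  by apply: rpred_sum => j _; apply: rpredZ; case: (HP j).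
have uU : u \in U.
  apply/mem_osc; split; first exact: (subvP sWV).
  have M := Mk_sum (index_enum 'I_s) (R := xpredT) (fun j _ => MkZ (c 0 j) (proj2 (HP j))).
  apply: Mk_ext M _ => v _ _.
  under eq_bigr => j _ do rewrite mulrBr.
  rewrite sumrB [X in _ - X](_ : _ = ev (\sum_j c 0 j *: H j) v).
    by rewrite HE /ev meval0 subr0 lin_suml mulr_suml; apply: eq_bigr => j _; rewrite linZl mulrA.
  by rewrite ev_sum; apply: eq_bigr => j _; rewrite /ev mevalZ.
have : u \in (U :&: W)%VS by rewrite memv_cap uU.
rewrite capvC capv_diff memv0 => /eqP u0.
have /freeP fr := basis_free (vbasisP W); move/eqP: c0; apply; apply/rowP => j.
by rewrite mxE; apply: (fr (fun j => c 0 j)).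
Qed.
End Count.

Lemma DEG_sub (k : fieldType) n (Q : set 'rV[k]_n) (V V' : {vspace 'rV[k]_n}) delta :
  (V <= V')%VS -> DEG Q V' delta -> DEG Q V delta.
Proof.
move=> sV H u w /(subvP sV) uV /(subvP sV) wV nw a Aa.
by apply: (H u w uV wV nw) => i; apply: Aw_subV sV (Aa i).
Qed.

(** * Contraction along the covering curves *)

Section Core.
Variables (k : closedFieldType) (n delta : nat) (P : set 'rV[k]_n).
Hypotheses (char0 : [pchar k] =i pred0) (iP : irr P) (d0 : (0 < delta)%N).
Variables (V : {vspace 'rV[k]_n}) (w x : 'rV[k]_n).
Hypotheses (Px : P x) (wV : w \in V) (wx : lin w x != 0).

Lemma osc_at u : u \in osc P V w x delta -> lin u x = 0.
Proof. by case: delta d0 => // i _; apply: osc_x. Qed.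

(* An element of osc at x has contact delta with Q at x, so it cannot vanish
   anywhere else on Q unless it vanishes on all of Q. *)
Lemma osc_on_curve Q y u0 u : goodcurve P Q delta x y ->
  u0 \in osc P V w x delta -> u \in osc P V w x delta -> lin w y != 0 -> lin u0 y != 0 ->
  forall v, Q v -> lin u v = lin u y / lin u0 y * lin u0 v.
Proof.
move=> [iQ QP Qx Qy dQ] ou0 ou wy u0y.
pose z := u - (lin u y / lin u0 y) *: u0.
have oz : z \in osc P V w x delta by rewrite memvB // memvZ.
suff nzz : ~ nz Q (lin z).
  move=> v Qv; apply/eqP; rewrite -subr_eq0 -linZl -linBl; apply/eqP.
  by move/nzPn: nzz; apply.
move=> nzz; have [zV Mz] := (mem_osc _ _ _ _ _ _).1 oz.
have [u0V _] := (mem_osc _ _ _ _ _ _).1 ou0.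
have nw : nz Q (lin w) by exists x.
have u0x := osc_at ou0.
have := mult_bound (V := V) (l := 1) (kappa := delta) (p := fun=> y) iQ
  (DEG_sub (subvf V) dQ zV wV nw) Qx wx zV nzz (Mk_sub QP Mz).
rewrite addn1 ltnn => H; suff : false by []; apply: H.
- by move=> _; split=> //; rewrite /z linBl linZl divfK // subrr.
- by move=> i j; rewrite !ord1.
- by move=> _ _; exists u0.
Qed.

Hypothesis good : gen P (fun y => exists Q, goodcurve P Q delta x y).

(** On a curve Q through x and a general y the ratios of the us are constant, so F restricts to a
    polynomial equation with constant coefficients for v over [us ord0]; on the irreducible Q this
    ratio is then constant as well. *)
Lemma core m (us : 'I_m.+1 -> 'rV[k]_n) v e (F : {mpoly k[m.+2]}) :
  (forall j, us j \in osc P V w x delta) -> indep P us -> F \is e.-homog -> F != 0 ->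
  (forall z, P z -> F.@[cons0 (lin v z) (fun j => lin (us j) z)] = 0) ->
  exists y Q, [/\ goodcurve P Q delta x y, nz Q (lin (us ord0)) &
    exists c, forall z, Q z -> lin v z = c * lin (us ord0) z].
Proof.
move=> ous ind Fe F0 FE.
have [s Fs] := mpoly_nonroot char0 (mulf_neq0 F0 (mvar_neq0 k (lift ord0 ord0 : 'I_m.+2))).
move: Fs; rewrite mevalM mevalXU mulf_eq0 negb_or => /andP [Fs s1].
(* c is such that F does not become 0 when c times the second variable is put for the first. For
   general y this keeps the equation on Q nontrivial. *)
pose c := s ord0 / s (lift ord0 ord0).
have pf : polyfun e (fun t : 'rV[k]_m.+1 => F.@[cons0 (c * t 0 ord0) (t 0)]).
  rewrite -[e]muln1.
  apply: (polyfun_comp (f := fun i (t : 'rV[k]_m.+1) => cons0 (c * t 0 ord0) (t 0) i) Fe) => i.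
  rewrite /cons0; case: (unlift ord0 i) => [j|]; first exact: polyfun_var.
  by apply: polyfunZ; exact: polyfun_var.
have [G Ge GE] := form_of_polyfun pf.
have G0 : G != 0.
  apply: contraNneq Fs => G0; have := GE (fun j => s (lift ord0 j)); rewrite G0 meval0 => E.
  rewrite E; apply/eqP; apply: meval_eq => i; rewrite /cons0.
  by case: unliftP => [j|] ->; rewrite !mxE // /c divfK.
have GE' t : G.@[t] = F.@[cons0 (c * t ord0) t].
  rewrite GE; apply: meval_eq => i; rewrite /cons0.
  by case: (unlift ord0 i) => [j|]; rewrite !mxE.
have nG := ind e G Ge G0; have pG := polyfun_lins us Ge.
have nu := indep_nz ord0 ind.
have nw : nz P (lin w) by exists x.
have [y Py [[[Q gQ] Gy] [uy wy]]] := gen_ex (gen_and iP (gen_and iP good (gen_nz pG nG))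
  (gen_and iP (gen_nz (polyfun_lin _) nu) (gen_nz (polyfun_lin _) nw))).
exists y, Q; have [iQ QP Qx Qy dQ] := gQ.
have nuQ : nz Q (lin (us ord0)) by exists y.
split=> //.
pose al j := lin (us j) y / lin (us ord0) y.
have alE j z : Q z -> lin (us j) z = al j * lin (us ord0) z.
  by move=> Qz; apply: (osc_on_curve gQ (ous ord0) (ous j) wy uy).
have [p pE] := mpoly_line F (cons0 0 al) (cons0 1 (fun=> 0)).
have pE' t : p.[t] = F.@[cons0 t al].
  rewrite pE; apply: meval_eq => i; rewrite /cons0; case: (unlift ord0 i) => [j|].
    by rewrite mulr0 addr0.
  by rewrite mulr1 add0r.
have p0 : p != 0.
  apply: contraNneq Gy => p0; rewrite GE'.
  have -> : F.@[cons0 (c * lin (us ord0) y) (fun j => lin (us j) y)] =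
    lin (us ord0) y ^+ e * F.@[cons0 c al].
    rewrite -(homog_scale _ _ Fe); apply: meval_eq => i; rewrite /cons0.
    by case: (unlift ord0 i) => [j|]; rewrite [RHS]mulrC // /al divfK.
  by rewrite -pE' p0 horner0 mulr0.
apply: const_of_poly iQ nuQ p0 _ => z Qz uz; rewrite pE'.
apply/eqP; have := FE z (QP z Qz).
rewrite (meval_eq (v2 := fun i => lin (us ord0) z * cons0 (lin v z / lin (us ord0) z) al i)).
  by rewrite (homog_scale _ _ Fe) => /eqP; rewrite mulf_eq0 expf_eq0 (negbTE uz) andbF.
move=> i; rewrite /cons0; case: (unlift ord0 i) => [j|].
  by rewrite alE // mulrC.
by rewrite mulrC divfK.
Qed.

(** Otherwise independent us in the osculating system would, together with w', satisfy the
    hypotheses of [core], and w' would be proportional to [us ord0] on a curve through x. But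
    [us ord0] vanishes at x and w' does not. *)
Lemma contraction j (V' V'' : {vspace 'rV[k]_n}) : (exists2 w', w' \in V' & lin w' x != 0) ->
  (V'' <= V')%VS -> (V'' <= osc P V w x delta)%VS -> tdle P j.+1 V' -> tdle P j V''.
Proof.
move=> [w' w'V w'x] sV so td us usV; apply: contrapT => H.
have ind : indep P us.
  move=> e F Fe F0; apply: contrapT => /nzPn E; apply: H; by exists e, F.
have [|d [F [Fd F0 FE]]] := td (cons0 w' us).
  by move=> i; rewrite /cons0; case: (unlift ord0 i) => // l; exact: (subvP sV).
have ous i : us i \in osc P V w x delta by exact: (subvP so).
have [|y [Q [[_ _ Qx _ _] _ [c cE]]]] := core (v := w') ous ind Fd F0.
  move=> z Pz; rewrite -[RHS](FE z Pz); apply: meval_eq => i; rewrite /cons0.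
  by case: (unlift ord0 i).
have := cE x Qx; rewrite (osc_at (ous _)) mulr0 => /eqP.
by rewrite (negbTE w'x).
Qed.
End Core.

(** * The dimension bound *)

Section Bound.
Variables (k : closedFieldType) (n delta : nat) (P : set 'rV[k]_n).
Hypotheses (char0 : [pchar k] =i pred0) (iP : irr P) (d0 : (0 < delta)%N).
Hypothesis nondeg : forall u, u != 0 -> nz P (lin u).
Hypothesis cov : gen P (fun x => gen P (fun y => exists Q, goodcurve P Q delta x y)).

(** In transcendence degree 0 each ratio u/w satisfies an equation over k and is therefore
    constant. *)
Lemma tdle0_dim V : tdle P 0 V -> (\dim V <= 1)%N.
Proof.
move=> td; have [->|V0] := eqVneq V 0%VS; first by rewrite dimv0.
pose w := vpick V; have w0 : w != 0 by rewrite vpick0.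
suff sV : (V <= <[w]>)%VS by apply: leq_trans (dimvS sV) _; rewrite dim_vline; case: (_ != 0).
apply/subvP => u uV; have [|d [F [Fd F0 FE]]] := td (cons0 u (fun=> w)).
  by move=> i; rewrite /cons0; case: (unlift ord0 i) => // _; exact: memv_pick.
have [s Fs] := mpoly_nonroot char0 (mulf_neq0 F0 (mvar_neq0 k (lift ord0 ord0 : 'I_2))).
move: Fs; rewrite mevalM mevalXU mulf_eq0 negb_or => /andP [Fs s1].
have [p pE] := mpoly_line F (cons0 0 (fun=> 1)) (cons0 1 (fun=> 0)).
have pE' t : p.[t] = F.@[cons0 t (fun=> 1)].
  rewrite pE; apply: meval_eq => i; rewrite /cons0; case: (unlift ord0 i) => [j|].
    by rewrite mulr0 addr0.
  by rewrite mulr1 add0r.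
have p0 : p != 0.
  apply: contraNneq Fs => p0; apply/eqP.
  rewrite (meval_eq (v2 := fun i => s (lift ord0 ord0) * cons0 (s ord0 / s (lift ord0 ord0)) (fun=> 1) i)).
    by rewrite (homog_scale _ _ Fd) -pE' p0 horner0 mulr0.
  move=> i; rewrite /cons0; case: unliftP => [j|] ->; last by rewrite mulrC divfK.
  by rewrite mulr1 [j]ord1.
have [|c cE] := const_of_poly (u := u) (w := w) iP (nondeg w0) p0.
  move=> v Pv wv; rewrite pE'; apply/eqP.
  have := FE v Pv.
  rewrite (meval_eq (v2 := fun i => lin w v * cons0 (lin u v / lin w v) (fun=> 1) i)).
    by rewrite (homog_scale _ _ Fd) => /eqP; rewrite mulf_eq0 expf_eq0 (negbTE wv) andbF.
  move=> i; rewrite /cons0; case: (unlift ord0 i) => [j|]; first by rewrite mulr1.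
  by rewrite mulrC divfK.
have -> : u = c *: w; last by rewrite memvZ // memv_line.
apply/eqP; rewrite -subr_eq0; apply/negPn/negP => /nondeg [v Pv].
by rewrite linBl linZl cE // subrr eqxx.
Qed.

Definition good x := gen P (fun y => exists Q, goodcurve P Q delta x y).

(** Contact delta costs at most one condition for each monomial of degree delta - 1 in m + 2
    variables. *)
Lemma osc_step m V w : tdle P m.+1 V -> w \in V -> w != 0 ->
  gen P (fun x => [/\ good x, lin w x != 0, tdle P m (osc P V w x delta) &
    (\dim V <= \dim (osc P V w x delta) + 'C(m.+1 + delta.-1, m.+1))%N]).
Proof.
move=> td wV w0; have nw := nondeg w0.
have G := gen_and iP (gen_and iP cov (gen_nz (polyfun_lin _) nw)) (cotangent char0 iP td wV nw).
apply: gen_imp G => x Px [[gx wx] /(_ wx) [b Hb]]; split=> //.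
  apply: (contraction char0 iP d0 Px wV wx gx (V' := V)) td; first by exists w.
    exact: osc_sub.
  exact: subvv.
by have := osc_dim Px wx Hb delta.-1; rewrite prednK.
Qed.

Lemma binD_pred m : 'C(m.+1 + delta, m.+1) = ('C(m + delta, m) + 'C(m.+1 + delta.-1, m.+1))%N.
Proof. by case: delta d0 => // i _; rewrite addnS binS addnC addSnnS. Qed.

Lemma dim_bound m V : tdle P m V -> (\dim V <= 'C(m + delta, m))%N.
Proof.
elim: m V => [|m IHm] V td; first by rewrite bin0; exact: tdle0_dim.
have [->|V0] := eqVneq V 0%VS; first by rewrite dimv0.
have [|x Px [_ _ td' D]] := gen_ex (osc_step td (memv_pick V) _); first by rewrite vpick0.
by apply: (leq_trans D); rewrite binD_pred leq_add2r; apply: IHm.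
Qed.

Lemma osc_dim_eq m V w : tdle P m.+1 V -> w \in V -> w != 0 -> \dim V = 'C(m.+1 + delta, m.+1) ->
  gen P (fun x => [/\ good x, lin w x != 0, tdle P m (osc P V w x delta) &
    \dim (osc P V w x delta) = 'C(m + delta, m)]).
Proof.
move=> td wV w0 dV; apply: gen_imp (osc_step td wV w0) => x Px [gx wx td' D]; split=> //.
apply/eqP; rewrite eqn_leq dim_bound //=.
by move: D; rewrite dV binD_pred leq_add2r.
Qed.
End Bound.

(** * Linear systems of Veronese type *)

Section Forms.
Variables (k : closedFieldType) (K : fieldType) (i0 : {rmorphism k -> K}).
Hypothesis char0 : [pchar k] =i pred0.

Notation mev := (mmap i0).

Definition dot m (c e : 'I_m -> k) : k := \sum_i c i * e i.
Definition lcomb m (c : 'I_m -> k) (b : 'I_m -> K) : K := \sum_i i0 (c i) * b i.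
Definition lspan m (b : 'I_m -> K) (x : K) : Prop := exists c, x = lcomb c b.

Lemma mevX m (b : 'I_m -> K) (M : 'X_{1..m}) : mev b 'X_[M] = \prod_i b i ^+ M i.
Proof. by rewrite mmapX. Qed.

Lemma mev_scale m d (b : 'I_m -> K) c (F : {mpoly k[m]}) : F \is d.-homog ->
  mev (fun i => c * b i) F = c ^+ d * mev b F.
Proof.
move=> Fd; rewrite /mmap big_distrr /= big_seq [RHS]big_seq.
apply: eq_bigr => M /(dhomogP _ _ _ Fd) <-.
rewrite mulrCA; congr (_ * _); rewrite /= mdegE -prodrXr /mmap1 -big_split /=.
by apply: eq_bigr => i _; rewrite exprMn.
Qed.

Lemma mev_iota m (s : 'I_m -> k) (F : {mpoly k[m]}) : mev (fun i => i0 (s i)) F = i0 F.@[s].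
Proof.
rewrite /mmap mevalE rmorph_sum; apply: eq_bigr => M _; rewrite rmorphM; congr (_ * _).
by rewrite /mmap1 rmorph_prod; apply: eq_bigr => i _; rewrite rmorphXn.
Qed.

Lemma eq_mev m (b b' : 'I_m -> K) (F : {mpoly k[m]}) : b =1 b' -> mev b F = mev b' F.
Proof.
move=> bb; rewrite /mmap; apply: eq_bigr => M _; congr (_ * _).
by apply: eq_bigr => i _; rewrite bb.
Qed.

Lemma mmap_comp (R : comNzRingType) (f : {rmorphism k -> R}) l m (q : 'I_l -> {mpoly k[m]})
    (F : {mpoly k[l]}) (b : 'I_m -> R) :
  mmap f b (mmap (@mpolyC m k) q F) = mmap f (fun j => mmap f b (q j)) F.
Proof.
rewrite {2}/mmap rmorph_sum; apply: eq_bigr => M _.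
rewrite rmorphM /= mmapC; congr (_ * _).
by rewrite /mmap1 rmorph_prod; apply: eq_bigr => j _; rewrite rmorphXn.
Qed.

Lemma meval_comp l m (q : 'I_l -> {mpoly k[m]}) (F : {mpoly k[l]}) s :
  (mmap (@mpolyC m k) q F).@[s] = F.@[fun j => (q j).@[s]].
Proof. by rewrite /meval mmap_comp. Qed.

Lemma dhomog_comp l m d e (q : 'I_l -> {mpoly k[m]}) (F : {mpoly k[l]}) :
  (forall j, q j \is e.-homog) -> F \is d.-homog ->
  mmap (@mpolyC m k) q F \is (d * e).-homog.
Proof.
move=> qe Fd; have pf : polyfun (d * e) (fun t : 'rV[k]_m => F.@[fun j => (q j).@[t 0]]).
  by apply: (polyfun_comp (f := fun j (t : 'rV[k]_m) => (q j).@[t 0]) Fd) => j; exists (q j).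
have [F' F'd F'E] := form_of_polyfun pf.
suff -> : mmap (@mpolyC m k) q F = F' by [].
apply: (mpoly_eq char0) => s; rewrite F'E meval_comp; apply: meval_eq => j.
by apply: meval_eq => i; rewrite mxE.
Qed.

Lemma form_subst l m d (c : 'I_l -> 'I_m -> k) (F : {mpoly k[l]}) : F \is d.-homog ->
  exists F' : {mpoly k[m]}, [/\ F' \is d.-homog, forall s, F'.@[s] = F.@[fun j => dot (c j) s] &
    forall b, mev b F' = mev (fun j => lcomb (c j) b) F].
Proof.
move=> Fd; pose q j : {mpoly k[m]} := \sum_i c j i *: 'X_i.
exists (mmap (@mpolyC m k) q F); split=> [|s|b].
- rewrite -[d]muln1; apply: dhomog_comp => // j; apply: rpred_sum => i _.
  by apply: rpredZ; rewrite dhomogX /= mdeg1.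
- rewrite meval_comp; apply: meval_eq => j.
  by rewrite rmorph_sum; apply: eq_bigr => i _; rewrite /= mevalZ mevalXU.
- rewrite mmap_comp; apply: eq_mev => j; rewrite rmorph_sum; apply: eq_bigr => i _ /=.
  by rewrite mmapZ mmapX mmap1U.
Qed.

Lemma pow_form m (c : 'I_m -> k) d : exists F : {mpoly k[m]}, [/\ F \is d.-homog,
  forall s, F.@[s] = dot c s ^+ d & forall b, mev b F = lcomb c b ^+ d].
Proof.
exists ((\sum_i c i *: 'X_i) ^+ d); split=> [|s|b].
- rewrite -[X in X.-homog]mul1n; apply: dhomogMn; apply: rpred_sum => i _.
  by apply: rpredZ; rewrite dhomogX /= mdeg1.
- by rewrite rmorphXn rmorph_sum; congr (_ ^+ _); apply: eq_bigr => i _; rewrite /= mevalZ mevalXU.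
- by rewrite rmorphXn rmorph_sum; congr (_ ^+ _); apply: eq_bigr => i _; rewrite /= mmapZ mmapX mmap1U.
Qed.

(** The polynomial with roots x/y splits over the algebraically closed k, so a d-th root in K of a
    constant is constant. *)
Lemma pow_prop d x y (kap : k) : (0 < d)%N -> y != 0 -> x ^+ d = i0 kap * y ^+ d ->
  exists mu, x = i0 mu * y.
Proof.
move=> d0 y0 E.
have [r rE] := closed_field_poly_normal ('X^d - kap%:P).
have /eqP : (map_poly i0 ('X^d - kap%:P)).[x / y] = 0.
  by rewrite rmorphB /= map_polyXn map_polyC hornerD hornerN hornerC hornerXn expr_div_n E mulfK ?expf_neq0 // subrr.
rewrite rE lead_coefXnsubC // scale1r rmorph_prod horner_prod => /eqP.
move/eqP; rewrite prodf_seq_eq0 => /hasP [mu _ /=].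
rewrite rmorphB /= map_polyX map_polyC hornerXsubC subr_eq0 => /eqP xy.
by exists mu; rewrite -xy divfK.
Qed.

Definition hai m (b : 'I_m -> K) := forall d F, F \is d.-homog -> mev b F = 0 -> F = 0.

Lemma dotDl m (c c' e : 'I_m -> k) : dot (fun i => c i + c' i) e = dot c e + dot c' e.
Proof. by rewrite /dot -big_split; apply: eq_bigr => i _; rewrite mulrDl. Qed.
Lemma dotZl m a (c e : 'I_m -> k) : dot (fun i => a * c i) e = a * dot c e.
Proof. by rewrite /dot mulr_sumr; apply: eq_bigr => i _; rewrite mulrA. Qed.
Lemma lcombD m (c c' : 'I_m -> k) b : lcomb (fun i => c i + c' i) b = lcomb c b + lcomb c' b.
Proof. by rewrite /lcomb -big_split; apply: eq_bigr => i _; rewrite rmorphD mulrDl. Qed.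
Lemma lcombZ m a (c : 'I_m -> k) b : lcomb (fun i => a * c i) b = i0 a * lcomb c b.
Proof. by rewrite /lcomb mulr_sumr; apply: eq_bigr => i _; rewrite rmorphM mulrA. Qed.
Lemma eq_lcomb m (c c' : 'I_m -> k) b : c =1 c' -> lcomb c b = lcomb c' b.
Proof. by move=> cc; apply: eq_bigr => i _; rewrite cc. Qed.

(** Two distinct hyperplanes span the space: c is moved along l, which lies in the first but not in
    the second. *)
Lemma dot_split m (l c e e' : 'I_m -> k) : dot l e = 0 -> dot l e' != 0 ->
  exists c1 c2, [/\ dot c1 e = 0, dot c2 e' = 0 & forall i, c i = c1 i + c2 i].
Proof.
move=> le le'; pose t := dot c e' / dot l e'.
exists (fun i => t * l i), (fun i => c i + - t * l i); split=> [||i].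
- by rewrite dotZl le mulr0.
- by rewrite dotDl dotZl mulNr divfK // subrr.
- by rewrite mulNr addrC subrK.
Qed.

Lemma lspanD m (b : 'I_m -> K) x y : lspan b x -> lspan b y -> lspan b (x + y).
Proof. by move=> [c ->] [c' ->]; exists (fun i => c i + c' i); rewrite lcombD. Qed.
Lemma lspanZ m (b : 'I_m -> K) a x : lspan b x -> lspan b (i0 a * x).
Proof. by move=> [c ->]; exists (fun i => a * c i); rewrite lcombZ. Qed.

End Forms.

Section VSK.
Variables (k : closedFieldType) (n delta : nat) (P : set 'rV[k]_n) (G : genf P).
Hypotheses (char0 : [pchar k] =i pred0) (iP : irr P) (d0 : (0 < delta)%N).
Hypothesis nondeg : forall u, u != 0 -> nz P (lin u).
Hypothesis cov : gen P (fun x => good delta P x).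
Implicit Types (V : {vspace 'rV[k]_n}) (h x y : G) (u v z : 'rV[k]_n).

Let i0 : {rmorphism k -> G} := iota G.
Local Notation mev := (mmap i0).

Definition gl u : G := ge G (lin u).

Lemma gl_sum (I : Type) (s : seq I) (c : I -> k) (F : I -> 'rV[k]_n) :
  gl (\sum_(i <- s) c i *: F i) = \sum_(i <- s) i0 (c i) * gl (F i).
Proof.
rewrite /gl -(eq_bigr _ (fun i _ => geZ G (c i) (lin (F i)))) -ge_sum.
by congr ge; apply/funext => v; rewrite lin_suml; apply: eq_bigr => i _; rewrite linZl.
Qed.

Lemma glB u v : gl (u - v) = gl u - gl v.
Proof. by rewrite /gl -geB; congr ge; apply/funext => z; rewrite linBl. Qed.

Lemma gl_eq0 u : gl u = 0 -> u = 0.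
Proof.
move=> u0; apply/eqP; apply/negPn/negP => /nondeg [v Pv].
by rewrite (ge_eq0 (polyfun_lin u) u0) // eqxx.
Qed.

Lemma gl_inj : injective gl.
Proof. by move=> u v E; apply/eqP; rewrite -subr_eq0; apply/eqP/gl_eq0; rewrite glB E subrr. Qed.

(* the linear system V is h times the space of forms of degree delta in
   b_0, ..., b_m *)
Definition VSK m V h (b : 'I_m.+1 -> G) : Prop :=
  [/\ h != 0, hai i0 b, tdle P m V,
      forall u, u \in V -> exists2 F, F \is delta.-homog & gl u = h * mev b F &
      forall F, F \is delta.-homog -> exists2 u, u \in V & gl u = h * mev b F].

(** The scale of e is tied to that of the vector z, so values agree exactly and not only up to a
    factor. e = 0 is allowed; it occurs when V vanishes at z. *)
Definition isvpt m V h (b : 'I_m.+1 -> G) z (e : 'I_m.+1 -> k) : Prop :=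
  forall u F, u \in V -> F \is delta.-homog -> gl u = h * mev b F -> lin u z = F.@[e].

(** The monomials in b give ['C(m + delta, m)] independent members of V; with the bound on the
    dimension they form a basis, so only one of the two inclusions has to be shown elsewhere. *)
Lemma VSK_of_dim m V h (b : 'I_m.+1 -> G) : h != 0 -> hai i0 b -> tdle P m V ->
  (forall F, F \is delta.-homog -> exists2 u, u \in V & gl u = h * mev b F) ->
  (\dim V <= 'C(m + delta, m))%N -> VSK V h b.
Proof.
move=> h0 hb td FV dV; split=> //.
pose ms := monomials m.+1 delta; pose mm (j : 'I_(size ms)) := nth 0%MM ms j.
have mmd j : mdeg (mm j) = delta.
  by apply/eqP; rewrite -mem_monomials mem_nth.
have XM j : ('X_[mm j] : {mpoly k[m.+1]}) \is delta.-homog by rewrite dhomogX /= mmd.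
have /choice [U UP] : forall j, exists u, u \in V /\ gl u = h * mev b 'X_[mm j].
  by move=> j; have [u ? ?] := FV _ (XM j); exists u.
pose X := [tuple U j | j < size ms].
have glE (c : 'I_(size ms) -> k) : gl (\sum_j c j *: U j) = h * mev b (\sum_j c j *: 'X_[mm j]).
  rewrite gl_sum rmorph_sum mulr_sumr; apply: eq_bigr => j _.
  by rewrite (proj2 (UP j)) /= mmapZ mulrCA.
have sumd (c : 'I_(size ms) -> k) : \sum_j c j *: 'X_[mm j] \is delta.-homog.
  by apply: rpred_sum => j _; apply: rpredZ.
have fX : free X.
  apply/freeP => c E; have : gl (\sum_j c j *: U j) = 0.
    rewrite -[RHS](_ : gl 0 = 0); last by rewrite -(subr0 0) glB subrr.
    by congr gl; rewrite -[RHS]E; apply: eq_bigr => j _; rewrite -tnth_nth tnth_mktuple.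
  rewrite glE => /eqP; rewrite mulf_eq0 (negbTE h0) /= => /eqP /(hb _ _ (sumd c)) F0 j.
  have := congr1 (mcoeff (mm j)) F0; rewrite raddf_sum mcoeff0 (bigD1 j) //= mcoeffZ mcoeffX eqxx mulr1.
  rewrite big1 ?addr0 // => l lj; rewrite mcoeffZ mcoeffX.
  rewrite nth_uniq ?uniq_monomials // (_ : (l == j :> nat) = false) ?mulr0 //.
  exact/negbTE.
have sX : (<<X>> <= V)%VS.
  by apply/span_subvP => u /tnthP [j ->]; rewrite tnth_mktuple; case: (UP j).
have VE : V = <<X>>%VS.
  apply/esym/eqP; rewrite eqEdim sX /= (eqnP fX) size_tuple size_monomials prednK //.
  by rewrite bin_gt0 leq_addr.
move=> u; rewrite VE => /(coord_span (X := X)) uE; exists (\sum_j coord X j u *: 'X_[mm j]) => //.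
rewrite -glE; congr gl; rewrite {1}uE; apply: eq_bigr => j _.
by rewrite -tnth_nth tnth_mktuple.
Qed.

(* a point z of P defines a point e of the source of the Veronese map *)
Lemma VSK_pt m V h (b : 'I_m.+1 -> G) z : VSK V h b -> P z -> exists e, isvpt V h b z e.
Proof.
move=> VK Pz; have [h0 hb _ VF FV] := VK.
have /choice [U UP] : forall M : 'X_{1..m.+1}, exists u, mdeg M = delta ->
    u \in V /\ gl u = h * \prod_i b i ^+ M i.
  move=> M; have [Md|nMd] := eqVneq (mdeg M) delta; last first.
    by exists 0 => Md; rewrite Md eqxx in nMd.
  have XM : ('X_[M] : {mpoly k[m.+1]}) \is delta.-homog by rewrite dhomogX /= Md.
  by have [u uV uE] := FV _ XM; exists u; rewrite uE mevX.
suff [e eE] : exists e : 'I_m.+1 -> k, forall M, mdeg M = delta -> lin (U M) z = \prod_i e i ^+ M i.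
  exists e => u F uV Fd uE.
  have -> : u = \sum_(M <- msupp F) F@_M *: U M.
    apply: gl_inj; rewrite uE gl_sum /mmap mulr_sumr big_seq [RHS]big_seq.
    apply: eq_bigr => M /(dhomogP _ _ _ Fd) Md; rewrite (proj2 (UP M Md)) mulrCA.
    by rewrite /mmap1.
  rewrite lin_suml mevalE big_seq [RHS]big_seq.
  by apply: eq_bigr => M /(dhomogP _ _ _ Fd) Md; rewrite linZl eE.
(* Products of sections obey the homogeneous relations of the monomials they represent; this carries
   the relations from germs to the point z. *)
have rel N (f : 'rV[k]_n -> k) : polyfun N f -> ge G f = 0 -> f z = 0.
  by move=> pf f0; exact: (ge_eq0 pf f0).
have Ud i : mdeg (U_(i) *+ delta : 'X_{1..m.+1})%MM = delta by rewrite mdegMn mdeg1 mul1n.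
have UdE i : gl (U (U_(i) *+ delta)%MM) = h * b i ^+ delta.
  rewrite (proj2 (UP _ (Ud i))) (bigD1 i) //= mulmnE mnm1E eqxx mul1n big1 ?mulr1 // => j ji.
  by rewrite mulmnE mnm1E eq_sym (negbTE ji) mul0n expr0.
(* If all pure powers vanish at z, so do all monomials, because their delta-th powers are products
   of pure powers; then e = 0. *)
have [[i wi]|nw] := pselect (exists i, lin (U (U_(i) *+ delta)%MM) z != 0); last first.
  exists (fun=> 0) => M Md.
  have /existsP [j Mj] : [exists j, M j != 0%N].
    apply: contraLR d0; rewrite negb_exists => /forallP H; rewrite -leqNgt -Md mdegE big1 // => j _.
    by apply/eqP; have := H j; rewrite negbK.
  rewrite (bigD1 j) //= expr0n (negbTE Mj) mul0r.
  have : lin (U M) z ^+ delta - \prod_i lin (U (U_(i) *+ delta)%MM) z ^+ M i = 0.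
    apply: (rel delta (fun v => lin (U M) v ^+ delta - \prod_i lin (U (U_(i) *+ delta)%MM) v ^+ M i)).
      apply: polyfunB; first by rewrite -[X in polyfun X]mul1n; apply: polyfunX; exact: polyfun_lin.
      rewrite -[X in polyfun X]Md mdegE; apply: polyfun_prod => l _.
      have := polyfunX (M l) (polyfun_lin (U (U_(l) *+ delta)%MM)); by rewrite mul1n.
    rewrite geB geX ge_prod -/(gl _) (proj2 (UP M Md)) exprMn -prodrXl; apply/eqP; rewrite subr_eq0; apply/eqP.
    under [RHS]eq_bigr => l _ do rewrite geX -/(gl _) UdE exprMn.
    rewrite big_split /= prodrXr -mdegE Md; congr (_ * _); apply: eq_bigr => l _.
    by rewrite -!exprM mulnC.
  rewrite [X in _ - X](bigD1 j) //= (_ : lin (U (U_(j) *+ delta)%MM) z = 0); last first.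
    by apply/eqP; apply: contrapT => /negP E; apply: nw; exists j.
  by rewrite expr0n (negbTE Mj) mul0r subr0 => /eqP; rewrite expf_eq0 => /andP [_ /eqP].
pose w0 := U (U_(i) *+ delta)%MM.
pose N j : 'X_{1..m.+1} := (U_(i) *+ delta.-1 + U_(j))%MM.
have Nd j : mdeg (N j) = delta by rewrite mdegD mdegMn !mdeg1 mul1n addn1 prednK.
have NE j : gl (U (N j)) = h * (b i ^+ delta.-1 * b j).
  rewrite (proj2 (UP _ (Nd j))); congr (_ * _).
  rewrite (eq_bigr (fun l => b l ^+ (U_(i)%MM l * delta.-1)%N * b l ^+ U_(j)%MM l)); last first.
    by move=> l _; rewrite mnmDE mulmnE exprD.
  rewrite big_split /= (bigD1 i) //= mnm1E eqxx mul1n big1 ?mulr1; last first.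
    by move=> l li; rewrite mnm1E eq_sym (negbTE li) mul0n expr0.
  congr (_ * _); rewrite (bigD1 j) //= mnm1E eqxx expr1 big1 ?mulr1 // => l lj.
  by rewrite mnm1E eq_sym (negbTE lj) expr0.
(* The j-th coordinate relative to the i-th is read off from the sections of b_i^(delta-1) b_j and
   b_i^delta; a delta-th root of the latter's value at z fixes the scale. *)
have [rho rhoE] : exists rho, rho ^+ delta = lin w0 z.
  have [r] := solve_monicpoly (fun l => if l == 0%N then lin w0 z else 0) d0.
  rewrite -(prednK d0) big_ord_recl /= expr0 mulr1 big1 ?addr0 => [E|l _]; first by exists r.
  by rewrite mul0r.
have rho0 : rho != 0 by apply: contraNneq wi => r0; rewrite -/w0 -rhoE r0 expr0n (gtn_eqF d0).
exists (fun j => lin (U (N j)) z / lin w0 z * rho) => M Md.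
have E : lin (U M) z * lin w0 z ^+ delta.-1 = \prod_j lin (U (N j)) z ^+ M j.
  apply/eqP; rewrite -subr_eq0; apply/eqP.
  apply: (rel delta (fun v => lin (U M) v * lin w0 v ^+ delta.-1 - \prod_j lin (U (N j)) v ^+ M j)).
    apply: polyfunB.
      rewrite -[X in polyfun X](prednK d0) -add1n; apply: polyfunM; first exact: polyfun_lin.
      by rewrite -[X in polyfun X]mul1n; apply: polyfunX; exact: polyfun_lin.
    rewrite -[X in polyfun X]Md mdegE; apply: polyfun_prod => l _.
    have := polyfunX (M l) (polyfun_lin (U (N l))); by rewrite mul1n.
  rewrite geB geM geX ge_prod -!/(gl _) (proj2 (UP M Md)) UdE; apply/eqP; rewrite subr_eq0; apply/eqP.
  under [RHS]eq_bigr => l _ do rewrite geX -/(gl _) NE !exprMn.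
  rewrite !big_split /= !prodrXr -mdegE Md exprMn -!exprM [(delta.-1 * delta)%N]mulnC.
  have -> : h ^+ delta = h * h ^+ delta.-1 by rewrite -exprS prednK.
  by move: (\prod_(_ < _) _) (h ^+ _) (b i ^+ _) => A B C; ring.
have lw0 : lin w0 z != 0 by [].
apply: (mulIf (expf_neq0 delta.-1 lw0)); rewrite E.
under [X in _ = X * _]eq_bigr => l _ do rewrite -mulrA exprMn [_^-1 * _]mulrC.
rewrite big_split /= prodrXr -mdegE Md expr_div_n rhoE -mulrA -[LHS]mulr1; congr (_ * _).
by rewrite -[X in _ / _ ^+ X * _](prednK d0) exprS invfM mulrA divff // mul1r mulVf // expf_neq0.
Qed.
End VSK.

Lemma Mk_prodX (k : fieldType) n (Q : set 'rV[k]_n) V w x (I : Type) (s : seq I) (M : I -> nat)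
    (f : I -> 'rV[k]_n -> k) : (forall j, Mk Q V w x 1 (f j)) ->
  Mk Q V w x (\sum_(j <- s) M j) (fun v => \prod_(j <- s) f j v ^+ M j).
Proof.
move=> H; elim: s => [|j s IHs].
  by rewrite big_nil; apply: Aw_ext (Aw_const _ _ _ 1) _ => v _ _; rewrite big_nil.
rewrite big_cons; apply: Mk_ext (MkM (MkX (M j) (H j)) IHs) _ => v _ _.
by rewrite big_cons.
Qed.

(** * Osculating subsystems and uniqueness of the presentation *)

Section Sub.
Variables (k : closedFieldType) (n delta : nat) (P : set 'rV[k]_n) (G : genf P).
Hypotheses (char0 : [pchar k] =i pred0) (iP : irr P) (d0 : (0 < delta)%N).
Hypothesis nondeg : forall u, u != 0 -> nz P (lin u).
Hypothesis cov : gen P (fun x => good delta P x).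

Let i0 : {rmorphism k -> G} := iota G.
Local Notation mev := (mmap i0).
Local Notation gl := (gl G).
Local Notation VSK := (VSK delta).
Local Notation isvpt := (isvpt delta).

Lemma isvpt_neq0 m V0 h (b : 'I_m.+1 -> G) z e : VSK V0 h b -> isvpt V0 h b z e ->
  (exists2 u, u \in V0 & lin u z != 0) -> exists i, e i != 0.
Proof.
move=> [_ _ _ VF _] ez [u uV uz]; apply: contrapT => e0; move/eqP: uz; apply.
have [F Fd uE] := VF u uV; rewrite (ez u F uV Fd uE).
have -> : F.@[e] = F.@[fun i => 0 * e i].
  apply: meval_eq => i; rewrite mul0r; apply/eqP; apply: contrapT => ei; apply: e0.
  by exists i; apply/negP.
by rewrite (homog_scale _ _ Fd) expr0n (gtn_eqF d0) mul0r.
Qed.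

Lemma VSK_pow m V0 h (b : 'I_m.+1 -> G) (c : 'I_m.+1 -> k) : VSK V0 h b ->
  exists2 u, u \in V0 & gl u = h * lcomb i0 c b ^+ delta /\
    forall z e, isvpt V0 h b z e -> lin u z = dot c e ^+ delta.
Proof.
move=> [_ _ _ _ FV]; have [F [Fd FE FE']] := pow_form i0 c delta.
have [u uV uE] := FV F Fd; exists u => //; split; first by rewrite uE FE'.
by move=> z e ez; rewrite (ez u F uV Fd uE) FE.
Qed.

Lemma lcomb_neq0 m (b : 'I_m -> G) c : hai i0 b -> (exists i, c i != 0) -> lcomb i0 c b != 0.
Proof.
move=> hb [i ci]; have [F [Fd FE FE']] := pow_form i0 c 1.
apply: contraNneq ci => c0; have := FE' b; rewrite c0 expr1 => /(hb _ _ Fd) F0.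
have := FE (fun j => (j == i)%:R); rewrite F0 meval0 expr1 /dot (bigD1 i) //= eqxx mulr1.
by rewrite big1 ?addr0 => [<-|j /negbTE ->]; rewrite ?mulr0.
Qed.

Variables (V : {vspace 'rV[k]_n}) (w : 'rV[k]_n).
Hypothesis wV : w \in V.

Section Dual.
Variables (m : nat) (e : 'I_m.+2 -> k) (i : 'I_m.+2).
Hypothesis ei : e i != 0.

(** A basis of the linear forms vanishing at e: each coordinate other than the i-th, minus the
    multiple of the i-th that cancels its value at e. *)
Definition dual_basis (j : 'I_m.+1) (l : 'I_m.+2) : k :=
  (l == lift i j)%:R - (l == i)%:R * (e (lift i j) / e i).

Lemma dot_dual j s : dot (dual_basis j) s = s (lift i j) - e (lift i j) / e i * s i.
Proof.
rewrite /dot (bigD1_ord i) //= /dual_basis eqxx (negbTE (neq_lift i j)) sub0r mul1r.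
rewrite mulNr addrC (bigD1 j) //= eqxx eq_sym (negbTE (neq_lift i j)) mul0r subr0 mul1r.
rewrite big1 ?addr0 // => l lj; rewrite (inj_eq lift_inj) (negbTE lj).
by rewrite eq_sym (negbTE (neq_lift i l)) mul0r subr0 mul0r.
Qed.

Lemma lcomb_dual j (b : 'I_m.+2 -> G) :
  lcomb i0 (dual_basis j) b = b (lift i j) - i0 (e (lift i j) / e i) * b i.
Proof.
rewrite /lcomb (bigD1_ord i) //= /dual_basis eqxx (negbTE (neq_lift i j)) sub0r mul1r.
rewrite rmorphN mulNr addrC (bigD1 j) //= eqxx eq_sym (negbTE (neq_lift i j)) mul0r subr0.
rewrite rmorph1 mul1r big1 ?addr0 // => l lj; rewrite (inj_eq lift_inj) (negbTE lj).
by rewrite eq_sym (negbTE (neq_lift i l)) mul0r subr0 rmorph0 mul0r.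
Qed.

Lemma dot_dual_e j : dot (dual_basis j) e = 0.
Proof. by rewrite dot_dual divfK // subrr. Qed.

Lemma lspan_dual (b : 'I_m.+2 -> G) x : lspan i0 (fun j => lcomb i0 (dual_basis j) b) x <->
  exists2 c, dot c e = 0 & x = lcomb i0 c b.
Proof.
split=> [[c ->]|[c ce ->]].
  exists (fun l => \sum_j c j * dual_basis j l).
    rewrite /dot; under eq_bigr => l _ do rewrite mulr_suml.
    rewrite exchange_big /=; apply: big1 => j _; transitivity (c j * dot (dual_basis j) e).
      by rewrite mulr_sumr; apply: eq_bigr => l _; rewrite mulrA.
    by rewrite dot_dual_e mulr0.
  rewrite /lcomb; under eq_bigr => j _ do rewrite mulr_sumr.
  rewrite exchange_big; apply: eq_bigr => l _; rewrite rmorph_sum mulr_suml.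
  by apply: eq_bigr => j _; rewrite rmorphM mulrA.
exists (fun j => c (lift i j)).
rewrite [LHS](bigD1_ord i) //= addrC.
rewrite [RHS]/lcomb; under [in RHS]eq_bigr => j _ do rewrite lcomb_dual mulrBr mulrA -rmorphM.
rewrite sumrB; congr (_ + _); rewrite -mulr_suml -rmorph_sum -mulNr -rmorphN; congr (i0 _ * _).
apply: (mulIf ei); rewrite mulNr mulr_suml; apply/eqP; rewrite -addr_eq0; apply/eqP.
rewrite -[RHS]ce /dot (bigD1_ord i) //=; congr (_ + _); apply: eq_bigr => j _.
by rewrite mulrA divfK.
Qed.

Lemma hai_dual (b : 'I_m.+2 -> G) : hai i0 b -> hai i0 (fun j => lcomb i0 (dual_basis j) b).
Proof.
move=> hb d F Fd F0; have [F' [F'd F'E F'E']] := form_subst i0 char0 dual_basis Fd.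
have F'0 : F' = 0 by apply: (hb d) => //; rewrite F'E'.
apply: (mpoly_eq char0) => t; rewrite meval0.
have := F'E (fun l => if unlift i l is Some j then t j else 0); rewrite F'0 meval0 => E.
rewrite [RHS]E.
by apply: meval_eq => j; rewrite dot_dual liftK unlift_none mulr0 subr0.
Qed.
End Dual.

(** A product of delta linear forms vanishing at e has contact delta with z. The intersection has
    smaller transcendence degree by [contraction], and [dim_bound] leaves room for nothing but these
    products. *)
Lemma VSK_osc m V0 h (b : 'I_m.+2 -> G) z e : VSK V0 h b -> (V0 <= V)%VS ->
  P z -> lin w z != 0 -> good delta P z -> isvpt V0 h b z e ->
  (exists2 u, u \in V0 & lin u z != 0) ->
  exists2 b' : 'I_m.+1 -> G, VSK (V0 :&: osc P V w z delta)%VS h b' &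
    forall x, lspan i0 b' x <-> exists2 c : 'I_m.+2 -> k, dot c e = 0 & x = lcomb i0 c b.
Proof.
move=> VK sV Pz wz gz ez V0z; have [h0 hb td VF FV] := VK.
have [i ei] := isvpt_neq0 VK ez V0z.
pose b' j := lcomb i0 (dual_basis e i j) b; exists b'; last exact: lspan_dual.
have td' : tdle P m (V0 :&: osc P V w z delta)%VS.
  by apply: (contraction char0 iP d0 Pz wV wz gz V0z (capvSl _ _) (capvSr _ _) td).
have hb' : hai i0 b' by exact: hai_dual.
apply: (VSK_of_dim h0 hb' td'); last exact: (dim_bound char0 iP d0 nondeg cov td').
have Xi d : ('X_i ^+ d : {mpoly k[m.+2]}) \is d.-homog.
  by rewrite -[X in X.-homog]mul1n; apply: dhomogMn; rewrite dhomogX /= mdeg1.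
have [w' w'V w'E] := FV _ (Xi delta); rewrite rmorphXn /= mmapX mmap1U in w'E.
have w'z : lin w' z != 0.
  have -> : lin w' z = e i ^+ delta.
    rewrite (ez w' _ w'V (Xi delta)); first by rewrite rmorphXn /= mevalXU.
    by rewrite w'E rmorphXn /= mmapX mmap1U.
  exact: expf_neq0.
have /choice [U UP] : forall j, exists u, [/\ u \in V0, gl u = h * (b' j * b i ^+ delta.-1) & lin u z = 0].
  move=> j; have [L [Ld LE LE']] := pow_form i0 (dual_basis e i j) 1.
  have Fd : L * 'X_i ^+ delta.-1 \is delta.-homog.
    by have := dhomogM Ld (Xi delta.-1); rewrite add1n prednK.
  have [u uV uE] := FV _ Fd; exists u; split=> //.
    by rewrite uE rmorphM rmorphXn /= mmapX mmap1U LE' expr1.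
  by rewrite (ez u _ uV Fd uE) mevalM LE expr1 dot_dual_e ?mul0r.
have main M : mdeg M = delta -> exists2 u, u \in (V0 :&: osc P V w z delta)%VS &
    gl u = h * \prod_j b' j ^+ M j.
  move=> Md; have XM : ('X_[M] : {mpoly k[m.+1]}) \is delta.-homog by rewrite dhomogX /= Md.
  have [F' [F'd _ F'E']] := form_subst i0 char0 (dual_basis e i) XM.
  have [u uV uE] := FV _ F'd; exists u; last by rewrite uE F'E' mevX.
  rewrite memv_cap uV; apply/mem_osc; have uV' := subvP sV _ uV; split=> //.
  have w'V' := subvP sV _ w'V.
  (* u is compared with a product of delta sections that vanish at z. The surplus factor, a power of
     w', is nonzero at z and is cancelled by [Mk_local]. *)
  have rel v : P v -> lin u v * lin w' v ^+ delta.-1 = \prod_j lin (U j) v ^+ M j.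
    move=> Pv; apply/eqP; rewrite -subr_eq0; apply/eqP; move: v Pv.
    apply: (ge_eq0 (g0 := G) (d := delta)).
      apply: polyfunB.
        rewrite -[X in polyfun X](prednK d0) -add1n; apply: polyfunM; first exact: polyfun_lin.
        by rewrite -[X in polyfun X]mul1n; apply: polyfunX; exact: polyfun_lin.
      rewrite -[X in polyfun X]Md mdegE; apply: polyfun_prod => l _.
      have := polyfunX (M l) (polyfun_lin (U l)); by rewrite mul1n.
    rewrite geB geM geX ge_prod -!/(gl _) uE F'E' mevX w'E; apply/eqP; rewrite subr_eq0; apply/eqP.
    under [RHS]eq_bigr => l _.
      rewrite geX -/(gl _); have [_ -> _] := UP l; rewrite !exprMn; over.
    rewrite !big_split /= !prodrXr -mdegE Md exprMn -!exprM [(delta.-1 * delta)%N]mulnC.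
    have -> : h ^+ delta = h * h ^+ delta.-1 by rewrite -exprS prednK.
    by rewrite -/b'; move: (\prod_(_ < _) _) (h ^+ _) (b i ^+ _) => A B C; ring.
  have Aw' : Aw P V w (fun v => lin w' v / lin w v) by exact: Aw_lin.
  apply: (@Mk_local _ _ P V w z Pz wz delta _ (fun v => (lin w' v / lin w v) ^+ delta.-1)).
  - exact: Aw_lin.
  - exact: AwX.
  - by rewrite expf_neq0 // mulf_neq0 ?invr_eq0.
  have M1 j : Mk P V w z 1 (fun v => lin (U j) v / lin w v).
    by have [UV _ Uz] := UP j; apply: Mk1_lin => //; exact: (subvP sV).
  rewrite -[X in Mk _ _ _ _ X]Md mdegE.
  apply: Mk_ext (Mk_prodX _ M M1) _ => v Pv wv.
  under eq_bigr => j _ do rewrite exprMn.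
  rewrite big_split /= -rel // prodrXr -mdegE Md exprMn.
  have -> : (lin w v)^-1 ^+ delta = (lin w v)^-1 * (lin w v)^-1 ^+ delta.-1 by rewrite -exprS prednK.
  by move: (_ ^+ _) (_^-1) (_^-1 ^+ _) => A B C; ring.
move=> F Fd.
have /choice [UM UMP] : forall M : 'X_{1..m.+1}, exists u, mdeg M = delta ->
    u \in (V0 :&: osc P V w z delta)%VS /\ gl u = h * \prod_j b' j ^+ M j.
  move=> M; have [Md|nMd] := eqVneq (mdeg M) delta; last first.
    by exists 0 => Md; rewrite Md eqxx in nMd.
  by have [u ? ?] := main M Md; exists u.
exists (\sum_(M <- msupp F) F@_M *: UM M).
  rewrite big_seq; apply: memv_suml => M /(dhomogP _ _ _ Fd) Md; apply: memvZ.
  by case: (UMP M Md).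
rewrite gl_sum /mmap mulr_sumr big_seq [RHS]big_seq.
apply: eq_bigr => M /(dhomogP _ _ _ Fd) Md; rewrite (proj2 (UMP M Md)) mulrCA.
by rewrite /mmap1.
Qed.

Hypothesis w0 : w != 0.

Lemma VSK_pow_neq0 m V0 h (b : 'I_m.+1 -> G) (c : 'I_m.+1 -> k) : VSK V0 h b ->
  (exists i, c i != 0) -> exists u, [/\ u \in V0, u != 0 &
    forall z e, isvpt V0 h b z e -> lin u z = dot c e ^+ delta].
Proof.
move=> VK c0; have [u uV [uE uz]] := VSK_pow c VK; exists u; split=> //.
have [h0 hb _ _ _] := VK; apply/eqP => u0; move: uE.
have -> : gl u = 0 by rewrite u0 -(subr0 0) glB subrr.
by move/esym/eqP; rewrite mulf_eq0 expf_eq0 (negbTE h0) (negbTE (lcomb_neq0 hb c0)) andbF.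
Qed.

Lemma VSK_nz m V0 h (b : 'I_m.+1 -> G) : VSK V0 h b -> exists2 u, u \in V0 & u != 0.
Proof.
move=> VK; have [|u [uV u0 _]] := VSK_pow_neq0 (c := fun=> 1) VK; last by exists u.
by exists ord0; exact: oner_neq0.
Qed.

(** The power of a linear form through e is a nonzero section, so it does not vanish at a general
    point; the source points of general z are thus not proportional to e. *)
Lemma VSK_indep_pt m V0 h (b : 'I_m.+2 -> G) e : VSK V0 h b -> (exists i, e i != 0) ->
  exists l, dot l e = 0 /\ gen P (fun z => forall e', isvpt V0 h b z e' -> dot l e' != 0).
Proof.
move=> VK [i ei]; pose l := dual_basis e i ord0.
have [|u [uV u0 uz]] := VSK_pow_neq0 (c := l) VK.
  exists (lift i ord0); rewrite /l /dual_basis eqxx [_ == i]eq_sym (negbTE (neq_lift _ _)).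
  rewrite mul0r subr0.
  exact: oner_neq0.
exists l; split; first exact: dot_dual_e.
apply: gen_imp (gen_nz (polyfun_lin u) (nondeg u0)) => z _ + e' ze'.
by rewrite (uz z e' ze') expf_eq0 negb_and d0.
Qed.

(** The presentation is unique up to a germ c. Two general points cut out systems with smaller m,
    for which c is known by induction up to constants, and the two hyperplanes of linear forms
    obtained in this way span everything. *)
Lemma VSK_sym m V0 h h' (a a' : 'I_m.+1 -> G) : VSK V0 h a -> VSK V0 h' a' -> (V0 <= V)%VS ->
  exists c kap, [/\ c != 0, kap != 0, h * c ^+ delta = i0 kap * h' &
    forall x, lspan i0 a (c * x) <-> lspan i0 a' x].
Proof.
elim: m V0 h h' a a' => [|m IHm] V0 h h' a a' VK VK' sV.
  have [u uV [uE _]] := VSK_pow (fun=> 1) VK.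
  have [h0 hb _ _ _] := VK; have [h'0 hb' _ VF' _] := VK'.
  have one : exists i : 'I_1, (1 : k) != 0 by exists ord0; exact: oner_neq0.
  have := lcomb_neq0 hb one; have := lcomb_neq0 hb' one.
  rewrite /lcomb !big_ord1 rmorph1 !mul1r => a'0 a0.
  have [F Fd uE'] := VF' u uV.
  have FE : mev a' F = a' ord0 ^+ delta * i0 F.@[fun=> 1].
    rewrite -mev_iota -(mev_scale _ _ _ Fd); apply: eq_mev => i.
    by rewrite ord1 rmorph1 mulr1.
  pose c := a ord0 / a' ord0; have c0 : c != 0 by rewrite mulf_neq0 ?invr_eq0.
  have E : h * c ^+ delta = i0 F.@[fun=> 1] * h'.
    apply: (mulIf (expf_neq0 delta a'0)); rewrite -mulrA -exprMn divfK //.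
    move: uE'; rewrite uE /lcomb big_ord1 rmorph1 mul1r FE => ->.
    by move: (i0 _) (_ ^+ _) => A B; ring.
  exists c, F.@[fun=> 1]; split=> //.
    apply: contraTneq (expf_neq0 delta c0) => F0; rewrite negbK.
    by move/eqP: E; rewrite F0 rmorph0 mul0r mulf_eq0 (negbTE h0).
  move=> x; split=> -[s E']; exists s; rewrite /lcomb big_ord1; rewrite /lcomb big_ord1 in E'.
    by apply: (mulfI c0); rewrite E' mulrCA divfK.
  by rewrite E' mulrCA divfK.
have [u0 u0V u00] := VSK_nz VK.
have base := gen_and iP cov (gen_and iP (gen_nz (polyfun_lin w) (nondeg w0))
   (gen_nz (polyfun_lin u0) (nondeg u00))).
have [z1 Pz1 [gz1 [wz1 uz1]]] := gen_ex base.
have V0z1 : exists2 u, u \in V0 & lin u z1 != 0 by exists u0.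
have [e1 ez1] := VSK_pt d0 nondeg VK Pz1; have [e1' ez1'] := VSK_pt d0 nondeg VK' Pz1.
have [l [le1 Gl]] := VSK_indep_pt VK (isvpt_neq0 VK ez1 V0z1).
have [l' [le1' Gl']] := VSK_indep_pt VK' (isvpt_neq0 VK' ez1' V0z1).
have [z2 Pz2 [[gz2 [wz2 uz2]] [Hl Hl']]] := gen_ex (gen_and iP base (gen_and iP Gl Gl')).
have V0z2 : exists2 u, u \in V0 & lin u z2 != 0 by exists u0.
have [e2 ez2] := VSK_pt d0 nondeg VK Pz2; have [e2' ez2'] := VSK_pt d0 nondeg VK' Pz2.
have {Hl} le2 := Hl _ ez2; have {Hl'} le2' := Hl' _ ez2'.
have sub z : (V0 :&: osc P V w z delta <= V)%VS by apply: subv_trans sV; exact: capvSl.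
have [b1 VKb1 sb1] := VSK_osc VK sV Pz1 wz1 gz1 ez1 V0z1.
have [b1' VKb1' sb1'] := VSK_osc VK' sV Pz1 wz1 gz1 ez1' V0z1.
have [b2 VKb2 sb2] := VSK_osc VK sV Pz2 wz2 gz2 ez2 V0z2.
have [b2' VKb2' sb2'] := VSK_osc VK' sV Pz2 wz2 gz2 ez2' V0z2.
have [c1 [k1 [c10 k10 E1 S1]]] := IHm _ _ _ _ _ VKb1 VKb1' (sub z1).
have [c2 [k2 [c20 k20 E2 S2]]] := IHm _ _ _ _ _ VKb2 VKb2' (sub z2).
have [h0 _ _ _ _] := VK; have [h'0 _ _ _ _] := VK'.
(* The quotient of the two germs given by induction has a constant delta-th power, hence is itself
   constant. *)
have [mu muE] : exists mu, c1 = i0 mu * c2.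
  apply: (pow_prop (kap := k1 / k2) d0 c20); apply: (mulfI h0).
  by rewrite mulrCA E2 E1 mulrA -rmorphM divfK.
have mu0 : mu != 0 by apply: contraNneq c10 => E; rewrite muE E rmorph0 mul0r.
exists c1, k1; split=> // x; split.
  move=> [s sE]; have [s1 [s2 [d1 d2 ss]]] := dot_split s le1 le2.
  have -> : x = lcomb i0 s1 a / c1 + lcomb i0 s2 a / c1.
    by rewrite -mulrDl -lcombD -(eq_lcomb i0 a ss) -sE mulrC mulKf.
  apply: lspanD.
    have /S1/sb1' [t _ ->] : lspan i0 b1 (c1 * (lcomb i0 s1 a / c1)); last by exists t.
    by apply/sb1; exists s1 => //; rewrite mulrC divfK.
  have /S2/sb2' [t _ ->] : lspan i0 b2 (c2 * (lcomb i0 s2 a / c1)); last by exists t.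
  apply/sb2; exists (fun i => mu^-1 * s2 i); first by rewrite dotZl d2 mulr0.
  by rewrite lcombZ fmorphV muE invfM [_ * lcomb _ _ _]mulrC [c2 * _]mulrC -!mulrA mulVf // mulr1.
move=> [s ->]; have [s1 [s2 [d1 d2 ss]]] := dot_split s le1' le2'.
rewrite (eq_lcomb i0 a' ss) lcombD mulrDr; apply: lspanD.
  have /S1/sb1 [t _ ->] : lspan i0 b1' (lcomb i0 s1 a'); last by exists t.
  by apply/sb1'; exists s1.
have /S2/sb2 [t _ E] : lspan i0 b2' (lcomb i0 s2 a'); last first.
  by rewrite muE -mulrA E; apply: lspanZ; exists t.
by apply/sb2'; exists s2.
Qed.

(** With equal h the germ c of [VSK_sym] has a constant delta-th power, so it is constant and may be
    dropped. *)
Lemma VSK_same_h m V0 h (a a' : 'I_m.+1 -> G) : VSK V0 h a -> VSK V0 h a' -> (V0 <= V)%VS ->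
  forall x, lspan i0 a x -> lspan i0 a' x.
Proof.
move=> VK VK' sV; have [c [kap [c0 k0 E S]]] := VSK_sym VK VK' sV.
have [h0 _ _ _ _] := VK.
have [mu muE] : exists mu, c = i0 mu * 1.
  apply: (pow_prop (kap := kap) d0 (oner_neq0 _)); apply: (mulfI h0).
  by rewrite E expr1n mulr1 mulrC.
rewrite mulr1 in muE; have mu0 : mu != 0 by apply: contraNneq c0 => E'; rewrite muE E' rmorph0.
move=> x ax; apply/S; rewrite muE; exact: lspanZ.
Qed.

Lemma VSK_scale m V0 h h' (b : 'I_m.+1 -> G) c kap : VSK V0 h' b -> h' != 0 -> c != 0 ->
  kap != 0 -> h * c ^+ delta = i0 kap * h' -> VSK V0 h (fun i => c * b i).
Proof.
move=> [_ hb td VF FV] h'0 c0 k0 E.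
have ik0 : i0 kap != 0 by rewrite fmorph_eq0.
have h0 : h != 0.
  by apply: contraNneq h'0 => h0; move/eqP: E; rewrite h0 mul0r eq_sym mulf_eq0 (negbTE ik0).
have FE F : F \is delta.-homog -> h * mev (fun i => c * b i) F = h' * (i0 kap * mev b F).
  by move=> Fd; rewrite (mev_scale _ _ _ Fd) mulrA E mulrAC mulrC mulrA mulrC mulrA.
split=> // [d F Fd|u uV|F Fd].
- rewrite (mev_scale _ _ _ Fd) => /eqP; rewrite mulf_eq0 expf_eq0 (negbTE c0) andbF /=.
  by move/eqP; apply: hb Fd.
- have [F Fd uE] := VF u uV; exists (kap^-1 *: F); first exact: rpredZ.
  by rewrite FE ?rpredZ // mmapZ fmorphV mulVKf.
- have [|u uV uE] := FV (kap *: F); first exact: rpredZ.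
  by exists u => //; rewrite uE FE // mmapZ.
Qed.
End Sub.

(** A vector space over an infinite field is not a finite union of proper subspaces: move along a
    line and avoid the roots of a product of nonzero linear polynomials. *)
Lemma vspace_avoid (k : fieldType) (E : vectType k) (V : {vspace E}) N (f : 'I_N -> E -> k) :
  [pchar k] =i pred0 ->
  (forall i a u v, u \in V -> v \in V -> f i (a *: u + v) = a * f i u + f i v) ->
  (forall i, exists2 v, v \in V & f i v != 0) -> exists2 v, v \in V & forall i, f i v != 0.
Proof.
move=> char0; elim: N f => [|N IHN] f fL fV; first by exists 0; [exact: mem0v|case].
have [v vV fv] := IHN (fun i => f (lift ord0 i)) (fun i => fL _) (fun i => fV _).
have [v' v'V fv'] := fV ord0.
have p0 : \prod_i (f i v' *: 'X + (f i v)%:P) != 0.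
  apply/prodf_neq0 => i _; case: (unliftP ord0 i) => [j|] ->.
    apply/eqP => /(congr1 (horner^~ 0)); rewrite !(hornerE, mulr0, add0r) => /eqP.
    by rewrite (negbTE (fv j)).
  apply/eqP => /(congr1 (coefp 1)); rewrite /= coefD coefZ coefX coefC mulr1 addr0 coef0 => /eqP.
  by rewrite (negbTE fv').
have [t] := poly_nonroot char0 p0; rewrite horner_prod => /prodf_neq0 H.
exists (t *: v' + v); first by rewrite memvD // memvZ.
by move=> i; rewrite fL // mulrC; have := H i isT; rewrite !hornerE.
Qed.

Lemma dim_indep (k : fieldType) (E : vectType k) (V : {vspace E}) w : (1 < \dim V)%N ->
  exists2 u, u \in V & forall c, u != c *: w.
Proof.
move=> dV; apply: contrapT => H.
suff : (\dim V <= 1)%N by rewrite leqNgt dV.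
have sV : (V <= <[w]>)%VS.
  apply/subvP => u uV; apply: contrapT => nu; apply: H; exists u => // c.
  by apply: contra_not_neq nu => ->; rewrite memvZ // memv_line.
by apply: leq_trans (dimvS sV) _; rewrite dim_vline; case: (_ != 0).
Qed.

(** * The base of the induction *)

Section Base.
Variables (k : closedFieldType) (n delta : nat) (P : set 'rV[k]_n) (G : genf P).
Hypotheses (char0 : [pchar k] =i pred0) (iP : irr P) (cP : ccl P) (d0 : (0 < delta)%N).
Hypothesis nondeg : forall u, u != 0 -> nz P (lin u).
Hypothesis cov : gen P (fun x => good delta P x).
Variable V : {vspace 'rV[k]_n}.
Hypotheses (td : tdle P 1 V) (dV : \dim V = delta.+1).

Let i0 : {rmorphism k -> G} := iota G.
Local Notation mev := (mmap i0).
Local Notation gl := (gl G).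

(* A function of k[V/w] is algebraic over k[u/w]; if it vanishes on a curve on
   which u/w is not constant, its norm does too, so the norm is 0. *)
Lemma surface_DEG : DEG P V delta.
Proof.
move=> u1 w uV wV nw a Aa.
have [x Px [gx wx]] := gen_ex (gen_and iP cov (gen_nz (polyfun_lin _) nw)).
have [v vV vw] := @dim_indep _ _ V w (ltac:(by rewrite dV)).
pose u := lin w x *: v - lin v x *: w.
have uV' : u \in V by rewrite memvB // memvZ.
have ux : lin u x = 0 by rewrite linBl !linZl mulrC subrr.
have u0 : u != 0.
  rewrite subr_eq0; apply: contra (vw (lin v x / lin w x)) => /eqP E.
  by rewrite mulrC -scalerA -E scalerA mulVf // scale1r.
have [y Py [[Q [iQ QP Qx Qy dQ]] [wy uy]]] := gen_ex (gen_and iP gx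
  (gen_and iP (gen_nz (polyfun_lin _) nw) (gen_nz (polyfun_lin _) (nondeg u0)))).
have nwQ : nz Q (lin w) by exists x.
have [p p0 pE] := DEG_sub (subvf V) dQ uV wV nwQ (fun i => Aw_sub QP (Aa i)).
exists p => //; apply: contrapT => H.
pose f v := \sum_i (p i).[lin u1 v / lin w v] * a i v.
have Af : Aw P V w f.
  by apply: Aw_sum => i _; apply: AwM; [apply: Aw_horner; exact: Aw_lin|exact: Aa].
have [||b [f' [b0 Af' bE]]] := Aw_norm G char0 td nw uV' wV _ Af.
- move=> c; have [->|c0] := eqVneq c 0; first by exists y; rewrite // mul0r.
  by exists x => //; rewrite ux eq_sym mulf_neq0.
- apply: contrapT => nf; apply: H => z Pz wz; apply/eqP; apply: contrapT => /negP fz.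
  by apply: nf; exists z.
have [|c cE] := const_of_poly (u := u) iQ nwQ b0.
  by move=> z Qz wz; rewrite -(bE z (QP z Qz) wz) (_ : f z = 0) ?mulr0 //; exact: pE.
have := cE x Qx; rewrite ux => /esym/eqP; rewrite mulf_eq0 (negbTE wx) orbF => /eqP c0.
by move: uy; rewrite (cE y Qy) c0 mul0r eqxx.
Qed.

Definition evs (s : G) (p : {poly k}) : G := (map_poly i0 p).[s].

Lemma evsD s p q : evs s (p + q) = evs s p + evs s q.
Proof. by rewrite /evs rmorphD hornerD. Qed.
Lemma evsM s p q : evs s (p * q) = evs s p * evs s q.
Proof. by rewrite /evs rmorphM hornerM. Qed.
Lemma evsZ s c p : evs s (c *: p) = i0 c * evs s p.
Proof. by rewrite /evs map_polyZ hornerZ. Qed.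

(** g0 and g1 are taken with contact delta - 1 at x. Every member of their pencil then has room for
    only one more zero, so the general fibre of s = g1/g0 has at most one point and all ratios of V
    lie in k(s). *)
Lemma pencil : exists g0 g1, [/\ g0 \in V, g0 != 0, transcendental i0 (rat G g1 g0), g1 \in V &
  forall v, v \in V -> exists p0 p1 : {poly k}, p1 != 0 /\
    evs (rat G g1 g0) p0 + evs (rat G g1 g0) p1 * rat G v g0 = 0].
Proof.
have wV := memv_pick V; set w := vpick V in wV.
have w0 : w != 0 by rewrite vpick0 -dimv_eq0 dV.
have nw := nondeg w0.
have [x Px [wx /(_ wx) [b Hb]]] := gen_ex (gen_and iP (gen_nz (polyfun_lin _) nw)
  (cotangent char0 iP td wV nw)).
pose O := osc P V w x delta.-1.
(* Contact delta - 1 costs at most delta - 1 of the delta + 1 dimensions. For delta = 1 there is no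
   condition, a case that [osc_dim] does not cover. *)
have dO : (1 < \dim O)%N.
  rewrite /O; case E: delta.-1 => [|i].
    rewrite (_ : osc P V w x 0 = V) ?dV //; apply/vspaceP => u; apply/idP/idP.
      by move/mem_osc => [].
    by move=> uV; apply/mem_osc; split=> //; exact: Aw_lin.
  have := osc_dim Px wx Hb i; rewrite dV -(prednK d0) E bin1 add1n.
  by rewrite -[i.+3]/(2 + i.+1)%N leq_add2r.
have g0O := memv_pick O; set g0 := vpick O in g0O.
have g00 : g0 != 0 by rewrite vpick0 -dimv_eq0; case: (\dim O) dO.
have [g1 g1O g10] := dim_indep g0 dO.
have sO := subvP (osc_sub P V w x delta.-1).
have g0V := sO _ g0O; have g1V := sO _ g1O.
have ng0 := nondeg g00.
have nc c : exists2 v, P v & lin g1 v != c * lin g0 v.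
  have : g1 - c *: g0 != 0 by rewrite subr_eq0.
  by move=> /nondeg [v Pv]; rewrite linBl linZl subr_eq0; exists v.
exists g0, g1; have tr := nonconst_transc G ng0 nc; split=> // v vV.
(* The auxiliary form is w: contact is measured in k[V/w], so the points of the fibre must avoid its
   zeros. *)
have [D [[B B0 HB] Hdep]] := fib_points G char0 iP cP td ng0 nw g1V g0V nc.
have le_D : (D <= 1)%N.
  have [c /HB [p [Pp g0p g1p wp sep]]] := poly_nonroot char0 B0.
  pose z := g1 - c *: g0; have zO : z \in O by rewrite memvB // memvZ.
  have z0 : z != 0 by rewrite subr_eq0.
  have [zV Mz] := (mem_osc _ _ _ _ _ _).1 zO.
  rewrite -(leq_add2l delta.-1) addn1 prednK //.
  apply: (mult_bound iP (surface_DEG zV wV nw) Px wx zV (nondeg z0) Mz (p := p)).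
  - by move=> i; split=> //; rewrite /z linBl linZl g1p g0p mulr1 subrr.
  - move=> i j ij; have [l lV lp] := sep i j ij.
    exists (l - lin l (p j) *: g0); first by rewrite memvB // memvZ.
    by rewrite !linBl !linZl !g0p !mulr1 subrr subr_eq0.
  - move=> dgt i; exists g0 => //; split; last by rewrite g0p oner_neq0.
    exact: (osc_at dgt Px wx g0O).
pose a (i : 'I_2) : 'rV[k]_n -> k := if i == ord0 then fun=> 1 else fun z => lin v z / lin g0 z.
have [|p [i pi] pE] := Hdep 2 a le_D.
  by move=> i; rewrite /a; case: ifP => _; [exact: Aw_const|exact: Aw_lin].
have E : evs (rat G g1 g0) (p ord0) + evs (rat G g1 g0) (p (lift ord0 ord0)) * rat G v g0 = 0.
  rewrite /evs /rat -!ge_horner -geM -geD.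
  rewrite (ge_eq_on G (polyfun_lin g0) ng0 (g := fun=> 0)) ?ge0 // => z Pz gz.
  by have := pE z Pz gz; rewrite !big_ord_recl big_ord0 /a /= mulr1 addr0.
exists (p ord0), (p (lift ord0 ord0)); split=> //.
apply/eqP => p1; move: E; rewrite p1 {2}/evs rmorph0 horner0 mul0r addr0.
apply/eqP/tr; apply: contraNneq pi => p00.
by case: (unliftP ord0 i) => [j|] ->; rewrite ?p00 // [j]ord1 p1.
Qed.

Lemma evs_sum s (I : Type) (r : seq I) (R : pred I) (F : I -> {poly k}) :
  evs s (\sum_(i <- r | R i) F i) = \sum_(i <- r | R i) evs s (F i).
Proof. by rewrite /evs rmorph_sum horner_sum. Qed.
Lemma evsX s p e : evs s (p ^+ e) = evs s p ^+ e.
Proof. by rewrite /evs rmorphXn horner_exp. Qed.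
Lemma evs_polyX s : evs s 'X = s.
Proof. by rewrite /evs map_polyX hornerX. Qed.
Lemma evs_inj s : transcendental i0 s -> injective (evs s).
Proof.
move=> tr p q E; apply/eqP; rewrite -subr_eq0; apply/negPn/negP => /tr /negP; apply.
by rewrite rmorphB /= hornerD hornerN subr_eq0; apply/eqP.
Qed.

Definition polys (s : G) e : Prop := exists2 h : G, h != 0 &
  forall v, v \in V -> exists2 p : {poly k}, (size p <= e.+1)%N & gl v = h * evs s p.

(** A common denominator for the finitely many basis elements of V is absorbed into h. *)
Lemma polys_exists : exists g0 g1 e, [/\ g0 \in V, g0 != 0, g1 \in V,
  transcendental i0 (rat G g1 g0) & polys (rat G g1 g0) e].
Proof.
have [g0 [g1 [g0V g00 tr g1V H]]] := pencil; exists g0, g1; set s := rat G g1 g0 in tr H *.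
have vV (i : 'I_(\dim V)) : (vbasis V)`_i \in V by rewrite vbasis_mem // mem_nth // size_tuple.
have /choice [p0 p0P] : forall i : 'I_(\dim V), exists p0 : {poly k}, exists p1 : {poly k},
  p1 != 0 /\ evs s p0 + evs s p1 * rat G (vbasis V)`_i g0 = 0 by move=> i; apply: H.
have /choice [p1 p1P] := p0P.
pose d := \prod_i p1 i; have d1 : d != 0 by apply/prodf_neq0 => i _; case: (p1P i).
have ed : evs s d != 0 by exact: tr.
pose q i := - p0 i * \prod_(j | j != i) p1 j.
pose pol v := \sum_i coord (vbasis V) i v *: q i.
have gg : gl g0 != 0 by apply: contra g00 => /eqP /(gl_eq0 nondeg) ->.
exists (\max_i size (q i)); split=> //; exists (gl g0 / evs s d); first by rewrite mulf_neq0 ?invr_eq0.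
move=> v vV'; exists (pol v).
  apply: leq_trans (leqnSn _); apply: leq_trans (size_sum _ _ _) _; apply/bigmax_leqP => i _.
  by apply: leq_trans (size_scale_leq _ _) _; apply: leq_bigmax.
have qE i : evs s (q i) = evs s d * rat G (vbasis V)`_i g0.
  have [p1i /eqP] := p1P i; rewrite addr_eq0 => /eqP E.
  rewrite evsM {1}/evs rmorphN hornerN -/(evs s (p0 i)) E opprK mulrAC -evsM.
  by rewrite /d [\prod_i0 _](bigD1 i).
rewrite {1}(coord_vbasis vV') gl_sum /pol evs_sum mulr_sumr; apply: eq_bigr => i _.
rewrite evsZ qE mulrCA; congr (_ * _).
rewrite mulrA divfK // /rat geM geV mulrC divfK //.
Qed.

(** If e cannot be lowered, the polynomials have no common root and one of them, U, has degree e.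
    For U' prime to U the function U/U' has degree e on the line, so 1, s, ..., s^delta are
    independent over k(U/U') when delta < e, against [surface_DEG]. *)
Lemma degree_bound g0 g1 e : g0 \in V -> g0 != 0 -> g1 \in V ->
  transcendental i0 (rat G g1 g0) -> polys (rat G g1 g0) e -> (delta < e)%N ->
  polys (rat G g1 g0) e.-1.
Proof.
move=> g0V g00 g1V tr [h h0 hV] lt_d; set s := rat G g1 g0 in tr hV *.
apply: contrapT => nP.
have gg : gl g0 != 0 by apply: contra g00 => /eqP /(gl_eq0 nondeg) ->.
have /choice [pol polP] : forall v, exists p : {poly k}, v \in V -> (size p <= e.+1)%N /\ gl v = h * evs s p.
  move=> v; have [vV|nV] := boolP (v \in V); last by exists 0.
  by have [p ? ?] := hV v vV; exists p.
have polE v : v \in V -> gl v = h * evs s (pol v) by case/polP.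
have polL a u v : u \in V -> v \in V -> pol (a *: u + v) = a *: pol u + pol v.
  move=> uV vV; apply: (evs_inj tr); apply: (mulfI h0).
  rewrite -polE ?memvD ?memvZ // evsD evsZ mulrDr mulrCA -!polE //.
  have := gl_sum G [:: true; false] (fun c : bool => if c then a else 1) (fun c : bool => if c then u else v).
  by rewrite !big_cons !big_nil !addr0 scale1r rmorph1 mul1r.
have nroot r : exists2 v, v \in V & (pol v).[r] != 0.
  apply: contrapT => H; apply: nP; exists (h * evs s ('X - r%:P)).
    by rewrite mulf_neq0 //; apply: tr; rewrite polyXsubC_eq0.
  move=> v vV; have /factor_theorem [q qE] : root (pol v) r.
    by apply/eqP/eqP; apply: contrapT => /negP E; apply: H; exists v.
  exists q; last by rewrite polE // qE evsM mulrA mulrAC.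
  have [->|q0] := eqVneq q 0; first by rewrite size_poly0.
  have [sz _] := polP v vV; move: sz; rewrite qE size_Mmonic ?monicXsubC // size_XsubC addn2 /= ltnS.
  by rewrite prednK // (leq_ltn_trans _ lt_d).
have [u uV su] : exists2 u, u \in V & size (pol u) = e.+1.
  apply: contrapT => H; apply: nP; exists h => // v vV; exists (pol v); last exact: polE.
  have [sz _] := polP v vV; rewrite prednK ?(leq_ltn_trans _ lt_d) // -ltnS ltn_neqAle sz andbT.
  by apply/eqP => E; apply: H; exists v.
set U := pol u in su; have U0 : U != 0 by rewrite -size_poly_eq0 su.
have [rs UE] := closed_field_poly_normal U.
have [u' u'V u'P] : exists2 v, v \in V & forall i : 'I_(size rs), (pol v).[rs`_i] != 0.
  apply: (vspace_avoid (f := fun i v => (pol v).[rs`_i]) char0) => // i a u1 v1 u1V v1V.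
  by rewrite polL // !hornerE.
set U' := pol u' in u'P.
have cop : coprimep U U'.
  apply/Pdiv.ClosedField.coprimepP => r.
  rewrite UE rootZ ?lead_coef_eq0 // root_prod_XsubC => /(nthP 0) [i lt_i <-].
  exact: (u'P (Ordinal lt_i)).
have U'0 : U' != 0.
  have lt_0 : (0 < size rs)%N.
    move: su; rewrite UE size_scale ?lead_coef_eq0 // size_prod_XsubC => -[->].
    exact: leq_ltn_trans lt_d.
  by apply/eqP => E; have := u'P (Ordinal lt_0); rewrite -/U' E horner0 eqxx.
have EU : evs s U != 0 by exact: tr.
have EU' : evs s U' != 0 by exact: tr.
have u'0 : u' != 0.
  apply: contraNneq U'0 => E; apply/eqP/(evs_inj tr)/(mulfI h0).
  by rewrite -polE // E -(subr0 0) glB subrr /evs rmorph0 horner0 mulr0.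
have nu' := nondeg u'0.
(* After multiplication by the fixed factor (g0/u')^delta, each power s^i with i at most delta
   becomes an element of k[V/u']. *)
pose a (i : 'I_delta.+1) z := (lin g1 z / lin u' z) ^+ i * (lin g0 z / lin u' z) ^+ (delta - i).
have [|q [i0' qi0] qE] := surface_DEG uV u'V nu' (a := a).
  by move=> i; apply: AwM; apply: AwX; exact: Aw_lin.
pose tau := evs s U / evs s U'.
have rE : \sum_i evs tau (q i) * s ^+ i = 0.
  have gu' : gl u' != 0 by apply: contra u'0 => /eqP /(gl_eq0 nondeg) ->.
  apply: (mulIf (expf_neq0 delta (mulf_neq0 gg (invr_neq0 gu')))).
  rewrite mul0r mulr_suml.
  transitivity (ge G (fun z => \sum_i (q i).[lin u z / lin u' z] * a i z)); last first.
    by rewrite (ge_eq_on G (polyfun_lin u') nu' (g := fun=> 0)) ?ge0.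
  have geQ x y : ge G (fun z => lin x z / lin y z) = gl x / gl y by rewrite geM geV.
  rewrite ge_sum; apply: eq_bigr => i _; rewrite geM ge_horner geQ.
  have -> : ge G (a i) = (gl g1 / gl u') ^+ i * (gl g0 / gl u') ^+ (delta - i).
    by rewrite geM !geX !geQ.
  have -> : gl u / gl u' = tau.
    by rewrite (polE u) // (polE u') // /tau invfM mulrACA divff // mul1r.
  rewrite -/(evs tau (q i)) -mulrA; congr (_ * _).
  have -> : (gl g0 / gl u') ^+ delta = (gl g0 / gl u') ^+ i * (gl g0 / gl u') ^+ (delta - i).
    by rewrite -exprD subnKC // -ltnS.
  by rewrite /s /rat geQ mulrA -exprMn mulrA divfK.
pose J := (\max_i size (q i))%N.
pose Pj j : {poly k} := \sum_(i < delta.+1) (q i)`_j *: 'X^i.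
have szP j : (size (Pj j) <= delta.+1)%N.
  apply: leq_trans (size_sum _ _ _) _; apply/bigmax_leqP => i _.
  by apply: leq_trans (size_scale_leq _ _) _; rewrite size_polyXn.
have Pcoef j (i : 'I_delta.+1) : (Pj j)`_i = (q i)`_j.
  rewrite coef_sum (bigD1 i) //= coefZ coefXn eqxx mulr1 big1 ?addr0 // => l li.
  by rewrite coefZ coefXn eq_sym (_ : (l == i :> nat) = false) ?mulr0 //; exact: negbTE.
have main : \sum_(j < J) U ^+ j * U' ^+ (J - j) * Pj j = 0.
  apply: (evs_inj tr); rewrite evs_sum [RHS]/evs rmorph0 horner0.
  transitivity ((\sum_i evs tau (q i) * s ^+ i) * evs s U' ^+ J); last by rewrite rE mul0r.
  rewrite mulr_suml.
  transitivity (\sum_(j < J) \sum_(i < delta.+1) i0 (q i)`_j * tau ^+ j * s ^+ i * evs s U' ^+ J).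
    apply: eq_bigr => j _; rewrite !evsM !evsX /Pj evs_sum mulr_sumr; apply: eq_bigr => i _.
    rewrite evsZ evsX evs_polyX.
    have -> : evs s U' ^+ J = evs s U' ^+ j * evs s U' ^+ (J - j) by rewrite -exprD subnKC // ltnW.
    rewrite /tau expr_div_n.
    have := expf_neq0 j EU'; move: (evs s U ^+ j) (evs s U' ^+ j) (evs s U' ^+ (J - j)) (i0 _) (s ^+ i).
    by move=> A B C D E B0; field.
  rewrite exchange_big; apply: eq_bigr => i _; rewrite -!mulr_suml; congr (_ * _ * _).
  rewrite [RHS]/evs horner_coef size_map_poly.
  rewrite [RHS](big_ord_widen J (fun j => (map_poly i0 (q i))`_j * tau ^+ j)) ?leq_bigmax //.
  rewrite [RHS]big_mkcond; apply: eq_bigr => j _; rewrite coef_map; case: ifP => // /negbT.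
  by rewrite -leqNgt => le_j; rewrite nth_default // rmorph0 mul0r.
have exP : exists j, Pj j != 0.
  have [j qj] : exists j, (q i0')`_j != 0.
    by exists (size (q i0')).-1; rewrite -lead_coefE lead_coef_eq0.
  by exists j; apply: contra qj => /eqP E; rewrite -Pcoef E coef0.
(* All terms beyond the lowest nonzero one are divisible by a higher power of U. By coprimality U,
   of degree e, divides a nonzero polynomial of degree at most delta. *)
case: (ex_minnP exP) => j0 Pj0 jmin.
have lt_j0 : (j0 < J)%N.
  rewrite ltnNge; apply: contra Pj0 => le_J; rewrite /Pj big1 // => i _.
  by rewrite nth_default ?scale0r // (leq_trans _ le_J) // leq_bigmax.
have dv : U ^+ j0.+1 %| U ^+ j0 * (U' ^+ (J - j0) * Pj j0).
  move: main; rewrite (bigD1 (Ordinal lt_j0)) //= -mulrA => /eqP; rewrite addr_eq0 => /eqP ->.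
  rewrite -mulN1r; apply: dvdp_mull; apply: (big_ind (fun x => U ^+ j0.+1 %| x)); rewrite ?dvdp0 //.
    by move=> ? ? ? ?; apply: dvdp_add.
  move=> j jj; have [lt_j|le_j] := ltnP j j0.
    rewrite (_ : Pj j = 0) ?mulr0 ?dvdp0 //; apply/eqP; apply: contraTT lt_j => /jmin.
    by rewrite leqNgt.
  have lt_j : (j0 < j)%N by rewrite ltn_neqAle le_j andbT eq_sym.
  by rewrite -mulrA; apply: dvdp_mulr; apply: dvdp_exp2l.
move: dv; rewrite exprSr dvdp_mul2l ?expf_neq0 // Gauss_dvdpr ?coprimep_expr // => /dvdp_leq -/(_ Pj0).
by rewrite su => /leq_trans /(_ (szP j0)); rewrite ltnS leqNgt lt_d.
Qed.

Lemma polys_le g0 g1 e : g0 \in V -> g0 != 0 -> g1 \in V ->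
  transcendental i0 (rat G g1 g0) -> polys (rat G g1 g0) e -> polys (rat G g1 g0) delta.
Proof.
move=> g0V g00 g1V tr; elim: e => [|e IHe] H.
  case: H => h h0 H; exists h => // v /H [p sp vE]; exists p => //.
  exact: leq_trans sp _.
have [lt_d|le_e] := ltnP delta e.+1; first by apply: IHe; apply: degree_bound H lt_d.
case: H => h h0 H; exists h => // v /H [p sp vE]; exists p => //.
exact: leq_trans sp _.
Qed.

Definition dehom (F : {mpoly k[2]}) : {poly k} :=
  \sum_(M <- msupp F) F@_M *: 'X^(M (lift ord0 ord0)).

Lemma evs_dehom s F : evs s (dehom F) = mev (cons0 1 (fun _ : 'I_1 => s)) F.
Proof.
rewrite evs_sum /mmap; apply: eq_bigr => M _; rewrite evsZ evsX evs_polyX; congr (_ * _).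
by rewrite /mmap1 big_ord_recl big_ord1 cons00 cons0S expr1n mul1r.
Qed.

Lemma size_dehom d F : F \is d.-homog -> (size (dehom F) <= d.+1)%N.
Proof.
move=> Fd; rewrite /dehom big_seq; apply: (big_ind (fun p : {poly k} => size p <= d.+1)%N).
- by rewrite size_poly0.
- by move=> p q sp sq; rewrite (leq_trans (size_polyD _ _)) // geq_max sp.
move=> M /(dhomogP _ _ _ Fd) <-; apply: leq_trans (size_scale_leq _ _) _.
by rewrite size_polyXn ltnS /= mdegE big_ord_recl big_ord1 leq_addl.
Qed.

Lemma dehom_eq0 d F : F \is d.-homog -> dehom F = 0 -> F = 0.
Proof.
move=> Fd F0; apply/eqP; apply/negPn/negP => nF.
have [s] := mpoly_nonroot char0 (mulf_neq0 nF (mvar_neq0 k (ord0 : 'I_2))).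
rewrite mevalM mevalXU mulf_eq0 negb_or => /andP [Fs s0]; move/negP: Fs; apply.
have E c : F.@[cons0 1 (fun _ : 'I_1 => c)] = (dehom F).[c].
  rewrite mevalE horner_sum; apply: eq_bigr => M _; rewrite hornerZ hornerXn; congr (_ * _).
  by rewrite big_ord_recl big_ord1 cons00 cons0S expr1n mul1r.
rewrite (meval_eq (v2 := fun i => s ord0 * cons0 1 (fun _ : 'I_1 => s (lift ord0 ord0) / s ord0) i)).
  by rewrite (homog_scale _ _ Fd) E F0 horner0 mulr0.
move=> i; case: (unliftP ord0 i) => [j|] ->; last by rewrite cons00 mulr1.
by rewrite cons0S [j]ord1 mulrC divfK.
Qed.

(** V and the polynomials of degree at most delta both have dimension delta + 1, so the inclusion
    coming from [polys_le] is an equality. *)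
Lemma VSK_base : exists h (b : 'I_2 -> G), VSK delta V h b.
Proof.
have [g0 [g1 [e [g0V g00 g1V tr H]]]] := polys_exists.
have {H} := polys_le g0V g00 g1V tr H; set s := rat G g1 g0 in tr * => -[h h0 hV].
exists h, (cons0 1 (fun=> s)); apply: VSK_of_dim => //; last by rewrite dV bin1.
  have ev0 : evs s 0 = 0 by rewrite /evs rmorph0 horner0.
  by move=> d F Fd; rewrite -evs_dehom -ev0 => /(evs_inj tr) /(dehom_eq0 Fd).
move=> F Fd.
have vV (i : 'I_(\dim V)) : (vbasis V)`_i \in V by rewrite vbasis_mem // mem_nth // size_tuple.
have /choice [pol polP] : forall i : 'I_(\dim V), exists p : {poly k},
    (size p <= delta.+1)%N /\ gl (vbasis V)`_i = h * evs s p.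
  by move=> i; have [p ? ?] := hV _ (vV i); exists p.
have glE (c : 'I_(\dim V) -> k) : gl (\sum_i c i *: (vbasis V)`_i) = h * evs s (\sum_i c i *: pol i).
  rewrite gl_sum evs_sum mulr_sumr; apply: eq_bigr => i _.
  by rewrite evsZ mulrCA; case: (polP i) => _ ->.
pose M : 'M[k]_(\dim V, delta.+1) := \matrix_(i, j) (pol i)`_j.
have polM (c : 'rV[k]_(\dim V)) (q : {poly k}) : (size q <= delta.+1)%N ->
    c *m M = \row_j q`_j -> \sum_i c 0 i *: pol i = q.
  move=> sq cM; apply/polyP => j; rewrite coef_sum; have [lt_j|le_j] := ltnP j delta.+1.
    move/rowP: cM => /(_ (Ordinal lt_j)); rewrite !mxE /= => <-.
    by apply: eq_bigr => i _; rewrite coefZ mxE.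
  rewrite [RHS]nth_default ?(leq_trans sq) // big1 // => i _.
  by rewrite coefZ nth_default ?mulr0 // (leq_trans _ le_j) //; case: (polP i).
have fM : row_free M.
  rewrite -kermx_eq0; apply/rowV0P => c /sub_kermxP cM.
  have /(polM c 0%R) E : (size (0%R : {poly k}) <= delta.+1)%N by rewrite size_poly0.
  have {}E : \sum_i c 0 i *: pol i = 0.
    by apply: E; rewrite cM; apply/rowP => j; rewrite !mxE coef0.
  have := glE (fun i => c 0 i); rewrite E /evs rmorph0 horner0 mulr0 => /(gl_eq0 nondeg) u0.
  have /freeP fr := basis_free (vbasisP V); apply/rowP => j.
  by rewrite mxE; apply: (fr (fun j => c 0 j)).
have /submxP [c cE] : (\row_j (dehom F)`_j <= M)%MS.
  by apply: submx_full; rewrite /row_full (eqP fM) dV.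
exists (\sum_i c 0 i *: (vbasis V)`_i); first by apply: memv_suml => i _; apply: memvZ.
by rewrite glE -evs_dehom (polM c (dehom F)) // ?size_dehom.
Qed.
End Base.

(** * The inductive step *)

Section Dense.
Variables (k : fieldType) (n : nat) (P : set 'rV[k]_n).
Hypothesis nondeg : forall u, u != 0 -> nz P (lin u).
Variable U : set_system 'rV[k]_n.
Hypothesis UU : UltraFilter U.
Hypothesis UP : forall d q, polyfun d q -> nz P q -> U [set v | P v /\ q v != 0].

Lemma gen_ultra (R : 'rV[k]_n -> Prop) : gen P R -> U [set z | P z /\ R z].
Proof.
move=> [d [q [pq nq H]]]; apply: filterS (UP pq nq) => z [Pz qz].
by split=> //; exact: H.
Qed.

Lemma ultra_notn (A : set 'rV[k]_n) : ~ U A -> U (~` A).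
Proof. by case: (in_ultra_setVsetC A UU). Qed.

Lemma lin_sep (W : {vspace 'rV[k]_n}) x : x \notin W ->
  exists2 l : 'rV[k]_n, lin l x != 0 & forall v, v \in W -> lin l v = 0.
Proof.
move=> xW; pose B : 'M[k]_(\dim W, n) := \matrix_(i, j) (vbasis W)`_i 0 j.
have mulB (c : 'rV[k]_(\dim W)) : c *m B = \sum_i c 0 i *: (vbasis W)`_i.
  by apply/rowP => j; rewrite mxE summxE; apply: eq_bigr => i _; rewrite !mxE.
have : ~~ (x <= B)%MS.
  apply: contra xW => /submxP [c ->]; rewrite mulB; apply: memv_suml => i _.
  by apply: memvZ; rewrite vbasis_mem // mem_nth // size_tuple.
rewrite submxE => /eqP/rowP xB.
have [j xBj] : exists j, (x *m cokermx B) 0 j != 0.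
  by apply: contrapT => H; apply: xB => j; rewrite [RHS]mxE; apply/eqP; apply: contrapT => /negP E; apply: H; exists j.
exists (\row_i cokermx B i j).
  by move: xBj; rewrite mxE linC; congr (_ != 0); apply: eq_bigr => i _; rewrite mxE.
move=> v vW; have : v *m cokermx B = 0.
  have -> : v = (\row_i coord (vbasis W) i v) *m B.
    by rewrite mulB {1}(coord_vbasis vW); apply: eq_bigr => i _; rewrite mxE.
  by rewrite -mulmxA mulmx_coker mulmx0.
move/rowP/(_ j); rewrite mxE [RHS]mxE => E; rewrite linC -[RHS]E.
by apply: eq_bigr => i _; rewrite mxE.
Qed.

(* The y at which almost all the u z vanish form a proper linear subspace. *)
Lemma ultra_nonvanishing (u : 'rV[k]_n -> 'rV[k]_n) : U [set z | u z != 0] ->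
  gen P (fun y => U [set z | lin (u z) y != 0]).
Proof.
move=> Uu; pose N y := U [set z | lin (u z) y = 0].
have [||W WN] := @vspace_of_closed _ _ N.
- by apply: filterS filterT => z _ /=; rewrite linC lin0l.
- move=> a v v' Nv Nv'; apply: filterS (filterI Nv Nv') => z [/= E E'].
  by rewrite linDr linZr E E' mulr0 addr0.
have WT : W != fullv.
  apply/eqP => WT.
  have : U [set z | forall i : 'I_n, lin (u z) (delta_mx 0 i) = 0].
    by apply: filter_forall => i; apply/WN; rewrite WT memvf.
  move=> H; have [z [/eqP uz Hz]] := filter_ex (filterI Uu H); apply: uz; apply/rowP => i.
  by rewrite mxE -(Hz i) linC lin_delta.
have [x xW] : exists x, x \notin W.
  apply: contrapT => H; case/negP: WT; rewrite eqEsubv subvf /=; apply/subvP => v _.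
  by apply: contrapT => /negP nv; apply: H; exists v.
have [l lx lW] := lin_sep xW.
have l0 : l != 0 by apply: contraNneq lx => ->; rewrite lin0l.
apply: gen_imp (gen_nz (polyfun_lin l) (nondeg l0)) => y _ ly.
have nN : ~ N y by move/WN/lW/eqP; rewrite (negbTE ly).
by apply: filterS (ultra_notn nN) => z /= /eqP.
Qed.
End Dense.

(** The Vandermonde matrix of the distinct t i is invertible, and its inverse recovers each
    coefficient from the given values. *)
Lemma vandermonde_extract (k K : fieldType) (i0 : {rmorphism k -> K}) (S : K -> Prop) N
    (g : 'I_N -> K) (t : 'I_N -> k) : S 0 ->
  (forall a x y, S x -> S y -> S (i0 a * x + y)) -> injective t ->
  (forall i, S (\sum_(f < N) i0 (t i ^+ f) * g f)) -> forall f, S (g f).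
Proof.
move=> S0 SD tinj H f.
have Ssum (I : finType) (c : I -> k) (x : I -> K) : (forall i, S (x i)) -> S (\sum_i i0 (c i) * x i).
  by move=> Sx; apply: big_rec => // i y _ Sy; apply: SD.
pose M := Vandermonde N (\row_i t i).
have uM : M \in unitmx.
  rewrite unitmxE unitfE det_Vandermonde; apply/prodf_neq0 => i _; apply/prodf_neq0 => j ij.
  by rewrite !mxE subr_eq0 (inj_eq tinj) neq_ltn ij orbT.
have -> : g f = \sum_i i0 (invmx M i f) * \sum_(f' < N) i0 (t i ^+ f') * g f'.
  under eq_bigr => i _ do rewrite mulr_sumr.
  rewrite exchange_big /= (bigD1 f) //= [X in _ + X]big1 ?addr0 => [|f' f'f].
    have /matrixP /(_ f f) := mulmxV uM; rewrite !mxE eqxx => /(congr1 i0).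
    rewrite rmorph1 rmorph_sum => E; rewrite -[LHS]mul1r -E mulr_suml; apply: eq_bigr => i _.
    by rewrite !mxE rmorphM mulrA [i0 (invmx _ _ _) * _]mulrC.
  have /matrixP /(_ f' f) := mulmxV uM; rewrite !mxE (negbTE f'f) => /(congr1 i0) E.
  transitivity (i0 (\sum_j M f' j * invmx M j f) * g f'); last by rewrite E rmorph0 mul0r.
  rewrite rmorph_sum mulr_suml; apply: eq_bigr => i _.
  by rewrite !mxE rmorphM mulrA [i0 (invmx _ _ _) * _]mulrC.
exact: Ssum.
Qed.

Section Powers.
Variables (k : closedFieldType) (K : fieldType) (i0 : {rmorphism k -> K}) (S : K -> Prop).
Hypothesis char0 : [pchar k] =i pred0.
Hypotheses (S0 : S 0) (SD : forall a x y, S x -> S y -> S (i0 a * x + y)).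

Lemma SZ a x : S x -> S (i0 a * x).
Proof. by move=> Sx; rewrite -[X in S X]addr0; apply: SD. Qed.

(** Expand the powers as polynomials in t i and extract coefficients; the binomial coefficients are
    invertible in characteristic 0. *)
Lemma power_extract N h x y (t : 'I_N.+1 -> k) : injective t ->
  (forall i, S (h * (x + i0 (t i) * y) ^+ N)) ->
  forall f, (f <= N)%N -> S (h * (x ^+ (N - f) * y ^+ f)).
Proof.
move=> tinj H f le_f.
have bin0' : ('C(N, f)%:R : k) != 0.
  by apply/eqP => /(@natr_inj0 _ char0 _ 0%N) /eqP; rewrite eqn0Ngt bin_gt0 le_f.
have := vandermonde_extract (S := S) (i0 := i0)
  (g := fun f : 'I_N.+1 => h * (x ^+ (N - f) * y ^+ f *+ 'C(N, f))) S0 SD tinj.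
move=> /(_ _ (Ordinal (le_f : (f < N.+1)%N))) /= E.
have -> : h * (x ^+ (N - f) * y ^+ f) =
    i0 ('C(N, f)%:R^-1) * (h * (x ^+ (N - f) * y ^+ f *+ 'C(N, f))).
  rewrite -[_ * _ *+ _]mulr_natr fmorphV rmorph_nat; rewrite -(fmorph_eq0 i0) rmorph_nat in bin0'.
  by move: bin0'; move: (_ ^+ _) (_ ^+ _) (_%:R) => A C D D0; field.
apply: SZ; apply: E => i; have := H i; rewrite exprDn mulr_sumr; congr S; apply: eq_bigr => g _.
rewrite exprMn rmorphXn !mulrnAr; congr (_ *+ _).
by move: (x ^+ _) (i0 _ ^+ _) (y ^+ _) => A C D; ring.
Qed.

(* h y^(d - e) M is a section for all linear y and monomials M of degree e in
   the first l variables, by induction on l *)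
Lemma powers_span m d h (b : 'I_m -> K) :
  (forall c, S (h * lcomb i0 c b ^+ d)) ->
  forall F : {mpoly k[m]}, F \is d.-homog -> S (h * mmap i0 b F).
Proof.
move=> H.
have main l (M : 'I_m -> nat) c : (\sum_(i < m | (i < l)%N) M i <= d)%N ->
    S (h * (lcomb i0 c b ^+ (d - \sum_(i < m | (i < l)%N) M i) * \prod_(i < m | (i < l)%N) b i ^+ M i)).
  elim: l c => [|l IHl] c; first by rewrite !big_pred0 // subn0 mulr1.
  have [lt_l|le_m] := ltnP l m; last first.
    have E (i : 'I_m) : (i < l.+1)%N = (i < l)%N.
      by rewrite ltnS leq_eqVlt (ltn_eqF (leq_trans (ltn_ord i) le_m)).
    by under eq_bigl => i do rewrite E; under [X in _ * (_ * X)]eq_bigl => i do rewrite E; apply: IHl.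
  pose o := Ordinal lt_l.
  have E (i : 'I_m) : (i < l.+1)%N && (i != o) = (i < l)%N.
    by rewrite ltnS andbC ltn_neqAle -val_eqE.
  rewrite (bigD1 o) ?ltnS //= [X in _ * (_ * X)](bigD1 o) ?ltnS //=.
  under eq_bigl => i do rewrite E; under [X in _ * (_ * (_ * X))]eq_bigl => i do rewrite E.
  set D := (\sum_(i < m | (i < l)%N) M i)%N; set B := \prod_(i < m | (i < l)%N) _ => le_d.
  have le_D : (D <= d)%N by apply: leq_trans le_d; rewrite leq_addl.
  have le_M : (M o <= d - D)%N by rewrite leq_subRL // addnC.
  have tinj' : injective (fun i : 'I_(d - D).+1 => (i : nat)%:R : k).
    by move=> i j /(natr_inj0 char0) /val_inj.
  have := power_extract (N := d - D) (h := h * B) (x := lcomb i0 c b) (y := b o) tinj' _ le_M.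
  rewrite -subnDA [(D + _)%N]addnC mulrA -[h * _ * _]mulrA [B * _]mulrC => X.
  rewrite [X in S X](_ : _ = h * (lcomb i0 c b ^+ (d - (M o + D)) * B) * b o ^+ M o); last by ring.
  apply: X => i; have := IHl (fun j => c j + (i : nat)%:R * (j == o)%:R) le_D.
  rewrite lcombD lcombZ (_ : lcomb _ (fun j => (j == o)%:R) b = b o).
    by rewrite [_ ^+ _ * B]mulrC mulrA.
  rewrite /lcomb (bigD1 o) //= eqxx rmorph1 mul1r big1 ?addr0 // => j /negbTE ->.
  by rewrite rmorph0 mul0r.
move=> F Fd; rewrite /mmap mulr_sumr big_seq.
apply: (big_ind S) => // [x y Sx Sy|M /(dhomogP _ _ _ Fd) Md].
  by rewrite -[x]mul1r -(rmorph1 i0); apply: SD.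
rewrite mulrCA; apply: SZ.
have E : (\sum_(i < m | (i < m)%N) M i)%N = d.
  by rewrite -Md /= mdegE; apply: eq_bigl => i; rewrite ltn_ord.
have := main m M (fun=> 0); rewrite E subnn expr0 mul1r => /(_ (leqnn d)).
by congr (S (h * _)); apply: eq_bigl => i; rewrite ltn_ord.
Qed.
End Powers.

(** * Gluing osculating systems at several points *)

Section Gluing.
Variables (k : closedFieldType) (n delta : nat) (P : set 'rV[k]_n) (G : genf P).
Hypotheses (char0 : [pchar k] =i pred0) (iP : irr P) (cP : ccl P) (d0 : (0 < delta)%N).
Hypothesis nondeg : forall u, u != 0 -> nz P (lin u).
Hypothesis cov : gen P (fun x => good delta P x).

Let i0 : {rmorphism k -> G} := iota G.
Local Notation mev := (mmap i0).
Local Notation gl := (gl G).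
Local Notation VSK := (VSK delta).
Local Notation isvpt := (isvpt delta).
Local Notation lcomb := (lcomb i0).
Local Notation lspan := (lspan i0).

Section Step.
Variables (V : {vspace 'rV[k]_n}) (w : 'rV[k]_n) (m : nat).
Hypotheses (wV : w \in V) (w0 : w != 0) (td : tdle P m.+2 V).
Local Notation O x := (osc P V w x delta).

Definition nice x := [/\ P x, good delta P x, lin w x != 0 &
  exists h (b : 'I_m.+2 -> G), VSK (O x) h b].

(* O x and O z meet in a system of the same kind, so h can be taken to be the
   same for both *)
Lemma adjacent x z h (b : 'I_m.+2 -> G) e : nice x -> nice z -> VSK (O x) h b ->
  isvpt (O x) h b z e -> (exists2 u, u \in O x & lin u z != 0) ->
  (exists2 u, u \in O z & lin u x != 0) ->
  exists (b' : 'I_m.+2 -> G) e', [/\ VSK (O z) h b', isvpt (O z) h b' x e' &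
    forall X, (exists2 c, dot c e = 0 & X = lcomb c b) <->
              (exists2 c, dot c e' = 0 & X = lcomb c b')].
Proof.
move=> [Px gx wx _] [Pz gz wz [hz [bz VKz]]] VKx ez Oxz Ozx.
have [f fx] := VSK_pt d0 nondeg VKz Px.
have [b1 VK1 S1] := VSK_osc char0 iP d0 nondeg cov wV VKx (osc_sub _ _ _ _ _) Pz wz gz ez Oxz.
have [b2 VK2 S2] := VSK_osc char0 iP d0 nondeg cov wV VKz (osc_sub _ _ _ _ _) Px wx gx fx Ozx.
rewrite capvC in VK2; have sub : (O x :&: O z <= V)%VS.
  by apply: subv_trans (osc_sub P V w x delta); exact: capvSl.
have [c [kap [c0 k0 E S12]]] := VSK_sym char0 iP d0 nondeg cov wV w0 VK1 VK2 sub.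
have [hz0 _ _ _ _] := VKz.
have VKz' := VSK_scale VKz hz0 c0 k0 E.
have [rho rhoE] : exists rho, rho ^+ delta = kap.
  have [r] := solve_monicpoly (fun l => if l == 0%N then kap else 0) d0.
  rewrite -(prednK d0) big_ord_recl /= expr0 mulr1 big1 ?addr0 => [E'|l _]; first by exists r.
  by rewrite mul0r.
have rho0 : rho != 0 by apply: contraNneq k0 => r0; rewrite -rhoE r0 expr0n (gtn_eqF d0).
exists (fun i => c * bz i), (fun i => rho * f i); split=> //.
  move=> u F uV Fd uE; rewrite (homog_scale _ _ Fd) rhoE -mevalZ.
  apply: (fx u _ uV); first exact: rpredZ.
  by rewrite uE mmapZ (mev_scale _ _ _ Fd) mulrA E -mulrA mulrCA.
have lE s : lcomb s (fun i => c * bz i) = c * lcomb s bz.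
  by rewrite /lcomb mulr_sumr; apply: eq_bigr => i _; rewrite mulrCA.
have dE s : dot s (fun i => rho * f i) = rho * dot s f.
  by rewrite /dot mulr_sumr; apply: eq_bigr => i _; rewrite mulrCA.
move=> X; split.
  move/S1 => H; have /S12 : lspan b1 (c * (X / c)) by rewrite mulrC divfK.
  move/S2 => [s sf sE]; exists s; first by rewrite dE sf mulr0.
  by rewrite lE -sE mulrC divfK.
move=> [s sf ->]; apply/S1; rewrite lE; apply/S12/S2; exists s => //.
by move/eqP: sf; rewrite dE mulf_eq0 (negbTE rho0) => /eqP.
Qed.

Section Frame.
Variable U : set_system 'rV[k]_n.
Hypothesis UU : UltraFilter U.
Hypothesis UP : forall d q, polyfun d q -> nz P q -> U [set v | P v /\ q v != 0].

Variables (x y : 'rV[k]_n) (h : G) (b : 'I_m.+2 -> G) (by_ : 'I_m.+2 -> G).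
Variables (ex ey : 'I_m.+2 -> k) (s0 : 'I_m.+2 -> k).
Hypotheses (nx : nice x) (ny : nice y).
Hypotheses (VKx : VSK (O x) h b) (VKy : VSK (O y) h by_).
Hypotheses (exy : isvpt (O x) h b y ex) (eyx : isvpt (O y) h by_ x ey).
Hypothesis Sxy : forall X, (exists2 c, dot c ex = 0 & X = lcomb c b) <->
                           (exists2 c, dot c ey = 0 & X = lcomb c by_).
Hypotheses (Oxy : exists2 u, u \in O x & lin u y != 0) (Oyx : exists2 u, u \in O y & lin u x != 0).
Hypothesis Unice : U [set z | nice z /\ ((exists2 u, u \in O z & lin u x != 0) /\
  (exists2 u, u \in O z & lin u y != 0))].

(** To the basis b at x one element of the span of [by_] is added, which lies outside the common
    hyperplane if [dot s0 ey != 0]. These m + 3 germs are the candidate linear forms for V. *)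
Definition frame : 'I_m.+3 -> G := cons0 (lcomb s0 by_) b.

Lemma lcomb_frame c : lcomb c frame =
  i0 (c ord0) * lcomb s0 by_ + lcomb (fun j => c (lift ord0 j)) b.
Proof.
rewrite {1}/lcomb big_ord_recl; congr (_ + _); first by rewrite /frame cons00.
by apply: eq_bigr => j _; rewrite /frame cons0S.
Qed.

Definition power c := exists2 u, u \in V & gl u = h * lcomb c frame ^+ delta.

(* eps is the equation of the hyperplane of k^(m+3) attached to z *)
Definition hyp z (eps : 'I_m.+3 -> k) := [/\ nice z, (exists2 u, u \in O x & lin u z != 0),
  isvpt (O x) h b z (fun j => eps (lift ord0 j)) & forall c, dot c eps = 0 -> power c].

(** For almost all z the system at z can be normalized against x and against y with the same h. By
    [VSK_same_h] both normalizations have the same span, which contains a hyperplane of the span of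
    b and an element involving the added germ: together a hyperplane of the frame. *)
Lemma hyp_exists : U [set z | exists eps, hyp z eps].
Proof.
have [ux uxO ux0] := VSK_nz VKx; have [uy uyO uy0] := VSK_nz VKy.
have [l [le Gl]] := VSK_indep_pt d0 nondeg VKy (isvpt_neq0 d0 VKy eyx Oyx).
have G1 := gen_and iP Gl (gen_and iP (gen_nz (polyfun_lin ux) (nondeg ux0))
  (gen_nz (polyfun_lin uy) (nondeg uy0))).
apply: filterS (filterI Unice (gen_ultra UU UP G1)) => z [[nZ [Ozx Ozy]] [Pz [Hl [uxz uyz]]]].
have Oxz : exists2 u, u \in O x & lin u z != 0 by exists ux.
have Oyz : exists2 u, u \in O y & lin u z != 0 by exists uy.
have [e ez] := VSK_pt d0 nondeg VKx Pz; have [f fz] := VSK_pt d0 nondeg VKy Pz.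
have lf := Hl f fz.
have [b1 [e1 [VK1 _ S1]]] := adjacent nx nZ VKx ez Oxz Ozx.
have [b2 [e2 [VK2 _ S2]]] := adjacent ny nZ VKy fz Oyz Ozy.
(* t makes s vanish at f, the source point of z seen from y. As l vanishes at ey, the correction
   [t * l] stays within the span of b. *)
pose t := - (dot s0 f / dot l f).
pose s j := s0 j + t * l j.
have sf : dot s f = 0 by rewrite dotDl dotZl mulNr divfK // subrr.
have [c _ cE] : exists2 c, dot c ex = 0 & i0 t * lcomb l by_ = lcomb c b.
  by apply/Sxy; exists (fun j => t * l j); rewrite ?lcombZ // dotZl le mulr0.
have dE : lcomb s by_ = lcomb s0 by_ + lcomb c b by rewrite lcombD lcombZ cE.
(* With this first coordinate, a vector killed by the equation splits into a multiple of
   [lcomb s by_] and a combination of b that vanishes at e. *)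
exists (cons0 (- dot c e) e); split=> //.
  by move=> u F uV Fd uE; rewrite (ez u F uV Fd uE); apply: meval_eq => j; rewrite cons0S.
move=> a; rewrite {1}/dot big_ord_recl cons00 => ae.
pose a' j := a (lift ord0 j) + - a ord0 * c j.
have a'e : dot a' e = 0.
  rewrite dotDl dotZl mulNr; move: ae; rewrite mulrN addrC.
  by under eq_bigr => j _ do rewrite cons0S.
have aE : lcomb a frame = i0 (a ord0) * lcomb s by_ + lcomb a' b.
  rewrite lcomb_frame dE mulrDr lcombD lcombZ rmorphN mulNr.
  by rewrite -addrA; congr (_ + _); rewrite addrCA subrr addr0.
have sp1 : lspan b1 (lcomb a' b).
  by have /S1 [a1 _ ->] : exists2 c, dot c e = 0 & lcomb a' b = lcomb c b; [exists a'|exists a1].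
have sp2 : lspan b1 (lcomb s by_).
  apply: (VSK_same_h char0 iP d0 nondeg cov wV w0 VK2 VK1 (osc_sub _ _ _ _ _)).
  by have /S2 [a2 _ ->] : exists2 c, dot c f = 0 & lcomb s by_ = lcomb c by_; [exists s|exists a2].
have [a3 a3E] : lspan b1 (lcomb a frame).
  by rewrite aE; apply: lspanD => //; apply: lspanZ.
have [u uO [uE _]] := VSK_pow a3 VK1.
by exists u; [exact: (subvP (osc_sub P V w z delta))|rewrite a3E].
Qed.

Lemma hyp_indep z eps : hyp z eps -> exists2 l, dot l eps = 0 &
  U [set z' | forall eps', hyp z' eps' -> dot l eps' != 0].
Proof.
move=> [_ Oxz ez _].
have [l [le Gl]] := VSK_indep_pt d0 nondeg VKx (isvpt_neq0 d0 VKx ez Oxz).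
have dE eps' : dot (cons0 0 l) eps' = dot l (fun j => eps' (lift ord0 j)).
  rewrite /dot big_ord_recl cons00 mul0r add0r.
  by apply: eq_bigr => j _; rewrite cons0S.
exists (cons0 0 l); first by rewrite dE.
apply: filterS (gen_ultra UU UP Gl) => z' [_ H] eps' [_ _ ez' _].
by rewrite dE; apply: H.
Qed.

(** Hyperplanes are added one at a time: being distinct from each of the finitely many earlier ones
    holds for almost all z. *)
Lemma hyps_exist N : exists eps : nat -> 'I_m.+3 -> k,
  (forall i, (i < N)%N -> exists z, hyp z (eps i)) /\
  forall i j, (i < j < N)%N -> exists2 l, dot l (eps i) = 0 & dot l (eps j) != 0.
Proof.
elim: N => [|N [eps [H1 H2]]].
  by exists (fun _ _ => 0); split=> // i j; rewrite ltn0 andbF.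
have /choice [l lP] : forall i : 'I_N, exists l, dot l (eps i) = 0 /\
    U [set z' | forall eps', hyp z' eps' -> dot l eps' != 0].
  by move=> i; have [z /hyp_indep [l ? ?]] := H1 i (ltn_ord i); exists l.
have UA : U [set z' | forall (i : 'I_N) eps', hyp z' eps' -> dot (l i) eps' != 0].
  by apply: filter_forall => i; case: (lP i).
have [z [[e he] Hz]] := filter_ex (filterI hyp_exists UA).
exists (fun i => if (i < N)%N then eps i else e); split=> i.
  by case: ifP => [lt_i _|_ _]; [exact: H1|exists z].
move=> j /andP [lt_ij]; rewrite ltnS leq_eqVlt => /orP [/eqP jN|lt_j].
  rewrite jN ltnn -jN lt_ij; rewrite jN in lt_ij.
  by exists (l (Ordinal lt_ij)); [case: (lP (Ordinal lt_ij))|exact: Hz].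
by rewrite lt_j (ltn_trans lt_ij lt_j); apply: H2; rewrite lt_ij.
Qed.

Let S X := exists2 u, u \in V & gl u = X.

Let S0 : S 0.
Proof. by exists 0; [exact: mem0v|rewrite -(subr0 0) glB subrr]. Qed.

Let SD a X Y : S X -> S Y -> S (i0 a * X + Y).
Proof.
move=> [u uV <-] [v vV <-]; exists (a *: u + v); first by rewrite memvD // memvZ.
have := gl_sum G [:: true; false] (fun c : bool => if c then a else 1) (fun c : bool => if c then u else v).
by rewrite !big_cons !big_nil !addr0 scale1r rmorph1 mul1r.
Qed.

(** Some d makes the line c + t d meet delta + 1 of the hyperplanes at distinct parameters. The
    powers at these points are in V, and the coefficient of t^0 in them is the power of c. *)
Lemma power_all c : power c.
Proof.
have [eps [H1 H2]] := hyps_exist delta.+1.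
have [[i [lt_i ci]]|nc] := pselect (exists i, (i < delta.+1)%N /\ dot c (eps i) = 0).
  by have [z [_ _ _]] := H1 i lt_i; apply.
have {}nc (i : 'I_delta.+1) : dot c (eps i) != 0.
  by apply/eqP => ci; apply: nc; exists i; split.
pose T := ('I_delta.+1 * 'I_delta.+1)%type.
(* A diagonal pair requires d to lie off a hyperplane, an off-diagonal pair that two hyperplanes be
   met at different parameters. *)
pose f (p : T) (v : 'rV[k]_m.+3) := if p.1 == p.2 then dot (v 0) (eps p.1) else
  dot c (eps p.1) * dot (v 0) (eps p.2) - dot c (eps p.2) * dot (v 0) (eps p.1).
have dotL a (u v : 'rV[k]_m.+3) e : dot ((a *: u + v) 0) e = a * dot (u 0) e + dot (v 0) e.
  rewrite -dotZl -dotDl; apply: eq_bigr => i _; by rewrite !mxE.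
have dotR (l : 'I_m.+3 -> k) e : dot ((\row_j l j) 0) e = dot l e.
  by apply: eq_bigr => i _; rewrite mxE.
have [||v _ Hv] := @vspace_avoid _ _ (@fullv _ 'rV[k]_m.+3) #|{: T}| (fun i => f (enum_val i)) char0.
- move=> i a u v _ _; rewrite /f; case: (enum_val i) => p q /=; case: eqP => _; rewrite !dotL //.
  by move: (dot _ _) (dot _ _) (dot _ _) (dot _ _) (dot _ _) (dot _ _) => A B C D E F; ring.
- move=> i; rewrite /f; case: (enum_val i) => p q /=; case: eqVneq => [_|pq].
    have [z [_ Oxz ez _]] := H1 p (ltn_ord p).
    have [j ej] := isvpt_neq0 d0 VKx ez Oxz.
    exists (\row_l (l == lift ord0 j)%:R); first exact: memvf.
    rewrite dotR /dot (bigD1 (lift ord0 j)) //= eqxx mul1r big1 ?addr0 // => l /negbTE ->.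
    by rewrite mul0r.
  have [lt_pq|lt_qp|E] := ltngtP p q; last by rewrite (val_inj E) eqxx in pq.
    have [|l lp lq] := H2 p q; first by rewrite lt_pq ltn_ord.
    by exists (\row_j l j); [exact: memvf|rewrite !dotR lp mulr0 subr0 mulf_neq0].
  have [|l lq lp] := H2 q p; first by rewrite lt_qp ltn_ord.
  by exists (\row_j l j); [exact: memvf|rewrite !dotR lq mulr0 sub0r oppr_eq0 mulf_neq0].
pose d := v 0.
have dn (i : 'I_delta.+1) : dot d (eps i) != 0.
  by have := Hv (enum_rank ((i, i) : T)); rewrite enum_rankK /f /= eqxx.
pose t (i : 'I_delta.+1) := - (dot c (eps i) / dot d (eps i)).
have tinj : injective t.
  move=> i j /oppr_inj E; apply/eqP; apply/negPn/negP => ij.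
  have := Hv (enum_rank ((i, j) : T)); rewrite enum_rankK /f /= (negbTE ij) subr_eq0 => /eqP; apply.
  by rewrite -[dot c (eps i)](divfK (dn i)) E mulrAC divfK.
have := power_extract char0 S0 SD (h := h) (x := lcomb c frame) (y := lcomb d frame) tinj _ (leq0n _).
rewrite subn0 expr0 mulr1; apply=> i.
have [z [_ _ _ Hz]] := H1 i (ltn_ord i).
have [|u uV uE] := Hz (fun j => c j + t i * d j).
  by rewrite dotDl dotZl mulNr divfK // subrr.
by exists u => //; rewrite uE lcombD lcombZ.
Qed.

Lemma forms_all F : F \is delta.-homog -> exists2 u, u \in V & gl u = h * mev frame F.
Proof. by apply: (powers_span char0 S0 SD) => c; exact: power_all. Qed.

Hypothesis s0y : dot s0 ey != 0.

(** Write c0 for [lcomb s0 by_]. By [core], a relation would make h b0^(delta-1) c0 proportional to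
    h b0^delta on a curve through x, and then h c0^delta as well. But h b0^delta has contact delta
    with x, while h c0^delta is nonzero there because [dot s0 ey != 0]. *)
Lemma frame_indep : hai i0 frame.
Proof.
move=> d F Fd F0; apply/eqP; apply/negPn/negP => nF.
have [h0 hb _ _ FVx] := VKx; have [Px gx wx _] := nx.
pose b0 := b ord0; have b00 : b0 != 0.
  apply: contraTneq (mvar_neq0 k (ord0 : 'I_m.+2)) => E; rewrite negbK.
  by apply/eqP/(hb 1%N); rewrite ?mmapX ?mmap1U // dhomogX /= mdeg1.
pose g := h * b0 ^+ delta.-1; have g0 : g != 0 by rewrite mulf_neq0 ?expf_neq0.
have Xd l (j i : 'I_l) : ('X_i ^+ delta.-1 * 'X_j : {mpoly k[l]}) \is delta.-homog.
  have X1 : ('X_j : {mpoly k[l]}) \is 1.-homog by rewrite dhomogX /= mdeg1.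
  have Xp : ('X_i ^+ delta.-1 : {mpoly k[l]}) \is delta.-1.-homog.
    by rewrite -[X in X.-homog]mul1n; apply: dhomogMn; rewrite dhomogX /= mdeg1.
  by have := dhomogM Xp X1; rewrite addn1 prednK.
have /choice [us usP] : forall j, exists u, u \in O x /\ gl u = g * b j.
  move=> j; have [u uO uE] := FVx _ (Xd _ j ord0); exists u; split=> //.
  by rewrite uE rmorphM rmorphXn /= !mmapX !mmap1U /g mulrA.
have [v vV vE] := forms_all (Xd _ ord0 (lift ord0 ord0)).
have {}vE : gl v = g * lcomb s0 by_.
  by rewrite vE rmorphM rmorphXn /= !mmapX !mmap1U /frame cons00 cons0S /g mulrA.
have [u uO [uE uz]] := VSK_pow s0 VKy.
have ux : lin u x != 0 by rewrite (uz x ey eyx) expf_neq0.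
have ind : indep P us.
  move=> e H He H0; apply: contrapT => /nzPn E; move/eqP: H0; apply; apply: (hb e) => //.
  have : ge G (fun z => H.@[fun j => lin (us j) z]) = 0.
    by rewrite (ge_eq_on G (polyfun_lin w) (nondeg w0) (g := fun=> 0)) ?ge0 // => z Pz _; apply: E.
  rewrite (ge_comp G H (fun j => lin (us j))) (@eq_mev _ _ i0 _ _ (fun j => g * b j)); last first.
    by move=> j; case: (usP j).
  by rewrite (mev_scale _ _ _ He) => /eqP; rewrite mulf_eq0 expf_eq0 (negbTE g0) andbF => /eqP.
have rel z : P z -> F.@[cons0 (lin v z) (fun j => lin (us j) z)] = 0.
  move: z; apply: (ge_eq0 (g0 := G) (d := d)).
    apply: polyfun_ext (polyfun_lins (cons0 v us) Fd) => z; apply: meval_eq => i.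
    by rewrite /cons0; case: (unlift ord0 i).
  rewrite (ge_comp G F (fun i z => cons0 (lin v z) (fun j => lin (us j) z) i)).
  rewrite (@eq_mev _ _ i0 _ _ (fun j => g * frame j)) ?(mev_scale _ _ _ Fd) ?F0 ?mulr0 // => i.
  case: (unliftP ord0 i) => [j|] ->; rewrite /frame ?cons0S ?cons00.
    rewrite -[RHS](proj2 (usP j)); congr (ge G _); apply/funext => z; by rewrite cons0S.
  by rewrite -vE; congr (ge G _); apply/funext => z; rewrite cons00.
have [y' [Q [gQ nuQ [c cE]]]] := core char0 iP d0 Px wV wx gx (fun j => proj1 (usP j)) ind Fd nF rel.
have [iQ QP Qx _ _] := gQ.
have rel2 z : P z -> lin u z * lin (us ord0) z ^+ delta.-1 = lin v z ^+ delta.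
  move=> Pz; apply/eqP; rewrite -subr_eq0; apply/eqP; move: z Pz; apply: (ge_eq0 (g0 := G) (d := delta)).
    have pX r e : polyfun e (fun z : 'rV[k]_n => lin r z ^+ e).
      by rewrite -[X in polyfun X]mul1n; apply: polyfunX; exact: polyfun_lin.
    apply: polyfunB; last exact: pX.
    by rewrite -[X in polyfun X](prednK d0) -add1n; apply: polyfunM; [exact: polyfun_lin|exact: pX].
  rewrite geB geM !geX -!/(gl _) uE vE (proj2 (usP ord0)) -/b0; apply/eqP; rewrite subr_eq0; apply/eqP.
  rewrite [(g * b0) ^+ _]exprMn [(g * _) ^+ delta]exprMn; have -> : g ^+ delta = g * g ^+ delta.-1 by rewrite -exprS prednK.
  by rewrite {2}/g; move: (_ ^+ delta) (g ^+ _) (b0 ^+ _) => A C D; ring.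
have uQ z : Q z -> lin u z = c ^+ delta * lin (us ord0) z.
  have pd : polyfun 1 (fun z => lin (u - c ^+ delta *: us ord0) z) by exact: polyfun_lin.
  have pe : polyfun delta.-1 (fun z => lin (us ord0) z ^+ delta.-1).
    by rewrite -[X in polyfun X]mul1n; apply: polyfunX; exact: polyfun_lin.
  case: (iQ) => _ /(_ _ _ _ _ pd pe) [t Qt|H|H].
  - rewrite linBl linZl mulrBl (rel2 t (QP t Qt)) (cE t Qt) exprMn -mulrA -exprS prednK //.
    by rewrite subrr.
  - by move=> Qz; apply/eqP; rewrite -subr_eq0 -linZl -linBl H.
  - case: nuQ => t Qt; have := H t Qt; move/eqP; rewrite expf_eq0 => /andP [_ /eqP ->].
    by rewrite eqxx.
move/eqP: ux; apply; rewrite uQ // (osc_at d0 Px wx (proj1 (usP ord0))) mulr0 //.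
Qed.
End Frame.
End Step.

Lemma VSK_step m V :
  (forall V', tdle P m.+1 V' -> \dim V' = 'C(m.+1 + delta, m.+1) ->
    exists h (b : 'I_m.+2 -> G), VSK V' h b) ->
  tdle P m.+2 V -> \dim V = 'C(m.+2 + delta, m.+2) -> exists h (b : 'I_m.+3 -> G), VSK V h b.
Proof.
move=> IH td dV; have wV := memv_pick V; set w := vpick V in wV.
have w0 : w != 0 by rewrite vpick0 -dimv_eq0 dV -lt0n bin_gt0 leq_addr.
have [U UU UP] := ultra_irr iP.
have Gn : gen P (nice V w m).
  apply: gen_imp (osc_dim_eq char0 iP d0 nondeg cov td wV w0 dV) => x Px [gx wx tdx dx].
  by split=> //; exact: IH.
(* An arbitrary section of each system; its dependence on z is uncontrolled, which is why its
   nonvanishing at x and y is obtained from the ultrafilter. *)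
pose u z := vpick (osc P V w z delta).
have un z : nice V w m z -> u z != 0.
  move=> [_ _ _ [h [b VK]]]; have [v vO v0] := VSK_nz VK; rewrite vpick0.
  by apply: contraNneq v0 => E; rewrite E memv0 in vO.
have uO z : u z \in osc P V w z delta by exact: memv_pick.
have Uu : U [set z | u z != 0] by apply: filterS (gen_ultra UU UP Gn) => z [_ /un].
have GS := ultra_nonvanishing nondeg UU Uu.
have [x Px [nx Sx]] := gen_ex (gen_and iP Gn GS).
have Gy := gen_and iP Gn (gen_and iP GS (gen_nz (polyfun_lin _) (nondeg (un x nx)))).
have [y [[Py [ny [Sy uxy]]] uyx]] := filter_ex (filterI (gen_ultra UU UP Gy) Sx).
have Oxy : exists2 v, v \in osc P V w x delta & lin v y != 0 by exists (u x).
have Oyx : exists2 v, v \in osc P V w y delta & lin v x != 0 by exists (u y).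
have [_ _ _ [h [b VKx]]] := nx.
have [ex exy] := VSK_pt d0 nondeg VKx Py.
have [by_ [ey [VKy eyx Sxy]]] := adjacent wV w0 nx ny VKx exy Oxy Oyx.
have [i eyi] := isvpt_neq0 d0 VKy eyx Oyx.
(* A coordinate that is nonzero at ey selects the element of [by_] to be added to b. *)
pose s0 (j : 'I_m.+2) : k := (j == i)%:R.
have s0y : dot s0 ey != 0.
  by rewrite /dot (bigD1 i) //= /s0 eqxx mul1r big1 ?addr0 // => j /negbTE ->; rewrite mul0r.
have Un : U [set z | nice V w m z /\ ((exists2 u, u \in osc P V w z delta & lin u x != 0) /\
  (exists2 u, u \in osc P V w z delta & lin u y != 0))].
  apply: filterS (filterI (gen_ultra UU UP Gn) (filterI Sx Sy)) => z [[_ nZ] [zx zy]].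
  by split=> //; split; exists (u z).
have [h0 _ _ _ _] := VKx.
exists h, (frame b by_ s0); apply: VSK_of_dim => //; last by rewrite dV.
- exact: (frame_indep wV w0 UU UP nx ny VKx VKy eyx Sxy Oyx Un s0y).
- exact: (forms_all wV w0 UU UP s0 nx ny VKx VKy eyx Sxy Oyx Un).
Qed.

Theorem VSK_exists m V : tdle P m.+1 V -> \dim V = 'C(m.+1 + delta, m.+1) ->
  exists h (b : 'I_m.+2 -> G), VSK V h b.
Proof.
elim: m V => [|m IHm] V td dV; last exact: VSK_step.
by apply: VSK_base => //; rewrite dV bin1.
Qed.
End Gluing.

(** * The Veronese manifold *)

Lemma nondeg_lin (k : closedFieldType) N (X : set (proj k N)) : non_degenerate X ->
  forall u, u != 0 -> nz (cone X) (lin u).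
Proof.
move=> nd u u0; apply: contrapT => /nzPn H; apply: nd; exists (mkpt u0) => x Xx u' v /=.
move=> /(vline_eq u0) [c c0 uE] xE; have Xv : cone X v by exists x.
apply/matrixP => r s; rewrite !ord1 [RHS]mxE mxE.
transitivity (lin u' v); first by apply: eq_bigr => l _; rewrite [_^T _ _]mxE.
by have := H v Xv; rewrite {1}uE linZl => /eqP; rewrite mulf_eq0 (negbTE c0) => /eqP.
Qed.

Section VeroneseMap.
Variables (k : closedFieldType) (n delta : nat).
Hypotheses (char0 : [pchar k] =i pred0) (d0 : (0 < delta)%N).
Let N := ('C(n + delta, n)).-1.

Definition vmon (i : 'I_N.+1) : 'X_{1..n.+1} := nth 0%MM (monomials n.+1 delta) i.

Lemma vmon_deg i : mdeg (vmon i) = delta.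
Proof. by apply/eqP; rewrite -mem_monomials mem_nth // size_monomials. Qed.

Lemma vmon_homog i : ('X_[vmon i] : {mpoly k[n.+1]}) \is delta.-homog.
Proof. by rewrite dhomogX /= vmon_deg. Qed.

Definition ver (e : 'rV[k]_n.+1) : 'rV[k]_N.+1 := \row_i ('X_[vmon i]).@[e 0].

Lemma verZ c e : ver (c *: e) = c ^+ delta *: ver e.
Proof.
apply/rowP => i; rewrite !mxE -(homog_scale c _ (vmon_homog i)).
by apply: meval_eq => j; rewrite mxE.
Qed.

Lemma ver_form F : F \is delta.-homog -> exists u, forall e, lin u (ver e) = F.@[e 0].
Proof.
move=> Fd; exists (\row_i F@_(vmon i)) => e.
have FE : F = \sum_(i < N.+1) F@_(vmon i) *: 'X_[vmon i].
  apply/mpolyP => M; rewrite raddf_sum /=.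
  have [Md|nMd] := eqVneq (mdeg M) delta.
    have MM : M \in monomials n.+1 delta by rewrite mem_monomials Md.
    have lt_M : (index M (monomials n.+1 delta) < N.+1)%N by rewrite -size_monomials index_mem.
    have vM : vmon (Ordinal lt_M) = M by rewrite /vmon nth_index.
    rewrite (bigD1 (Ordinal lt_M)) //= mcoeffZ vM mcoeffX eqxx mulr1 big1 ?addr0 // => i iM.
    rewrite mcoeffZ mcoeffX (_ : (vmon i == M) = false) ?mulr0 //; apply: contraNF iM => /eqP E.
    by rewrite -val_eqE /= -E /vmon index_uniq ?uniq_monomials // size_monomials.
  rewrite big1 => [|i _]; first exact: (dhomog_nemf_coeff Fd nMd).
  rewrite mcoeffZ mcoeffX (_ : (vmon i == M) = false) ?mulr0 //.
  by apply: contraNF nMd => /eqP <-; rewrite vmon_deg.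
rewrite {2}FE raddf_sum; apply: eq_bigr => i _.
by rewrite !mxE /= mevalZ.
Qed.

Lemma ver_prod (l : 'I_delta -> 'rV[k]_n.+1) :
  exists u, forall e, lin u (ver e) = \prod_i lin (l i) e.
Proof.
have := @polyfun_prod k n.+1 _ (index_enum 'I_delta) xpredT (fun=> 1%N) (fun i => lin (l i)).
rewrite sum1_card card_ord => -[i _|F Fd FE]; first exact: polyfun_lin.
by have [u uE] := ver_form Fd; exists u => e; rewrite uE FE.
Qed.

Lemma lin_neq0 (e : 'rV[k]_n.+1) : e != 0 -> exists l, lin l e != 0.
Proof. by move=> /lin_nz [l _]; exists l; rewrite linC. Qed.

Lemma ver_neq0 e : e != 0 -> ver e != 0.
Proof.
move=> /lin_neq0 [l le]; have [u uE] := ver_prod (fun _ : 'I_delta => l).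
apply: contraNneq (expf_neq0 delta le) => E; have := uE e.
by rewrite E linC lin0l prodr_const card_ord => <-.
Qed.

Lemma ver_inj e e' c : e != 0 -> e' != 0 -> ver e = c *: ver e' -> exists a, e = a *: e'.
Proof.
move=> e0 e'0 E; apply: contrapT => H.
have [|l [le' le]] := @sep_lin _ _ e' e e'0.
  by move=> c'; apply/eqP => eE; apply: H; exists c'.
have [u uE] := ver_prod (fun _ : 'I_delta => l).
have := uE e; rewrite E linZr uE !prodr_const !card_ord le' expr0n (gtn_eqF d0) mulr0.
by move/esym/eqP; rewrite expf_eq0 (negbTE le) andbF.
Qed.

Lemma veroneseP (y : proj k N) : veronese y <-> exists2 e, e != 0 & val y = <[ver e]>%VS.
Proof.
split=> [[x H]|[e e0 yE]].
  by have [e e0 xE] := proj_rep x; exists e => //; exact: H.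
exists (mkpt e0) => v /= /(vline_eq e0) [c c0 eE]; rewrite yE eE verZ vlineZ //.
exact: expf_neq0.
Qed.
End VeroneseMap.

Section VeroneseMatrix.
Variables (k : closedFieldType) (r delta : nat).
Hypotheses (char0 : [pchar k] =i pred0) (d0 : (0 < delta)%N).
Let N := ('C(r.+1 + delta, r.+1)).-1.
Variable X : set (proj k N).
Hypotheses (vX : projective_variety X) (nX : non_degenerate X) (dX : ~ variety_chain X r.+2).
Hypothesis cov : gen (cone X) (fun x => good delta (cone X) x).

(** The equality case is applied to the full space of linear forms. The sections representing the
    monomials in b are new coordinates, in which every vector of the cone is the Veronese image of
    its source point. *)
Theorem veronese_matrix : exists2 A : 'M[k]_N.+1, A \in unitmx &
  forall v, cone X v <-> exists2 e : 'rV[k]_r.+2, e != 0 & v = ver delta e *m A.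
Proof.
have cP := closed_ccl vX.1; have iP := irr_cone vX.2; have nd := nondeg_lin nX.
have [G _] := genf_exists iP.
have dV : \dim {:'rV[k]_N.+1} = 'C(r.+1 + delta, r.+1).
  by rewrite dimvf /dim /= mul1n prednK // bin_gt0 leq_addr.
have [h [b VK]] := VSK_exists G char0 iP cP d0 nd cov (no_chain_tdle char0 vX dX) dV.
have [h0 hb _ _ FV] := VK.
have /choice [U UE] : forall i : 'I_N.+1, exists u,
    gl G u = h * mmap (iota G) b 'X_[vmon i].
  by move=> i; have [u _ uE] := FV _ (vmon_homog k i); exists u.
pose B : 'M[k]_N.+1 := \matrix_(j, i) U i 0 j.
have zB z i : (z *m B) 0 i = lin (U i) z.
  by rewrite linC mxE; apply: eq_bigr => j _; rewrite !mxE.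
(* A kernel vector would be the coefficient vector of a form of degree delta vanishing at b. *)
have uB : B \in unitmx.
  rewrite unitmxE unitfE -det_tr; apply/det0P => -[v v0 vB].
  pose F : {mpoly k[r.+2]} := \sum_i v 0 i *: 'X_[vmon i].
  have Fd : F \is delta.-homog by apply: rpred_sum => i _; apply: rpredZ (vmon_homog k i).
  have : mmap (iota G) b F = 0.
    apply: (mulfI h0); rewrite mulr0 /F raddf_sum mulr_sumr.
    transitivity (gl G (\sum_i v 0 i *: U i)).
      by rewrite gl_sum; apply: eq_bigr => i _; rewrite UE /= mmapZ mulrCA.
    rewrite (_ : \sum_i _ = 0) /gl; last first.
      transitivity (v *m B^T); last exact: vB.
      apply/rowP => j; rewrite summxE mxE.
      by apply: eq_bigr => i _; rewrite !mxE.
    by rewrite -[RHS](ge0 G); congr ge; apply/funext => x; rewrite lin0l.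
  move=> /(hb _ _ Fd) F0; move/eqP: v0; apply; apply/rowP => i.
  have := congr1 (mcoeff (vmon i)) F0; rewrite mcoeff0 mxE raddf_sum (bigD1 i) //=.
  rewrite mcoeffZ mcoeffX eqxx mulr1 big1 ?addr0 // => j ji.
  rewrite mcoeffZ mcoeffX (_ : (_ == _) = false) ?mulr0 //.
  by rewrite nth_uniq ?uniq_monomials ?size_monomials //; apply: negbTE.
have zE z : cone X z -> exists2 e : 'rV[k]_r.+2, e != 0 & z *m B = ver delta e.
  move=> Pz; have [e ez] := VSK_pt d0 nd VK Pz; exists (\row_i e i).
    have [i ei] : exists i, e i != 0.
      apply: (isvpt_neq0 d0 VK ez); have [l lz] := lin_neq0 (cone_neq0 Pz).
      by exists l; rewrite ?memvf.
    by apply: contraNneq ei => /rowP /(_ i); rewrite !mxE => ->.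
  apply/rowP => i; rewrite zB (ez _ _ (memvf _) (vmon_homog k i) (UE i)) mxE.
  by apply: meval_eq => j; rewrite mxE.
exists (invmx B) => [|v]; first by rewrite unitmx_inv.
split=> [Pv|[e e0 ->]].
  by have [e e0 E] := zE v Pv; exists e => //; rewrite -E mulmxK.
(* For the converse, a form vanishing on the cone is pulled back to the source; the result vanishes
   at the independent germs b and is therefore 0. *)
apply: cP => [|d g gd gP].
  apply: contraNneq (ver_neq0 delta e0) => E.
  by rewrite -[ver _ _](mulmxKV uB) E mul0mx.
have [Gp Gd gE] := gd.
pose q j : {mpoly k[r.+2]} := \sum_i (invmx B) i j *: 'X_[vmon i].
have qd j : q j \is delta.-homog by apply: rpred_sum => i _; apply: rpredZ (vmon_homog k i).
have qE (e' : 'rV_r.+2) j : (q j).@[e' 0] = (ver delta e' *m invmx B) 0 j.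
  by rewrite /q raddf_sum mxE; apply: eq_bigr => i _; rewrite !mxE /= mevalZ mulrC.
suff H0 : mmap (@mpolyC _ k) q Gp = 0.
  by rewrite gE -(meval_eq (v1 := fun j => (q j).@[e 0])) // -meval_comp H0 meval0.
apply: hb; first exact: (dhomog_comp char0 qd Gd).
rewrite mmap_comp; apply: (mulfI (expf_neq0 d h0)); rewrite mulr0 -(mev_scale _ _ _ Gd).
transitivity (ge G (fun u => Gp.@[fun j => lin (delta_mx 0 j) u])).
  rewrite ge_comp; apply: eq_mev => j.
  transitivity (gl G (\sum_i (invmx B) i j *: U i)).
    rewrite gl_sum /q raddf_sum mulr_sumr; apply: eq_bigr => i _.
    by rewrite UE /= mmapZ mulrCA.
  congr gl; apply/rowP => l; have /matrixP /(_ l j) := mulmxV uB.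
  rewrite !mxE summxE eqxx eq_sym => <-.
  by apply: eq_bigr => i _; rewrite !mxE mulrC.
rewrite -[RHS](ge0 G).
apply: (ge_eq_on G (polyfun_lin (ver delta e)) (nd _ (ver_neq0 delta e0))) => z Pz _.
by rewrite -(gP z Pz) gE; apply: meval_eq => j; rewrite lin_delta.
Qed.
End VeroneseMatrix.

(** * Rational normal curves *)

Lemma closed_root (k : closedFieldType) d (a : k) : (0 < d)%N -> exists c, c ^+ d = a.
Proof.
move=> d0; have [c cP] := @solve_monicpoly k d (fun i => if i == 0%N then a else 0) d0.
exists c; rewrite cP (bigD1 (Ordinal d0)) //= expr0 mulr1 big1 ?addr0 // => i.
by rewrite -val_eqE /= => /negbTE ->; rewrite mul0r.
Qed.

Lemma cone_inj (k : closedFieldType) N (X Y : set (proj k N)) :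
  (forall v, v != 0 -> cone X v <-> cone Y v) -> X = Y.
Proof.
move=> XY; apply/seteqP; split; apply/cone_subset => v Xv; apply/XY => //; exact: cone_neq0 Xv.
Qed.

Lemma closed_singleton (k : closedFieldType) N (x : proj k N) : projective_variety [set x].
Proof.
have [v v0 xE] := proj_rep x; split; last first.
  split=> [|B C _ _ BC]; first by exists x.
  by have [] := BC x erefl; [left|right] => _ ->.
pose S := [set f | exists2 l, f = lin l & lin l v = 0].
have HS f : S f -> exists d, polyfun d f by move=> [l -> _]; exists 1%N; exact: polyfun_lin.
rewrite (_ : [set x] = zeros S); first exact: zeros_closed.
apply: cone_inj => u u0; rewrite zeros_cone //; split=> [[_ -> yE] _ [l -> lv]|H].
  by have [c _ ->] := rep_scale xE yE; rewrite linZr lv mulr0.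
apply: contrapT => nu; have [c|l [lv lu]] := @sep_lin _ _ v u v0.
  apply/eqP => uE; apply: nu; exists x => //.
  by rewrite xE uE vlineZ //; apply: contraNneq u0 => c0; rewrite uE c0 scale0r.
by move/eqP: lu; apply; apply: H; exists l.
Qed.

(* Multiply linear forms vanishing at the members of s, but not at both p and q. *)
Lemma irr_not_finite (k : closedFieldType) n (Q : set 'rV[k]_n) p q (s : seq 'rV[k]_n) :
  irr Q -> Q p -> Q q -> p != 0 -> (forall c, q != c *: p) -> all (fun z => z != 0) s ->
  exists2 v, Q v & forall z, z \in s -> forall c, v != c *: z.
Proof.
move=> iQ Qp Qq p0 pq sz; suff [e [f [pf [v Qv fv] fs]]] : exists e f,
    [/\ polyfun e f, nz Q f & forall z, z \in s -> f z = 0].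
  exists v => // z /fs fz c; apply: contraNneq fv => ->.
  by rewrite (polyfun_scale _ _ pf) fz mulr0.
elim: s sz => [_|z s IHs /= /andP [z0 /IHs [e [f [pf nf fs]]]]].
  exists 0%N, (fun=> 1); split=> //; first exact: polyfun_const.
  by exists p; rewrite // oner_eq0.
have [l lz nl] : exists2 l, lin l z = 0 & nz Q (lin l).
  have [[c pz]|pz] := pselect (exists c, p = c *: z).
    have [c' |l [lz lq]] := @sep_lin _ _ z q z0; last by exists l => //; exists q.
    have c0 : c != 0 by apply: contraNneq p0 => c0; rewrite pz c0 scale0r.
    apply/eqP => qz; move/eqP: (pq (c' / c)); apply.
    by rewrite pz scalerA divfK.
  have [c|l [lz lp]] := @sep_lin _ _ z p z0; last by exists l => //; exists p.
  by apply/eqP => pE; apply: pz; exists c.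
exists (1 + e)%N, (fun v => lin l v * f v); split.
- exact: polyfunM (polyfun_lin l) pf.
- exact: irr_nzM iQ (polyfun_lin l) pf nl nf.
- by move=> x; rewrite inE => /orP [/eqP ->|/fs ->]; rewrite ?lz ?mul0r ?mulr0.
Qed.

Section RationalNormal.
Variables (k : closedFieldType) (d : nat).
Hypotheses (char0 : [pchar k] =i pred0) (d0 : (0 < d)%N).

Definition mu (t : 'rV[k]_2) : 'rV[k]_d.+1 := \row_i (t 0 0 ^+ (d - i) * t 0 1 ^+ i).

Lemma muZ c t : mu (c *: t) = c ^+ d *: mu t.
Proof.
apply/rowP => i; rewrite !mxE !exprMn mulrACA -exprD subnK //.
by rewrite -ltnS.
Qed.

Lemma row2_neq0 (t : 'rV[k]_2) : t != 0 -> (t 0 0 != 0) || (t 0 1 != 0).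
Proof.
apply: contraNT; rewrite negb_or !negbK => /andP [/eqP t0 /eqP t1].
by apply/eqP/rowP => i; rewrite mxE -t0; case: (unliftP 0 i) => [j ->|-> //]; rewrite ord1 t0 -t1; congr (t 0 _); apply/val_inj.
Qed.

Lemma mu_neq0 t : t != 0 -> mu t != 0.
Proof.
move=> /row2_neq0 /orP [] ti; apply/rV0Pn.
  by exists ord0; rewrite mxE expr0 mulr1 expf_neq0.
by exists ord_max; rewrite mxE subnn expr0 mul1r expf_neq0.
Qed.

Definition chart (r : k) : 'rV[k]_2 := \row_i r ^+ i.

Lemma mu_chart r i : mu (chart r) 0 i = r ^+ i.
Proof. by rewrite !mxE expr1n mul1r expr1. Qed.

Lemma chart_neq0 r : chart r != 0.
Proof. by apply/rV0Pn; exists 0; rewrite mxE oner_eq0. Qed.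

Lemma chartE (t : 'rV[k]_2) : t 0 0 != 0 -> t = t 0 0 *: chart (t 0 1 / t 0 0).
Proof.
move=> t0; apply/rowP => i; rewrite !mxE; case: (unliftP 0 i) => [j ->|->] /=.
  rewrite ord1 /= expr1 mulrC divfK //; congr (t 0 _); exact/val_inj.
by rewrite expr0 mulr1.
Qed.

Lemma lin_mu_chart u r : lin u (mu (chart r)) = (\poly_(i < d.+1) u 0 (inord i)).[r].
Proof.
rewrite horner_poly; apply: eq_bigr => i _.
by rewrite mu_chart inord_val.
Qed.

Lemma mu_span u : (forall t, t != 0 -> lin u (mu t) = 0) -> u = 0.
Proof.
move=> H; set p := (\poly_(i < d.+1) u 0 (inord i)); have p0 : p = 0.
  apply/eqP; apply: contraT => /(poly_nonroot char0) [c].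
  by rewrite -lin_mu_chart H ?chart_neq0 // eqxx.
apply/rowP => i; have := congr1 (fun q : {poly k} => q`_i) p0.
by rewrite coef_poly ltn_ord inord_val coef0 mxE.
Qed.

Lemma mu_form (f : 'rV[k]_2 -> k) : polyfun d f -> exists u, forall t, lin u (mu t) = f t.
Proof.
move=> [F Fd FE].
exists (\sum_(M <- msupp F) F@_M *: delta_mx 0 (inord (M ord_max))) => t.
rewrite FE lin_suml mevalE !big_seq; apply: eq_bigr => M MF.
have := dhomogP _ _ _ Fd M MF; rewrite /= mdegE !big_ord_recl big_ord0 addn0 => Md.
have e1 : lift ord0 ord0 = ord_max :> 'I_2 by exact/val_inj.
have e2 : 1 = ord_max :> 'I_2 by exact/val_inj.
rewrite e1 in Md *; rewrite linZl lin_delta mxE big_ord0 mulr1 inordK.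
  by rewrite e2 -Md addnK.
by rewrite ltnS -Md leq_addl.
Qed.

(** The quadrics say that successive coordinates have a constant ratio. Either the first coordinate
    is nonzero and a is a geometric progression, or all coordinates but the last vanish; a d-th root
    adjusts the scale. *)
Lemma mu_param (a : 'rV[k]_d.+1) : a != 0 ->
  (forall i j, (i < d)%N -> (j < d)%N ->
    a 0 (inord i) * a 0 (inord j.+1) = a 0 (inord i.+1) * a 0 (inord j)) ->
  exists2 t, t != 0 & a = mu t.
Proof.
move=> an H; have [a0|a0] := eqVneq (a 0 (inord 0)) 0; last first.
  have [c cd] := closed_root (a 0 (inord 0)) d0.
  have c0 : c != 0 by apply: contraNneq a0 => c0; rewrite -cd c0 expr0n (gtn_eqF d0).
  pose r := a 0 (inord 1) / a 0 (inord 0).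
  exists (c *: chart r); first by rewrite scaler_eq0 negb_or c0 chart_neq0.
  apply/rowP => i; rewrite muZ mxE mu_chart cd -[i in LHS]inord_val.
  elim: (i : nat) (leq_ord i) => [|j IHj] jd; first by rewrite expr0 mulr1.
  apply: (mulfI a0); rewrite H // IHj ?(ltnW jd) // exprS mulrCA (mulrCA _ r).
  by congr (_ * _); rewrite mulrA; congr (_ * _); rewrite /r divfK.
have ai i : (i < d)%N -> a 0 (inord i) = 0.
  elim: i => [|i IHi] id //; have := H i i.+1 (ltnW id) id.
  by rewrite IHi ?(ltnW id) // mul0r => /esym/eqP; rewrite mulf_eq0 orbb => /eqP.
have [c cd] := closed_root (a 0 (inord d)) d0.
pose t : 'rV[k]_2 := \row_i (c *+ (i == 1)).
have aE : a = mu t.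
  apply/rowP => i; rewrite !mxE /= mulr0n mulr1n expr0n subn_eq0 -[i in LHS]inord_val.
  case: ltngtP (leq_ord i) => //= [lt_id _|-> _]; last by rewrite mul1r.
  by rewrite ai // mul0r.
exists t => //; apply: contraNneq an => t0; rewrite aE t0 -(scale0r 0) muZ expr0n (gtn_eqF d0).
by rewrite scale0r.
Qed.

(** * Embedded rational normal curves *)

Section Curve.
Variables (N : nat) (D : 'M[k]_(d.+1, N.+1)) (E : 'M[k]_(N.+1, d.+1)).
Hypothesis DE : D *m E = 1%:M.

Lemma mulDE a : a *m D *m E = a :> 'rV[k]_d.+1.
Proof. by rewrite -mulmxA DE mulmx1. Qed.

Lemma mulD_neq0 (a : 'rV[k]_d.+1) : a != 0 -> a *m D != 0.
Proof. by apply: contraNneq => aD; rewrite -[a]mulDE aD mul0mx. Qed.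

Definition curve : set (proj k N) := [set x | exists2 t, t != 0 & val x = <[mu t *m D]>%VS].

Lemma cone_curve v : cone curve v <-> exists2 t, t != 0 & v = mu t *m D.
Proof.
split=> [[x [t t0 xE] xE']|[t t0 ->]].
  have [c c0 ->] := rep_scale xE xE'; have [b bd] := closed_root c d0.
  exists (b *: t); last by rewrite muZ bd scalemxAl.
  rewrite scaler_eq0 negb_or t0 andbT; apply: contraNneq c0 => b0.
  by rewrite -bd b0 expr0n (gtn_eqF d0).
apply/(cone_mkpt _ (mulD_neq0 (mu_neq0 t0))); by exists t.
Qed.

Lemma curve_mu t : t != 0 -> cone curve (mu t *m D).
Proof. by move=> t0; apply/cone_curve; exists t. Qed.

(** The first kind says that v lies in the row space of D, on which E inverts D; the second kind are
    the quadrics of the rational normal curve in the coordinates [v *m E]. *)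
Definition curve_eqs : set ('rV[k]_N.+1 -> k) :=
  [set f | (exists j, f = fun v : 'rV[k]_N.+1 => v 0 j - (v *m E *m D) 0 j) \/
    exists i j, [/\ (i < d)%N, (j < d)%N & f = fun v : 'rV[k]_N.+1 =>
      (v *m E) 0 (inord i) * (v *m E) 0 (inord j.+1) -
      (v *m E) 0 (inord i.+1) * (v *m E) 0 (inord j)]].

Lemma polyfun_mulmx m n (M : 'M[k]_(m, n)) j : polyfun 1 (fun v : 'rV[k]_m => (v *m M) 0 j).
Proof.
apply: (polyfun_ext _ (polyfun_lin (col j M)^T)) => v.
by rewrite linC mxE; apply: eq_bigr => i _; rewrite !mxE.
Qed.

Lemma curve_eqs_polyfun f : curve_eqs f -> exists e, polyfun e f.
Proof.
move=> [[j ->]|[i [j [_ _ ->]]]].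
  exists 1%N; apply: polyfunB (polyfun_var _ _) _.
  by apply: (polyfun_ext _ (polyfun_mulmx (E *m D) j)) => v; rewrite mulmxA.
by exists 2%N; apply: polyfunB; apply: (polyfunM (d := 1) (e := 1)); exact: polyfun_mulmx.
Qed.

Lemma mu_eqs t i j : (i < d)%N -> (j < d)%N ->
  mu t 0 (inord i) * mu t 0 (inord j.+1) = mu t 0 (inord i.+1) * mu t 0 (inord j).
Proof.
move=> id jd; rewrite !mxE !inordK ?ltnS ?(ltnW id) ?(ltnW jd) //.
by rewrite -(subnSK id) -(subnSK jd) !exprSr; ring.
Qed.

Lemma curve_eqs0 f t : curve_eqs f -> f (mu t *m D) = 0.
Proof.
by move=> [[j ->]|[i [j [id jd ->]]]]; rewrite mulDE ?mu_eqs // subrr.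
Qed.

Lemma curve_closed : zariski_closed curve.
Proof.
rewrite (_ : curve = zeros curve_eqs); first exact: zeros_closed curve_eqs_polyfun.
apply: cone_inj => v v0; rewrite (zeros_cone v0 curve_eqs_polyfun) cone_curve.
split=> [[t t0 ->] f /curve_eqs0 ->//|H].
have vE : v = v *m E *m D.
  by apply/rowP => j; apply/eqP; rewrite -subr_eq0; apply/eqP; apply: (H (fun v => _)); left; exists j.
have [||t t0 tE] := @mu_param (v *m E).
- by apply: contraNneq v0 => vE0; rewrite vE vE0 mul0mx.
- move=> i j id jd; apply/eqP; rewrite -subr_eq0; apply/eqP.
  by apply: (H (fun v => _)); right; exists i, j.
by exists t; rewrite // -tE.
Qed.

Lemma polyfun_mu e f : polyfun e f -> polyfun (e * d) (fun t => f (mu t *m D)).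
Proof.
move=> [F Fe FE].
apply: (polyfun_ext _ (polyfun_comp (f := fun j t => (mu t *m D) 0 j) Fe _)) => [t|j].
  by rewrite FE.
apply: (polyfun_ext (f := fun t => \sum_i D i j * mu t 0 i)) => [t|].
  by rewrite mxE; apply: eq_bigr => i _; rewrite mulrC.
apply: polyfun_sum => i _; apply: polyfunZ.
apply: (polyfun_ext (f := fun t => t 0 0 ^+ (d - i) * t 0 1 ^+ i)) => [t|]; first by rewrite mxE.
have := polyfunM (polyfunX (d - i) (polyfun_var k (0 : 'I_2))) (polyfunX i (polyfun_var k (1 : 'I_2))).
by rewrite !mul1n ?muln1 subnK // -ltnS.
Qed.

Lemma mu_zero e (f : 'rV[k]_2 -> k) : polyfun e f ->
  (forall t, t != 0 -> f t = 0) -> forall t, f t = 0.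
Proof.
move=> pf H; have [_ /(_ 1%N e (lin (delta_mx 0 0)) f (polyfun_lin _) pf)] := @irr_setT k 2 char0.
case=> [t _|E0 t|E0 t]; first by have [->|/H ->] := eqVneq t 0; rewrite ?mulr0 // linC lin0l mul0r.
- by have := E0 (delta_mx 0 0) I; rewrite lin_delta mxE !eqxx => /eqP; rewrite oner_eq0.
- exact: E0.
Qed.

Lemma curve_irr : irreducible curve.
Proof.
have [x Cx] : curve !=set0.
  by have [x Cx _] := curve_mu (chart_neq0 0); exists x.
split=> [|B C cB cC BC]; first by exists x.
apply: contrapT => /not_orP [nB nC].
have sep (Z : set (proj k N)) : zariski_closed Z -> ~ curve `<=` Z ->
    exists e f, [/\ polyfun e f, forall v, cone Z v -> f v = 0 & exists2 t, t != 0 & f (mu t *m D) != 0].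
  move=> cZ nZ; have [t t0 nt] : exists2 t, t != 0 & ~ cone Z (mu t *m D).
    apply: contrapT => H; apply: nZ; apply/cone_subset => v /cone_curve [t t0 ->].
    by apply: contrapT => nt; apply: H; exists t.
  have [e [f [pf fZ ft]]] := closed_sep cZ (mulD_neq0 (mu_neq0 t0)) nt.
  by exists e, f; split=> //; exists t.
have [e [f [pf fB [t t0 ft]]]] := sep B cB nB.
have [e' [g [pg gC [t' t'0 gt]]]] := sep C cC nC.
have [_ /(_ _ _ _ _ (polyfun_mu pf) (polyfun_mu pg))] := @irr_setT k 2 char0.
case=> [|/(_ t I) /eqP|/(_ t' I) /eqP]; [|by rewrite (negbTE ft)|by rewrite (negbTE gt)].
move=> s _; apply: (mu_zero (polyfunM (polyfun_mu pf) (polyfun_mu pg))) => {}s s0.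
have [y Cy yE] := curve_mu s0; have [By|Cy'] := BC y Cy.
  by rewrite fB ?mul0r //; exists y.
by rewrite gC ?mulr0 //; exists y.
Qed.

(** A form vanishing on Z but not on the whole curve pulls back to a nonzero binary form, which has
    finitely many zeros; an irreducible Z with two points is not contained in finitely many
    points. *)
Lemma curve_in_closed Z : zariski_closed Z -> irreducible Z -> Z `<=` curve ->
  (exists p q, [/\ cone Z p, cone Z q & forall c, q != c *: p]) -> curve `<=` Z.
Proof.
move=> cZ iZ ZC [p [q [Zp Zq pq]]]; apply: contrapT => nZ.
have [t1 t10 nt] : exists2 t, t != 0 & ~ cone Z (mu t *m D).
  apply: contrapT => H; apply: nZ; apply/cone_subset => v /cone_curve [t t0 ->].
  by apply: contrapT => nt; apply: H; exists t.
have [e [f [pf fZ ft]]] := closed_sep cZ (mulD_neq0 (mu_neq0 t10)) nt.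
pose phi t := f (mu t *m D); have pphi : polyfun (e * d) phi := polyfun_mu pf.
have [g gE] := polyfun_line (delta_mx 0 0) (delta_mx 0 1) pphi.
have chE r : chart r = delta_mx 0 0 + r *: delta_mx 0 1.
  apply/rowP => i; case: (unliftP 0 i) => [j ->|->]; rewrite !mxE /= ?ord1 /=.
    by rewrite expr1 mulr1 add0r.
  by rewrite expr0 mulr0 addr0.
have g0 : g != 0.
  apply: contraNneq ft => g0; apply/eqP.
  have [_ /(_ _ _ _ _ (polyfun_lin (delta_mx 0 0)) pphi)] := @irr_setT k 2 char0.
  case=> [t _|E0|E0]; last exact: E0.
    rewrite lin_delta; have [->|tn] := eqVneq (t 0 0) 0; first by rewrite mul0r.
    by rewrite (chartE tn) (polyfun_scale _ _ pphi) chE -gE g0 horner0 !mulr0.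
  by have := E0 (delta_mx 0 0) I; rewrite lin_delta mxE !eqxx => /eqP; rewrite oner_eq0.
have [rs gr] := closed_field_poly_normal g.
(* The zeros in the chart together with the single point outside it. *)
pose s := [seq mu t *m D | t <- delta_mx 0 1 :: [seq chart r | r <- rs]].
have s0 : all (fun z => z != 0) s.
  apply/allP => z /mapP [t]; rewrite inE => /orP [/eqP ->|/mapP [r _ ->]] ->; apply/mulD_neq0/mu_neq0.
    by apply/rV0Pn; exists 1; rewrite mxE !eqxx oner_eq0.
  exact: chart_neq0.
have [v Zv vs] := irr_not_finite (irr_cone iZ) Zp Zq (cone_neq0 Zp) pq s0.
have [t t0 vE] : exists2 t, t != 0 & v = mu t *m D by apply/cone_curve; exact: (cone_subset _ _).1 ZC _ Zv.
have [t00|t00] := eqVneq (t 0 0) 0.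
  have tE : t = t 0 1 *: delta_mx 0 1.
    apply/rowP => i; rewrite !mxE /=.
    case: (unliftP 0 i) => [j ->|->] /=; last by rewrite t00 mulr0.
    by rewrite ord1 (_ : lift _ _ = 1) ?eqxx ?mulr1 //; exact/val_inj.
  have /eqP := vs (mu (delta_mx 0 1) *m D) (mem_head _ _) (t 0 1 ^+ d); apply.
  by rewrite vE {1}tE muZ scalemxAl.
have st : mu (chart (t 0 1 / t 0 0)) *m D \in s.
  rewrite /s map_cons inE -map_comp; apply/orP; right; apply/mapP; exists (t 0 1 / t 0 0) => //.
  have : g.[t 0 1 / t 0 0] = 0.
    rewrite gE -chE; apply: (mulfI (expf_neq0 (e * d) t00)).
    by rewrite mulr0 -(polyfun_scale _ _ pphi) -chartE // /phi -vE fZ.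
  rewrite gr hornerZ => /eqP; rewrite mulf_eq0 lead_coef_eq0 (negbTE g0) /=.
  by rewrite -/(root _ _) root_prod_XsubC.
have /eqP := vs _ st (t 0 0 ^+ d); apply.
by rewrite vE {1}(chartE t00) muZ scalemxAl.
Qed.

Lemma mu_indep r r' c : r != r' -> mu (chart r) *m D != c *: (mu (chart r') *m D).
Proof.
move=> rr'; apply/eqP => /(congr1 (mulmx^~ E)); rewrite -scalemxAl !mulDE => /rowP H.
have := H ord0; rewrite [RHS]mxE !mu_chart expr0 mulr1 => c1.
have := H (inord 1); rewrite [RHS]mxE !mu_chart -c1 inordK // !expr1 mul1r => rE.
by rewrite rE eqxx in rr'.
Qed.

Lemma curve_dim : has_dim curve 1.
Proof.
have [x0 C0 x0E] := curve_mu (chart_neq0 0); have [x1 C1 x1E] := curve_mu (chart_neq0 1).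
split.
  exists (fun i => if i == 0%N then [set x0] else curve); split=> [[|i] _|[] // _] /=.
  - by split; [exact: closed_singleton|move=> _ ->].
  - by split=> //; split; [exact: curve_closed|exact: curve_irr].
  split=> [_ -> //|H]; have x10 := H x1 C1.
  have [c _ cE] := @rep_scale _ _ x0 _ _ x0E (etrans (congr1 val (esym x10)) x1E).
  by have := @mu_indep 1 0 c (oner_neq0 _); rewrite cE eqxx.
move=> [Z [Z1 Z2]].
have [[cZ1 iZ1] sZ1] := Z1 1%N isT; have [_ sZ2] := Z1 2%N isT; have [_ nZ2] := Z2 1%N isT.
apply: nZ2 => x /sZ2; move: x; apply: curve_in_closed => //.
have [[_ [[x Zx] _]] _] := Z1 0%N isT; have [sZ nZ] := Z2 0%N isT.
have [y Zy nxy] : exists2 y, Z 1%N y & ~ Z 0%N y.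
  by apply: contrapT => H; apply: nZ => y Zy; apply: contrapT => ny; apply: H; exists y.
have [p p0 xE] := proj_rep x; have [q q0 yE] := proj_rep y.
exists p, q; split; [by exists x => //; exact: sZ|by exists y|] => c.
apply/eqP => qE; apply: nxy; suff -> : y = x by [].
apply: val_inj; rewrite /= yE xE qE vlineZ //.
by apply: contraNneq q0 => c0; rewrite qE c0 scale0r.
Qed.
End Curve.
End RationalNormal.

Lemma hyperplaneP (k : closedFieldType) N (a x : proj k N) u v :
  val a = <[u]>%VS -> val x = <[v]>%VS -> hyperplane a x <-> lin u v = 0.
Proof.
have linE (u' v' : 'rV[k]_N.+1) : u' *m v'^T = (lin u' v')%:M.
  apply/matrixP => i j; rewrite !ord1 mxE [RHS]mxE eqxx mulr1n.
  by apply: eq_bigr => l _; rewrite [_^T _ _]mxE.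
move=> aE xE; split=> [/(_ u v aE xE)|uv u' v' aE' xE'].
  by rewrite linE => /matrixP /(_ 0 0); rewrite !mxE eqxx mulr1n.
have [c _ ->] := rep_scale aE aE'; have [c' _ ->] := rep_scale xE xE'.
by rewrite linE linZl linZr uv !mulr0 raddf0.
Qed.

(** * Discriminants through Sylvester matrices *)

Section Sylvester.
Variables (k : closedFieldType) (d : nat).
Hypotheses (char0 : [pchar k] =i pred0) (d0 : (0 < d)%N).

(** The Sylvester matrix of p and its derivative for the formal degree d; the size is fixed so that
    its determinant is polynomial in the coefficients of p. *)
Definition sylv (p : {poly k}) : 'M[k]_(d.-1 + d) := \matrix_(i, j)
  match fintype.split i with
  | inl a => ('X^a * p)`_j
  | inr b => ('X^b * p^`())`_j
  end.

(** The powers of a common root form a kernel vector. *)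
Lemma sylv_root (p : {poly k}) x : (size p <= d.+1)%N -> root p x -> root p^`() x -> \det (sylv p) = 0.
Proof.
move=> sp /rootP px /rootP p'x; rewrite -det_tr; apply/eqP/det0P.
exists (\row_j x ^+ j).
  have n0 : (0 < d.-1 + d)%N by rewrite addn_gt0 d0 orbT.
  apply/rV0Pn; exists (Ordinal n0); rewrite mxE expr0; exact: oner_neq0.
have coefsum (q : {poly k}) : (size q <= d.-1 + d)%N ->
    \sum_(j < d.-1 + d) x ^+ j * q`_j = q.[x].
  by move=> sq; rewrite (horner_coef_wide _ sq); apply: eq_bigr => j _; rewrite mulrC.
have sizeXM a (q : {poly k}) m : (size q <= m)%N -> (size ('X^a * q)%R <= a + m)%N.
  move=> sq; apply: leq_trans (size_polyMleq _ _) _.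
  by rewrite size_polyXn addSn /= leq_add2l.
apply/rowP => i; rewrite !mxE.
case: (splitP i) => [a ia|b ib].
  transitivity ('X^a * p).[x]; last by rewrite hornerM px mulr0.
  rewrite -coefsum; last first.
    apply: leq_trans (sizeXM _ _ _ sp) _.
    by rewrite addnS -addSn leq_add2r.
  apply: eq_bigr => j _; rewrite !mxE; case: splitP => [a' /esym|b' /esym].
    by rewrite ia => /val_inj ->.
  by rewrite ia => E; have := ltn_ord a; rewrite -E ltnNge leq_addr.
transitivity ('X^b * p^`()).[x]; last by rewrite hornerM p'x mulr0.
rewrite -coefsum; last first.
  apply: (leq_trans (n := b + d)).
    apply: sizeXM; rewrite -ltnS.
    have [->|p0] := eqVneq p 0; first by rewrite linear0 size_poly0.
    exact: leq_trans (lt_size_deriv p0) sp.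
  by rewrite leq_add2r -ltnS prednK.
apply: eq_bigr => j _; rewrite !mxE; case: splitP => [a' /esym|b' /esym].
  by rewrite ib => E; have := ltn_ord a'; rewrite E ltnNge leq_addr.
by rewrite ib => /addnI /val_inj ->.
Qed.

(** A kernel vector encodes A p + B p' = 0 with B shorter than p; coprimality makes p divide B, so B
    and then A are 0. *)
Lemma sylv_det (p : {poly k}) : size p = d.+1 -> coprimep p p^`() -> \det (sylv p) != 0.
Proof.
move=> sp cop; apply/negP => /det0P [v v0 /rowP vS].
pose A := \poly_(i < d.-1) (if insub i is Some a then v 0 (lshift d a) else 0).
pose B := \poly_(i < d) (if insub i is Some b then v 0 (rshift d.-1 b) else 0).
have AE : A = \sum_(a < d.-1) v 0 (lshift d a) *: 'X^a.
  by rewrite /A poly_def; apply: eq_bigr => a _; rewrite valK.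
have BE : B = \sum_(b < d) v 0 (rshift d.-1 b) *: 'X^b.
  by rewrite /B poly_def; apply: eq_bigr => b _; rewrite valK.
have p0 : p != 0 by rewrite -size_poly_gt0 sp.
have sp' : (size p^`() <= d)%N by rewrite -ltnS -sp lt_size_deriv.
have AB : A * p + B * p^`() = 0.
  apply/polyP => j; rewrite coef0; have [jn|jn] := ltnP j (d.-1 + d); last first.
    apply: nth_default; apply: leq_trans jn; apply: leq_trans (size_polyD _ _) _.
    rewrite geq_max; apply/andP; split; apply: leq_trans (size_polyMleq _ _) _.
      by rewrite sp addnS /= leq_add2r size_poly.
    rewrite -subn1 leq_subLR addnA add1n prednK //.
    by apply: leq_add sp'; exact: size_poly.
  transitivity ((v *m sylv p) 0 (Ordinal jn)); last by rewrite vS mxE.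
  rewrite [RHS]mxE big_split_ord /=.
  rewrite AE BE !mulr_suml [LHS]coefD !coef_sum; congr (_ + _); apply: eq_bigr => i _.
    rewrite mxE; case: splitP => [a /= /val_inj <-|b /= E]; first by rewrite -scalerAl coefZ.
    by have := ltn_ord i; rewrite E ltnNge leq_addr.
  rewrite mxE; case: splitP => [a /= E|b /= /addnI /val_inj <-]; last by rewrite -scalerAl coefZ.
  by have := ltn_ord a; rewrite -E ltnNge leq_addr.
have B0 : B = 0.
  apply: contraTeq isT => nB; have : (p %| B * p^`()).
    by rewrite -(dvdp_addr _ (dvdp_mull A (dvdpp p))) AB dvdp0.
  rewrite Gauss_dvdpl // => /(dvdp_leq nB); rewrite sp => /leq_trans /(_ (size_poly _ _)).
  by rewrite ltnn.
have A0 : A = 0.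
  by move/eqP: AB; rewrite B0 mul0r addr0 mulf_eq0 (negbTE p0) orbF => /eqP.
move/eqP: v0; apply; apply/rowP => i; rewrite mxE.
case: (split_ordP i) => [a ->|b ->].
  by have := congr1 (fun q : {poly k} => q`_a) A0; rewrite coef_poly ltn_ord valK coef0.
by have := congr1 (fun q : {poly k} => q`_b) B0; rewrite coef_poly ltn_ord valK coef0.
Qed.

Lemma sylv_roots (p : {poly k}) : (size p <= d.+1)%N -> p`_d != 0 -> \det (sylv p) != 0 ->
  exists rs, [/\ uniq rs, size rs = d & forall x, (x \in rs) = root p x].
Proof.
move=> sp pd dp; have [rs pE] := closed_field_poly_normal p; exists rs.
have p0 : p != 0 by apply: contraNneq pd => ->; rewrite coef0.
have rsE x : (x \in rs) = root p x.
  by rewrite pE rootZ ?lead_coef_eq0 // root_prod_XsubC.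
split=> //.
  rewrite -separable_prod_XsubC unlock; apply: Pdiv.ClosedField.root_coprimep => x.
  rewrite root_prod_XsubC => xrs; apply: contraNneq dp => x'0; apply/eqP.
  apply: (@sylv_root _ x) => //; first by rewrite -rsE.
  by rewrite pE derivZ rootZ ?lead_coef_eq0 //; apply/rootP.
suff : size p = d.+1 by rewrite pE size_scale ?lead_coef_eq0 // size_prod_XsubC => -[].
apply/eqP; rewrite eqn_leq sp ltnNge; apply: contraNN pd => sp'.
by rewrite nth_default.
Qed.
End Sylvester.

(** * Degree and span of the embedded curve *)

Section CurveDegree.
Variables (k : closedFieldType) (d : nat).
Hypotheses (char0 : [pchar k] =i pred0) (d0 : (0 < d)%N).
Variables (N : nat) (D : 'M[k]_(d.+1, N.+1)) (E : 'M[k]_(N.+1, d.+1)).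
Hypothesis DE : D *m E = 1%:M.

Lemma lin_mulmx u (a : 'rV[k]_d.+1) : lin u (a *m D) = lin (u *m D^T) a.
Proof.
rewrite [RHS]linC /lin.
rewrite (eq_bigr (fun j => \sum_i u 0 j * (a 0 i * D i j))); last first.
  by move=> j _; rewrite mxE mulr_sumr.
rewrite exchange_big /=; apply: eq_bigr => i _; rewrite mxE mulr_sumr.
by apply: eq_bigr => j _; rewrite mxE mulrCA.
Qed.

Definition cpoly (u : 'rV[k]_N.+1) : {poly k} := \poly_(i < d.+1) (u *m D^T) 0 (inord i).

Lemma cpoly_chart u r : lin u (mu d (chart r) *m D) = (cpoly u).[r].
Proof. by rewrite lin_mulmx lin_mu_chart. Qed.

(** Where this is nonzero the equation of the hyperplane on the chart has exact degree d, so the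
    point outside the chart is avoided, and its d roots are simple. *)
Definition cdisc u : k := (cpoly u)`_d * \det (sylv d (cpoly u)).

Lemma polyfun_cpoly j : polyfun 1 (fun u => (cpoly u)`_j).
Proof.
have [jd|jd] := ltnP j d.+1.
  by apply: (polyfun_ext _ (polyfun_mulmx D^T (inord j))) => u; rewrite coef_poly jd.
by apply: (polyfun_ext _ (polyfun0 _ _ _)) => u; rewrite coef_poly ltnNge jd.
Qed.

Lemma polyfun_cdisc : polyfun (1 + (d.-1 + d)) cdisc.
Proof.
apply: polyfunM (polyfun_cpoly d) _; apply: polyfun_sum => s _; apply: polyfunZ.
have := @polyfun_prod k N.+1 _ (index_enum 'I_(d.-1 + d)) xpredT (fun=> 1%N)
  (fun i u => sylv d (cpoly u) i ((s : {perm _}) i)); rewrite sum1_card card_ord; apply=> i _.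
case E' : (fintype.split i) => [a|b].
  have [ja|ja] := ltnP (s i) a.
    by apply: (polyfun_ext _ (polyfun0 _ _ _)) => u; rewrite mxE E' coefXnM ja.
  by apply: (polyfun_ext _ (polyfun_cpoly (s i - a))) => u; rewrite mxE E' coefXnM ltnNge ja.
have [ja|ja] := ltnP (s i) b.
  by apply: (polyfun_ext _ (polyfun0 _ _ _)) => u; rewrite mxE E' coefXnM ja.
apply: (polyfun_ext _ (polyfunZ (s i - b).+1%:R (polyfun_cpoly (s i - b).+1))) => u.
by rewrite mxE E' coefXnM ltnNge ja coef_deriv mulr_natl.
Qed.

(** The hyperplane cutting out the roots of X^d - 1, a separable polynomial in characteristic 0. *)
Lemma cdisc_nz : exists u, cdisc u != 0.
Proof.
pose p : {poly k} := 'X^d - 1; have sp : size p = d.+1 by rewrite size_XnsubC.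
pose w : 'rV[k]_d.+1 := \row_i p`_i; exists (w *m E^T).
have pE : cpoly (w *m E^T) = p.
  rewrite /cpoly -mulmxA -trmx_mul DE trmx1 mulmx1; apply/polyP => i; rewrite coef_poly.
  case: ltnP => [id|di]; first by rewrite mxE inordK.
  by rewrite nth_default // sp.
rewrite /cdisc pE mulf_neq0 //.
  by rewrite coefB coefXn eqxx coef1 (gtn_eqF d0) subr0 oner_eq0.
apply: sylv_det => //; have := @separable_Xn_sub_1 k d; rewrite unlock; apply.
by apply: contraTneq d0 => /(natr_inj0 char0 (x2 := 0)) ->.
Qed.

Lemma curve_degree_curve : curve_degree (curve D) d.
Proof.
pose B := zeros [set cdisc].
have HB f : [set cdisc] f -> exists e, polyfun e f.
  by move=> ->; exists (1 + (d.-1 + d))%N; exact: polyfun_cdisc.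
exists B; split; first exact: zeros_closed.
  move=> BT; have [u nu] := cdisc_nz.
  have u0 : u != 0.
    apply: contraNneq nu => ->.
    by rewrite -(scale0r 0) (polyfun_scale _ _ polyfun_cdisc) expr0n mul0r.
  have : B (mkpt u0) by rewrite BT.
  by move=> /(_ _ erefl u erefl) /eqP; rewrite (negbTE nu).
move=> a nBa; have [u u0 aE] := proj_rep a.
have nu : cdisc u != 0.
  apply: contra_notN nBa => /eqP cu; apply/(coneP _ aE).
  by apply/(zeros_cone u0 HB) => _ ->.
move: (nu); rewrite mulf_eq0 negb_or => /andP [ld dt].
have [rs [urs srs rsE]] := sylv_roots d0 (size_poly _ _) ld dt.
pose f i := mkpt (mulD_neq0 DE (mu_neq0 d (chart_neq0 (rs`_i)))).
suff -> : curve D `&` hyperplane a = f @` `I_d.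
  apply: inj_card_eq => i j /set_mem /= id /set_mem /= jd fij.
  apply/eqP; rewrite eq_sym -(nth_uniq 0 _ _ urs) ?srs //; apply/eqP; apply: contrapT => /eqP rij.
  have [c _ cE] := @rep_scale _ _ (f i) _ _ erefl (congr1 val fij).
  by have := mu_indep d0 DE c rij; rewrite cE eqxx.
apply/seteqP; split=> x /= => [[[t t0 xE] ax]|[i id <-]]; last first.
  split; first by exists (chart (rs`_i)) => //; exact: chart_neq0.
  apply/(@hyperplaneP _ _ a (f i) _ _ aE erefl); rewrite cpoly_chart; apply/rootP.
  by rewrite -rsE mem_nth // srs.
have ut : lin u (mu d t *m D) = 0 by apply/(hyperplaneP aE xE).
have t00 : t 0 0 != 0.
  apply: contraNneq ld => t00; have t01 : t 0 1 != 0 by move: (row2_neq0 t0); rewrite t00 eqxx.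
  rewrite coef_poly ltnSn; apply/eqP; apply: (mulIf (expf_neq0 d t01)).
  rewrite mul0r -ut lin_mulmx /lin (bigD1 ord_max) //= big1 ?addr0 => [|i].
    rewrite [mu d t _ _]mxE subnn expr0 mul1r (_ : inord d = ord_max) //.
    by apply/val_inj; rewrite /= inordK.
  rewrite -val_eqE /= => id; rewrite [mu d t _ _]mxE t00 expr0n subn_eq0.
  by rewrite leqNgt ltn_neqAle id -ltnS ltn_ord /= mul0r mulr0.
have tE := chartE t00; set r := t 0 1 / t 0 0 in tE.
have rrs : r \in rs.
  rewrite rsE; apply/rootP; rewrite -cpoly_chart; apply: (mulfI (expf_neq0 d t00)).
  by rewrite mulr0 -linZr scalemxAl -muZ -tE.
exists (index r rs); first by rewrite -srs index_mem.
apply/val_inj; rewrite /= nth_index // xE tE muZ -scalemxAl vlineZ //.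
exact: expf_neq0.
Qed.

Lemma curve_span : exists2 W, linear_span (curve D) W & \dim W = d.+1.
Proof.
pose rows := [tuple row i D | i < d.+1].
have fr : free rows.
  apply/freeP => c /rowP cD i.
  have cD0 : (\row_i c i) *m D = 0.
    apply/rowP => j; transitivity ((\sum_i c i *: rows`_i) 0 j); last exact: cD.
    rewrite mxE summxE.
    by apply: eq_bigr => l _; rewrite !mxE (nth_map l) ?size_enum_ord // nth_ord_enum !mxE.
  have /rowP /(_ i) := mulDE DE (\row_i c i).
  by rewrite cD0 mul0mx !mxE.
exists <<rows>>%VS; last by rewrite (eqP fr) size_tuple.
have rowin i : row i D \in rows by apply/mapP; exists i; rewrite ?mem_enum.
split=> [x [t t0 ->]|W' HW].
  rewrite -memvE mulmx_sum_row; apply: rpred_sum => i _; apply: rpredZ.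
  exact: memv_span.
apply/span_subvP => _ /mapP [i _ ->]; apply: contrapT => /negP /lin_sep [l li lW].
move/eqP: li; apply.
have : l *m D^T = 0.
  apply: (mu_span char0) => t t0; rewrite -lin_mulmx; apply: lW.
  have tD := mulD_neq0 DE (mu_neq0 d t0).
  by rewrite memvE; apply: (HW (mkpt tD)); exists t.
move=> /rowP /(_ i); rewrite !mxE => <-.
by apply: eq_bigr => j _; rewrite !mxE.
Qed.
End CurveDegree.

(** * Tangent spaces and smoothness *)

Section ChainRule.
Variables (k : fieldType) (n : nat) (q : 'I_n -> {poly k}).

Lemma horner_mmap (f : {mpoly k[n]}) c :
  (mmap (@polyC k) q f).[c] = f.@[fun i => (q i).[c]].
Proof.
rewrite mevalE /mmap horner_sum; apply: eq_bigr => M _.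
rewrite hornerM hornerC /mmap1 horner_prod; congr (_ * _).
by apply: eq_bigr => i _; rewrite horner_exp.
Qed.

Let chain (f : {mpoly k[n]}) := (mmap (@polyC k) q f)^`() =
  \sum_i mmap (@polyC k) q f^`M(i) * (q i)^`().

Lemma deriv_mmap f : chain f.
Proof.
move: f; have chM f g : chain f -> chain g -> chain (f * g).
  rewrite /chain => cf cg; rewrite rmorphM /= derivM cf cg mulr_suml mulr_sumr -big_split /=.
  apply: eq_bigr => i _; rewrite mderivM rmorphD !rmorphM /=; ring.
have ch1 : chain 1.
  rewrite /chain rmorph1 derivC big1 // => i _.
  by rewrite -mpolyC1 mderivC raddf0 mul0r.
have chX i : chain 'X_i.
  rewrite /chain mmapX mmap1U (bigD1 i) //= big1 => [|j ji].
    rewrite mderivX mnm1E eqxx scale1r (_ : (U_(i) - U_(i))%MM = 0%MM).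
      by rewrite mpolyX0 rmorph1 mul1r addr0.
    by apply/mnmP => j; rewrite mnmBE subnn mnm0E.
  by rewrite mderivX mnm1E eq_sym (negbTE ji) scale0r raddf0 mul0r.
elim/mpolyind => [|c M f _ _ IHf].
  by rewrite /chain raddf0 derivC big1 // => i _; rewrite mderiv0 raddf0 mul0r.
have cX : chain 'X_[M].
  rewrite mpolyXE_id; apply: big_ind => // i _.
  by elim: (M i) => [|m IHm]; rewrite ?expr0 ?exprS //; exact: chM.
rewrite /chain raddfD derivD IHf /= mmapZ mul_polyC derivZ cX scaler_sumr -big_split /=.
apply: eq_bigr => i _; rewrite mderivD mderivZ raddfD /= mmapZ mulrDl; congr (_ + _).
by rewrite -mul_polyC mulrA.
Qed.

(** Differentiate the identically zero polynomial obtained by substituting the path into f. *)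
Lemma path_deriv (f : {mpoly k[n]}) x : [pchar k] =i pred0 ->
  (forall c, f.@[fun i => (q i).[c]] = 0) ->
  \sum_i f^`M(i).@[fun i => (q i).[x]] * (q i)^`().[x] = 0.
Proof.
move=> char0 H; have f0 : mmap (@polyC k) q f = 0.
  by apply/eqP; apply: contraT => /(poly_nonroot char0) [c]; rewrite horner_mmap H eqxx.
have := congr1 (fun p : {poly k} => p.[x]) (deriv_mmap f); rewrite f0 derivC horner0 => /esym.
rewrite horner_sum => E; rewrite -[RHS]E.
by apply: eq_bigr => i _; rewrite hornerM horner_mmap.
Qed.
End ChainRule.

Section Tangent.
Variables (k : closedFieldType) (d : nat).
Hypotheses (char0 : [pchar k] =i pred0) (d0 : (0 < d)%N).

Lemma rowDZ n (p q : 'rV[k]_n) x i : (p + x *: q) 0 i = p 0 i + x * q 0 i.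
Proof. by rewrite !mxE. Qed.

(** The derivative of [mu d (chart r)] in r. Entry 0 is zero because of [*+ 0], so the truncated
    predecessor does no harm. *)
Definition dchart (r : k) : 'rV[k]_d.+1 := \row_i (r ^+ i.-1 *+ i).

(** The velocities along the ray and along the curve lie in the tangent cone; conversely the
    linearized equations of the curve give a recursion whose solutions form just the plane they
    span. *)
Lemma smooth_chart N (D : 'M[k]_(d.+1, N.+1)) E p r : D *m E = 1%:M ->
  val p = <[mu d (chart r) *m D]>%VS -> exists2 U : {vspace 'rV[k]_N.+1},
    \dim U = 2 & forall w, w \in U <-> tangent_cone_space (curve D) p w.
Proof.
move=> DE pE; set a := mu d (chart r); pose a' := dchart r.
have aD0 : a *m D != 0 := mulD_neq0 DE (mu_neq0 d (chart_neq0 r)).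
have Uw w : w \in <<[:: a *m D; a' *m D]>>%VS <-> exists b c, w = (b *: a + c *: a') *m D.
  rewrite span_cons span_seq1; split=> [/memv_addP [_ /vlineP [b ->] [_ /vlineP [c ->] ->]]|[b [c ->]]].
    by exists b, c; rewrite mulmxDl -!scalemxAl.
  by rewrite mulmxDl -!scalemxAl; apply: memv_add; rewrite memvZ ?memv_line.
exists <<[:: a *m D; a' *m D]>>%VS => [|w].
  apply/eqP; rewrite -[2]/(size [:: a *m D; a' *m D]); change (free [:: a *m D; a' *m D]).
  rewrite free_cons span_seq1 seq1_free; apply/andP; split.
    apply/negP => /vlineP [c] /(congr1 (mulmx^~ E)); rewrite -scalemxAl !(mulDE DE).
    move/rowP/(_ ord0); rewrite mu_chart [RHS]mxE [a' _ _]mxE mulr0n mulr0 expr0.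
    by move/eqP; rewrite oner_eq0.
  apply: (mulD_neq0 DE); apply/rV0Pn; exists (inord 1).
  by rewrite mxE inordK // expr0 oner_eq0.
rewrite Uw; split=> [[b [c ->]] e f fe fX v pE'|tw].
  have [s s0 vE] := rep_scale pE pE'.
  have fC u : cone (curve D) u -> f.@[u 0] = 0.
    by move=> [x Xx xE]; apply/(vanishes_atP fe xE)/fX.
  (* Two polynomial paths in the cone: the ray through the point, and the curve itself rescaled by s
     so as to pass through v. *)
  have p1 := @path_deriv k _ (fun i => (a *m D) 0 i *: 'X) f s char0.
  have p2 := @path_deriv k _ (fun i => s *: (\sum_l D l i *: 'X^l)) f r char0.
  have -> : \sum_i f^`M(i).@[v 0] * ((b *: a + c *: a') *m D) 0 i =
      b * (\sum_i f^`M(i).@[v 0] * (a *m D) 0 i) + c * (\sum_i f^`M(i).@[v 0] * (a' *m D) 0 i).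
    rewrite !mulr_sumr -big_split; apply: eq_bigr => i _ /=.
    by rewrite mulmxDl -!scalemxAl !mxE; ring.
  have -> : \sum_i f^`M(i).@[v 0] * (a *m D) 0 i = 0.
    rewrite -[RHS]p1 => [|x].
      apply: eq_bigr => i _; rewrite derivZ derivX hornerZ hornerC mulr1; congr (_ * _).
      by apply: meval_eq => j; rewrite hornerZ hornerX vE mxE mulrC.
    rewrite (meval_eq (v2 := fun i => x * (a *m D) 0 i)) => [|i]; last by rewrite hornerZ hornerX mulrC.
    have fa : f.@[(a *m D) 0] = 0 := fC _ (curve_mu d0 DE (chart_neq0 r)).
    by rewrite (homog_scale _ _ fe) fa mulr0.
  have -> : \sum_i f^`M(i).@[v 0] * (a' *m D) 0 i = 0.
    apply: (mulfI s0); rewrite mulr0 -[RHS]p2 => [|x].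
      rewrite mulr_sumr; apply: eq_bigr => i _; rewrite mulrCA; congr (_ * _).
        apply: meval_eq => j; rewrite hornerZ horner_sum vE [LHS]mxE; congr (_ * _).
        rewrite mxE; apply: eq_bigr => l _; rewrite mu_chart hornerZ hornerXn mulrC //.
      rewrite derivZ hornerZ linear_sum horner_sum /=; congr (_ * _).
      rewrite mxE; apply: eq_bigr => l _; rewrite mxE derivZ hornerZ derivXn hornerMn hornerXn.
      by rewrite mulrC.
    rewrite (meval_eq (v2 := (s *: (mu d (chart x) *m D)) 0)) => [|i].
      by apply/fC/coneZ => //; exact: (curve_mu d0 DE (chart_neq0 x)).
    rewrite hornerZ [RHS]mxE; congr (_ * _); rewrite horner_sum mxE.
    by apply: eq_bigr => l _; rewrite mu_chart hornerZ hornerXn mulrC.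
  by rewrite !mulr0 addr0.
set v := a *m D.
have tang e g (G : {poly k}) : polyfun e g -> (forall u, cone (curve D) u -> g u = 0) ->
    (forall x, G.[x] = g (v + x *: w)) -> G^`().[0] = 0.
  move=> [f fe fE] gC GE.
  have := tw e f fe _ v pE => /(_ _)/=.
  have GF : G = mmap (@polyC k) (fun i => (v 0 i)%:P + w 0 i *: 'X) f.
    apply/eqP; rewrite -subr_eq0; apply: contraT => /(poly_nonroot char0) [c].
    rewrite hornerD hornerN horner_mmap GE fE subr_eq0 => /eqP [].
    by apply: meval_eq => i; rewrite !hornerE rowDZ mulrC.
  move=> H; rewrite GF deriv_mmap horner_sum -[RHS]H => [|x [t t0 xE]].
    apply: eq_bigr => i _; rewrite hornerM horner_mmap derivD derivC add0r derivZ derivX hornerZ hornerC mulr1.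
    congr (_ * _).
    by apply: meval_eq => j; rewrite !hornerE.
  by apply/(vanishes_atP fe xE); rewrite -fE gC //; apply: (curve_mu d0 DE).
pose b := w *m E.
have vE : v *m E = a := mulDE DE _.
have gC g : curve_eqs D E g -> forall u, cone (curve D) u -> g u = 0.
  by move=> cg u /(cone_curve d0 DE) [t _ ->]; exact: (curve_eqs0 DE).
have wE : w = b *m D.
  apply/rowP => j; apply/eqP; rewrite -subr_eq0; apply/eqP.
  pose g (u : 'rV[k]_N.+1) := u 0 j - (u *m E *m D) 0 j.
  have cg : curve_eqs D E g by left; exists j.
  have [e pg] := curve_eqs_polyfun cg.
  have := tang e g ((w 0 j - (b *m D) 0 j) *: 'X) pg (gC g cg).
  rewrite derivZ derivX hornerZ hornerC mulr1; apply=> x.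
  rewrite hornerZ hornerX /g !mulmxDl -!scalemxAl vE -/v !rowDZ; ring.
(* The linearization, at the point with coordinates r^i, of the quadric with indices 0 and j. *)
have bS j : (j < d)%N -> b 0 (inord j.+1) =
    r * b 0 (inord j) + b 0 (inord 1) * r ^+ j - b 0 (inord 0) * r ^+ j.+1.
  move=> jd; pose g (u : 'rV[k]_N.+1) := (u *m E) 0 (inord 0) * (u *m E) 0 (inord j.+1) -
      (u *m E) 0 (inord 1) * (u *m E) 0 (inord j).
  have cg : curve_eqs D E g by right; exists 0%N, j.
  have [e pg] := curve_eqs_polyfun cg.
  pose L i : {poly k} := (a 0 (inord i))%:P + b 0 (inord i) *: 'X.
  have := tang e g (L 0%N * L j.+1 - L 1%N * L j) pg (gC g cg).
  have dL i : (L i)^`() = (b 0 (inord i))%:P.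
    by rewrite derivD derivC add0r derivZ derivX scale_polyC mulr1.
  have L0 i : (L i).[0] = a 0 (inord i) by rewrite hornerD hornerC hornerZ hornerX mulr0 addr0.
  have LE i x : (L i).[x] = ((v + x *: w) *m E) 0 (inord i).
    by rewrite mulmxDl -scalemxAl vE hornerD hornerC hornerZ hornerX rowDZ mulrC.
  rewrite derivB !derivM !dL hornerD hornerN !hornerD !hornerM !hornerC !L0.
  rewrite !mu_chart !inordK ?ltnS ?(ltnW jd) // expr0 expr1 => H.
  have {}H : b 0 (inord 0) * r ^+ j.+1 + 1 * b 0 (inord j.+1) -
    (b 0 (inord 1) * r ^+ j + r * b 0 (inord j)) = 0.
    by apply: H => x; rewrite hornerD hornerN !hornerM !LE.
  by apply/eqP; rewrite -subr_eq0 -[X in _ == X]H; apply/eqP; ring.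
exists (b 0 (inord 0)), (b 0 (inord 1) - r * b 0 (inord 0)); rewrite wE; congr (_ *m D).
have rhsE i : (b 0 (inord 0) *: a + (b 0 (inord 1) - r * b 0 (inord 0)) *: a') 0 i =
    b 0 (inord 0) * r ^+ i + (b 0 (inord 1) - r * b 0 (inord 0)) * (r ^+ i.-1 *+ i).
  by rewrite mxE [X in X + _]mxE [X in _ + X]mxE mu_chart [a' _ _]mxE.
apply/rowP => i; rewrite rhsE -{1}(inord_val i).
elim: (i : nat) (leq_ord i) => [_|j IHj jd]; first by rewrite expr0 mulr0n mulr0 addr0 mulr1.
rewrite (bS j jd) (IHj (ltnW jd)) -[_ *+ j]mulr_natr -[_ *+ j.+1]mulr_natr.
have -> : r * (b 0 (inord 0) * r ^+ j +
    (b 0 (inord 1) - r * b 0 (inord 0)) * (r ^+ j.-1 * j%:R)) =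
    b 0 (inord 0) * r ^+ j.+1 + (b 0 (inord 1) - r * b 0 (inord 0)) * (r ^+ j * j%:R).
  by case: j {IHj jd} => [|j]; rewrite ?mulr0 /= ?exprS; ring.
by rewrite /= -natr1 exprS; ring.
Qed.
End Tangent.

(** * Exchanging the charts, and rationality *)

Section Rnc.
Variables (k : closedFieldType) (d : nat).
Hypotheses (char0 : [pchar k] =i pred0) (d0 : (0 < d)%N).

(** Together with a reversal of the rows of D this moves the point outside the chart into it, so
    smoothness is computed in one chart only. *)
Definition swap (t : 'rV[k]_2) : 'rV[k]_2 := \row_i t 0 (rev_ord i).

Lemma swap0 t : swap t 0 0 = t 0 1.
Proof. by rewrite mxE; congr (t 0 _); apply/val_inj. Qed.

Lemma swap1 t : swap t 0 1 = t 0 0.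
Proof. by rewrite mxE; congr (t 0 _); apply/val_inj. Qed.

Lemma swapK t : swap (swap t) = t.
Proof. by apply/rowP => i; rewrite !mxE rev_ordK. Qed.

Lemma swap_neq0 t : t != 0 -> swap t != 0.
Proof.
apply: contraNneq => t0; rewrite -[t]swapK t0; apply/eqP/rowP => i; by rewrite !mxE.
Qed.

Lemma mu_swap N (D : 'M[k]_(d.+1, N.+1)) t : mu d (swap t) *m rowsub (@rev_ord _) D = mu d t *m D.
Proof.
apply/rowP => j; rewrite !mxE (reindex_inj rev_ord_inj); apply: eq_bigr => i _ /=.
rewrite [in LHS]mxE [in RHS]mxE swap0 swap1 !mxE rev_ordK; congr (_ * _).
by rewrite /= !subSS subKn 1?mulrC // -ltnS.
Qed.

Lemma curve_rev N (D : 'M[k]_(d.+1, N.+1)) : curve (rowsub (@rev_ord _) D) = curve D.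
Proof.
apply/seteqP; split=> x [t t0 xE]; exists (swap t); rewrite ?swap_neq0 //.
  by rewrite -mu_swap swapK.
by rewrite mu_swap.
Qed.

Section Fixed.
Variables (N : nat) (D : 'M[k]_(d.+1, N.+1)) (E : 'M[k]_(N.+1, d.+1)).
Hypothesis DE : D *m E = 1%:M.

Lemma curve_smooth : smooth_of_dim (curve D) 1.
Proof.
move=> p [t t0 pE]; have [t00|t00] := eqVneq (t 0 0) 0; last first.
  apply: (smooth_chart (r := t 0 1 / t 0 0) char0 d0 DE).
  by rewrite pE {1}(chartE t00) muZ -scalemxAl vlineZ // expf_neq0.
have DE' : rowsub (@rev_ord _) D *m colsub (@rev_ord _) E = 1%:M.
  apply/matrixP => i j; have /matrixP /(_ (rev_ord i) (rev_ord j)) := DE.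
  rewrite !mxE (inj_eq rev_ord_inj) => <-; apply: eq_bigr => l _; by rewrite !mxE.
have t01 : swap t 0 0 != 0 by have := row2_neq0 t0; rewrite t00 eqxx swap0.
rewrite -curve_rev; apply: (smooth_chart (r := swap t 0 1 / swap t 0 0) char0 d0 DE').
by rewrite pE -mu_swap {1}(chartE t01) muZ -scalemxAl vlineZ // expf_neq0.
Qed.

Lemma zeros1 M (f : 'rV[k]_M.+1 -> k) e x v : polyfun e f -> val x = <[v]>%VS ->
  zeros [set f] x <-> f v = 0.
Proof.
move=> pf xE; rewrite -(coneP _ xE) zeros_cone ?(rep_neq0 xE) //.
  by split=> [/(_ f erefl)|fv g ->].
by move=> g ->; exists e.
Qed.

(** The inverse map takes the first two coordinates of [v *m E], which are t0^(d-1) times the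
    parameters. *)
Lemma curve_rational : rational_curve (curve D).
Proof.
have pD j : polyfun (1 * d) (fun t => (mu d t *m D) 0 j) := polyfun_mu D (polyfun_var _ j).
have /choice [F FE] : forall j, exists F : {mpoly k[2]},
    F \is (1 * d).-homog /\ forall t : 'rV_2, F.@[t 0] = (mu d t *m D) 0 j.
  by move=> j; have [F Fd FE] := pD j; exists F; split=> // t; rewrite FE.
have /choice [G GE] : forall i : 'I_2, exists G : {mpoly k[N.+1]},
    G \is 1.-homog /\ forall v : 'rV_N.+1, G.@[v 0] = (v *m E) 0 (inord i).
  by move=> i; have [G Gd GE] := polyfun_mulmx E (inord i); exists G; split=> // v; rewrite GE.
pose U := ~` zeros [set fun t : 'rV[k]_2 => t 0 0].
pose W := curve D `\` zeros [set fun v => (v *m E) 0 (inord 0)].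
have UP x t : val x = <[t]>%VS -> U x <-> t 0 0 != 0.
  move=> xE; rewrite /U /setC /= (zeros1 (polyfun_var _ _) xE).
  by split=> [/eqP|/eqP].
have key t x y : val x = <[t]>%VS -> val y = <[mu d t *m D]>%VS -> t 0 0 != 0 ->
    [/\ U x, W y, rational_map_at F x y & rational_map_at G y x].
  move=> xE yE t00; have t0 := rep_neq0 xE; split.
  - exact/(UP _ _ xE).
  - split; first by exists t.
    apply/(zeros1 (polyfun_mulmx E (inord 0)) yE); rewrite mulDE // mxE inordK // subn0 expr0 mulr1.
    by apply/eqP; rewrite expf_neq0.
  - move=> v xE'; have [c c0 vE] := rep_scale xE xE'.
    rewrite (_ : \row_i _ = mu d v *m D); last by apply/rowP => j; rewrite mxE (FE j).2.
    by rewrite vE muZ -scalemxAl vlineZ ?expf_neq0.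
  move=> v yE'; have [c c0 vE] := rep_scale yE yE'.
  rewrite (_ : \row_i _ = (c * t 0 0 ^+ d.-1) *: t); first by rewrite vlineZ // mulf_neq0 ?expf_neq0.
  apply/rowP => j; rewrite mxE (GE j).2 vE -scalemxAl mulDE // mxE [RHS]mxE -mulrA; congr (_ * _).
  have jd : (j <= d)%N by apply: leq_trans d0; rewrite -ltnS.
  rewrite mxE inordK //; case: (unliftP 0 j) jd => [j' ->|->] _ /=.
    rewrite ord1 /= expr1 subn1; congr (_ * t 0 _); exact/val_inj.
  by rewrite expr0 mulr1 subn0 -exprSr prednK.
pose x0 : proj k 1 := mkpt (chart_neq0 (0 : k)).
have x0E : val x0 = <[chart (0 : k)]>%VS by [].
have c00 : chart (0 : k) 0 0 != 0 by rewrite mxE expr0 oner_eq0.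
exists (1 * d)%N, 1%N, F, G, U, W; split.
- by split=> i; [exact: (FE i).1|exact: (GE i).1].
- split.
    exists (zeros [set fun t : 'rV[k]_2 => t 0 0]); first by apply: zeros_closed => _ ->; exists 1%N; exact: polyfun_var.
    by rewrite /U; apply/seteqP; split=> x //= [].
  exists x0; exact/(UP _ _ x0E).
- split.
    exists (zeros [set fun v => (v *m E) 0 (inord 0)]) => //.
    by apply: zeros_closed => _ ->; exists 1%N; exact: polyfun_mulmx.
  pose y := mkpt (mulD_neq0 DE (mu_neq0 d (chart_neq0 0))).
  by exists y; have [] := key _ x0 y x0E erefl c00.
- move=> x Ux; have [t t0 xE] := proj_rep x; have t00 := (UP _ _ xE).1 Ux.
  pose y := mkpt (mulD_neq0 DE (mu_neq0 d t0)); exists y.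
  by have [] := key t x y xE erefl t00.
move=> y [[t t0 yE] /(zeros1 (polyfun_mulmx E (inord 0)) yE)].
rewrite mulDE // mxE inordK // subn0 expr0 mulr1 => /eqP; rewrite expf_eq0 d0 /= => t00.
by exists (mkpt t0); have [] := key t (mkpt t0) y erefl yE t00.
Qed.

Lemma curve_rnc : rational_normal_curve d (curve D).
Proof.
split; last exact: (curve_span char0 DE).
- split; last exact: (curve_degree_curve char0 d0 DE).
    by split; [exact: (curve_closed d0 DE)|exact: (curve_irr char0 d0 DE)].
  exact: (curve_dim char0 d0 DE).
- exact: curve_smooth.
exact: curve_rational.
Qed.
End Fixed.
End Rnc.

(** * Curves of degree delta on the Veronese manifold *)

Lemma nonprop_sym (k : fieldType) n (p q : 'rV[k]_n) : p != 0 ->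
  (forall c, q != c *: p) -> forall c, p != c *: q.
Proof.
move=> p0 qp c; apply/eqP => pE; have [c0|c0] := eqVneq c 0.
  by move: p0; rewrite pE c0 scale0r eqxx.
by have := qp c^-1; rewrite pE scalerA mulVf // scale1r eqxx.
Qed.

Section Lines.
Variables (k : closedFieldType) (n delta : nat).
Hypotheses (char0 : [pchar k] =i pred0) (d0 : (0 < delta)%N).
Let N := ('C(n + delta, n)).-1.
Variables (A : 'M[k]_N.+1) (e1 e2 : 'rV[k]_n.+1).
Hypotheses (uA : A \in unitmx) (e10 : e1 != 0) (e12 : forall c, e2 != c *: e1).

Definition pline (t : 'rV[k]_2) := t 0 0 *: e1 + t 0 1 *: e2.

Lemma pline_neq0 t : t != 0 -> pline t != 0.
Proof.
move=> t0; apply/eqP => E; have [t1|t1] := eqVneq (t 0 1) 0.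
  have := row2_neq0 t0; rewrite t1 eqxx orbF => t00.
  by move/eqP: E; rewrite /pline t1 scale0r addr0 scaler_eq0 (negbTE t00) (negbTE e10).
have := e12 (- (t 0 0 / t 0 1)); case/eqP.
apply: (scalerI t1); rewrite scalerA mulrN mulrCA divff // mulr1 scaleNr.
by apply/eqP; rewrite -addr_eq0 addrC -/(pline t) E.
Qed.

(** On the line, l1 and l2 are its two coordinates up to nonzero factors. The sections l1^(delta-i)
    l2^i therefore recover the entries of [mu], and after division by these factors they give the
    right inverse E. *)
Lemma pline_curve : exists (D : 'M[k]_(delta.+1, N.+1)) E, D *m E = 1%:M /\
  forall t, mu delta t *m D = ver delta (pline t) *m A.
Proof.
have e20 : e2 != 0 by have := e12 0; rewrite scale0r.
have [l2 [l21 l22]] := sep_lin e10 e12.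
have [l1 [l12 l11]] := sep_lin e20 (nonprop_sym e10 e12).
have /choice [u uE] : forall j : 'I_N.+1, exists u : 'rV_delta.+1,
    forall t, lin u (mu delta t) = ver delta (pline t) 0 j.
  move=> j; apply: mu_form.
  have pl i : polyfun 1 (fun t => pline t 0 i).
    have H := polyfunD (polyfunZ (e1 0 i) (polyfun_var k (0 : 'I_2)))
                       (polyfunZ (e2 0 i) (polyfun_var k (1 : 'I_2))).
    by apply: (polyfun_ext _ H) => t; rewrite !mxE (mulrC (t 0 0)) (mulrC (t 0 1)).
  have := polyfun_comp (vmon_homog k j) pl; rewrite muln1; apply: polyfun_ext => t.
  by rewrite mxE.
have /choice [w wE] : forall i : 'I_delta.+1, exists w : 'rV_N.+1,
    forall e, lin w (ver delta e) = lin l1 e ^+ (delta - i) * lin l2 e ^+ i.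
  move=> i; have := polyfunM (polyfunX (delta - i) (polyfun_lin l1)) (polyfunX i (polyfun_lin l2)).
  rewrite !mul1n ?muln1 subnK -1?ltnS // => -[F Fd FE].
  by have [w wE] := ver_form Fd; exists w => e; rewrite wE FE.
pose D0 : 'M[k]_(delta.+1, N.+1) := \matrix_(i, j) u j 0 i.
pose E0 : 'M[k]_(N.+1, delta.+1) := \matrix_(j, i)
  ((lin l1 e1 ^+ (delta - i) * lin l2 e2 ^+ i)^-1 * w i 0 j).
have D0E t : mu delta t *m D0 = ver delta (pline t).
  by apply/rowP => j; rewrite -uE linC mxE; apply: eq_bigr => i _; rewrite [D0 _ _]mxE.
have DE0 : D0 *m E0 = 1%:M.
  apply/eqP; rewrite -subr_eq0; apply/eqP/matrixP => i j; rewrite [RHS]mxE.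
  have : (col j (D0 *m E0 - 1%:M))^T = 0.
    apply: (mu_span char0) => t _.
    transitivity ((mu delta t *m (D0 *m E0 - 1%:M)) 0 j).
      rewrite linC mxE; apply: eq_bigr => l _; congr (_ * _).
      by rewrite [LHS]mxE [LHS]mxE.
    rewrite mulmxBr mulmx1 mulmxA D0E mxE [X in _ + X]mxE; apply/eqP; rewrite subr_eq0; apply/eqP.
    transitivity ((lin l1 e1 ^+ (delta - j) * lin l2 e2 ^+ j)^-1 * lin (w j) (ver delta (pline t))).
      rewrite (linC (w j)) {3}/lin mulr_sumr mxE; apply: eq_bigr => l _.
      by rewrite [E0 _ _]mxE mulrCA.
    rewrite wE !linDr !linZr l12 l21 !mulr0 addr0 add0r !exprMn mulrACA mulrC mulfK ?mxE //.
    by rewrite mulf_neq0 ?expf_neq0.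
  by move=> /rowP /(_ i); rewrite !mxE.
exists (D0 *m A), (invmx A *m E0); split=> [|t]; first by rewrite mulmxA mulmxK.
by rewrite mulmxA D0E.
Qed.

Variable X : set (proj k N).
Hypothesis XE : forall v, cone X v <-> exists2 e : 'rV[k]_n.+1, e != 0 & v = ver delta e *m A.

Lemma verA_neq0 (e : 'rV[k]_n.+1) : e != 0 -> ver delta e *m A != 0.
Proof.
move=> e0; apply: contraNneq (ver_neq0 delta e0) => E.
by rewrite -[ver _ _](mulmxK uA) E mul0mx.
Qed.

Lemma verA_nonprop (e e' : 'rV[k]_n.+1) c : e != 0 -> e' != 0 ->
  (forall c, e' != c *: e) -> ver delta e' *m A != c *: (ver delta e *m A).
Proof.
move=> e0 e'0 ee'; apply/eqP; rewrite scalemxAl => /(congr1 (mulmx^~ (invmx A))).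
rewrite !mulmxK // => /(ver_inj d0 e'0 e0) [a aE].
by have := ee' a; rewrite aE eqxx.
Qed.

Section Points.
Variable C : set (proj k N).
Hypotheses (cC : irreducible_curve C delta) (CX : C `<=` X).
Hypotheses (C1 : cone C (ver delta e1 *m A)) (C2 : cone C (ver delta e2 *m A)).

Let e20 : e2 != 0. Proof. by have := e12 0; rewrite scale0r. Qed.
Let iC : irr (cone C). Proof. by case: cC => -[_ /irr_cone]. Qed.

(** [irr_not_finite] adds one point at a time to the two given ones. *)
Lemma curve_points m : exists p : nat -> 'rV[k]_n.+1, [/\ p 0%N = e1, p 1%N = e2,
  forall i, (i < m.+2)%N -> p i != 0 /\ cone C (ver delta (p i) *m A) &
  forall i j c, (i < j < m.+2)%N -> p j != c *: p i].
Proof.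
elim: m => [|m [p [p0 p1 pC pp]]].
  exists (fun i => if i == 0%N then e1 else e2); split=> [//|//|[|[|]] //|].
  by move=> [|i] [|[|j]] c /andP [] // _ _; exact: e12.
pose s := [seq ver delta (p i) *m A | i <- seq.iota 0 m.+2].
have s0 : all (fun z => z != 0) s.
  apply/allP => v /mapP [j]; rewrite mem_iota /= add0n => jm ->.
  by apply: verA_neq0; case: (pC j jm).
have [v Cv vs] := irr_not_finite iC C1 C2 (verA_neq0 e10) (fun c => verA_nonprop c e10 e20 e12) s0.
have [e e0 vE] := (XE v).1 ((cone_subset _ _).1 CX v Cv).
exists (fun i => if i == m.+2 then e else p i); split=> [//|//|i|i j c].
  rewrite ltnS leq_eqVlt; case: eqP => [_ _|_ /= /pC //]; by rewrite -vE.
case/andP=> ij; rewrite ltnS => jm; have im := leq_trans ij jm; rewrite (ltn_eqF im).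
move: jm; rewrite leq_eqVlt; case: eqP => [jE _|_ /= jm]; last by apply: pp; rewrite ij.
apply/eqP => eE.
have := vs (ver delta (p i) *m A) _ (c ^+ delta); rewrite vE eE verZ -scalemxAl eqxx.
move=> H; suff : ~~ true by []; apply: H.
by apply/mapP; exists i; rewrite ?mem_iota.
Qed.

Lemma curve_in_line e : e != 0 -> cone C (ver delta e *m A) -> exists t, e = pline t.
Proof.
move=> en Ce; have [eW|eW] := boolP (e \in <<[:: e1; e2]>>%VS).
  move: eW; rewrite span_cons span_seq1 => /memv_addP [_ /vlineP [b ->] [_ /vlineP [c ->] ->]].
  by exists (\row_(i < 2) [:: b; c]`_i); rewrite /pline !mxE.
have [l0 l0e l0W] := lin_sep eW; exfalso.
have l01 : lin l0 e1 = 0 by apply: l0W; rewrite memv_span // mem_head.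
have l02 : lin l0 e2 = 0 by apply: l0W; rewrite memv_span // !inE eqxx orbT.
have [p [p0 p1 pC pp]] := curve_points delta.-1.
have dE : delta.-1.+2 = delta.+1 by rewrite prednK.
rewrite dE in pC pp.
have pp' i j c : (i < delta.+1)%N -> (j < delta.+1)%N -> i != j -> p i != c *: p j.
  move=> id jd; rewrite neq_ltn => /orP [ij|ji]; last by apply: pp; rewrite ji.
  by apply: nonprop_sym; [case: (pC i id)|move=> c'; apply: pp; rewrite ij].
(* The factor with index 0 is l0, which vanishes at both e1 and e2; factor i > 0 vanishes at p (i +
   1) only as required and not at e1. The delta factors thus account for delta + 1 zeros. *)
have /choice [l lP] : forall i : 'I_delta, exists l, [/\ lin l (p i.+1) = 0,
    (i == 0 :> nat -> lin l e1 = 0) & exists2 e', e' != 0 /\ cone C (ver delta e' *m A) & lin l e' != 0].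
  move=> i; have [i0|i0] := eqVneq (i : nat) 0%N.
    by exists l0; rewrite i0 p1; split=> //; exists e.
  have id : (i.+1 < delta.+1)%N by rewrite ltnS.
  have [|l [li l1]] := @sep_lin _ _ (p i.+1) e1 (pC _ id).1.
    by move=> c; rewrite -p0; apply: pp'.
  by exists l; split=> //; exists e1.
have [u0 u0E] := ver_prod l.
pose u := u0 *m (invmx A)^T.
have uE e' : lin u (ver delta e' *m A) = \prod_i lin (l i) e'.
  by rewrite lin_mulmx /u -mulmxA -trmx_mul mulmxV // trmx1 mulmx1 u0E.
(* A linear form in the source is not a function on C, but its delta-th power is a section; each
   factor is thus nonzero at a general point, and irreducibility combines them. *)
have nu : nz (cone C) (lin u).
  have : gen (cone C) (fun v => forall i : 'I_delta, forall e', v = ver delta e' *m A -> lin (l i) e' != 0).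
    apply: (gen_all iC) => i.
    have [ui uiE] := ver_prod (fun _ : 'I_delta => l i).
    pose u' := ui *m (invmx A)^T.
    have u'E e' : lin u' (ver delta e' *m A) = lin (l i) e' ^+ delta.
      by rewrite lin_mulmx /u' -mulmxA -trmx_mul mulmxV // trmx1 mulmx1 uiE prodr_const card_ord.
    apply: gen_imp (gen_nz (polyfun_lin u') _) => [v Cv u'v e' vE|].
      by apply: contraNneq u'v => E; rewrite vE u'E E expr0n (gtn_eqF d0).
    have [_ _ [e' [e'0 Ce'] le']] := lP i; exists (ver delta e' *m A) => //.
    by rewrite u'E expf_neq0.
  move=> [d [q [pq [v Cv qv] H]]]; exists v => //.
  have [e' e'0 vE] := (XE v).1 ((cone_subset _ _).1 CX v Cv).
  by rewrite vE uE; apply/prodf_neq0 => i _; apply: H vE.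
pose P (i : 'I_delta.+1) := ver delta (p i) *m A.
have CP i : cone C (P i) by case: (pC i (ltn_ord i)).
have [w _ wP] := @vspace_avoid k _ fullv _ (fun (i : 'I_delta.+1) v => lin v (P i)) char0
  (fun i a u v _ _ => etrans (linDl _ _ _) (congr1 (+%R^~ _) (linZl _ _ _)))
  (fun i => let: ex_intro l li := lin_neq0 (cone_neq0 (CP i)) in ex_intro2 _ _ l (memvf l) li).
have nw : nz (cone C) (lin w) by exists (P ord0).
have := mult_bound iC (curve_DEG char0 cC (memvf u) (memvf w) nw) (CP ord0) (wP ord0) (memvf u) nu
  (kappa := 0) (p := P).
move=> H; suff : (0 + delta.+1 <= delta)%N by rewrite add0n ltnn.
apply: H => //.
- by apply: Aw_lin; exact: memvf.
- move=> i; split=> //; rewrite uE; apply/eqP; apply/prodf_eq0.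
  case: (unliftP ord0 i) => [j ->|->].
    by exists j => //; have [-> _ _] := lP j.
  by exists (Ordinal d0) => //; have [_ l00 _] := lP (Ordinal d0); rewrite /= p0 l00.
move=> i j ij; have [|s [sj si]] := @sep_lin _ _ (P j) (P i) (cone_neq0 (CP j)).
  move=> c; apply: verA_nonprop.
  - by case: (pC j (ltn_ord j)).
  - by case: (pC i (ltn_ord i)).
  - by move=> c'; apply: pp'.
by exists s; rewrite ?memvf.
Qed.
End Points.

(** C lies in the image of the line by [curve_in_line] and contains two of its points, so
    [curve_in_closed] gives equality. *)
Theorem line_unique : exists L : set (proj k N), [/\ rational_normal_curve delta L, L `<=` X,
  cone L (ver delta e1 *m A) /\ cone L (ver delta e2 *m A) &
  forall C, irreducible_curve C delta -> C `<=` X ->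
    cone C (ver delta e1 *m A) -> cone C (ver delta e2 *m A) -> C = L].
Proof.
have e20 : e2 != 0 by have := e12 0; rewrite scale0r.
have [D [E [DE DA]]] := pline_curve.
have cL := cone_curve d0 DE.
exists (curve D); split=> [|||C cC CX C1 C2].
- exact: (curve_rnc char0 d0 DE).
- apply/cone_subset => v /cL [t t0 ->]; apply/XE; exists (pline t); first exact: pline_neq0.
  exact: DA.
- split; apply/cL.
    exists (delta_mx 0 0); first by apply/rV0Pn; exists 0; rewrite mxE !eqxx oner_eq0.
    by rewrite DA /pline !mxE /= scale1r scale0r addr0.
  exists (delta_mx 0 1); first by apply/rV0Pn; exists 1; rewrite mxE !eqxx oner_eq0.
  by rewrite DA /pline !mxE /= scale1r scale0r add0r.
have CL : C `<=` curve D.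
  apply/cone_subset => v Cv; have [e e0 vE] := (XE v).1 ((cone_subset _ _).1 CX v Cv).
  rewrite vE in Cv *; have [t tE] := curve_in_line cC CX C1 C2 e0 Cv.
  apply/cL; exists t; last by rewrite DA tE.
  by apply: contraNneq e0 => t0; rewrite tE t0 /pline !mxE !scale0r addr0.
apply/seteqP; split=> //.
have [[clC irrC] _ _] := cC; apply: (curve_in_closed char0 d0 DE) => //.
exists (ver delta e1 *m A), (ver delta e2 *m A); split=> // c.
exact: verA_nonprop.
Qed.
End Lines.

(** * The three conclusions for a 2-covered variety *)

Section Main.
Variables (k : closedFieldType) (r delta : nat).
Hypotheses (char0 : [pchar k] =i pred0) (d0 : (0 < delta)%N).
Let N := ('C(r.+1 + delta, r.+1)).-1.
Variables (X : set (proj k N)) (Sigma : set (set (proj k N))).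
Hypotheses (vX : projective_variety X) (nX : non_degenerate X) (dX : has_dim X r.+1).
Hypothesis cov : two_covered X delta Sigma.

Theorem two_covered_veronese :
  [/\ projectively_equivalent X (@veronese k r.+1 delta),
      forall C, Sigma C -> rational_normal_curve delta C &
      forall x y, X x -> X y -> x <> y ->
        exists! C : set (proj k N), [/\ rational_normal_curve delta C, C `<=` X, C x & C y]].
Proof.
have [A uA XE] := veronese_matrix char0 d0 vX nX dX.2 (two_covered_gen char0 cov).
split.
- exists A => // x; split=> [Xx|[y /veroneseP [e e0 yE] xE]].
    have [v v0 xE] := proj_rep x.
    have [e e0 vE] := (XE v).1 ((coneP _ xE).2 Xx).
    exists (mkpt (ver_neq0 delta e0)); first by apply/veroneseP; exists e.
    move=> v' /(vline_eq (ver_neq0 delta e0)) [c c0 eE].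
    by rewrite xE vE eE -scalemxAl vlineZ.
  by apply/(coneP _ (xE _ yE))/XE; exists e.
- move=> C SC; have [_ /(_ C SC) [cC CX] _] := cov.
  (* Any two distinct points of C determine a line in the source, and uniqueness identifies C with
     the image of that line. *)
  have [p [q [Cp Cq pq]]] := curve_two_points cC.
  have [e1 e10 pE] := (XE p).1 ((cone_subset _ _).1 CX p Cp).
  have [e2 e20 qE] := (XE q).1 ((cone_subset _ _).1 CX q Cq).
  rewrite {}pE {}qE in Cp Cq pq.
  have e12 c : e2 != c *: e1.
    by apply: contraNneq (pq (c ^+ delta)) => ->; rewrite verZ -scalemxAl.
  have [L [rL _ _ uL]] := line_unique char0 d0 uA e10 e12 XE.
  by rewrite (uL C).
move=> x y Xx Xy xy.
have [p p0 xE] := proj_rep x; have [q q0 yE] := proj_rep y.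
have [e1 e10 pE] := (XE p).1 ((coneP _ xE).2 Xx).
have [e2 e20 qE] := (XE q).1 ((coneP _ yE).2 Xy).
have e12 c : e2 != c *: e1.
  apply/eqP => eE; apply: xy; apply/val_inj; rewrite xE yE pE qE eE verZ -scalemxAl vlineZ //.
  by apply: expf_neq0; apply: contraNneq e20 => c0; rewrite eE c0 scale0r.
have [L [rL LX [L1 L2] uL]] := line_unique char0 d0 uA e10 e12 XE.
rewrite -pE in L1 uL; rewrite -qE in L2 uL.
exists L; split; first by split=> //; [exact/(coneP _ xE)|exact/(coneP _ yE)].
move=> C [[cC _ _ _] CX Cx Cy]; apply/esym/uL => //; first exact/(coneP _ xE).
exact/(coneP _ yE).
Qed.
End Main.

Theorem theorem2p2 (R : realType) (r delta : nat)
    (X : set (proj (complex R) ('C(r.+1 + delta, r.+1)).-1))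
    (Sigma : set (set (proj (complex R) ('C(r.+1 + delta, r.+1)).-1))) :
  (1 <= r)%N -> (1 <= delta)%N ->
  projective_variety X ->
  non_degenerate X ->
  has_dim X r.+1 ->
  two_covered X delta Sigma ->
  [/\ projectively_equivalent X (@veronese (complex R) r.+1 delta),
      forall C, Sigma C -> rational_normal_curve delta C &
      forall x y, X x -> X y -> x <> y ->
        exists! C : set (proj (complex R) ('C(r.+1 + delta, r.+1)).-1),
          [/\ rational_normal_curve delta C, C `<=` X, C x & C y]].
Proof.
move=> _ d0; apply: two_covered_veronese => //; exact: Num.Theory.pchar_num.
Qed.
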